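(* Let $m\ge1$, and consider the exact vacuum Heisenberg family of the context (the case $q=0$, with $\chi_r>0$ for every $r$). On $H_{2m+1}$ and every discrete left quotient, exactly one of the following cases occurs: (i) A horizontal exponent ($p_i$ with $1\le i\le2m$) is negative, and the spacetime is globally $C^0$-inextendible. (ii) $p_0=1$ and $p_i=0$ for every $i>0$. The past end has two analytic Ricci-flat one-sided extensions. In either extension the added boundary is a nondegenerate Killing horizon and the past Cauchy horizon of each original spatial slice. On a compact quotient its null generators are closed, and the region beyond it contains closed timelike curves.
   Context: $H_{2m+1}$ has left-invariant coframe $\omega^0,\dots,\omega^{2m}$ with $\mathrm d\omega^0=-\sum_{r=1}^m\omega^{2r-1}\wedge\omega^{2r}$ and $\mathrm d\omega^i=0$ for $i\ge1$. Data: $A_0,\dots,A_{2m}>0$ and real $p_0,\dots,p_{2m}$ with $\sum_ap_a=\sum_ap_a^2=1$ and $\chi_r=1+p_0-p_{2r-1}-p_{2r}>0$ for $1\le r\le m$. With $\kappa_r=A_0/(A_{2r-1}A_{2r})$ and $F_r(\tau)=1+\frac{\kappa_r^2}{4\chi_r^2}e^{2\chi_r\tau}$, the exact family is the Ricci-flat metric $g=-N^2\mathrm d\tau^2+\sum_aa_a^2(\omega^a)^2$, $\tau\in\mathbb R$, with $a_0=A_0e^{p_0\tau}\prod_rF_r^{-1/2}$, $a_{2r-1}=A_{2r-1}e^{p_{2r-1}\tau}F_r^{1/2}$, $a_{2r}=A_{2r}e^{p_{2r}\tau}F_r^{1/2}$, $N=e^\tau\prod_rF_r^{1/2}$; the past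 end is $\tau\to-\infty$. Discrete left quotients are $\Gamma\backslash H_{2m+1}$ with $\Gamma$ a discrete subgroup. A one-sided extension here is an analytic Lorentzian metric on $\mathbb R_s\times\Gamma\backslash H_{2m+1}$ whose restriction to $\{s>0\}$ is isometric to the original spacetime by an isometry carrying the original spatial slices to constant-$s$ slices ($s=e^{2\tau}$); the added boundary is $\{s=0\}$ and the region beyond is $\{s<0\}$. Nondegenerate means nonzero surface gravity. Globally $C^0$-inextendible: there is no connected Hausdorff second-countable smooth manifold of the same dimension with a continuous Lorentzian metric admitting a smooth isometric embedding of the spacetime onto a proper open subset. *)

(* Defs.v *)
From HB Require Import structures.
From mathcomp Require Import all_boot all_order all_algebra.
From mathcomp Require Import all_classical all_reals all_analysis.
Set Implicit Arguments.
Unset Strict Implicit.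
Unset Printing Implicit Defensive.
Import Order.TTheory GRing.Theory Num.Theory.
Import numFieldNormedType.Exports.
Local Open Scope classical_set_scope.
Local Open Scope ring_scope.
Local Open Scope quotient_scope.

(* Tangent vectors in a chart are row vectors, so a differential acts on the
   right, v |-> v *m 'J f x, and a bilinear form G is v *m G *m w^T. *)

Section Calculus.
Context {R : realType}.

(* For V finite dimensional and U open this is the usual C^k condition
   (continuity of all iterated partial derivatives up to order k). *)
Fixpoint Ck_on (k : nat) (V W : normedModType R) (U : set V) (f : V -> W)
    : Prop :=
  (forall x, U x -> {for x, continuous f}) /\
  (if k is k'.+1 then
     forall v : V, (forall x, U x -> derivable f x v) /\
                   Ck_on k' U (fun x => 'D_v f x)
   else True).

Definition smooth_on (V W : normedModType R) (U : set V) (f : V -> W) : Prop :=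
  forall k, Ck_on k U f.

(* The N-th partial sum of the power series with coefficients c centred at x:
   the multi-indices with all components < N. *)
Definition power_sum n (c : {ffun 'I_n -> nat} -> R) (u : 'rV[R]_n) (N : nat)
    : R :=
  \sum_(al : {ffun 'I_n -> 'I_N})
    c [ffun i => al i : nat] * \prod_(i < n) u 0 i ^+ al i.

Definition analytic_at n (f : 'rV[R]_n -> R) (x : 'rV[R]_n) : Prop :=
  exists (c : {ffun 'I_n -> nat} -> R) (r : R), 0 < r /\
    forall u : 'rV[R]_n, `|u| < r ->
      (exists B : R, forall N,
         power_sum (fun al => `|c al|) (\row_i `|u 0 i|) N <= B) /\
      power_sum c u @ \oo --> f (x + u).

Definition pderiv n (i : 'I_n) (f : 'rV[R]_n -> R) (x : 'rV[R]_n) : R :=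
  'D_(delta_mx 0 i) f x.

End Calculus.

(* A chart is given by its inverse, the local parametrization [cmap]. *)
Record chart (R : realType) (n : nat) (M : Type) := Chart {
  cdom : set 'rV[R]_n;
  cmap : 'rV[R]_n -> M }.

Record manifold (R : realType) (n : nat) := Manifold {
  mcarrier :> topologicalType;
  atlas : set (chart R n mcarrier) }.
Arguments atlas {R n} _.

Section Manifolds.
Context {R : realType}.

Definition cran n (M : Type) (c : chart R n M) : set M := cmap c @` cdom c.

(* The coordinates of a point; meaningful for points of [cran c]. *)
Definition coord n (M : Type) (c : chart R n M) (q : M) : 'rV[R]_n :=
  xget 0 [set x | cdom c x /\ cmap c x = q].

Definition locrep n n' (M N : Type) (F : M -> N) (c : chart R n M)
  (c' : chart R n' N) : 'rV[R]_n -> 'rV[R]_n' := coord c' \o F \o cmap c.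

Definition locdom n n' (M N : Type) (F : M -> N) (c : chart R n M)
  (c' : chart R n' N) : set 'rV[R]_n :=
  [set x | cdom c x /\ cran c' (F (cmap c x))].

Record smooth_manifold n (M : manifold R n) : Prop := {
  chart_open : forall c, atlas M c -> open (cdom c);
  chart_inj : forall c, atlas M c -> {in cdom c &, injective (cmap c)};
  chart_continuous : forall c, atlas M c ->
    forall x, cdom c x -> {for x, continuous (cmap c)};
  chart_open_map : forall c, atlas M c ->
    forall U, U `<=` cdom c -> open U -> open (cmap c @` U);
  chart_cover : forall q : M, exists2 c, atlas M c & cran c q;
  chart_smooth : forall c c', atlas M c -> atlas M c' ->
    smooth_on (locdom id c c') (locrep id c c') }.

Definition smooth_map n n' (M : manifold R n) (N : manifold R n') (F : M -> N)
    : Prop :=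
  continuous F /\
  forall c c', atlas M c -> atlas N c' ->
    smooth_on (locdom F c c') (locrep F c c').

(* Tensor fields as families of components, one for each chart; only the
   values for charts of the atlas at points of their domain matter. *)
Definition vfield n (M : manifold R n) := chart R n M -> 'rV[R]_n -> 'rV[R]_n.
Definition bfield n (M : manifold R n) := chart R n M -> 'rV[R]_n -> 'M[R]_n.

Definition vfield_compat n (M : manifold R n) (X : vfield M) : Prop :=
  forall c c', atlas M c -> atlas M c' -> forall x, locdom id c c' x ->
    X c' (locrep id c c' x) = X c x *m 'J (locrep id c c') x.

Definition vfield_cont n (M : manifold R n) (X : vfield M) : Prop :=
  vfield_compat X /\
  forall c, atlas M c -> forall x, cdom c x -> {for x, continuous (X c)}.

Definition vfield_smooth n (M : manifold R n) (X : vfield M) : Prop :=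
  vfield_compat X /\ forall c, atlas M c -> smooth_on (cdom c) (X c).

(* Signature (-, +, ..., +). *)
Definition lorentz_form n (G : 'M[R]_n) : Prop :=
  exists2 P : 'M[R]_n, P \in unitmx &
    P *m G *m P^T = diag_mx (\row_i (if i == 0%N :> nat then -1 else 1)).

Definition lorentz_metric n (M : manifold R n) (g : bfield M) : Prop :=
  (forall c x, atlas M c -> cdom c x -> lorentz_form (g c x)) /\
  (forall c c', atlas M c -> atlas M c' -> forall x, locdom id c c' x ->
     g c x = 'J (locrep id c c') x *m g c' (locrep id c c' x)
             *m ('J (locrep id c c') x)^T).

Definition continuous_lorentz_metric n (M : manifold R n) (g : bfield M) : Prop :=
  lorentz_metric g /\
  forall c, atlas M c -> forall x, cdom c x -> {for x, continuous (g c)}.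

Definition analytic_lorentz_metric n (M : manifold R n) (g : bfield M) : Prop :=
  lorentz_metric g /\
  forall c, atlas M c -> forall x, cdom c x ->
    forall i j, analytic_at (fun y => g c y i j) x.

(* Smooth isometric embedding onto an open subset, in equal dimensions. *)
Record isometric_open_embedding n (M N : manifold R n) (g : bfield M)
    (h : bfield N) (F : M -> N) : Prop := {
  ioe_smooth : smooth_map F;
  ioe_inj : injective F;
  ioe_open : forall U : set M, open U -> open (F @` U);
  ioe_isometric : forall c c', atlas M c -> atlas N c' ->
    forall x, locdom F c c' x ->
      g c x = 'J (locrep F c c') x *m h c' (locrep F c c' x)
              *m ('J (locrep F c c') x)^T }.

Definition C0_inextendible n (M : manifold R n) (g : bfield M) : Prop :=
  ~ exists (N : manifold R n) (h : bfield N) (F : M -> N),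
      [/\ smooth_manifold N, connected [set: N], hausdorff_space N
        & @second_countable N] /\
      [/\ continuous_lorentz_metric h, isometric_open_embedding g h F
        & range F <> [set: N]].

End Manifolds.

Section Curvature.
Context {R : realType}.

Definition christoffel n (G : 'rV[R]_n -> 'M[R]_n) (k i j : 'I_n)
    (x : 'rV[R]_n) : R :=
  2^-1 * \sum_(l < n) invmx (G x) k l *
    (pderiv i (fun y => G y j l) x + pderiv j (fun y => G y i l) x
     - pderiv l (fun y => G y i j) x).

Definition ricci n (G : 'rV[R]_n -> 'M[R]_n) (i j : 'I_n) (x : 'rV[R]_n) : R :=
  \sum_(k < n) (pderiv k (christoffel G k i j) x
                - pderiv j (christoffel G k i k) x)
  + \sum_(k < n) \sum_(l < n)
      (christoffel G k k l x * christoffel G l i j x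
       - christoffel G k j l x * christoffel G l i k x).

Definition ricci_flat n (M : manifold R n) (g : bfield M) : Prop :=
  forall c, atlas M c -> forall x, cdom c x ->
    forall i j, ricci (g c) i j x = 0 :> R.

(* Vanishing of the Lie derivative of g along K, in coordinates. *)
Definition killing_field n (M : manifold R n) (g : bfield M) (K : vfield M)
    : Prop :=
  vfield_smooth K /\
  forall c, atlas M c -> forall x, cdom c x -> forall i j : 'I_n,
    \sum_(k < n) (K c x 0 k * pderiv k (fun y => g c y i j) x
                  + g c x k j * pderiv i (fun y => K c y 0 k) x
                  + g c x i k * pderiv j (fun y => K c y 0 k) x) = 0 :> R.

(* The k-th component of nabla_K K. *)
Definition acceleration n (G : 'rV[R]_n -> 'M[R]_n)
    (K : 'rV[R]_n -> 'rV[R]_n) (x : 'rV[R]_n) (k : 'I_n) : R :=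
  \sum_(i < n) K x 0 i * pderiv i (fun y => K y 0 k) x
  + \sum_(i < n) \sum_(j < n) christoffel G k i j x * K x 0 i * K x 0 j.

(* The hypersurface {f = 0} is a Killing horizon of K with surface gravity
   kap: it is regular (df <> 0), K is nonzero, null and normal along it, and
   nabla_K K = kap K there. *)
Definition killing_horizon n (M : manifold R n) (g : bfield M) (f : M -> R)
    (K : vfield M) (kap : R) : Prop :=
  killing_field g K /\
  forall c, atlas M c -> forall x, cdom c x -> f (cmap c x) = 0 ->
    [/\ smooth_on (cdom c) (f \o cmap c),
        exists v : 'rV[R]_n, 'D_v (f \o cmap c) x <> 0 :> R,
        K c x <> 0 /\ K c x *m g c x *m (K c x)^T = 0,
        forall v : 'rV[R]_n, 'D_v (f \o cmap c) x = 0 :> R ->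
          K c x *m g c x *m v^T = 0
      & forall k, acceleration (g c) (K c) x k = kap * K c x 0 k].

End Curvature.

Section Causality.
Context {R : realType}.

Definition smooth_curve n (M : manifold R n) (J : set R) (ga : R -> M) : Prop :=
  (forall t, J t -> {for t, continuous ga}) /\
  forall c, atlas M c ->
    smooth_on (J `&` ga @^-1` cran c) (coord c \o ga : R -> 'rV[R]_n).

(* P c x v is a condition on the velocity v, in the chart c, at coordinates
   x. *)
Definition velocity_cond n (M : manifold R n)
    (P : chart R n M -> 'rV[R]_n -> 'rV[R]_n -> Prop) (J : set R) (ga : R -> M)
    : Prop :=
  forall t, J t -> forall c, atlas M c -> cran c (ga t) ->
    P c (coord c (ga t)) (derive1 (coord c \o ga) t).

Definition time_orientation n (M : manifold R n) (g : bfield M) (T : vfield M)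
    : Prop :=
  vfield_cont T /\
  forall c, atlas M c -> forall x, cdom c x ->
    (T c x *m g c x *m (T c x)^T) 0 0 < 0.

Definition future_timelike n (M : manifold R n) (g : bfield M) (T : vfield M)
    (c : chart R n M) (x v : 'rV[R]_n) : Prop :=
  (v *m g c x *m v^T) 0 0 < 0 /\ (v *m g c x *m (T c x)^T) 0 0 < 0.

Definition future_causal n (M : manifold R n) (g : bfield M) (T : vfield M)
    (c : chart R n M) (x v : 'rV[R]_n) : Prop :=
  [/\ v <> 0, (v *m g c x *m v^T) 0 0 <= 0
    & (v *m g c x *m (T c x)^T) 0 0 < 0].

(* Smoothness up to the end points is restriction from an open interval. *)
Definition segment n (M : manifold R n)
    (P : chart R n M -> 'rV[R]_n -> 'rV[R]_n -> Prop) (ga : R -> M) (a b : R)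
    : Prop :=
  exists (si : R -> M) (J : set R),
    [/\ open J, `[a, b]%classic `<=` J, smooth_curve J si,
        forall t, `[a, b]%classic t -> ga t = si t
      & velocity_cond P `[a, b]%classic si].

Definition piecewise n (M : manifold R n)
    (P : chart R n M -> 'rV[R]_n -> 'rV[R]_n -> Prop) (ga : R -> M) (a b : R)
    : Prop :=
  exists (k : nat) (t : nat -> R),
    [/\ t 0%N = a, t k = b
      & forall i, (i < k)%N -> t i < t i.+1 /\ segment P ga (t i) (t i.+1)].

(* I^+(A). *)
Definition chronological_future n (M : manifold R n) (g : bfield M)
    (T : vfield M) (A : set M) : set M :=
  [set q | exists ga : R -> M,
     [/\ piecewise (future_timelike g T) ga 0 1, A (ga 0) & ga 1 = q]].

(* Curves on [0, +oo[, every half-open interval being diffeomorphic to it. *)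
Definition future_inextendible_causal n (M : manifold R n) (g : bfield M)
    (T : vfield M) (ga : R -> M) : Prop :=
  (forall b, 0 < b -> piecewise (future_causal g T) ga 0 b) /\
  ~ exists q : M, ga t @[t --> +oo] --> q.

(* D^-(S). *)
Definition past_domain_of_dependence n (M : manifold R n) (g : bfield M)
    (T : vfield M) (S : set M) : set M :=
  [set q | forall ga : R -> M, future_inextendible_causal g T ga -> ga 0 = q ->
     exists2 t, 0 <= t & S (ga t)].

(* H^-(S). *)
Definition past_cauchy_horizon n (M : manifold R n) (g : bfield M)
    (T : vfield M) (S : set M) : set M :=
  closure (past_domain_of_dependence g T S) `\`
  chronological_future g T (past_domain_of_dependence g T S).

(* The generators of a Killing horizon S of K are the K-orbits in S. *)
Definition null_generator n (M : manifold R n) (K : vfield M) (S : set M)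
    (ga : R -> M) : Prop :=
  [/\ smooth_curve setT ga, forall t, S (ga t)
    & velocity_cond (fun c x v => v = K c x) setT ga].

Definition closed_curve (M : Type) (ga : R -> M) : Prop :=
  exists2 per, 0 < per & forall t, ga (t + per) = ga t.

Definition null_generators_closed n (M : manifold R n) (K : vfield M)
    (S : set M) : Prop :=
  (forall q, S q -> exists2 ga, null_generator K S ga & ga 0 = q) /\
  (forall ga, null_generator K S ga -> closed_curve ga).

Definition closed_timelike_curve n (M : manifold R n) (g : bfield M)
    (T : vfield M) (ga : R -> M) : Prop :=
  [/\ smooth_curve setT ga, closed_curve ga
    & velocity_cond (future_timelike g T) setT ga].

End Causality.

(* H_{2m+1} is R^{2m+1} with coordinates (z, x_1, y_1, ..., x_m, y_m) and
   coframe w^0 = dz - \sum_r x_r dy_r, w^{2r-1} = dx_r, w^{2r} = dy_r.  The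
   pair (2r-1, 2r), 1 <= r <= m, is (ix r, iy r) with r : 'I_m counted from
   0. *)
Section Heisenberg.
Context {R : realType}.

Definition hdim (m : nat) : nat := m.*2.+1.

Definition ix m (r : 'I_m) : 'I_(hdim m) := inord r.*2.+1.
Definition iy m (r : 'I_m) : 'I_(hdim m) := inord r.*2.+2.

Definition hmul m (h k : 'rV[R]_(hdim m)) : 'rV[R]_(hdim m) :=
  \row_a (h 0 a + k 0 a
          + (if a == 0 then \sum_(r < m) h 0 (ix r) * k 0 (iy r) else 0)).

Definition hinv m (h : 'rV[R]_(hdim m)) : 'rV[R]_(hdim m) :=
  \row_a (- h 0 a
          + (if a == 0 then \sum_(r < m) h 0 (ix r) * h 0 (iy r) else 0)).

(* The entry (b, a) is the component of w^a along the b-th coordinate. *)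
Definition hcoframe m (h : 'rV[R]_(hdim m)) : 'M[R]_(hdim m) :=
  \matrix_(b, a) ((b == a)%:R
     - (if a == 0 then \sum_(r < m | b == iy r) h 0 (ix r) else 0)).

Definition discrete_subgroup m (Ga : set 'rV[R]_(hdim m)) : Prop :=
  [/\ Ga 0, forall h k, Ga h -> Ga k -> Ga (hmul h k),
      forall h, Ga h -> Ga (hinv h)
    & forall h, Ga h -> \forall k \near h, Ga k -> k = h].

Definition orbit m (Ga : set 'rV[R]_(hdim m)) (h : 'rV[R]_(hdim m)) :=
  [set hmul ga h | ga in Ga].

(* Being in the same Ga-orbit, in a form which is an equivalence relation
   without assuming that Ga is a subgroup. *)
Definition same_orbit m (Ga : set 'rV[R]_(hdim m)) (h k : 'rV[R]_(hdim m))
    : bool := `[< orbit Ga h = orbit Ga k >].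

Lemma same_orbit_equiv m (Ga : set 'rV[R]_(hdim m)) :
  equiv_class_of (same_orbit Ga).
Proof.
split=> [h|h k|h k l]; rewrite /same_orbit; first exact/asboolP.
  by apply/asboolP/asboolP.
by move=> /asboolP -> /asboolP ->; apply/asboolP.
Qed.

Canonical same_orbit_rel m (Ga : set 'rV[R]_(hdim m)) :=
  EquivRelPack (same_orbit_equiv Ga).

(* Ga \ H_{2m+1} with the quotient topology. *)
Definition hquot m (Ga : set 'rV[R]_(hdim m)) : topologicalType :=
  quotient_topology {eq_quot same_orbit_rel Ga}.

Definition hproj m (Ga : set 'rV[R]_(hdim m)) (h : 'rV[R]_(hdim m))
    : hquot Ga :=
  \pi_(quotient_topology {eq_quot same_orbit_rel Ga}) h.

(* R x (Ga \ H_{2m+1}), with the local inverses of the projection from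
   R x H_{2m+1} as charts; coordinate 0 is the R factor. *)
Definition stproj m (Ga : set 'rV[R]_(hdim m)) (x : 'rV[R]_(1 + hdim m))
    : R * hquot Ga :=
  (lsubmx x 0 0, hproj Ga (rsubmx x)).

Definition spacetime m (Ga : set 'rV[R]_(hdim m)) : manifold R (1 + hdim m) :=
  @Manifold R (1 + hdim m) (R * hquot Ga)%type
    [set c | [/\ open (cdom c), {in cdom c &, injective (stproj Ga)}
               & cmap c = stproj Ga]].

(* The metric on the cover R x H_{2m+1} is invariant under left translations,
   so the quotient metric has the same component formula in every chart. *)
Section Family.
Variables (m : nat) (A p : 'I_(hdim m) -> R).

Definition chi (r : 'I_m) : R := 1 + p 0 - p (ix r) - p (iy r).

Definition kappa (r : 'I_m) : R := A 0 / (A (ix r) * A (iy r)).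

Definition Fr (r : 'I_m) (tau : R) : R :=
  1 + kappa r ^+ 2 / (4 * chi r ^+ 2) * expR (2 * chi r * tau).

(* For a <> 0 the product has exactly one factor. *)
Definition scale (a : 'I_(hdim m)) (tau : R) : R :=
  A a * expR (p a * tau) *
  (if a == 0 then \prod_(r < m) (Num.sqrt (Fr r tau))^-1
   else \prod_(r < m | (a == ix r) || (a == iy r)) Num.sqrt (Fr r tau)).

Definition lapse (tau : R) : R :=
  expR tau * \prod_(r < m) Num.sqrt (Fr r tau).

Definition family_form (x : 'rV[R]_(1 + hdim m)) : 'M[R]_(1 + hdim m) :=
  let tau := lsubmx x 0 0 in
  let w := hcoframe (rsubmx x) in
  block_mx (- lapse tau ^+ 2)%:M 0
           0 (w *m diag_mx (\row_a scale a tau ^+ 2) *m w^T).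

Definition family_metric (Ga : set 'rV[R]_(hdim m)) : bfield (spacetime Ga) :=
  fun _ x => family_form x.

End Family.

Definition slice m (Ga : set 'rV[R]_(hdim m)) (t : R) : set (spacetime Ga) :=
  [set q | q.1 = t].
Arguments slice {m} Ga t _.

Definition boundary m (Ga : set 'rV[R]_(hdim m)) : set (spacetime Ga) :=
  [set q | q.1 = 0].
Arguments boundary {m} Ga _.

(* A one-sided extension of g: a metric h on R_s x (Ga \ H_{2m+1}) and the
   isometry io of the original spacetime onto {s > 0}, s = e^{2 tau}. *)
Definition one_sided_extension m (Ga : set 'rV[R]_(hdim m))
    (g h : bfield (spacetime Ga)) (io : spacetime Ga -> spacetime Ga) : Prop :=
  [/\ analytic_lorentz_metric h, isometric_open_embedding g h io,
      range io = [set q | 0 < q.1]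
    & forall q, (io q).1 = expR (2 * q.1)].

Definition equivalent_extensions m (Ga : set 'rV[R]_(hdim m))
    (h1 : bfield (spacetime Ga)) (io1 : spacetime Ga -> spacetime Ga)
    (h2 : bfield (spacetime Ga)) (io2 : spacetime Ga -> spacetime Ga) : Prop :=
  exists Psi : spacetime Ga -> spacetime Ga,
    [/\ isometric_open_embedding h1 h2 Psi, range Psi = setT
      & Psi \o io1 = io2].

(* T is future pointing for the orientation of the original spacetime by
   increasing tau. *)
Definition time_orientation_extends m (Ga : set 'rV[R]_(hdim m))
    (h : bfield (spacetime Ga)) (io : spacetime Ga -> spacetime Ga)
    (T : vfield (spacetime Ga)) : Prop :=
  time_orientation h T /\
  forall c c', atlas (spacetime Ga) c -> atlas (spacetime Ga) c' ->
    forall x, locdom io c c' x ->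
      ((delta_mx 0 0 : 'rV[R]_(1 + hdim m)) *m 'J (locrep io c c') x
       *m h c' (locrep io c c' x)
       *m (T c' (locrep io c c' x))^T) 0 0 < 0.

(* Along the added boundary {s = 0} and beyond it. *)
Definition horizon_properties m (Ga : set 'rV[R]_(hdim m))
    (h : bfield (spacetime Ga)) (io : spacetime Ga -> spacetime Ga) : Prop :=
  exists (T K : vfield (spacetime Ga)) (kap : R),
    [/\ time_orientation_extends h io T,
        killing_horizon h (fun q : spacetime Ga => q.1) K kap /\ kap <> 0,
        forall tau : R,
          past_cauchy_horizon h T (io @` slice Ga tau) = boundary Ga
      & compact [set: hquot Ga] ->
        null_generators_closed K (boundary Ga) /\
        exists2 ga, closed_timelike_curve h T ga & forall t, (ga t).1 < 0].

End Heisenberg.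
Arguments family_metric {R m} A p Ga _ _.
Arguments slice {R m} Ga t _.
Arguments boundary {R m} Ga _.

(* Main.v *)
(* The conditions on the exponents give sum_(i > 0) p_i (1 + p_0 - p_i) = 0 and
   1 + p_0 - p_i > 0, so either some horizontal p_i is negative, or all of them
   vanish and p_0 = 1.

   Negative p_i.  A point of the boundary of the image of the spacetime in a
   C^0 extension has a chart whose metric is nearly Minkowski, so there timelike
   curves are confined by fixed cones.  They cannot leave the chart through the
   future end, where their length would be infinite; hence the boundary is met
   as tau -> -oo, after a change of time orientation if necessary.  There the
   horizons shrink, so that the boundary point is approached along a whole
   vertical line over some k in H, and the lines over all points near k end
   near it.  A slice tau = const crosses the chart in a Lipschitz graph, so the
   points of the slice on two such lines are joined by a spacelike curve of
   bounded length; but their distance in direction i is at least a constant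
   times a_i, which tends to infinity since p_i < 0: a contradiction.

   All p_i = 0.  Put s = e^{2 tau} and translate along the centre by psi_+ or
   psi_-, where psi_(+/-)' = -/+ P / A_0 and P(s) = prod_r F_r.  The metric turns
   into +/- A_0 ds w^0 + (A_0^2 s / P) (w^0)^2 + sum_i A_i^2 F_i (w^i)^2, which
   is analytic on all of R x H.  The centre is a Killing direction, null on
   s = 0 with surface gravity of modulus A_0, and timelike in s < 0;
   on a compact quotient its orbits close up.  No orbit of the centre
   converges in Ga \ H, which makes {s = 0} the full Cauchy horizon and the two
   extensions inequivalent. *)
Require Import Defs.
From HB Require Import structures.
From mathcomp Require Import all_boot all_order all_algebra.
From mathcomp Require Import all_classical all_reals all_analysis.
From mathcomp Require Import ring lra zify.
Set Implicit Arguments.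
Unset Strict Implicit.
Unset Printing Implicit Defensive.
Import Order.TTheory GRing.Theory Num.Theory.
Import numFieldNormedType.Exports.
Local Open Scope classical_set_scope.
Local Open Scope ring_scope.


(** * Calculus in finite dimension *)

(** The past end lies at finite proper time and a continuous metric has no curvature, so neither
    lengths nor curvature invariants exclude it; only the stretching of slices is left, and to use
    it points of a chart of the extension must be traced back to points of H. Two facts about
    [ratio a] = a_a / N allow this. It decays at least at the rate 1 - p_a > 0, so the displacement
    of causal curves up to time t is at most of order 1 / ratio(t), which vanishes at the past end.
    And ratio 0 <= chi_r ratio (2r-1) ratio (2r), so the area swept by horizontal motion stays
    within the central horizon: horizons respect the group dilations, which makes squeezing onto a
    vertical line possible. At the future end the gap 1 + p_a > 0 leaves room for the warp. The
    extension is an arbitrary manifold without usable causality theory; this is replaced by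
    continuity arguments inside one coordinate ball. Curves are treated on the cover R x H, where a
    point of the chart is known only up to Ga: hence the path lifting and the uniqueness statements
    near a line. *)

Section MatrixTopology.
Context {R : realType}.

Lemma coord_le_norm m n (x : 'M[R]_(m, n)) i j : `|x i j| <= `|x|.
Proof. by rewrite [leRHS]/Num.Def.normr/= mx_normrE; exact: (le_bigmax _ _ (i, j)). Qed.

Lemma mx_norm_leP m n (x : 'M[R]_(m, n)) e : 0 <= e ->
  (forall i j, `|x i j| <= e) -> `|x| <= e.
Proof.
move=> e0 h; rewrite /Num.Def.normr/= mx_normrE.
by apply: bigmax_le => // -[i j] _; exact: h.
Qed.

Lemma mx_norm_ltP m n (x : 'M[R]_(m, n)) e : 0 < e ->
  (forall i j, `|x i j| < e) -> `|x| < e.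
Proof.
move=> e0 h; rewrite /Num.Def.normr/= mx_normrE.
by apply/bigmax_ltP; split => // -[i j] _; exact: h.
Qed.

Lemma rV_norm_leP n (x : 'rV[R]_n) e : 0 <= e ->
  (forall j, `|x 0 j| <= e) -> `|x| <= e.
Proof. by move=> e0 h; apply: mx_norm_leP => // i j; rewrite ord1. Qed.

Lemma rV_norm_ltP n (x : 'rV[R]_n) e : 0 < e ->
  (forall j, `|x 0 j| < e) -> `|x| < e.
Proof. by move=> e0 h; apply: mx_norm_ltP => // i j; rewrite ord1. Qed.

Lemma cvg_bigsum (V : normedModType R) (T : Type) (F : set_system T) {FF : Filter F}
    (I : Type) (r : seq I) (P : pred I) (f : I -> T -> V) (l : I -> V) :
  (forall i, f i t @[t --> F] --> l i) ->
  \sum_(i <- r | P i) f i t @[t --> F] --> \sum_(i <- r | P i) l i.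
Proof.
move=> h; elim: r => [|i r IH].
  by rewrite big_nil; under eq_fun do rewrite big_nil; exact: cvg_cst.
rewrite big_cons; under eq_fun do rewrite big_cons.
by case: ifP => // _; apply: cvgD.
Qed.

Lemma cvg_mxP (T : Type) (F : set_system T) {FF : Filter F} m n
    (f : T -> 'M[R]_(m, n)) (l : 'M[R]_(m, n)) :
  (forall i j, f t i j @[t --> F] --> l i j) -> f @ F --> l.
Proof.
move=> h; apply/cvgrPdist_le => /= e e0.
have H : \forall t \near F, forall ij : 'I_m * 'I_n, `|l ij.1 ij.2 - f t ij.1 ij.2| <= e.
  apply: filter_forall => ij.
  by move/cvgrPdist_le: (h ij.1 ij.2) => /(_ _ e0).
apply: filterS H => t ht; apply: mx_norm_leP; first exact: ltW.
by move=> i j; rewrite !mxE; exact: (ht (i, j)).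
Qed.

Lemma cvg_coord (T : Type) (F : set_system T) {FF : Filter F} m n
    (f : T -> 'M[R]_(m, n)) (l : 'M[R]_(m, n)) i j :
  f @ F --> l -> f t i j @[t --> F] --> l i j.
Proof.
by apply: (@continuous_cvg _ _ _ _ _ _ (fun x : 'M[R]_(m, n) => x i j)); exact: coord_continuous.
Qed.

Lemma cvg_rVP (T : Type) (F : set_system T) {FF : Filter F} n
    (f : T -> 'rV[R]_n) (l : 'rV[R]_n) :
  (forall j, f t 0 j @[t --> F] --> l 0 j) -> f @ F --> l.
Proof. by move=> h; apply: cvg_mxP => i j; rewrite ord1; exact: h. Qed.

Lemma mulmx_continuous_at (T : topologicalType) m n p (f : T -> 'M[R]_(m, n))
    (g : T -> 'M[R]_(n, p)) x :
  {for x, continuous f} -> {for x, continuous g} ->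
  {for x, continuous (fun y => f y *m g y)}.
Proof.
move=> cf cg; apply: cvg_mxP => i j; rewrite mxE.
under eq_fun do rewrite mxE.
apply: cvg_bigsum => k.
apply: cvgM; exact: cvg_coord.
Qed.

Lemma linear_continuous_rV n (V : normedModType R) (f : {linear 'rV[R]_n -> V}) :
  continuous f.
Proof.
have -> : f = (fun x => \sum_j x 0 j *: f (delta_mx 0 j)) :> (_ -> _).
  apply/funext => x; rewrite {1}[x]row_sum_delta linear_sum.
  by apply: eq_bigr => j _; rewrite linearZ.
move=> x; apply: (@cvg_bigsum _ _ (nbhs x)) => j.
by apply: cvgZr_tmp; exact: coord_continuous.
Qed.

Lemma linear_bounded_rV n (V : normedModType R) (f : {linear 'rV[R]_n -> V}) :
  exists2 M : R, 0 < M & forall x, `|f x| <= M * `|x|.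
Proof.
exists (1 + \sum_j `|f (delta_mx 0 j)|).
  by rewrite ltr_pwDl ?ltr01// sumr_ge0.
move=> x; rewrite {1}[x]row_sum_delta linear_sum.
apply: le_trans (ler_norm_sum _ _ _) _.
rewrite mulrDl mul1r mulr_suml ler_wpDl//; apply: ler_sum => j _.
by rewrite linearZ normrZ mulrC ler_wpM2l//; exact: coord_le_norm.
Qed.

Lemma rV_cluster n (A : set 'rV[R]_n) (M : R) (F : set_system 'rV[R]_n) :
  ProperFilter F -> F [set x | `|x| <= M] ->
  exists2 z, `|z| <= M & cluster F z.
Proof.
move=> PF FM.
have cM : compact [set x : 'rV[R]_n | `|x| <= M].
  apply: bounded_closed_compact.
    exists M; split; first exact: num_real.
    by move=> y My x /= /le_trans; apply; exact: ltW.
  have := @closed_closed_ball_ R 'rV[R]_n 0 M.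
  by congr closed; apply/seteqP; split => x /=; rewrite /closed_ball_/= sub0r normrN.
by have [z [zM cz]] := cM F PF FM; exists z.
Qed.

End MatrixTopology.

Section OneVariable.
Context {R : realType}.
Implicit Types (f g : R -> R) (a b t : R).

Lemma is_derive_continuous (V : normedModType R) (f : R -> V) t v :
  is_derive t 1 f v -> {for t, continuous f}.
Proof. by case=> /derivable1_diffP/differentiable_continuous. Qed.

Lemma derive_ge0_le f df a b : a <= b ->
  (forall t, a <= t <= b -> is_derive t 1 f (df t)) ->
  (forall t, a <= t <= b -> 0 <= df t) -> f a <= f b.
Proof.
move=> ab fd d0.
have cf : {within `[a, b], continuous f}.
  apply: continuous_in_subspaceT => t; rewrite inE/= in_itv/= => tab.
  exact: is_derive_continuous (fd t tab).
have [|c] := @MVT_segment _ f df a b ab _ cf.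
  move=> t; rewrite in_itv/= => /andP[? ?].
  by apply: fd; rewrite !ltW.
rewrite in_itv/= => cab E; rewrite -subr_ge0 E mulr_ge0 ?subr_ge0//.
exact: d0.
Qed.

Lemma derive_gt0_lt f df a b : a < b ->
  (forall t, a <= t <= b -> is_derive t 1 f (df t)) ->
  (forall t, a <= t <= b -> 0 < df t) -> f a < f b.
Proof.
move=> ab fd d0.
have cf : {within `[a, b], continuous f}.
  apply: continuous_in_subspaceT => t; rewrite inE/= in_itv/= => tab.
  exact: is_derive_continuous (fd t tab).
have [|c] := @MVT_segment _ f df a b (ltW ab) _ cf.
  move=> t; rewrite in_itv/= => /andP[? ?].
  by apply: fd; rewrite !ltW.
rewrite in_itv/= => cab E; rewrite -subr_gt0 E mulr_gt0 ?subr_gt0//.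
exact: d0.
Qed.

Lemma derive_le_sub f g df dg a b : a <= b ->
  (forall t, a <= t <= b -> is_derive t 1 f (df t)) ->
  (forall t, a <= t <= b -> is_derive t 1 g (dg t)) ->
  (forall t, a <= t <= b -> df t <= dg t) -> f b - f a <= g b - g a.
Proof.
move=> ab fd gd le.
have : (g - f) a <= (g - f) b.
  apply: (@derive_ge0_le _ (fun t => dg t - df t)) => // t tab.
    by have := fd t tab; have := gd t tab; move=> ? ?; exact: is_deriveB.
  by rewrite subr_ge0 le.
by rewrite !fctE; lra.
Qed.

(** The majorant is given by its primitive [g], so the Lipschitz and horizon estimates along curves
    need no integral. *)
Lemma derive_norm_sub_le f g df dg a b : a <= b ->
  (forall t, a <= t <= b -> is_derive t 1 f (df t)) ->
  (forall t, a <= t <= b -> is_derive t 1 g (dg t)) ->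
  (forall t, a <= t <= b -> `|df t| <= dg t) -> `|f b - f a| <= g b - g a.
Proof.
move=> ab fd gd le; rewrite ler_norml; apply/andP; split; last first.
  by apply: derive_le_sub ab fd gd _ => t /le /ler_normlW.
have /= := @derive_le_sub (- f) g (fun t => - df t) dg a b ab.
rewrite lerNl !fctE; move=> H; have : - f b - - f a <= g b - g a.
  apply: H => // t tab; first by have := fd t tab => ?; exact: is_deriveN.
  by have := le t tab; rewrite ler_norml => /andP[]; rewrite lerNl.
by lra.
Qed.

End OneVariable.

Section Differentiation.
Context {R : realType}.

Lemma is_derive_line (V W : normedModType R) (f : V -> W) (y w : V) (s : R) :
  derivable f (y + s *: w) w ->
  is_derive s 1 (fun u => f (y + u *: w)) ('D_w f (y + s *: w)).
Proof.
have E : (fun h : R => h^-1 *: (((fun u => f (y + u *: w)) \o shift s) (h *: 1) - f (y + s *: w))) =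
  (fun h => h^-1 *: ((f \o shift (y + s *: w)) (h *: w) - f (y + s *: w))).
  apply/funext => h /=; rewrite (_ : h%:A = h) ?[_ *: 1]mulr1//.
  by rewrite scalerDl addrCA.
by move=> df; apply: DeriveDef; rewrite /derivable /derive E.
Qed.

Lemma is_derive_rV m n (V : normedModType R) (f : V -> 'M[R]_(m, n)) x v
    (df : 'M[R]_(m, n)) :
  (forall i j, is_derive x v (fun y => f y i j) (df i j)) -> is_derive x v f df.
Proof.
move=> h; have d : derivable f x v by apply/derivable_mxP => i j; case: (h i j).
apply: DeriveDef => //; rewrite derive_mx//; apply/matrixP => i j; rewrite mxE.
by case: (h i j).
Qed.

Lemma is_derive_coord m n (V : normedModType R) (f : V -> 'M[R]_(m, n)) x v
    (df : 'M[R]_(m, n)) i j :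
  is_derive x v f df -> is_derive x v (fun y => f y i j) (df i j).
Proof.
case=> d <-; apply: DeriveDef; first by have /derivable_mxP := d; apply.
by rewrite derive_mx// mxE.
Qed.

Lemma is_derive_comp_diff (V W : normedModType R) (f : V -> W) (g : R -> V) (t : R) v :
  is_derive t 1 g v -> differentiable f (g t) ->
  is_derive t 1 (f \o g) ('d f (g t) v).
Proof.
move=> gv df; have gd : differentiable g t by apply/derivable1_diffP; case: gv.
apply: DeriveDef; first by apply/derivable1_diffP; exact: differentiable_comp.
rewrite deriveE; last exact: differentiable_comp.
rewrite diff_comp//=; congr ('d f _ _).
by rewrite -deriveE//; case: gv.
Qed.

Lemma is_derive_compR (V : normedModType R) (f : R -> V) (g : R -> R) (t v : R) w :
  is_derive t 1 g v -> is_derive (g t) 1 f w ->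
  is_derive t 1 (f \o g) (v *: w).
Proof.
move=> gv fw; have df : differentiable f (g t) by apply/derivable1_diffP; case: fw.
have H := is_derive_comp_diff gv df; apply: is_derive_eq.
rewrite -[v in LHS]mulr1 -[v * 1]/(v *: 1) linearZ/=.
by rewrite -deriveE//; case: fw => _ ->.
Qed.

Lemma derive_line_mvt (V : normedModType R) (f : V -> R) (y w : V) :
  (forall s : R, 0 <= s <= 1 -> derivable f (y + s *: w) w) ->
  exists2 s : R, 0 <= s <= 1 & f (y + w) - f y = 'D_w f (y + s *: w).
Proof.
move=> d.
have D (s : R) : 0 <= s <= 1 ->
    is_derive s 1 (fun u => f (y + u *: w)) ('D_w f (y + s *: w)).
  by move=> s01; apply: is_derive_line; exact: d.
have [| |s s01 E] := @MVT R (fun u : R => f (y + u *: w)) (fun s : R => 'D_w f (y + s *: w)) 0 1 ltr01.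
- by move=> s; rewrite in_itv/= => /andP[? ?]; apply: D; rewrite !ltW.
- apply: continuous_in_subspaceT => t; rewrite inE/= in_itv/= => tab.
  exact: is_derive_continuous (D t tab).
exists s; first by move: s01; rewrite in_itv/= => /andP[? ?]; rewrite !ltW.
by move: E; rewrite scale1r scale0r addr0 subr0 mulr1.
Qed.

Lemma derivableZv (V W : normedModType R) (f : V -> W) (x v : V) (a : R) :
  derivable f x v -> is_derive x (a *: v) f (a *: 'D_v f x).
Proof.
move=> dv; have H : is_derive (0 : R) 1 (fun u : R => f (x + u *: v)) ('D_v f x).
  by have := @is_derive_line _ _ f x v 0; rewrite scale0r addr0; exact.
have ha : is_derive (0 : R) 1 (fun u : R => a * u) a.
  by apply: is_derive_eq; rewrite [_ *: 1]mulr1.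
have := @is_derive_compR _ (fun u => f (x + u *: v)) (fun u => a * u) 0 a
  ('D_v f x) ha.
rewrite mulr0 => /(_ H) [d e].
have E : (fun u : R => f (u *: (a *: v) + x)) =
         (fun u => f (x + u *: v)) \o (fun u => a * u).
  by apply/funext => u /=; rewrite scalerA mulrC addrC.
apply: DeriveDef; first by apply/derivable1P; rewrite E.
rewrite -e -E /derive; congr (lim _).
rewrite /fmap; congr ((fun g : R -> W => g @ 0^') _).
by apply/funext => h /=; rewrite addr0 scale0r add0r [h%:A]mulr1.
Qed.

Section ContinuousDerivatives.
Variables (V : normedModType R) (f : V -> R) (x : V).
Hypothesis df : forall v, \forall y \near x, derivable f y v.
Hypothesis cf : forall v, {for x, continuous (fun y => 'D_v f y)}.

(** [Ck_on] provides directional derivatives only, so their additivity has to be proved. The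
    quotient along v + w is the quotient along v at x plus one along w at x + h v, and by the mean
    value theorem the latter is a derivative along w at a point near x. *)
Lemma derive_additive v w : 'D_(v + w) f x = 'D_v f x + 'D_w f x.
Proof.
have dx u : derivable f x u by exact: nbhs_singleton (df u).
apply/eqP; rewrite -subr_eq0 -normr_le0; apply/ler_addgt0Pl => e e0; rewrite addr0.
have e40 : 0 < e / 4 by rewrite divr_gt0.
have Hw : \forall y \near x, derivable f y w /\ `|'D_w f x - 'D_w f y| < e / 4.
  have c : (fun y => 'D_w f y) @ x --> 'D_w f x := @cf w.
  by apply: filterI (df w) _; move/cvgrPdist_lt: c; exact.
have [d /= d0 Hd] := (nbhs_ballP _ _).1 Hw.
have quot u : \forall h \near (0 : R)^',
    `|'D_u f x - h^-1 *: (f (h *: u + x) - f x)| < e / 4.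
  by have /cvgrPdist_lt/(_ _ e40) := dx u.
pose M := `|v| + `|w| + 1.
have M0 : 0 < M by rewrite /M ltr_wpDl// addr_ge0.
have small : \forall h \near (0 : R)^', `|h| < d / M.
  by apply: dnbhs0_lt; rewrite divr_gt0.
have nz : \forall h \near (0 : R)^', h != 0 by exact: nbhs_dnbhs_neq.
have [h [q1 [q2 [hs h0]]]] := filter_ex (filterI (quot (v + w)) (filterI (quot v) (filterI small nz))).
have inb s : 0 <= s <= 1 -> ball x d (x + h *: v + s *: (h *: w)).
  move=> /andP[s0 s1]; rewrite -ball_normE /ball_/= opprD addrA opprD addrA subrr sub0r.
  rewrite -opprD normrN scalerA mulrC -scalerA -scalerDr normrZ.
  apply: (@le_lt_trans _ _ (`|h| * (`|v| + `|w|))).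
    rewrite ler_wpM2l// (le_trans (ler_normD _ _))// lerD2l normrZ ger0_norm//.
    by rewrite ler_piMl.
  move: hs; rewrite ltr_pdivlMr// => /(le_lt_trans _); apply.
  by rewrite ler_wpM2l// /M lerDl.
have [|s s01 E] := @derive_line_mvt V f (x + h *: v) (h *: w).
  by move=> s s01; have [d1 _] := Hd _ (inb s s01); case: (derivableZv h d1).
have [d1 d2] := Hd _ (inb s s01).
have E2 : 'D_(h *: w) f (x + h *: v + s *: (h *: w)) =
          h *: 'D_w f (x + h *: v + s *: (h *: w)).
  by case: (derivableZv h d1).
have E3 : h^-1 *: (f (h *: (v + w) + x) - f x) =
    'D_w f (x + h *: v + s *: (h *: w)) + h^-1 *: (f (h *: v + x) - f x).
  rewrite (_ : f (h *: (v + w) + x) - f x = (f (x + h *: v + h *: w) - f (x + h *: v)) + (f (h *: v + x) - f x)).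
    rewrite E E2 scalerDr; congr (_ + _).
    by rewrite scalerA mulVf// scale1r.
  rewrite (addrC (h *: v)) addrA subrK; congr (f _ - _).
  by rewrite scalerDr addrC addrA.
move: q1 q2 d2; rewrite E3.
set A := 'D_w f _; set B := h^-1 *: _; set C := 'D_(v + w) f x.
set D1 := 'D_v f x; set D2 := 'D_w f x.
rewrite !ltr_norml ler_norml; move: A B C D1 D2; clear=> A B C D1 D2.
move=> /andP[? ?] /andP[? ?] /andP[? ?]; apply/andP; split; lra.
Qed.

End ContinuousDerivatives.

Lemma diff_bound (V W : normedModType R) (f : V -> W) x e :
  differentiable f x -> 0 < e ->
  \forall h \near 0, `|f (x + h) - f x - 'd f x h| <= e * `|h|.
Proof.
move=> /diff_locally df e0.
have E h : f (x + h) = f x + 'd f x h + ([o_ 0 id of f \o shift x - (cst (f x) + 'd f x)] : _ -> _) h.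
  by have E := congr1 (@^~ h) df; rewrite (addrC x); exact: E.
have /eqoP/(_ e e0) : [o_ 0 id of f \o shift x - (cst (f x) + 'd f x)] =o_ 0 id.
  exact: littleo_eqo.
by apply: filterS => h; rewrite E -(addrA _ (- f x)) -opprD [f x + _ + _]addrC addrK.
Qed.

Lemma is_diff_bound (V W : normedModType R) (f : V -> W) (df : {linear V -> W}) x :
  continuous df ->
  (forall e, 0 < e -> \forall h \near 0, `|f (x + h) - f x - df h| <= e * `|h|) ->
  is_diff x f df.
Proof.
move=> cdf H.
have E : f \o shift x = cst (f x) + df +o_ 0 id.
  apply/eqaddoP => e e0; have := H e e0; apply: filterS => h.
  by rewrite !fctE /= (addrC h) opprD addrA.
have Ed := diff_unique cdf E.
by apply: DiffDef => //; apply/diff_locallyP; rewrite Ed.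
Qed.

(** The passage from [Ck_on] to Frechet differentiability. Each component has a derivative linear in
    the direction by [derive_additive]; the mean value theorem on the segment from x to x + h and
    continuity of the partial derivatives bound the remainder. *)
Lemma is_diff_C1 n m (U : set 'rV[R]_n) (f : 'rV[R]_n -> 'rV[R]_m) x :
  open U ->
  (forall v y, U y -> derivable f y v /\ {for y, continuous (fun z => 'D_v f z)}) ->
  U x -> differentiable f x.
Proof.
move=> oU H Ux.
pose fj j y := f y 0 j : R.
have dfj j v y : U y -> derivable (fj j) y v.
  by move=> /(H v)[/derivable_mxP + _]; exact.
have Ej j v y : U y -> 'D_v (fj j) y = ('D_v f y) 0 j.
  by move=> /(H v)[d _]; rewrite derive_mx// mxE.
have nU y : U y -> nbhs y U by move=> Uy; exact: open_nbhs_nbhs.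
have cfj j v y : U y -> {for y, continuous (fun z => 'D_v (fj j) z)}.
  move=> Uy; have [_ c] := H v y Uy; rewrite /prop_for/= /continuous_at Ej//.
  have c' := @cvg_coord _ _ (nbhs y) (nbhs_filter y) 1 m _ _ 0 j c.
  have ne : {near y, (fun z => ('D_v f z) 0 j) =1 (fun z => 'D_v (fj j) z)}.
    by apply: filterS (nU _ Uy) => z Uz; rewrite Ej.
  exact: cvg_trans (near_eq_cvg ne) c'.
have add j y v w : U y -> 'D_(v + w) (fj j) y = 'D_v (fj j) y + 'D_w (fj j) y.
  move=> Uy; apply: derive_additive => u; last exact: cfj.
  by apply: filterS (nU _ Uy) => z; exact: dfj.
have scal j y a v : U y -> 'D_(a *: v) (fj j) y = a * 'D_v (fj j) y.
  by move=> Uy; case: (derivableZv a (dfj j v y Uy)).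
have sum j y v : U y -> 'D_v (fj j) y = \sum_i v 0 i * 'D_(delta_mx 0 i) (fj j) y.
  move=> Uy; rewrite {1}[v]row_sum_delta.
  elim/big_rec2 : _ => [|i a b _ IH]; first by rewrite derive0.
  by rewrite add// scal// IH.
pose J : 'M[R]_(n, m) := \matrix_(i, j) 'D_(delta_mx 0 i) (fj j) x.
suff : is_diff x f (mulmxr J) by case.
apply: is_diff_bound; first exact: linear_continuous_rV.
move=> e e0.
(* The remainder is a sum of n terms, each allowed this error; the successor also covers n = 0. *)
have e'0 : 0 < e / n.+1%:R by rewrite divr_gt0.
have near1 : \forall y \near x, U y /\ forall ij : 'I_n * 'I_m,
    `|'D_(delta_mx 0 ij.1) (fj ij.2) x - 'D_(delta_mx 0 ij.1) (fj ij.2) y| <= e / n.+1%:R.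
  apply: filterI; first exact: nU.
  refine (@filter_forall _ _ (fun (ij : 'I_n * 'I_m) y =>
    `|'D_(delta_mx 0 ij.1) (fj ij.2) x - 'D_(delta_mx 0 ij.1) (fj ij.2) y| <= e / n.+1%:R)
    (nbhs x) (nbhs_filter x) _).
  by move=> ij; have /cvgrPdist_le/(_ _ e'0) := cfj ij.2 (delta_mx 0 ij.1) x Ux.
have [d /= d0 Hd] := (nbhs_ballP _ _).1 near1.
apply/nbhs_ballP; exists d => //= h; rewrite -ball_normE /ball_/= sub0r normrN => hd.
have inb s : 0 <= s <= 1 -> ball x d (x + s *: h).
  move=> /andP[s0 s1]; rewrite -ball_normE /ball_/= opprD addrA subrr sub0r normrN normrZ.
  by rewrite ger0_norm//; apply: le_lt_trans hd; rewrite ler_piMl.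
apply: rV_norm_leP => [|j]; first by rewrite mulr_ge0// ltW.
have [s s01 E] : exists2 s : R, 0 <= s <= 1 & fj j (x + h) - fj j x = 'D_h (fj j) (x + s *: h).
  by apply: derive_line_mvt => s s01; apply: dfj; have [] := Hd _ (inb s s01).
have [Us Hs] := Hd _ (inb s s01).
have -> : (f (x + h) - f x - mulmxr J h) 0 j = 'D_h (fj j) (x + s *: h) - 'D_h (fj j) x.
  rewrite !mxE -E; congr (_ - _); rewrite sum//.
  by apply: eq_bigr => i _; rewrite !mxE.
rewrite sum// [in X in _ - X]sum// -sumrB; apply: le_trans (ler_norm_sum _ _ _) _.
apply: (@le_trans _ _ (\sum_(i < n) `|h| * (e / n.+1%:R))).
  apply: ler_sum => i _; rewrite -mulrBr normrM; apply: ler_pM => //.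
    exact: coord_le_norm.
  by rewrite distrC; exact: (Hs (i, j)).
rewrite sumr_const card_ord -mulrnAr mulrC ler_wpM2r// -[in leLHS]mulr_natr -mulrA ler_piMr ?ltW//.
by rewrite mulrC ltr_pdivrMr// mul1r ltr_nat.
Unshelve. all: by end_near. Qed.

End Differentiation.

(** * The Heisenberg group and its quotients *)

Section RealInduction.
Context {R : realType}.

(** The continuity method: from P at all earlier points one must reach P at t and a little beyond.
    The supremum of the points all of whose predecessors satisfy P is then b. *)
Lemma real_induction (a b : R) (P : R -> Prop) :
  (forall t, a <= t <= b -> (forall u, a <= u < t -> P u) ->
     exists2 d, 0 < d & forall u, a <= u <= b -> u < t + d -> P u) ->
  forall t, a <= t <= b -> P t.
Proof.
move=> H t tab; have ab : a <= b by case/andP: tab => /le_trans; apply.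
pose E := [set t | a <= t <= b /\ forall u, a <= u < t -> P u].
have Ea : E a by split=> [|u /andP[? ?]]; [rewrite lexx|lra].
have hE : has_sup E by split; [exists a|exists b => u [/andP[]]].
have sab : a <= sup E <= b.
  by rewrite sup_upper_bound//= ge_sup//; [exists a|move=> u [/andP[]]].
have Es u : a <= u < sup E -> P u.
  case/andP=> au us; have /sup_adherent/(_ hE)[v [_ Pv] uv] : 0 < sup E - u by rewrite subr_gt0.
  by apply: Pv; rewrite au; move: uv; rewrite opprB addrCA subrr addr0.
have [d d0 Hd] := H _ sab Es.
have [sb|bs] := ltP (sup E) b; last first.
  by apply: Hd => //; case/andP: tab sab => ? ? /andP[? ?]; lra.
have : E (Num.min b (sup E + d)).
  case/andP: sab => ? ?; split.
    by rewrite le_min ge_min ab lexx; lra.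
  move=> u; rewrite lt_min => /and3P[au ub us]; apply: Hd => //.
  by rewrite au ltW.
move/(sup_upper_bound hE); rewrite ge_min; case/orP => ?; lra.
Qed.

(** The set where two lifts agree is closed because T is Hausdorff, and open by the local
    hypothesis. *)
Lemma path_eq (T : topologicalType) (hT : hausdorff_space T) (l1 l2 : R -> T) (a b : R) :
  l1 a = l2 a ->
  (forall t, a <= t <= b -> {for t, continuous l1}) ->
  (forall t, a <= t <= b -> {for t, continuous l2}) ->
  (forall t, a <= t <= b -> l1 t = l2 t -> \forall u \near t, l1 u = l2 u) ->
  forall t, a <= t <= b -> l1 t = l2 t.
Proof.
move=> ea c1 c2 loc; apply: real_induction => t tab IH.
have et : l1 t = l2 t.
  have [->//|nta] := eqVneq t a.
  have at' : a < t by rewrite lt_neqAle eq_sym nta; case/andP: tab.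
  have h1 : l1 u @[u --> t^'-] --> l1 t by apply: cvg_at_left_filter; exact: c1.
  have h2 : l1 u @[u --> t^'-] --> l2 t.
    have h2 : l2 u @[u --> t^'-] --> l2 t by apply: cvg_at_left_filter; exact: c2.
    apply: cvg_trans h2; apply: near_eq_cvg.
    near=> u; apply/esym/IH/andP; split; last by near: u; exact: nbhs_left_lt.
    by near: u; apply: nbhs_left_ge.
  exact: cvg_unique h1 h2.
have [d /= d0 Hd] := (nbhs_ballP _ _).1 (loc t tab et).
exists d => // u /andP[au _] ud; have [ut|tu] := ltP u t; first by apply: IH; rewrite au.
by apply: Hd; rewrite /ball/= ltr_norml; apply/andP; split; lra.
Unshelve. all: by end_near. Qed.

Lemma nbhs_pairP (V W : normedModType R) (x : V) (y : W) (A : set (V * W)) :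
  nbhs (x, y) A ->
  exists2 d, 0 < d & forall x' y', `|x - x'| < d -> `|y - y'| < d -> A (x', y').
Proof.
move=> /nbhs_ballP[d /= d0 Hd]; exists d => // x' y' hx hy.
by apply: Hd; split => /=; rewrite -ball_normE.
Qed.

Lemma nbhs_pair_near (V W : normedModType R) (x : V) (y : W) (A : set (V * W)) d :
  0 < d -> (forall x' y', `|x - x'| < d -> `|y - y'| < d -> A (x', y')) ->
  nbhs (x, y) A.
Proof.
move=> d0 H; apply/nbhs_ballP; exists d => // -[x' y'] [/=].
by rewrite -!ball_normE; exact: H.
Qed.

Lemma nbhs_distP (V : normedModType R) (x : V) (A : set V) :
  nbhs x A -> exists2 d, 0 < d & forall y, `|x - y| < d -> A y.
Proof. by move=> /nbhs_ballP[d /= d0 Hd]; exists d => // y h; apply: Hd; rewrite -ball_normE. Qed.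

Lemma dist_nbhs (V : normedModType R) (x : V) (A : set V) d :
  0 < d -> (forall y, `|x - y| < d -> A y) -> nbhs x A.
Proof. by move=> d0 H; apply/nbhs_ballP; exists d => // y; rewrite -ball_normE; exact: H. Qed.

Lemma continuous_near (T : topologicalType) (V : normedModType R) (f : T -> V) x e :
  {for x, continuous f} -> 0 < e -> \forall y \near x, `|f x - f y| < e.
Proof. by move=> c e0; have /cvgrPdist_lt/(_ _ e0) : f @ x --> f x := c. Qed.

Lemma continuous_nbhs (T U : topologicalType) (f : T -> U) x (A : set U) :
  {for x, continuous f} -> open A -> A (f x) -> nbhs x (f @^-1` A).
Proof. by move=> c oA Ax; apply: c; exact: open_nbhs_nbhs. Qed.

Lemma continuous_near_eq (T U : topologicalType) (f g : T -> U) x :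
  {for x, continuous g} -> (\forall y \near x, g y = f y) -> {for x, continuous f}.
Proof.
move=> c e; rewrite /prop_for /continuous_at -(nbhs_singleton e).
by apply: cvg_trans c; apply: near_eq_cvg; apply: filterS e => y ->.
Qed.

End RealInduction.

Section HeisenbergGroup.
Context {R : realType} {m : nat}.
Implicit Types (h k l : 'rV[R]_(hdim m)) (r : 'I_m).

Lemma val_ix r : ix r = r.*2.+1 :> nat.
Proof. by rewrite inordK//; have := ltn_ord r; rewrite /hdim; lia. Qed.

Lemma val_iy r : iy r = r.*2.+2 :> nat.
Proof. by rewrite inordK//; have := ltn_ord r; rewrite /hdim; lia. Qed.

Lemma ix_neq0 r : (ix r == 0 :> 'I_(hdim m)) = false.
Proof. by apply/negbTE/eqP => /(congr1 (@nat_of_ord _)); rewrite val_ix. Qed.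

Lemma iy_neq0 r : (iy r == 0 :> 'I_(hdim m)) = false.
Proof. by apply/negbTE/eqP => /(congr1 (@nat_of_ord _)); rewrite val_iy. Qed.

Lemma ix_inj : injective (@ix m).
Proof. by move=> r s /(congr1 (@nat_of_ord _)); rewrite !val_ix => -[/double_inj/val_inj]. Qed.

Lemma iy_inj : injective (@iy m).
Proof. by move=> r s /(congr1 (@nat_of_ord _)); rewrite !val_iy => -[/double_inj/val_inj]. Qed.

Lemma ix_neq_iy r s : (ix r == iy s) = false.
Proof.
apply/negbTE/eqP => /(congr1 (@nat_of_ord _)); rewrite val_ix val_iy; lia.
Qed.

Lemma hindexP (a : 'I_(hdim m)) : [\/ a = 0, exists r, a = ix r | exists r, a = iy r].
Proof.
case: (eqVneq a 0) => [->|a0]; first by constructor 1.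
have a1 : (0 < a)%N by rewrite lt0n; apply: contra a0 => /eqP e; apply/eqP/val_inj.
have e := odd_double_half a.-1.
have am : (a < m.*2.+1)%N := ltn_ord a.
have lt : (a.-1./2 < m)%N by lia.
case o : (odd a.-1); rewrite o in e; [constructor 3|constructor 2]; exists (Ordinal lt); apply: ord_inj.
  by rewrite val_iy /=; lia.
by rewrite val_ix /=; lia.
Qed.

Lemma sum_hindex (V : nmodType) (F : 'I_(hdim m) -> V) :
  \sum_a F a = F 0 + \sum_(r < m) (F (ix r) + F (iy r)).
Proof.
have dbl (G : nat -> V) n : \sum_(0 <= i < n.*2) G i = \sum_(0 <= r < n) (G r.*2 + G r.*2.+1).
  elim: n => [|n IH]; first by rewrite !big_geq.
  by rewrite doubleS !big_nat_recr//= IH addrA.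
rewrite big_ord_recl; congr (_ + _).
rewrite -(big_mkord xpredT (fun i => F (inord i.*2.+1) + F (inord i.*2.+2))).
rewrite -(dbl (fun i => F (inord i.+1))) big_mkord.
by apply: eq_bigr => i _; congr F; apply: ord_inj; rewrite inordK// ltnS.
Qed.

Lemma hmulE h k a : hmul h k 0 a = h 0 a + k 0 a
   + (if a == 0 then \sum_(r < m) h 0 (ix r) * k 0 (iy r) else 0).
Proof. by rewrite mxE. Qed.

Lemma hmul0E h k : hmul h k 0 0 = h 0 0 + k 0 0 + \sum_(r < m) h 0 (ix r) * k 0 (iy r).
Proof. by rewrite mxE eqxx. Qed.

Lemma hmulhE h k a : a != 0 -> hmul h k 0 a = h 0 a + k 0 a.
Proof. by rewrite mxE => /negbTE ->; rewrite addr0. Qed.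

Lemma hmul_ix h k r : hmul h k 0 (ix r) = h 0 (ix r) + k 0 (ix r).
Proof. by rewrite hmulhE// ix_neq0. Qed.

Lemma hmul_iy h k r : hmul h k 0 (iy r) = h 0 (iy r) + k 0 (iy r).
Proof. by rewrite hmulhE// iy_neq0. Qed.

Lemma hmulA h k l : hmul h (hmul k l) = hmul (hmul h k) l.
Proof.
apply/rowP => a; case: (eqVneq a 0) => [->|a0]; last by rewrite !hmulhE// addrA.
rewrite !hmul0E.
under [\sum_(r < m) h 0 _ * _]eq_bigr do rewrite hmul_iy mulrDr.
under [X in _ = _ + X]eq_bigr do rewrite hmul_ix mulrDl.
rewrite !big_split/=; ring.
Qed.

Lemma hmul0h h : hmul 0 h = h.
Proof.
apply/rowP => a; rewrite hmulE mxE add0r big1; first by rewrite if_same addr0.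
by move=> r _; rewrite mxE mul0r.
Qed.

Lemma hmulh0 h : hmul h 0 = h.
Proof.
apply/rowP => a; rewrite hmulE mxE addr0 big1; first by rewrite if_same addr0.
by move=> r _; rewrite mxE mulr0.
Qed.

Lemma hinvE h a : hinv h 0 a = - h 0 a + (if a == 0 then \sum_(r < m) h 0 (ix r) * h 0 (iy r) else 0).
Proof. by rewrite mxE. Qed.

Lemma hinv_ix h r : hinv h 0 (ix r) = - h 0 (ix r).
Proof. by rewrite hinvE ix_neq0 addr0. Qed.

Lemma hinv_iy h r : hinv h 0 (iy r) = - h 0 (iy r).
Proof. by rewrite hinvE iy_neq0 addr0. Qed.

Lemma hmulVh h : hmul (hinv h) h = 0.
Proof.
apply/rowP => a; rewrite hmulE hinvE [in RHS]mxE; case: ifP => _; last by ring.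
under [X in _ + X = _]eq_bigr do rewrite hinv_ix mulNr.
rewrite sumrN; ring.
Qed.

Lemma hmulhV h : hmul h (hinv h) = 0.
Proof.
apply/rowP => a; rewrite hmulE hinvE [in RHS]mxE; case: ifP => _; last by ring.
under [X in _ + X = _]eq_bigr do rewrite hinv_iy mulrN.
rewrite sumrN; ring.
Qed.

Lemma hmulKh h k : hmul (hinv h) (hmul h k) = k.
Proof. by rewrite hmulA hmulVh hmul0h. Qed.

Lemma hmulKVh h k : hmul h (hmul (hinv h) k) = k.
Proof. by rewrite hmulA hmulhV hmul0h. Qed.

Lemma hmulhK h k : hmul (hmul k h) (hinv h) = k.
Proof. by rewrite -hmulA hmulhV hmulh0. Qed.

Lemma hmul_continuous (T : topologicalType) (f g : T -> 'rV[R]_(hdim m)) x :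
  {for x, continuous f} -> {for x, continuous g} ->
  {for x, continuous (fun y => hmul (f y) (g y))}.
Proof.
move=> cf cg; apply: cvg_rVP => a; rewrite hmulE.
under eq_fun do rewrite hmulE.
apply: cvgD; first by apply: cvgD; exact: cvg_coord.
case: ifP => _; last exact: cvg_cst.
by apply: cvg_bigsum => r; apply: cvgM; exact: cvg_coord.
Qed.

Lemma hinv_continuous : continuous (@hinv R m).
Proof.
move=> x; apply: (@cvg_rVP _ _ (nbhs x)) => a; rewrite hinvE.
under eq_fun do rewrite hinvE.
apply: cvgD; first by apply: cvgN; exact: coord_continuous.
case: ifP => _; last exact: cvg_cst.
by apply: (@cvg_bigsum _ _ _ (nbhs x)) => r; apply: cvgM; exact: coord_continuous.
Qed.

End HeisenbergGroup.

Lemma continuous_pair (T U W : topologicalType) (f : T -> U) (g : T -> W) x :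
  {for x, continuous f} -> {for x, continuous g} ->
  {for x, continuous (fun y => (f y, g y))}.
Proof.
move=> cf cg; have cf' : f @ x --> f x := cf; have cg' : g @ x --> g x := cg.
exact: (cvg_pair cf' cg').
Qed.

(** * Covering theory of a discrete left quotient *)

Section Quotient.
Local Open Scope quotient_scope.
Context {R : realType} {m : nat} {Ga : set 'rV[R]_(hdim m)}.
Hypothesis dG : discrete_subgroup Ga.
Implicit Types (h k : 'rV[R]_(hdim m)).

Lemma same_orbitP h k : same_orbit Ga h k <-> exists2 ga, Ga ga & k = hmul ga h.
Proof.
case: dG => G0 GM GV _; split=> [/asboolP e|[ga Gga ->]].
  have : Defs.orbit Ga k k by exists 0 => //; rewrite hmul0h.
  by rewrite -e => -[ga Gga <-]; exists ga.
apply/asboolP/seteqP; split=> l [de Gde <-].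
  exists (hmul de (hinv ga)); first by apply: GM => //; exact: GV.
  by rewrite hmulA -(hmulA de) hmulVh hmulh0.
by exists (hmul de ga); [exact: GM|rewrite hmulA].
Qed.

Lemma hproj_eqP h k : hproj Ga h = hproj Ga k <-> exists2 ga, Ga ga & k = hmul ga h.
Proof.
rewrite -same_orbitP; split.
  by move=> e; have /eqmodP := (e : h = k %[mod {eq_quot same_orbit_rel Ga}]).
by move=> e; apply/(@eqmodP _ (same_orbit_rel Ga)).
Qed.

Lemma hproj_hmul ga h : Ga ga -> hproj Ga (hmul ga h) = hproj Ga h.
Proof. by move=> Gga; apply/esym/hproj_eqP; exists ga. Qed.

Lemma hproj_surj (q : hquot Ga) : exists h, hproj Ga h = q.
Proof. by exists (repr q); rewrite /hproj reprK. Qed.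

Lemma hproj_continuous : continuous (@hproj R m Ga).
Proof. exact: pi_continuous. Qed.

Lemma hproj_open (U : set 'rV[R]_(hdim m)) : open U -> open (hproj Ga @` U).
Proof.
move=> oU; rewrite /open/= /quotient_open.
rewrite (_ : _ @^-1` _ = \bigcup_(ga in Ga) (hmul (hinv ga) @^-1` U)).
  apply: bigcup_open => ga _; apply: open_comp => // h _.
  by apply: (@hmul_continuous _ _ _ (fun=> hinv ga) id h); [exact: cst_continuous|].
apply/seteqP; split=> [h [k Uk] /hproj_eqP[ga Gga ->]|h [ga Gga /= Uh]].
  by exists ga => //=; rewrite hmulKh.
by exists (hmul (hinv ga) h) => //; apply/hproj_eqP; exists ga => //; rewrite hmulKVh.
Qed.

(** If k and ga k are both close to h, then ga = (ga k) k^-1 is close to 0, hence equal to 0 by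
    discreteness. *)
Lemma hproj_locally_injective h :
  exists U, [/\ open U, U h & {in U &, injective (hproj Ga)}].
Proof.
case: dG => G0 GM GV dis.
have [d d0 Hd] : exists2 d, 0 < d & forall k, `|0 - k| < d -> Ga k -> k = 0 := nbhs_distP (dis _ G0).
have cf : {for (h, h), continuous (fun p : 'rV[R]_(hdim m) * 'rV[R]_(hdim m) => hmul p.2 (hinv p.1))}.
  apply: hmul_continuous; first exact: cvg_snd.
  by apply: continuous_comp; [exact: cvg_fst|exact: hinv_continuous].
have [e e0 He] := nbhs_pairP (continuous_near cf d0).
exists (ball h e); split; [exact: ball_open|exact: ballxx|].
move=> k l; rewrite !inE -!ball_normE /= => hk hl /hproj_eqP[ga Gga E].
have := He _ _ hk hl; rewrite /= E hmulhV hmulhK => gad.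
by rewrite (Hd _ gad Gga) hmul0h.
Qed.

(** The neighbourhood V does not depend on the point h above it: a section through one preimage is
    moved to any other by an element of Ga. The lifting argument relies on this uniformity. *)
Lemma hproj_section (q : hquot Ga) : exists V, [/\ open V, V q &
  forall h, V (hproj Ga h) -> exists s : hquot Ga -> 'rV[R]_(hdim m),
    [/\ forall q, V q -> {for q, continuous s},
        forall q, V q -> hproj Ga (s q) = q & s (hproj Ga h) = h]].
Proof.
have [h0 <-] := hproj_surj q.
have [U [oU Uh inj]] := hproj_locally_injective h0.
exists (hproj Ga @` U); split; [exact: hproj_open|by exists h0|] => h Vh.
pose s0 q := xget 0 [set k | U k /\ hproj Ga k = q].
have s0P q' : (hproj Ga @` U) q' -> U (s0 q') /\ hproj Ga (s0 q') = q'.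
  by case=> k Uk e; apply: (@xgetPex _ 0 [set k | U k /\ hproj Ga k = q']); exists k.
have [Us es] := s0P _ Vh.
have [ga Gga Ega] := (hproj_eqP _ _).1 es.
exists (fun q' => hmul ga (s0 q')); split => [q' Vq'|q' Vq'|//]; last first.
  by rewrite hproj_hmul//; exact: (s0P q' Vq').2.
apply: (@hmul_continuous _ _ _ (fun=> ga) s0 q'); first exact: cst_continuous.
move=> W; have [Us' es'] := s0P _ Vq'.
rewrite nbhsE => -[B [oB Bs] BW].
suff : nbhs q' (s0 @^-1` W) by [].
rewrite nbhsE; exists (hproj Ga @` (U `&` B)).
  by split; [apply: hproj_open; exact: openI|exists (s0 q')].
move=> _ [k [Uk Bk] <-]; apply: BW.
have [Us2 es2] := s0P (hproj Ga k) (ex_intro2 _ _ k Uk erefl).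
by rewrite (_ : s0 _ = k)//; apply: inj => //; rewrite inE.
Qed.

Lemma hproj_path_eq (l1 l2 : R -> 'rV[R]_(hdim m)) a b :
  l1 a = l2 a ->
  (forall t, a <= t <= b -> {for t, continuous l1}) ->
  (forall t, a <= t <= b -> {for t, continuous l2}) ->
  (forall t, a <= t <= b -> \forall u \near t, hproj Ga (l1 u) = hproj Ga (l2 u)) ->
  forall t, a <= t <= b -> l1 t = l2 t.
Proof.
move=> ea c1 c2 e; apply: path_eq => // t tab et.
have [U [oU Ut inj]] := hproj_locally_injective (l1 t).
have U1 : \forall u \near t, U (l1 u) by apply: c1 => //; exact: open_nbhs_nbhs.
have U2 : \forall u \near t, U (l2 u).
  by apply: c2 => //; rewrite -et; exact: open_nbhs_nbhs.
near=> u; apply: inj; rewrite ?inE; [by near: u|by near: u|].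
by near: u; exact: e.
Unshelve. all: by end_near. Qed.

Section Lifting.
Variables (V : normedModType R) (D : set V) (a : V) (f : V -> hquot Ga).
Variable h0 : 'rV[R]_(hdim m).
Hypotheses (oD : open D) (Da : D a).
Hypothesis starD : forall y t, D y -> 0 <= t <= 1 -> D (a + t *: (y - a)).
Hypothesis cf : forall y, D y -> {for y, continuous f}.
Hypothesis h0a : hproj Ga h0 = f a.

(** Clamping extends the homotopy to all real t, so continuity at t = 0 and t = 1 is ordinary
    two-sided continuity. *)
Let cl (t : R) : R := Num.max 0 (Num.min t 1).
Let Psi (t : R) (y : V) := f (a + cl t *: (y - a)).

Let cl01 (t : R) : 0 <= cl t <= 1.
Proof. by rewrite /cl le_max lexx/= ge_max ler01/= ge_min lexx orbT. Qed.

Let cl_continuous : continuous cl.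
Proof. have -> : cl = (fun t => (`|t| - `|t - 1| + 1) / 2).
  apply/funext => t; rewrite /cl; have [t1|t1] := leP t 1; have [t0|t0] := leP 0 t.
  - by rewrite ger0_norm// ler0_norm ?subr_le0//; lra.
  - by rewrite ltr0_norm// ler0_norm ?subr_le0//; lra.
  - by rewrite (max_idPr ler01) ger0_norm// gtr0_norm ?subr_gt0//; lra.
  - by exfalso; lra.
move=> t; apply: cvgM; last exact: cvg_cst.
apply: cvgD; last exact: cvg_cst.
apply: cvgB; first by apply: cvg_norm; exact: cvg_id.
by apply: cvg_norm; apply: cvgB; [exact: cvg_id|exact: cvg_cst]. Qed.

Let Psi_continuous (t : R) y : D y -> {for (t, y), continuous (fun p : R * V => Psi p.1 p.2)}.
Proof.
move=> Dy; apply: (@continuous_comp _ _ _ (fun p : R * V => a + cl p.1 *: (p.2 - a)) f).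
  apply: cvgD; first exact: cvg_cst.
  apply: cvgZ; last by apply: cvgB; [exact: cvg_snd|exact: cvg_cst].
  by apply: (@continuous_comp _ _ _ fst cl); [exact: cvg_fst|exact: cl_continuous].
by apply: cf; exact: (starD Dy (cl01 t)).
Qed.

Let Psi_le0 (t : R) y : t <= 0 -> Psi t y = f a.
Proof.
move=> t0; rewrite /Psi (_ : cl t = 0) ?scale0r ?addr0//.
by apply/max_idPl; rewrite ge_min t0.
Qed.

(* A lift of the homotopy [Psi] on []-oo, T + e[ x ball y0 e]. *)
Let partial_lift y0 (T : R) := exists (e : R) (L : R -> V -> 'rV[R]_(hdim m)),
  [/\ 0 < e, forall y, `|y0 - y| < e -> D y,
     forall (t : R) y, t < T + e -> `|y0 - y| < e ->
       {for (t, y), continuous (fun p : R * V => L p.1 p.2)},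
     forall (t : R) y, t < T + e -> `|y0 - y| < e -> hproj Ga (L t y) = Psi t y
   & forall (t : R) y, t <= 0 -> L t y = h0].

(** Continuity method in T: a lift available up to a time slightly before t1 is continued by a local
    section over an evenly covered neighbourhood of [Psi t1 y0]. *)
Let partial_liftP y0 : D y0 -> partial_lift y0 1.
Proof.
move=> Dy0; apply: (@real_induction R 0 1 (partial_lift y0)); last by rewrite ler01 lexx.
move=> t1 t101 IH.
have [W [oW Wq sec]] := hproj_section (Psi t1 y0).
have [d d0 Hd] : exists2 d : R, 0 < d & forall (t : R) y, `|t1 - t| < d -> `|y0 - y| < d ->
    W (Psi t y) /\ D y.
  have [d1 d10 Hd1] := nbhs_pairP (continuous_nbhs (@Psi_continuous t1 y0 Dy0) oW Wq).
  have [d2 d20 Hd2] := nbhs_distP (open_nbhs_nbhs (conj oD Dy0)).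
  exists (Num.min d1 d2); first by rewrite lt_min d10.
  by move=> t y; rewrite !lt_min => /andP[? ?] /andP[? ?]; split; [exact: Hd1|exact: Hd2].
(* The gluing time precedes t1, so the induction hypothesis applies, and lies in the strip where
   [Psi] stays in W. If it is negative, the constant h0 serves as the lift. *)
pose tm := t1 - d / 2.
have [e [L [e0 LD Lc Lp L0]]] : partial_lift y0 tm.
  have [tm0|tm0] := leP 0 tm; first by apply: IH; rewrite tm0 /tm; lra.
  have [d2 d20 Hd2] := nbhs_distP (open_nbhs_nbhs (conj oD Dy0)).
  exists (Num.min d2 (- tm)), (fun _ _ => h0); split; last by [].
  - by rewrite lt_min d20; lra.
  - by move=> y; rewrite lt_min => /andP[/Hd2].
  - by move=> t y _ _; exact: cst_continuous.
  - move=> t y; rewrite h0a -ltrBDl lt_min => /andP[_ ?] _; rewrite Psi_le0//; lra.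
have Wm : W (hproj Ga (L tm y0)).
  rewrite Lp ?subrr ?normr0 ?ltrDl//.
  by apply: (Hd _ _ _ _).1; rewrite ?subrr ?normr0// /tm opprB addrCA subrr addr0 ger0_norm; lra.
have [s [sc sp se]] := sec _ Wm.
have Dd y : `|y0 - y| < d -> D y.
  by move=> h; apply: (Hd t1 y _ _).2; rewrite ?subrr ?normr0.
have sPc (t : R) y : `|t1 - t| < d -> `|y0 - y| < d ->
    {for (t, y), continuous (fun p : R * V => s (Psi p.1 p.2))}.
  move=> ht hy; apply: (@continuous_comp _ _ _ (fun p : R * V => Psi p.1 p.2) s).
    by apply: Psi_continuous; exact: Dd.
  by apply: sc; exact: (Hd _ _ ht hy).1.
have tmd : `|t1 - tm| < d by rewrite /tm opprB addrCA subrr addr0 ger0_norm; lra.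
have yd0 (x : V) c : 0 < c -> `|x - x| < c by rewrite subrr normr0.
have [e' e'0 agree] : exists2 e' : R, 0 < e' & forall (t : R) y, `|tm - t| < e' -> `|y0 - y| < e' ->
    L t y = s (Psi t y).
  have [U [oU Uh inj]] := hproj_locally_injective (L tm y0).
  have tme : tm < tm + e by rewrite ltrDl.
  have n1 := continuous_nbhs (Lc tm y0 tme (yd0 _ _ e0)) oU Uh.
  have Es : s (Psi tm y0) = L tm y0 by rewrite -[RHS]se Lp ?ltrDl ?yd0.
  have Us : U (s (Psi tm y0)) by rewrite Es.
  have n2 := continuous_nbhs (sPc tm y0 tmd (yd0 _ _ d0)) oU Us.
  have [e1 e10 He1] := nbhs_pairP n1; have [e2 e20 He2] := nbhs_pairP n2.
  exists (Num.min (Num.min e1 e2) (Num.min e (d / 2))).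
    by rewrite !lt_min e10 e20 e0 divr_gt0.
  move=> t y; rewrite !lt_min => /andP[/andP[a1 a2] /andP[a3 a4]] /andP[/andP[b1 b2] /andP[b3 b4]].
  apply: inj; rewrite ?inE; [exact: He1|exact: He2|].
  move: a3 a4; rewrite !ltr_norml => /andP[? ?] /andP[? ?].
  rewrite Lp//; last by lra.
  rewrite sp//; apply: (Hd _ _ _ _).1; last by lra.
  have Etm : tm = t1 - d / 2 by [].
  by rewrite ltr_norml; apply/andP; split; lra.
exists d => // u u01 ud.
(* The two pieces agree on a full neighbourhood of the gluing time, which gives continuity there. *)
exists (Num.min (Num.min e e') (Num.min d (t1 + d - u))),
  (fun t y => if t < tm then L t y else s (Psi t y)); split.
- by rewrite !lt_min e0 e'0 d0; lra.
- by move=> y; rewrite !lt_min => /andP[/andP[/LD]].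
- move=> t y; rewrite -ltrBDl !lt_min => /andP[/andP[a1 a2] /andP[a3 a4]] /andP[/andP[b1 b2] /andP[b3 b4]].
  have near_y (c : R) : `|y0 - y| < c -> exists2 c' : R, 0 < c' & forall y', `|y - y'| < c' -> `|y0 - y'| < c.
    move=> h; exists (c - `|y0 - y|) => [|y' h']; first by lra.
    by rewrite -(subrKA y); apply: le_lt_trans (ler_normD _ _) _; lra.
  have [ttm|tmt|ttm] := ltgtP t tm.
  + have te : t < tm + e by lra.
    apply: (continuous_near_eq (Lc t y te b1)).
    apply: (@nbhs_pair_near _ _ _ _ _ _ (tm - t)); first by lra.
    by move=> t' y' /=; rewrite ltr_norml => /andP[? ?] _; case: ltP => // ?; exfalso; lra.
  + have c1 : `|t1 - t| < d by rewrite ltr_norml; move: tmt; rewrite /tm => ?; apply/andP; split; lra.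
    apply: (continuous_near_eq (sPc t y c1 b3)).
    apply: (@nbhs_pair_near _ _ _ _ _ _ (t - tm)); first by lra.
    by move=> t' y' /=; rewrite ltr_norml => /andP[? ?] _; case: ltP => // ?; exfalso; lra.
  + have c1 : `|t1 - t| < d by rewrite ttm.
    apply: (continuous_near_eq (sPc t y c1 b3)).
    have [c' c'0 Hc'] := near_y _ b2.
    apply: (@nbhs_pair_near _ _ _ _ _ _ (Num.min e' c')); first by rewrite lt_min e'0.
    move=> t' y' /=; rewrite !lt_min => /andP[? _] /andP[_ ?]; case: ltP => // _.
    by apply/esym/agree; [rewrite -ttm|exact: Hc'].
- move=> t y; rewrite -ltrBDl !lt_min => /andP[/andP[a1 a2] /andP[a3 a4]] /andP[/andP[b1 b2] /andP[b3 b4]].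
  have [ttm|tmt] := ltP t tm; first by apply: Lp => //; lra.
  rewrite sp//; apply: (Hd _ _ _ _).1 => //.
  by rewrite ltr_norml; move: tmt; rewrite /tm => ?; apply/andP; split; lra.
- move=> t y t0; have [ttm|tmt] := ltP t tm; first exact: L0.
  rewrite Psi_le0// -(Psi_le0 y0 (le_trans tmt t0)) -[s _]/(s (Psi tm y0)).
  by rewrite -Lp ?ltrDl ?yd0// se L0//; lra.
Qed.

(** The value at y is the end point of the lift of the path t |-> [Psi t y]. Uniqueness of path
    lifts identifies it with each local lift from [partial_liftP], whence continuity. *)
Lemma lifting : exists h : V -> 'rV[R]_(hdim m),
  [/\ forall y, D y -> {for y, continuous h}, forall y, D y -> hproj Ga (h y) = f y & h a = h0].
Proof.
pose Q y k := exists l : R -> 'rV[R]_(hdim m),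
  [/\ forall t : R, t <= 1 -> {for t, continuous l}, forall t : R, t <= 1 -> \forall u \near t, hproj Ga (l u) = Psi u y,
     l 0 = h0 & l 1 = k].
have Quniq y k k' : Q y k -> Q y k' -> k = k'.
  case=> l [lc lp l0 <-] [l' [lc' lp' l0' <-]].
  have e0 : l 0 = l' 0 by rewrite l0.
  have H := @hproj_path_eq l l' 0 1 e0; apply: H; last by rewrite ler01 lexx.
  - by move=> t /andP[_ t1]; exact: lc.
  - by move=> t /andP[_ t1]; exact: lc'.
  - by move=> t /andP[_ t1]; apply: filterS2 (lp t t1) (lp' t t1) => u -> ->.
have QL y0 : D y0 -> exists (e : R) (L : V -> 'rV[R]_(hdim m)), [/\ 0 < e, {for y0, continuous L} &
    forall y, `|y0 - y| < e -> Q y (L y)].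
  move=> Dy0; have [e [L [e0 LD Lc Lp L0]]] := partial_liftP Dy0.
  have e1 : 1 < 1 + e by rewrite ltrDl.
  exists e, (L 1); split; first exact: e0.
    refine (@continuous_comp V (R * V)%type _ (fun y => (1, y)) (fun p => L p.1 p.2) y0 _ _).
      by apply: (@continuous_pair V R V (cst 1) id y0); [exact: cst_continuous|exact: cvg_id].
    by apply: Lc => //; rewrite subrr normr0.
  move=> y hy; exists (fun t => L t y); split; last by [].
  - move=> t t1; refine (@continuous_comp R (R * V)%type _ (fun t => (t, y)) (fun p => L p.1 p.2) t _ _).
      by apply: (@continuous_pair R R V id (cst y) t); [exact: cvg_id|exact: cst_continuous].
    by apply: Lc; lra.
  - move=> t t1; near=> u; apply: Lp => //; near: u; apply: lt_nbhsl; lra.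
  - exact: L0.
exists (fun y => xget 0 (Q y)).
have hQ y : D y -> Q y (xget 0 (Q y)).
  move=> /QL[e [L [e0 _ QLy]]]; apply: (@xgetPex _ 0 (Q y)).
  by exists (L y); apply: QLy; rewrite subrr normr0.
split.
- move=> y Dy; have [e [L [e0 cL QLy]]] := QL y Dy.
  have E y' : `|y - y'| < e -> xget 0 (Q y') = L y'.
    move=> h; apply: (Quniq y'); last exact: QLy.
    by apply: (@xgetPex _ 0 (Q y')); exists (L y'); exact: QLy.
  rewrite /prop_for /continuous_at E ?subrr ?normr0//; apply: cvg_trans cL.
  by apply: near_eq_cvg; apply: (dist_nbhs e0) => y' /E ->.
- move=> y /hQ[l [_ lp _ <-]]; rewrite (nbhs_singleton (lp 1 _))//.
  by rewrite /Psi (_ : cl 1 = 1) ?scale1r ?subrKC// /cl minxx; apply/max_idPr.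
- apply: (Quniq a); first exact: hQ.
  exists (fun=> h0); split; [by move=> *; exact: cst_continuous| |by []|by []].
  by move=> t _; near=> u; rewrite /Psi subrr scaler0 addr0.
Unshelve. all: by end_near. Qed.

End Lifting.

End Quotient.

(** * Causal curves of the exact family *)

Section Coframe.
Context {R : realType} {m : nat}.
Implicit Types (h k v : 'rV[R]_(hdim m)) (x u : 'rV[R]_(1 + hdim m)).

(** The coframe: w^a at the point h applied to the tangent vector v, see [hcoframe_mul]. *)
Definition cow h v (a : 'I_(hdim m)) : R :=
  v 0 a - (if a == 0 then \sum_(r < m) h 0 (ix r) * v 0 (iy r) else 0).

Lemma hcoframe_mul h v a : (v *m hcoframe h) 0 a = cow h v a.
Proof.
rewrite mxE /cow.
under eq_bigr do rewrite mxE mulrBr.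
rewrite sumrB (bigD1 a)//= eqxx mulr1 big1 ?addr0; last first.
  by move=> b ba; rewrite (negbTE ba) mulr0.
congr (_ - _); case: ifP => _; last by rewrite big1 // => b _; rewrite mulr0.
rewrite sum_hindex [X in v 0 0 * X]big1 ?mulr0 ?add0r; last by move=> r; rewrite eq_sym iy_neq0.
apply: eq_bigr => r _; rewrite [X in _ * X + _]big1 ?mulr0 ?add0r; last by move=> s; rewrite ix_neq_iy.
by rewrite mulrC (big_pred1 r)// => s /=; apply/eqP/eqP => [/iy_inj|->].
Qed.

Lemma cow_neq0 h v a : a != 0 -> cow h v a = v 0 a.
Proof. by rewrite /cow => /negbTE ->; rewrite subr0. Qed.

Lemma cow0 h v : cow h v 0 = v 0 0 - \sum_(r < m) h 0 (ix r) * v 0 (iy r).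
Proof. by rewrite /cow eqxx. Qed.

Definition qform n (G : 'M[R]_n) (v : 'rV[R]_n) : R := (v *m G *m v^T) 0 0.

Lemma rV_time (x : 'rV[R]_(1 + hdim m)) : lsubmx x 0 0 = x 0 0.
Proof. by rewrite mxE; congr (x _ _); apply: val_inj. Qed.

Lemma row_mx_time (t : R) h : row_mx (t%:M : 'rV_1) h 0 0 = t.
Proof. by rewrite -rV_time row_mxKl mxE eqxx mulr1n. Qed.

Lemma row_mx_eta x : x = row_mx (x 0 0)%:M (rsubmx x).
Proof.
rewrite -[LHS]hsubmxK; congr row_mx; apply/rowP => i; rewrite !ord1 rV_time.
by rewrite mxE eqxx mulr1n.
Qed.

End Coframe.

(** * Growth and decay of the scale factors relative to the lapse *)

Section FamilyBounds.
Context {R : realType} {m : nat}.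
Variables (A p : 'I_(hdim m) -> R).
Hypothesis A0 : forall a, 0 < A a.
Hypothesis chi0 : forall r : 'I_m, 0 < chi p r.

Local Notation F := (Fr A p).
Local Notation chis := (\sum_(r < m) chi p r).

Lemma kappa_gt0 r : 0 < kappa A r.
Proof. by rewrite /kappa divr_gt0 // mulr_gt0. Qed.

Lemma Fr_ge1 r t : 1 <= F r t.
Proof.
by rewrite /Fr lerDl mulr_ge0 ?expR_ge0// divr_ge0 ?sqr_ge0// mulr_ge0 ?sqr_ge0.
Qed.

Lemma Fr_gt0 r t : 0 < F r t. Proof. exact: lt_le_trans (Fr_ge1 r t). Qed.

Lemma sqrtFr_gt0 r t : 0 < Num.sqrt (F r t). Proof. by rewrite sqrtr_gt0 Fr_gt0. Qed.

Lemma Fr_ndecr r t d : 0 <= d -> F r t <= F r (t + d).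
Proof.
move=> d0; rewrite /Fr lerD2l ler_wpM2l//.
  by rewrite divr_ge0 ?sqr_ge0// mulr_ge0 ?sqr_ge0.
by rewrite ler_expR ler_wpM2l ?lerDl// mulr_ge0// ltW.
Qed.

Lemma Fr_growth r t d : 0 <= d -> F r (t + d) <= expR (2 * chi p r * d) * F r t.
Proof.
move=> d0; rewrite /Fr [X in _ <= X]mulrDr mulr1 lerD//.
  by rewrite -expR0 ler_expR mulr_ge0// mulr_ge0// ltW.
rewrite [X in _ <= X]mulrCA; apply: ler_wpM2l; last by rewrite mulrDr expRD mulrC.
by rewrite divr_ge0 ?sqr_ge0// mulr_ge0 ?sqr_ge0.
Qed.

(** After division by N^2 the metric is - dt^2 + \sum_a (ratio_a w^a)^2, so 1 / ratio_a bounds the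
    speed of causal curves in direction a. *)
Definition ratio (a : 'I_(hdim m)) (t : R) : R := scale A p a t / lapse A p t.

(** The power of F_r in a_a / N: -1 for the central direction, 0 for the two directions of the pair
    r, -1/2 for the other horizontal ones. *)
Let wgt (a : 'I_(hdim m)) (r : 'I_m) (t : R) : R :=
  if a == 0 then (F r t)^-1
  else if (a == ix r) || (a == iy r) then 1 else (Num.sqrt (F r t))^-1.

Lemma ratioE a t : ratio a t = A a * expR ((p a - 1) * t) * \prod_(r < m) wgt a r t.
Proof.
rewrite /ratio /scale /lapse invfM.
have -> : expR ((p a - 1) * t) = expR (p a * t) * (expR t)^-1.
  by rewrite -expRN -expRD mulrBl mul1r.
rewrite -!mulrA; congr (_ * (_ * _)); rewrite mulrCA; congr (_ * _).
rewrite /wgt -prodfV; case: ifP => [a0|a0].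
  by rewrite -big_split/=; apply: eq_bigr => r _; rewrite -invfM -expr2 sqr_sqrtr ?ltW ?Fr_gt0.
rewrite [X in X * _]big_mkcond -big_split/=; apply: eq_bigr => r _.
by case: ifP => _; rewrite ?mul1r// divff// gt_eqF ?sqrtFr_gt0.
Qed.

Let wgt_gt0 a r t : 0 < wgt a r t.
Proof.
rewrite /wgt; case: ifP => _; first by rewrite invr_gt0 Fr_gt0.
by case: ifP => _; rewrite ?ltr01// invr_gt0 sqrtFr_gt0.
Qed.

Let wgt_le a r t d : 0 <= d -> wgt a r (t + d) <= wgt a r t.
Proof.
move=> d0; rewrite /wgt; case: ifP => _; first by rewrite lef_pV2 ?posrE ?Fr_gt0// Fr_ndecr.
case: ifP => _ //; rewrite lef_pV2 ?posrE ?sqrtFr_gt0//.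
by rewrite ler_wsqrtr// Fr_ndecr.
Qed.

Let wgt_ge a r t d : 0 <= d -> wgt a r t <= expR (2 * chi p r * d) * wgt a r (t + d).
Proof.
move=> d0; have E0 := expR_gt0 (2 * chi p r * d).
have E1 : 1 <= expR (2 * chi p r * d).
  by rewrite -expR0 ler_expR mulr_ge0// mulr_ge0// ltW.
rewrite /wgt; case: ifP => _.
  rewrite -[X in X <= _]mul1r ler_pdivrMr ?Fr_gt0// mulrAC ler_pdivlMr ?Fr_gt0// mul1r.
  exact: Fr_growth.
case: ifP => _; first by rewrite mulr1.
rewrite -[X in X <= _]mul1r ler_pdivrMr ?sqrtFr_gt0// mulrAC ler_pdivlMr ?sqrtFr_gt0// mul1r.
have -> : expR (2 * chi p r * d) * Num.sqrt (F r t) = Num.sqrt (expR (2 * chi p r * d) ^+ 2 * F r t).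
  by rewrite sqrtrM ?sqr_ge0// sqrtr_sqr ger0_norm// ltW.
rewrite ler_wsqrtr// (le_trans (Fr_growth r t d0))// (ler_wpM2r (ltW (Fr_gt0 r t)))//.
by rewrite expr2 (ler_peMl (ltW E0)).
Qed.

Lemma ratio_gt0 a t : 0 < ratio a t.
Proof. by rewrite ratioE mulr_gt0 ?prodr_gt0// mulr_gt0 ?expR_gt0. Qed.

Lemma ratio_decay a t d : 0 <= d -> ratio a (t + d) <= expR (- ((1 - p a) * d)) * ratio a t.
Proof.
move=> d0; rewrite !ratioE; set W := \prod_(r < m) wgt a r t.
have -> : expR (- ((1 - p a) * d)) * (A a * expR ((p a - 1) * t) * W) = A a * expR ((p a - 1) * (t + d)) * W.
  by rewrite (_ : (p a - 1) * (t + d) = - ((1 - p a) * d) + (p a - 1) * t); [rewrite expRD; ring|ring].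
apply: ler_wpM2l; first by rewrite mulr_ge0 ?expR_ge0// ltW.
by apply: ler_prod => r _; rewrite (ltW (wgt_gt0 _ _ _)) wgt_le.
Qed.

(** Each F_r grows at most like e^{2 chi_r t} and enters with exponent between -1 and 0, so all of
    them together cost at most the factor with exponent 2 \sum_r chi_r. *)
Lemma ratio_growth a t d : 0 <= d ->
  ratio a t <= expR ((1 - p a + 2 * chis) * d) * ratio a (t + d).
Proof.
move=> d0; rewrite !ratioE; set W := \prod_(r < m) wgt a r (t + d).
have -> : expR ((1 - p a + 2 * chis) * d) * (A a * expR ((p a - 1) * (t + d)) * W) =
    A a * expR ((p a - 1) * t) * ((\prod_(r < m) expR (2 * chi p r * d)) * W).
  rewrite -expR_sum -mulr_suml -mulr_sumr mulrDl expRD.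
  by rewrite (_ : (p a - 1) * t = (1 - p a) * d + (p a - 1) * (t + d)); [rewrite expRD; ring|ring].
apply: ler_wpM2l; first by rewrite mulr_ge0 ?expR_ge0// ltW.
by rewrite -big_split/=; apply: ler_prod => r _; rewrite (ltW (wgt_gt0 _ _ _)) wgt_ge.
Qed.

(** The factors F_s with s != r cancel and p_0 - 1 = chi_r + (p_{2r-1} - 1) + (p_{2r} - 1). With E =
    e^{chi_r t} there remains kappa_r E <= chi_r F_r, that is (2 chi_r - kappa_r E)^2 >= 0. Read for
    the inverses, it makes the central horizon scale dominate the product of the two horizontal
    ones. *)
Lemma ratio_central r t : ratio 0 t <= chi p r * (ratio (ix r) t * ratio (iy r) t).
Proof.
rewrite !ratioE.
have -> : \prod_(r0 < m) wgt 0 r0 t = (F r t)^-1 * \prod_(s < m | s != r) (F s t)^-1.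
  by rewrite (bigD1 r)//= /wgt eqxx.
have W a : a = ix r \/ a = iy r ->
    \prod_(r0 < m) wgt a r0 t = \prod_(s < m | s != r) (Num.sqrt (F s t))^-1.
  move=> aE; rewrite (bigD1 r)//= {1}/wgt.
  have -> : a == 0 = false by case: aE => ->; rewrite ?ix_neq0 ?iy_neq0.
  have -> : (a == ix r) || (a == iy r) by case: aE => ->; rewrite eqxx ?orbT.
  rewrite mul1r; apply: eq_bigr => s sr; rewrite /wgt.
  have -> : a == 0 = false by case: aE => ->; rewrite ?ix_neq0 ?iy_neq0.
  suff -> : (a == ix s) || (a == iy s) = false by [].
  apply/negbTE; apply: contra sr; case: aE => ->; rewrite ?ix_neq_iy.
    by rewrite orbF => /eqP/ix_inj ->.
  by rewrite eq_sym ix_neq_iy => /eqP/iy_inj ->.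
rewrite (W (ix r)); last by left.
rewrite (W (iy r)); last by right.
set Q := \prod_(s < m | s != r) (Num.sqrt (F s t))^-1.
have -> : \prod_(s < m | s != r) (F s t)^-1 = Q * Q.
  by rewrite /Q -big_split/=; apply: eq_bigr => s _; rewrite -invfM -expr2 sqr_sqrtr ?ltW ?Fr_gt0.
have Q0 : 0 < Q by apply: prodr_gt0 => s _; rewrite invr_gt0 sqrtFr_gt0.
rewrite -[X in _ <= X](_ : chi p r * A (ix r) * A (iy r) * (expR ((p (ix r) - 1) * t) * expR ((p (iy r) - 1) * t)) * (Q * Q) = _); last by ring.
rewrite [X in X <= _]mulrA (ler_wpM2r (ltW (mulr_gt0 Q0 Q0)))// ler_pdivrMr ?Fr_gt0// -expRD.
have e0 : (p 0 - 1) * t = chi p r * t + ((p (ix r) - 1) * t + (p (iy r) - 1) * t).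
  by rewrite /chi; ring.
rewrite e0 (expRD (chi p r * t)) mulrA -!mulrA [X in _ <= _ * (_ * (_ * X))]mulrC !mulrA.
rewrite ler_wpM2r ?expR_ge0// /Fr.
have -> : 2 * chi p r * t = chi p r * t + chi p r * t by ring.
rewrite expRD; set E := expR _; have E0 : 0 < E by exact: expR_gt0.
have -> : A 0 = kappa A r * (A (ix r) * A (iy r)) by rewrite /kappa divfK// gt_eqF// mulr_gt0.
have B0 : 0 < A (ix r) * A (iy r) by rewrite mulr_gt0.
rewrite -[X in _ <= X](_ : (chi p r * (1 + kappa A r ^+ 2 / (4 * chi p r ^+ 2) * (E * E))) * (A (ix r) * A (iy r)) = _); last by ring.
rewrite mulrAC (ler_wpM2r (ltW B0))//.
rewrite -subr_ge0 (_ : _ - _ = (2 * chi p r - kappa A r * E) ^+ 2 / (4 * chi p r)).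
  by rewrite divr_ge0 ?sqr_ge0// mulr_ge0// ltW.
by field; rewrite gt_eqF.
Qed.

Lemma lapse_gt0 t : 0 < lapse A p t.
Proof. by rewrite /lapse mulr_gt0 ?expR_gt0// prodr_gt0// => r _; exact: sqrtFr_gt0. Qed.

Lemma scale_gt0 a t : 0 < scale A p a t.
Proof.
rewrite /scale mulr_gt0// ?mulr_gt0 ?expR_gt0//; case: ifP => _; apply: prodr_gt0 => r _.
  by rewrite invr_gt0 sqrtFr_gt0.
exact: sqrtFr_gt0.
Qed.

Lemma scale_ge a t : a != 0 -> A a * expR (p a * t) <= scale A p a t.
Proof.
move=> /negbTE a0; rewrite /scale a0 (ler_peMr (mulr_ge0 (ltW (A0 a)) (expR_ge0 _)))//.
elim/big_ind : _ => // [x y x1 y1|r _]; first by rewrite -[1]mulr1; apply: ler_pM.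
by rewrite -sqrtr1 ler_wsqrtr// Fr_ge1.
Qed.

(** Dropping the summand 1 in F_r leaves sqrt(F_r) >= kappa_r / (2 chi_r) e^{chi_r t}. *)
Lemma lapse_ge : exists2 k, 0 < k & forall t, k * expR ((1 + chis) * t) <= lapse A p t.
Proof.
exists (\prod_(r < m) (kappa A r / (2 * chi p r))).
  by apply: prodr_gt0 => r _; rewrite divr_gt0 ?kappa_gt0// mulr_gt0.
move=> t; rewrite /lapse mulrDl mul1r expRD mulrCA ler_wpM2l ?expR_ge0//.
rewrite mulr_suml expR_sum -big_split/=; apply: ler_prod => r _; apply/andP; split.
  by rewrite mulr_ge0 ?expR_ge0// divr_ge0 ?ltW ?kappa_gt0// mulr_gt0.
have c0 := chi0 r; have k0 := kappa_gt0 r.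
rewrite -[X in X <= _]ger0_norm -?sqrtr_sqr; last first.
  by rewrite mulr_ge0 ?expR_ge0// divr_ge0 ?ltW// mulr_gt0.
rewrite ler_wsqrtr// /Fr -[X in X <= _]add0r lerD// exprMn expr2 -expr2 -expRM_natl.
rewrite (_ : expR _ = expR (2 * chi p r * t)); last by congr expR; ring.
rewrite ler_wpM2r ?expR_ge0//.
have -> // : (kappa A r / (2 * chi p r)) ^+ 2 = kappa A r ^+ 2 / (4 * chi p r ^+ 2).
by field; rewrite gt_eqF.
Qed.

End FamilyBounds.

Section TimelikeForm.
Context {R : realType} {m : nat}.
Variables (A p : 'I_(hdim m) -> R).

Definition pt (t : R) (h : 'rV[R]_(hdim m)) : 'rV[R]_(1 + hdim m) := row_mx t%:M h.

Lemma pt_time t h : pt t h 0 0 = t. Proof. exact: row_mx_time. Qed.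

Lemma pt_space t h : rsubmx (pt t h) = h. Proof. exact: row_mxKr. Qed.

Lemma pt_eta (x : 'rV[R]_(1 + hdim m)) : pt (x 0 0) (rsubmx x) = x. Proof. exact: esym (row_mx_eta x). Qed.

Lemma rsubmxE (x : 'rV[R]_(1 + hdim m)) a : rsubmx x 0 a = x 0 (rshift 1 a).
Proof. by rewrite mxE. Qed.

Lemma qform_family (x v : 'rV[R]_(1 + hdim m)) : (forall t, 0 < lapse A p t) ->
  qform (family_form A p x) v = lapse A p (x 0 0) ^+ 2 *
    (\sum_a (ratio A p a (x 0 0) * cow (rsubmx x) (rsubmx v) a) ^+ 2 - v 0 0 ^+ 2).
Proof.
move=> N0; rewrite /qform /family_form rV_time.
set N := lapse A p _; set w := hcoframe _; set D := diag_mx _.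
have E : v = row_mx (lsubmx v) (rsubmx v) by rewrite hsubmxK.
rewrite {1 2}E mul_row_block !mulmx0 addr0 add0r tr_row_mx mul_row_col.
rewrite mxE mulrBr addrC; congr (_ + _); last first.
  rewrite mul_mx_scalar -scalemxAl mxE [X in _ * X]mxE big_ord_recl big_ord0 addr0.
  rewrite !mxE -!rV_time !mxE; ring.
rewrite !mulmxA -mulmxA -trmx_mul mul_mx_diag mxE mulr_sumr; apply: eq_bigr => a _.
rewrite [X in X * _]mxE [X in _ * X]mxE [(\row__ _) 0 a]mxE !hcoframe_mul /ratio -/N.
by field; rewrite gt_eqF// N0.
Qed.

(** Minkowski's inequality, from (u + v)^2 <= (1 + V/U) u^2 + (1 + U/V) v^2; the degenerate cases U
    = 0 and V = 0 come first. *)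
Lemma sum_sqr_add (I : finType) (u v : I -> R) U V : 0 <= U -> 0 <= V ->
  \sum_i u i ^+ 2 <= U ^+ 2 -> \sum_i v i ^+ 2 <= V ^+ 2 ->
  \sum_i (u i + v i) ^+ 2 <= (U + V) ^+ 2.
Proof.
have z (w : I -> R) W i : \sum_i w i ^+ 2 <= W ^+ 2 -> W = 0 -> w i = 0.
  move=> le W0; apply/eqP; rewrite -sqrf_eq0 -[_ == 0]orFb eq_le sqr_ge0 andbT.
  apply: le_trans (_ : \sum_i w i ^+ 2 <= 0); last by move: le; rewrite W0 expr0n.
  by rewrite (bigD1 i)//= lerDl sumr_ge0// => j _; rewrite sqr_ge0.
move=> U0 V0 hu hv.
have [U1|U1] := eqVneq U 0.
  by under eq_bigr do rewrite (z u U _ hu U1) add0r; rewrite U1 add0r.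
have [V1|V1] := eqVneq V 0.
  by under eq_bigr do rewrite (z v V _ hv V1) addr0; rewrite V1 addr0.
apply: (@le_trans _ _ (\sum_i ((1 + V / U) * u i ^+ 2 + (1 + U / V) * v i ^+ 2))).
  apply: ler_sum => i _; rewrite -subr_ge0.
  rewrite (_ : _ - _ = (V * u i - U * v i) ^+ 2 / (U * V)).
    by rewrite divr_ge0 ?sqr_ge0// mulr_ge0.
  by field; rewrite U1 V1.
rewrite big_split/= -!mulr_sumr.
apply: (@le_trans _ _ ((1 + V / U) * U ^+ 2 + (1 + U / V) * V ^+ 2)).
  by rewrite lerD// ler_wpM2l// addr_ge0// divr_ge0.
by rewrite le_eqVlt (_ : _ + _ = (U + V) ^+ 2) ?eqxx//; field; rewrite U1 V1.
Qed.

(* The velocity of a left-translated curve. *)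
Definition dhmul (k v : 'rV[R]_(hdim m)) : 'rV[R]_(hdim m) :=
  \row_a (v 0 a + (if a == 0 then \sum_(r < m) k 0 (ix r) * v 0 (iy r) else 0)).

Lemma cow_dhmul k h v a : cow (hmul k h) (dhmul k v) a = cow h v a.
Proof.
rewrite /cow mxE; case: ifP => _; last by rewrite addr0.
rewrite [in RHS](_ : v 0 a - _ = v 0 a + \sum_(r < m) k 0 (ix r) * v 0 (iy r) - \sum_(r < m) hmul k h 0 (ix r) * v 0 (iy r)).
  by congr (_ - _); apply: eq_bigr => r _; rewrite [dhmul _ _ _ _]mxE iy_neq0 addr0.
rewrite -addrA -sumrB; congr (_ + _); rewrite -sumrN; apply: eq_bigr => r _.
by rewrite hmul_ix; ring.
Qed.

Lemma is_derive_hmul k (h : R -> 'rV[R]_(hdim m)) (s : R) v :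
  is_derive s 1 h v -> is_derive s 1 (fun s => hmul k (h s)) (dhmul k v).
Proof.
move=> hv; apply: is_derive_rV => i a; rewrite !ord1 mxE {i}.
have c b := is_derive_coord 0 b hv.
have E : (fun u => hmul k (h u) 0 a) = cst (k 0 a) + (fun u => h u 0 a) +
    (fun u => if a == 0 then \sum_(r < m) k 0 (ix r) * h u 0 (iy r) else 0).
  by apply/funext => u; rewrite hmulE.
rewrite E; apply: is_deriveD; first by have := c a => ?; apply: is_derive_eq; rewrite add0r.
case: ifP => _; last exact: is_derive_cst.
have -> : (fun u => \sum_(r < m) k 0 (ix r) * h u 0 (iy r)) =
    \sum_(r < m) (fun u => k 0 (ix r) * h u 0 (iy r)).
  by apply/funext => u; rewrite fct_sumE.
by apply: is_derive_sum => r; have := c (iy r) => ?; exact: is_deriveZ.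
Qed.

End TimelikeForm.

(** * Particle horizons *)

Section CausalPaths.
Context {R : realType} {m : nat}.
Variables (A p : 'I_(hdim m) -> R).
Hypothesis A0 : forall a, 0 < A a.
Hypothesis chi0 : forall r : 'I_m, 0 < chi p r.
Local Notation ratio := (ratio A p).
Local Notation chis := (\sum_(r < m) chi p r).

Let rg a t : 0 < ratio a t. Proof. exact: ratio_gt0. Qed.

Let ratio_inv_central (r : 'I_m) t :
  (ratio (ix r) t * ratio (iy r) t)^-1 <= chi p r / ratio 0 t.
Proof.
rewrite ler_pdivlMr// mulrC ler_pdivrMr; last by rewrite mulr_gt0.
exact: (ratio_central A0 chi0).
Qed.

(** A future causal curve on the cover in components; the last condition is g(v, v) <= 0 divided by
    N^2. *)
Definition fcausal (t : R -> R) (h : R -> 'rV[R]_(hdim m)) (dt : R -> R)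
    (dh : R -> 'rV[R]_(hdim m)) (s0 s1 : R) : Prop :=
  forall s, s0 <= s <= s1 -> [/\ is_derive s 1 t (dt s), is_derive s 1 h (dh s), 0 <= dt s &
    \sum_a (ratio a (t s) * cow (h s) (dh s) a) ^+ 2 <= dt s ^+ 2].

Lemma fcausal_sub t h dt dh s0 s1 u0 u1 : s0 <= u0 -> u1 <= s1 ->
  fcausal t h dt dh s0 s1 -> fcausal t h dt dh u0 u1.
Proof. by move=> a b H s /andP[? ?]; apply: H; rewrite (le_trans a)// (le_trans _ b). Qed.

Lemma fcausal_hmul k t h dt dh s0 s1 : fcausal t h dt dh s0 s1 ->
  fcausal t (fun s => hmul k (h s)) dt (fun s => dhmul k (dh s)) s0 s1.
Proof.
move=> H s /H[d1 d2 d3 d4]; split => //; first exact: is_derive_hmul.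
by under eq_bigr do rewrite cow_dhmul.
Qed.

Lemma fcausal_time_le t h dt dh s0 s1 u0 u1 : fcausal t h dt dh s0 s1 ->
  s0 <= u0 -> u0 <= u1 -> u1 <= s1 -> t u0 <= t u1.
Proof.
move=> H a b c; apply: (@derive_ge0_le _ _ dt) => // s /andP[? ?].
  by have [] := H s; rewrite ?(le_trans a)// ?(le_trans _ c).
by have [] := H s; rewrite ?(le_trans a)// ?(le_trans _ c).
Qed.

Lemma fcausal_cow t h dt dh s0 s1 s a : fcausal t h dt dh s0 s1 -> s0 <= s <= s1 ->
  `|cow (h s) (dh s) a| <= dt s / ratio a (t s).
Proof.
move=> H /H[_ _ d3 d4].
have r0 : 0 < ratio a (t s) by exact: ratio_gt0.
rewrite ler_pdivlMr// -[X in _ * X]ger0_norm ?(ltW r0)// -normrM -ler_sqr ?nnegrE//.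
rewrite real_normK ?num_real// mulrC; apply: le_trans d4.
by rewrite (bigD1 a)//= lerDl sumr_ge0// => j _; rewrite sqr_ge0.
Qed.

Section Horizon.
Variable c : R.
Hypotheses (c0 : 0 < c) (cp : forall a, c <= 1 - p a).

Lemma ratio_decay_le a t d : 0 <= d -> ratio a (t + d) <= expR (- (c * d)) * ratio a t.
Proof.
move=> d0; apply: le_trans (ratio_decay A0 chi0 a t d0) _.
rewrite (ler_wpM2r (ltW (rg _ _)))// ler_expR lerN2.
by rewrite ler_wpM2r.
Qed.

Lemma ratio_inv_le a t d : 0 <= d -> (ratio a t)^-1 <= expR (- (c * d)) / ratio a (t + d).
Proof.
move=> d0; rewrite ler_pdivlMr ?ratio_gt0// mulrC ler_pdivrMr ?ratio_gt0//.
exact: ratio_decay_le.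
Qed.

(** Backwards in time 1 / ratio_a decreases at least like e^{-c (t1 - t)}, so the integral of dt /
    ratio_a is at most 1 / (c ratio_a(t1)): the displacement is controlled by the scale at the end
    point alone. The majorant is the corresponding exponential. *)
Lemma fcausal_majorant t h dt dh s0 s1 a (f df : R -> R) M :
  s0 <= s1 -> fcausal t h dt dh s0 s1 -> 0 <= M ->
  (forall s, s0 <= s <= s1 -> is_derive s 1 f (df s)) ->
  (forall s, s0 <= s <= s1 -> `|df s| <= M * (dt s / ratio a (t s))) ->
  `|f s1 - f s0| <= M / c / ratio a (t s1).
Proof.
move=> s01 H M0 fd fb.
pose g s := M / c / ratio a (t s1) * expR (c * (t s - t s1)).
pose dg s := M / c / ratio a (t s1) * (c * dt s * expR (c * (t s - t s1))).
have r1 := rg a (t s1).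
have gd s : s0 <= s <= s1 -> is_derive s 1 g (dg s).
  move=> /H[dts _ _ _].
  have e1 : is_derive s 1 (fun u => c * (t u - t s1)) (c * dt s).
    by apply: is_derive_eq; rewrite subr0.
  have e2 := is_derive_compR e1 (is_derive_expR (c * (t s - t s1))).
  have e3 := @is_deriveZ _ _ _ _ (M / c / ratio a (t s1)) _ _ _ e2.
  exact: e3.
have bnd s : s0 <= s <= s1 -> `|df s| <= dg s.
  move=> ss; apply: le_trans (fb s ss) _.
  have d : 0 <= t s1 - t s by case/andP: ss => ? ?; rewrite subr_ge0; exact: (fcausal_time_le H).
  have := ratio_inv_le a (t s) d; rewrite subrKC => le.
  have [_ _ dt0 _] := H s ss.
  rewrite /dg [X in _ <= X](_ : _ = M * (dt s * (expR (- (c * (t s1 - t s))) / ratio a (t s1)))).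
    by rewrite ler_wpM2l// ler_wpM2l.
  by rewrite (_ : - (c * (t s1 - t s)) = c * (t s - t s1)); [field; rewrite !gt_eqF|ring].
apply: le_trans (derive_norm_sub_le s01 fd gd bnd) _.
rewrite /g subrr mulr0 expR0 mulr1 gerBl mulr_ge0 ?expR_ge0//.
by rewrite divr_ge0 ?(ltW r1)// divr_ge0// ltW.
Qed.

(** Twice the central coordinate in exponential coordinates. Its differential is 2 w^0 + \sum_r (x_r
    dy_r - y_r dx_r), and it is also the w^0-velocity of the group dilations, see [cow_ddil0]. *)
Definition hzeta (k : 'rV[R]_(hdim m)) : R := 2 * k 0 0 - \sum_(r < m) k 0 (ix r) * k 0 (iy r).

Let K0 := (2 + 2 / c * chis) / c.

Lemma chis_ge0 : 0 <= chis.
Proof. by apply: sumr_ge0 => r _; rewrite ltW. Qed.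

(** Horizontal coordinates are integrated directly. In the derivative of [hzeta] the area terms x dy
    - y dx are bounded by products of horizontal horizons, which [ratio_central] converts into chi_r
    / ratio_0; this is the second summand of [K0]. *)
Lemma fcausal_horizon_id t h dt dh s0 s1 : s0 <= s1 -> fcausal t h dt dh s0 s1 -> h s0 = 0 ->
  (forall a, a != 0 -> `|h s1 0 a| <= c^-1 / ratio a (t s1)) /\
  `|hzeta (h s1)| <= K0 / ratio 0 (t s1).
Proof.
move=> s01 H h0.
have C a s : s0 <= s <= s1 -> is_derive s 1 (fun u => h u 0 a) (dh s 0 a).
  by move=> /H[_ d _ _]; exact: is_derive_coord.
have B a s : a != 0 -> s0 <= s <= s1 -> `|h s 0 a| <= c^-1 / ratio a (t s).
  move=> a0 /andP[ss0 ss1].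
  have /= := @fcausal_majorant t h dt dh s0 s a (fun u => h u 0 a) (fun u => dh u 0 a) 1 ss0.
  rewrite h0 mxE subr0 mul1r; apply => //.
  - exact: fcausal_sub H.
  - by move=> u /andP[u0 u1]; apply: C; rewrite u0 (le_trans u1).
  - move=> u /andP[u0 u1]; rewrite mul1r -(cow_neq0 (h u) (dh u) a0).
    by apply: (fcausal_cow a H); rewrite u0 (le_trans u1).
split; first by move=> a a0; apply: B => //; rewrite s01 lexx.
pose f s := hzeta (h s).
pose df s := 2 * cow (h s) (dh s) 0 + \sum_(r < m) (h s 0 (ix r) * dh s 0 (iy r) - h s 0 (iy r) * dh s 0 (ix r)).
have fd s : s0 <= s <= s1 -> is_derive s 1 f (df s).
  move=> ss.
  have d1 : is_derive s 1 (fun u => 2 * h u 0 0) (2 * dh s 0 0).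
    by have := C 0 s ss => ?; exact: is_deriveZ.
  have d2 : is_derive s 1 (fun u => \sum_(r < m) h u 0 (ix r) * h u 0 (iy r))
     (\sum_(r < m) (h s 0 (ix r) * dh s 0 (iy r) + h s 0 (iy r) * dh s 0 (ix r))).
    have -> : (fun u => \sum_(r < m) h u 0 (ix r) * h u 0 (iy r)) =
       \sum_(r < m) ((fun u => h u 0 (ix r)) * (fun u => h u 0 (iy r))).
      by apply/funext => u; rewrite fct_sumE.
    apply: is_derive_sum => r.
    by have := C (ix r) s ss => ?; have := C (iy r) s ss => ?; exact: is_deriveM.
  apply: (is_derive_eq (is_deriveB d1 d2)).
  rewrite /df cow0 mulrBr mulr_sumr -!addrA; congr (_ + _); rewrite -!sumrN -big_split/=.
  by apply: eq_bigr => r _; ring.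
have M0 : 0 <= 2 + 2 / c * chis by rewrite addr_ge0// mulr_ge0 ?chis_ge0// divr_ge0// ltW.
have := fcausal_majorant (a := 0) s01 H M0 fd; rewrite {1}/f {1}/f h0.
have -> : hzeta 0 = 0 by rewrite /hzeta mxE mulr0 big1 ?subr0// => r _; rewrite mxE mul0r.
rewrite subr0; apply => s ss; have [_ _ dt0 _] := H s ss.
rewrite /df; apply: le_trans (ler_normD _ _) _; rewrite [X in _ <= X]mulrDl; apply: lerD.
  rewrite normrM ger0_norm// ler_wpM2l//; exact: fcausal_cow H ss.
apply: le_trans (ler_norm_sum _ _ _) _; rewrite mulr_sumr mulr_suml; apply: ler_sum => r _.
have rx := rg (ix r) (t s); have ry := rg (iy r) (t s).
have r0 := rg 0 (t s); have c1 := chi0 r.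
apply: le_trans (ler_normB _ _) _; rewrite !normrM.
have b1 : `|h s 0 (ix r)| <= c^-1 / ratio (ix r) (t s) by apply: B; rewrite ?ix_neq0.
have b2 : `|h s 0 (iy r)| <= c^-1 / ratio (iy r) (t s) by apply: B; rewrite ?iy_neq0.
have b3 : `|dh s 0 (ix r)| <= dt s / ratio (ix r) (t s).
  by rewrite -(@cow_neq0 _ _ (h s)) ?ix_neq0//; exact: fcausal_cow H ss.
have b4 : `|dh s 0 (iy r)| <= dt s / ratio (iy r) (t s).
  by rewrite -(@cow_neq0 _ _ (h s)) ?iy_neq0//; exact: fcausal_cow H ss.
apply: (@le_trans _ _ (2 / c * dt s * (ratio (ix r) (t s) * ratio (iy r) (t s))^-1)).
  rewrite [X in _ <= X](_ : _ = c^-1 / ratio (ix r) (t s) * (dt s / ratio (iy r) (t s)) + c^-1 / ratio (iy r) (t s) * (dt s / ratio (ix r) (t s))).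
    by rewrite lerD// ler_pM.
  by field; rewrite !gt_eqF.
apply: (@le_trans _ _ (2 / c * dt s * (chi p r / ratio 0 (t s)))).
  by rewrite ler_wpM2l// mulr_ge0// divr_ge0// ltW.
by rewrite le_eqVlt (_ : _ * _ = 2 / c * chi p r * (dt s / ratio 0 (t s))) ?eqxx//; ring.
Qed.

(** Left translation reduces to a start at the identity, so K is the same for all curves and all
    starting points. *)
Lemma fcausal_horizon : exists2 K, 0 < K & forall t h dt dh s0 s1,
  s0 <= s1 -> fcausal t h dt dh s0 s1 ->
  let k := hmul (hinv (h s0)) (h s1) in
  (forall a, `|k 0 a| <= K / ratio a (t s1)) /\ `|hzeta k| <= K / ratio 0 (t s1).
Proof.
have k00 : 0 <= K0.
  by rewrite /K0 divr_ge0 ?(ltW c0)// addr_ge0// mulr_ge0 ?chis_ge0// divr_ge0// ltW.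
have cc : 0 <= c^-1 by rewrite invr_ge0 ltW.
have cs : 0 <= c^-1 * c^-1 * chis by rewrite mulr_ge0 ?chis_ge0// mulr_ge0.
exists (1 + c^-1 + K0 + c^-1 * c^-1 * chis).
  by rewrite -!addrA ltr_pwDl// addr_ge0// addr_ge0.
move=> t h dt dh s0 s1 s01 H k.
have := fcausal_horizon_id s01 (fcausal_hmul (hinv (h s0)) H) (hmulVh _).
rewrite -/k => -[ka kz].
have leK a M : 0 <= M -> M <= 1 + c^-1 + K0 + c^-1 * c^-1 * chis ->
    M / ratio a (t s1) <= (1 + c^-1 + K0 + c^-1 * c^-1 * chis) / ratio a (t s1).
  by move=> _ le; rewrite ler_wpM2r// invr_ge0 ltW// ratio_gt0.
split; last by apply: le_trans kz _; apply: leK => //; lra.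
move=> a; have [->|a0] := eqVneq a 0; last by apply: le_trans (ka a a0) _; apply: leK => //; lra.
apply: (@le_trans _ _ ((K0 + c^-1 * c^-1 * chis) / ratio 0 (t s1))); last by apply: leK; lra.
have -> : k 0 0 = (hzeta k + \sum_(r < m) k 0 (ix r) * k 0 (iy r)) / 2.
  by rewrite /hzeta; field.
have S : `|\sum_(r < m) k 0 (ix r) * k 0 (iy r)| <= c^-1 * c^-1 * chis / ratio 0 (t s1).
  apply: le_trans (ler_norm_sum _ _ _) _; rewrite mulr_sumr mulr_suml; apply: ler_sum => r _.
  have rx := rg (ix r) (t s1); have ry := rg (iy r) (t s1).
  have r0 := rg 0 (t s1); have c1 := chi0 r.
  have le := ratio_inv_central r (t s1).
  rewrite normrM; apply: (@le_trans _ _ (c^-1 / ratio (ix r) (t s1) * (c^-1 / ratio (iy r) (t s1)))).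
    by rewrite ler_pM// ka// ?ix_neq0 ?iy_neq0.
  rewrite [X in X <= _](_ : _ = c^-1 * c^-1 * (ratio (ix r) (t s1) * ratio (iy r) (t s1))^-1).
    rewrite -[X in _ <= X]mulrA; apply: ler_wpM2l le; exact: mulr_ge0.
  by field; rewrite !gt_eqF.
rewrite normrM (ger0_norm (_ : 0 <= 2^-1))// mulrDl.
have := le_trans (ler_normD _ _) (lerD kz S).
have : 0 <= `|hzeta k + \sum_(r < m) k 0 (ix r) * k 0 (iy r)| by [].
by set X := `|_ + _|; set Y := _ + _; clearbody X Y => ? ?; lra.
Qed.

Lemma ratio_inv_cvg a e : 0 < e -> exists T, forall t, t <= T -> (ratio a t)^-1 < e.
Proof.
move=> e0; have r0 := rg a 0.
exists (Num.min 0 (ln (e * ratio a 0 / 2) / c)) => t; rewrite le_min => /andP[t0 tc].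
have := @ratio_inv_le a t (- t); rewrite subrr oppr_ge0 => /(_ t0) le.
apply: le_lt_trans le _; rewrite mulrN opprK ltr_pdivrMr//.
move: tc; rewrite ler_pdivlMr// mulrC => tc.
have x0 : 0 < e * ratio a 0 by rewrite mulr_gt0.
apply: (@le_lt_trans _ _ (expR (ln (e * ratio a 0 / 2)))); first by rewrite ler_expR.
by rewrite lnK ?posrE ?divr_gt0//; lra.
Qed.

End Horizon.

Lemma ratio_lower t0 t1 : exists2 M, 0 < M & forall a t, t0 <= t <= t1 -> (ratio a t)^-1 <= M.
Proof.
pose M a := expR (`|1 - p a + 2 * chis| * (t1 - t0)) / ratio a t0.
have M0 a : 0 < M a by rewrite divr_gt0 ?expR_gt0 ?ratio_gt0.
exists (1 + \sum_a M a); first by rewrite ltr_pwDl// sumr_ge0// => a _; rewrite ltW.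
move=> a t /andP[tt0 tt1]; apply: (@le_trans _ _ (M a)).
  have d0 : 0 <= t - t0 by rewrite subr_ge0.
  have := ratio_growth A0 chi0 a t0 d0; rewrite subrKC => le.
  rewrite /M ler_pdivlMr ?ratio_gt0// mulrC ler_pdivrMr ?ratio_gt0//.
  apply: le_trans le _; rewrite (ler_wpM2r (ltW (rg _ _)))// ler_expR.
  apply: (@le_trans _ _ (`|1 - p a + 2 * chis| * (t - t0))); first by rewrite ler_wpM2r// ler_norm.
  by rewrite ler_wpM2l// lerB.
by rewrite (bigD1 a)//= addrCA lerDl addr_ge0// sumr_ge0// => b _; rewrite ltW.
Qed.

Lemma fcausal_lipschitz_horizontal t0 t1 : exists2 M, 0 < M &
  forall t h dt dh s0 s1, s0 <= s1 -> fcausal t h dt dh s0 s1 -> t0 <= t s0 -> t s1 <= t1 ->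
  forall a, a != 0 -> `|h s1 0 a - h s0 0 a| <= M * (t s1 - t s0).
Proof.
have [M M0 HM] := ratio_lower t0 t1; exists M => // t h dt dh s0 s1 s01 H tt0 tt1 a a0.
rewrite mulrBr; apply: (@derive_norm_sub_le _ (fun u => h u 0 a) (fun u => M * t u)
  (fun u => dh u 0 a) (fun u => M * dt u)) => [|s ss|s ss|s ss]; first exact: s01.
- by have [_ d _ _] := H s ss; exact: is_derive_coord.
- by have [d _ _ _] := H s ss; exact: is_deriveZ.
have [_ _ dt0 _] := H s ss; rewrite -(cow_neq0 (h s) (dh s) a0).
apply: le_trans (fcausal_cow a H ss) _; rewrite mulrC ler_wpM2r//; apply: HM.
case/andP: ss => ? ?; apply/andP; split.
  by apply: le_trans tt0 _; exact: (fcausal_time_le H).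
by apply: le_trans tt1; exact: (fcausal_time_le H).
Qed.

(** Since dz = w^0 + \sum_r x_r dy_r, a bound for the central coordinate needs one for the x_r
    beforehand. *)
Lemma fcausal_lipschitz_vertical t0 t1 B : 0 <= B -> exists2 M, 0 < M &
  forall t h dt dh s0 s1, s0 <= s1 -> fcausal t h dt dh s0 s1 -> t0 <= t s0 -> t s1 <= t1 ->
  (forall s r, s0 <= s <= s1 -> `|h s 0 (ix r)| <= B) ->
  `|h s1 0 0 - h s0 0 0| <= M * (t s1 - t s0).
Proof.
move=> B0; have [M M0 HM] := ratio_lower t0 t1; exists (M * (1 + B * m%:R)).
  by rewrite mulr_gt0// ltr_pwDl// mulr_ge0.
move=> t h dt dh s0 s1 s01 H tt0 tt1 HB.
rewrite mulrBr; apply: (@derive_norm_sub_le _ (fun u => h u 0 0) (fun u => M * (1 + B * m%:R) * t u)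
  (fun u => dh u 0 0) (fun u => M * (1 + B * m%:R) * dt u)) => [|s ss|s ss|s ss]; first exact: s01.
- by have [_ d _ _] := H s ss; exact: is_derive_coord.
- by have [d _ _ _] := H s ss; exact: is_deriveZ.
have [_ _ dt0 _] := H s ss.
have b a : `|cow (h s) (dh s) a| <= M * dt s.
  apply: le_trans (fcausal_cow a H ss) _; rewrite mulrC ler_wpM2r//; apply: HM.
  case/andP: ss => ? ?; apply/andP; split.
    by apply: le_trans tt0 _; exact: (fcausal_time_le H).
  by apply: le_trans tt1; exact: (fcausal_time_le H).
have -> : dh s 0 0 = cow (h s) (dh s) 0 + \sum_(r < m) h s 0 (ix r) * dh s 0 (iy r).
  by rewrite cow0 subrK.
apply: le_trans (ler_normD _ _) _.
rewrite (_ : M * (1 + B * m%:R) * dt s = M * dt s + \sum_(r < m) B * (M * dt s)); last first.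
  by rewrite sumr_const card_ord -mulr_natr; ring.
rewrite lerD//; apply: le_trans (ler_norm_sum _ _ _) _; apply: ler_sum => r _.
rewrite normrM ler_pM//; first exact: HB.
by rewrite -(@cow_neq0 _ _ (h s)) ?iy_neq0.
Qed.

End CausalPaths.

(** * Nearly Minkowskian charts of an extension *)

Section FirstOrder.
Context {R : realType}.

Lemma is_derive1_bound (V : normedModType R) (f : R -> V) (s : R) (v : V) :
  (forall e : R, 0 < e -> \forall h \near 0, `|f (s + h) - f s - h *: v| <= e * `|h|) ->
  is_derive s 1 f v.
Proof.
move=> H.
have c : h^-1 *: ((f \o shift s) (h *: 1) - f s) @[h --> 0^'] --> v.
  apply/cvgrPdist_le => e e0; have := H e e0 => He; near=> h.
  have h0 : h != 0 by near: h; exact: nbhs_dnbhs_neq.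
  have hb : `|f (s + h) - f s - h *: v| <= e * `|h|.
    by near: h; apply: nbhs_dnbhs; exact: He.
  rewrite -(@ler_pM2r _ `|h|) ?normr_gt0// mulrC -normrZ scalerBr scalerA divff// scale1r.
  by rewrite distrC /= [h *: 1]mulr1 (addrC h).
by apply: DeriveDef; [apply/cvg_ex; exists v|exact/cvg_lim].
Unshelve. all: by end_near. Qed.

Lemma is_derive1_boundV (V : normedModType R) (f : R -> V) (s : R) (v : V) (e : R) :
  is_derive s 1 f v -> 0 < e -> \forall h \near 0, `|f (s + h) - f s - h *: v| <= e * `|h|.
Proof.
move=> [d dE] e0.
have c : h^-1 *: ((f \o shift s) (h *: 1) - f s) @[h --> 0^'] --> v by rewrite -dE.
have /cvgrPdist_le/(_ _ e0) := c; rewrite near_withinE; apply: filterS => h Hh.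
have [->|h0] := eqVneq h 0; first by rewrite addr0 subrr scale0r subr0 !normr0 mulr0.
have := Hh h0; rewrite -(@ler_pM2r _ `|h|) ?normr_gt0// mulrC -normrZ scalerBr scalerA divff// scale1r.
by rewrite distrC /= [h *: 1]mulr1 (addrC h).
Qed.

Lemma dist_lt_of_le (k u d : R) : k <= u -> u < k + d -> `|k - u| < d.
Proof. by move=> ku ud; rewrite ler0_norm ?subr_le0//; lra. Qed.

Lemma continuous_nbhs_pre (T U : topologicalType) (f : T -> U) x (B : set U) :
  {for x, continuous f} -> nbhs (f x) B -> nbhs x (f @^-1` B).
Proof. by move=> c n; exact: c. Qed.

(** The tube lemma for {k} x [a, b]. *)
Lemma segment_uniform (a b k : R) (P : R -> R -> Prop) :
  (forall s, a <= s <= b -> exists2 d : R, 0 < d &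
     forall k' s', `|k - k'| < d -> `|s - s'| < d -> P k' s') ->
  exists2 d : R, 0 < d & forall k' s, `|k - k'| < d -> a <= s <= b -> P k' s.
Proof.
move=> H; have [ab|ba] := leP a b; last first.
  by exists 1 => // k' s _ /andP[? ?]; exfalso; lra.
suff S s : a <= s <= b -> exists2 d : R, 0 < d & forall k' u, `|k - k'| < d -> a <= u <= s -> P k' u.
  by have := S b; rewrite ab lexx; apply.
apply: (@real_induction R a b (fun s => exists2 d : R, 0 < d & forall k' u, `|k - k'| < d -> a <= u <= s -> P k' u)) => {}s sab IH.
have [d d0 Hd] := H s sab.
have [e e0 He] : exists2 e : R, 0 < e & forall k' u, `|k - k'| < e -> a <= u <= s - d / 2 -> P k' u.
  have [as'|sa] := leP a (s - d / 2); first by apply: IH; rewrite as'; lra.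
  by exists 1 => // k' u _ /andP[? ?]; exfalso; lra.
exists d => // u /andP[_ _] ud.
exists (Num.min d e); first by rewrite lt_min d0.
move=> k' u'; rewrite lt_min => /andP[k1 k2] /andP[au uu].
have [us|su] := leP u' (s - d / 2); first by apply: He => //; rewrite au.
by apply: Hd => //; rewrite ltr_norml; apply/andP; split; lra.
Qed.

End FirstOrder.

Section LocalExtension.
Context {R : realType} {m : nat}.
Local Notation X := 'rV[R]_(1 + hdim m).

Definition eta (u : X) : R := \sum_(i | i != 0) u 0 i ^+ 2 - u 0 0 ^+ 2.

(* The part of a C^0 extension N of the quotient of the cover X = R x H by Ga
   seen in a chart of N with coordinates in the ball of radius r, in which the
   metric is close to that of Minkowski space: Phi is the coordinate expression
   of X -> Ga \ X -> N, defined on O.  Nothing else about N is needed. *)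
Record local_extension (Ga : set 'rV[R]_(hdim m)) (A p : 'I_(hdim m) -> R)
    (O : set X) (Phi : X -> X) (r : R) : Prop := {
  lx_open : open O;
  lx_diff : forall x, O x -> differentiable Phi x;
  lx_cont : forall v x, O x -> {for x, continuous (fun y => 'd Phi y v)};
  lx_unit : forall x, O x -> 'J Phi x \in unitmx;
  lx_metric : forall x v, O x ->
    `|qform (family_form A p x) v - eta ('d Phi x v)| <= 4^-1 * `|'d Phi x v| ^+ 2;
  lx_closed : forall r', r' < r -> closed [set x | O x /\ `|Phi x| <= r'];
  lx_openmap : forall U, U `<=` O -> open U -> open (Phi @` U);
  lx_fiber : forall x x', O x -> O x' -> Phi x = Phi x' -> stproj Ga x = stproj Ga x';
  lx_orbit : forall x x', O x -> stproj Ga x = stproj Ga x' -> O x' /\ Phi x' = Phi x;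
  lx_ball : forall x, O x -> `|Phi x| < r }.

(** For a form within 1/4 of the Minkowski form as in [lx_metric], images of future timelike vectors
    lie in [cone_out] ([future_cone_out]) and vectors mapped into [cone_in] are timelike
    ([cone_in_timelike]). *)
Definition cone_out (u : X) : Prop := forall i, `|u 0 i| <= 2 * u 0 0.

(** So small that 1 + hdim m squares of slopes at most theta add up to at most 1/4. *)
Definition theta : R := (2 * (1 + hdim m)%:R)^-1.

Definition cone_in (u : X) : Prop := 0 < u 0 0 /\ forall i, i != 0 -> `|u 0 i| <= theta * u 0 0.

Lemma theta_gt0 : 0 < theta. Proof. by rewrite invr_gt0 mulr_gt0. Qed.

Lemma theta_le : theta <= 2^-1.
Proof. by rewrite lef_pV2 ?posrE// ?mulr_gt0// ler_peMr// ler1n. Qed.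

Lemma cone_in_norm u : cone_in u -> `|u| = u 0 0.
Proof.
case=> u0 H; apply/eqP; rewrite eq_le; apply/andP; split; last first.
  by rewrite -[leLHS]ger0_norm ?coord_le_norm// ltW.
apply: rV_norm_leP => [|i]; first exact: ltW.
have [->|i0] := eqVneq i 0; first by rewrite ger0_norm// ltW.
apply: le_trans (H i i0) _; rewrite ler_piMl//; first exact: ltW.
by apply: le_trans theta_le _; rewrite invf_le1// ler1n.
Qed.

Lemma cone_inZ a u : 0 < a -> cone_in u -> cone_in (a *: u).
Proof.
move=> a0 [u0 uH]; split; first by rewrite mxE mulr_gt0.
by move=> i i0; rewrite !mxE normrM gtr0_norm// mulrCA ler_wpM2l ?uH// ltW.
Qed.

Definition vup : X := delta_mx 0 0.

Lemma vup0 : vup 0 0 = 1. Proof. by rewrite mxE !eqxx. Qed.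

Lemma vupi i : i != 0 -> vup 0 i = 0.
Proof. by move=> i0; rewrite mxE eqxx (negbTE i0). Qed.

Lemma cone_in_vup : cone_in vup.
Proof. by split; rewrite ?vup0// => i i0; rewrite vupi// normr0 mulr1 ltW// theta_gt0. Qed.

Lemma cone_in_vup_open (a : R) : 0 < a -> forall u : X, `|u| <= a * theta / 2 -> cone_in (a *: vup + u).
Proof.
move=> a0 u ub; have t0 := theta_gt0; have t1 := theta_le.
have b i : `|u 0 i| <= a * theta / 2 by apply: le_trans ub; exact: coord_le_norm.
have a0' : a / 2 <= (a *: vup + u) 0 0.
  rewrite !mxE !eqxx mulr1; have := b 0; rewrite ler_norml => /andP[h _].
  have : a * theta <= a * 2^-1 by rewrite ler_wpM2l// ltW.
  lra.
split=> [|i i0]; first by lra.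
rewrite mxE [_ 0 i]mxE vupi// mulr0 add0r; apply: le_trans (b i) _.
by rewrite -mulrA mulrCA ler_wpM2l// ltW.
Qed.

Section Data.
Variables (Ga : set 'rV[R]_(hdim m)) (A p : 'I_(hdim m) -> R).
Hypothesis A0 : forall a, 0 < A a.
Hypothesis chi0 : forall r : 'I_m, 0 < chi p r.
Variables (O : set X) (Phi : X -> X) (r : R).
Hypothesis lx : local_extension Ga A p O Phi r.
Local Notation qf x v := (qform (family_form A p x) v).

Let N0 t : 0 < lapse A p t. Proof. exact: lapse_gt0. Qed.

Let dJ x v : O x -> 'd Phi x v = v *m 'J Phi x.
Proof. by move=> Ox; rewrite -deriveEjacobian ?deriveE//; exact: (lx_diff lx). Qed.

Lemma lx_nearO x : O x -> nbhs x O.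
Proof. by move=> Ox; apply: open_nbhs_nbhs; split=> //; exact: (lx_open lx). Qed.

Lemma timelike_cone x v : O x -> qf x v < 0 ->
  (forall i, `|('d Phi x v) 0 i| <= 2 * `|('d Phi x v) 0 0|) /\
  0 < `|('d Phi x v) 0 0| /\ - qf x v <= 2 * ('d Phi x v) 0 0 ^+ 2.
Proof.
move=> Ox tl; have := lx_metric lx v Ox; set u := 'd Phi x v; rewrite ler_norml => /andP[m1 m2].
have et : eta u <= 4^-1 * `|u| ^+ 2 + qf x v by lra.
have [uz|un0] := eqVneq `|u| 0.
  exfalso; move: et; rewrite uz expr0n mulr0 add0r => et.
  have /normr0_eq0 z := uz; move: et; rewrite /eta z big1 => [|i _]; last by rewrite mxE expr0n.
  by rewrite mxE expr0n subrr leNgt tl.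
have [i ui] : exists i, `|u 0 i| = `|u|.
  have [[j k] /= e] := mx_norm_neq0 un0; exists k; move: e; rewrite (ord1 j) => <-; exact: esym.
have key : `|u| <= 2 * `|u 0 0| /\ 0 < `|u 0 0|.
  have [i0|i0] := eqVneq i 0.
    move: ui; rewrite i0 => e; rewrite -e; have : 0 <= `|u 0 0| by [].
    move=> ge; split; first by lra.
    rewrite lt_neqAle ge andbT eq_sym; apply/negP => /eqP z.
    move: et; rewrite -e z expr0n mulr0 add0r /eta.
    have -> : u 0 0 ^+ 2 = 0 by rewrite -[_ ^+ 2]ger0_norm ?sqr_ge0// normrX z expr0n.
    by rewrite subr0 => /le_lt_trans/(_ tl); rewrite ltNge sumr_ge0// => j _; rewrite sqr_ge0.
  have : `|u| ^+ 2 <= \sum_(i | i != 0) u 0 i ^+ 2.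
    rewrite (bigD1 i)//= -ui real_normK ?num_real// lerDl sumr_ge0// => j _; exact: sqr_ge0.
  move=> le.
  have lt : `|u| ^+ 2 < 4 * `|u 0 0| ^+ 2.
    move: et; rewrite /eta (real_normK (num_real (u 0 0))).
    by set S := \sum_(i | _) _ in le *; have := sqr_ge0 `|u|; lra.
  have lt2 : `|u| < 2 * `|u 0 0|.
    by rewrite -ltr_sqr ?nnegrE ?mulr_ge0// exprMn (_ : 2 ^+ 2 = 4 :> R)//; ring.
  by split; [exact: ltW|have := normr_ge0 u; lra].
case: key => k1 k2; split; first by move=> j; apply: le_trans k1; exact: coord_le_norm.
split=> //; have : eta u >= - u 0 0 ^+ 2.
  by rewrite /eta lerDr sumr_ge0// => j _; exact: sqr_ge0.
have : `|u| ^+ 2 <= 4 * u 0 0 ^+ 2.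
  rewrite -(real_normK (num_real (u 0 0))) (_ : 4 = 2 ^+ 2 :> R); last by ring.
  by rewrite -exprMn ler_sqr ?nnegrE// mulr_ge0.
lra.
Qed.

Lemma cone_in_timelike x v : O x -> cone_in ('d Phi x v) -> qf x v < 0.
Proof.
move=> Ox c; have := lx_metric lx v Ox; rewrite (cone_in_norm c).
case: c; set u := 'd Phi x v => u0 H; rewrite ler_norml => /andP[_ m2].
have : eta u <= - (3 / 4) * u 0 0 ^+ 2.
  rewrite /eta; suff : \sum_(i | i != 0) u 0 i ^+ 2 <= 4^-1 * u 0 0 ^+ 2 by lra.
  apply: (@le_trans _ _ (\sum_(i : 'I_(1 + hdim m)) (theta ^+ 2 * u 0 0 ^+ 2))).
    rewrite [leLHS]big_mkcond; apply: ler_sum => i _; case: ifP => [i0|_]; last first.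
      by rewrite mulr_ge0 ?sqr_ge0.
    rewrite -exprMn -(real_normK (num_real (u 0 i))) ler_sqr ?nnegrE ?H//.
    by rewrite mulr_ge0 ?ltW// theta_gt0.
  rewrite sumr_const card_ord -[leLHS]mulr_natr [leLHS]mulrAC; apply: ler_wpM2r; first exact: sqr_ge0.
  rewrite /theta; set n : R := (1 + hdim m)%:R; have n1 : 1 <= n by rewrite /n ler1n.
  rewrite (_ : _ * n = 4^-1 * n^-1); last by field; rewrite gt_eqF//; lra.
  by rewrite ler_piMr// invf_le1//; lra.
have : 0 < u 0 0 ^+ 2 by rewrite exprn_gt0.
lra.
Qed.

Lemma spacelike_le x v : O x -> qf x v <= (1 + hdim m).+1%:R * `|'d Phi x v| ^+ 2.
Proof.
move=> Ox; have := lx_metric lx v Ox; set u := 'd Phi x v; rewrite ler_norml => /andP[_ m2].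
have : eta u <= (1 + hdim m)%:R * `|u| ^+ 2.
  rewrite /eta; apply: (@le_trans _ _ (\sum_(i : 'I_(1 + hdim m)) `|u| ^+ 2)); last first.
    by rewrite sumr_const card_ord mulr_natl.
  apply: le_trans (_ : \sum_(i | i != 0) u 0 i ^+ 2 <= _).
    by rewrite gerBl sqr_ge0.
  rewrite [leLHS]big_mkcond; apply: ler_sum => i _; case: ifP => [i0|_]; last exact: sqr_ge0.
  by rewrite -(real_normK (num_real (u 0 i))) ler_sqr ?nnegrE// coord_le_norm.
by rewrite -[in X in _ -> _ <= X]addn1 natrD mulrDl; have := sqr_ge0 `|u|; lra.
Qed.

Lemma cow_lin (h : 'rV[R]_(hdim m)) v w a b i : cow h (a *: v + b *: w) i = a * cow h v i + b * cow h w i.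
Proof. by rewrite -!hcoframe_mul mulmxDl -!scalemxAl !mxE. Qed.

Lemma vup_timelike x : qf x vup < 0.
Proof.
rewrite qform_family// -[X in _ < X](mulr0 (lapse A p (x 0 0) ^+ 2)) ltr_pM2l ?exprn_gt0//.
rewrite big1 ?sub0r ?vup0 ?expr1n ?oppr_lt0// => a _.
have z b : (rsubmx vup) 0 b = 0 by rewrite mxE vupi//.
rewrite /cow z sub0r; case: ifP => _; last by rewrite oppr0 mulr0 expr0n.
by rewrite big1 ?oppr0 ?mulr0 ?expr0n// => s _; rewrite z mulr0.
Qed.

(** The vectors between v and the tau-direction are timelike, and the image of a timelike vector has
    nonzero chart time component; hence this component keeps its sign along the segment. *)
Lemma time_orient x v : O x -> qf x v < 0 -> 0 < v 0 0 ->
  0 < ('d Phi x vup) 0 0 * ('d Phi x v) 0 0.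
Proof.
move=> Ox tl v0; set b := ('d Phi x vup) 0 0; set a := ('d Phi x v) 0 0.
have a0 : a != 0.
  by have [_ [+ _]] := timelike_cone Ox tl; rewrite normr_gt0.
have nz l : 0 < l <= 1 -> (1 - l) * a + l * b != 0.
  move=> /andP[l0 l1].
  have tl' : qf x ((1 - l) *: v + l *: vup) < 0.
    move: tl; rewrite !qform_family// -[X in _ < X -> _](mulr0 (lapse A p (x 0 0) ^+ 2)).
    rewrite -[X in _ -> _ < X](mulr0 (lapse A p (x 0 0) ^+ 2)) !ltr_pM2l ?exprn_gt0//.
    rewrite !subr_lt0 => tl.
    have z b' : (rsubmx vup) 0 b' = 0 by rewrite mxE vupi//.
    have cz i : cow (rsubmx x) (rsubmx vup) i = 0.
      rewrite /cow z sub0r; case: ifP => _; last by rewrite oppr0.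
      by rewrite big1 ?oppr0// => s _; rewrite z mulr0.
    under eq_bigr do rewrite linearD !linearZ/= cow_lin cz mulr0 addr0 mulrCA exprMn.
    rewrite -mulr_sumr !mxE !eqxx mulr1.
    have l1' : 0 <= 1 - l by rewrite subr_ge0.
    apply: (@le_lt_trans _ _ ((1 - l) ^+ 2 * v 0 0 ^+ 2)); first by rewrite ler_wpM2l ?sqr_ge0// ltW.
    have vl : 0 <= (1 - l) * v 0 0 by rewrite mulr_ge0// ltW.
    by rewrite -exprMn ltr_sqr ?nnegrE ?ltrDl// addr_ge0// ltW.
  have [_ [+ _]] := timelike_cone Ox tl'; rewrite normr_gt0.
  by rewrite linearD !linearZ !mxE.
rewrite ltNge; apply/negP => ab.
have ab0 : a * (a - b) > 0.
  by rewrite mulrBr subr_gt0 mulrC; apply: le_lt_trans ab _; rewrite -expr2 exprn_even_gt0.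
have d0 : a - b != 0 by apply: contraTneq ab0 => ->; rewrite mulr0 ltxx.
(* The convex combination at which the chart time component would vanish if a and b had opposite
   signs. *)
have := nz (a / (a - b)); rewrite (_ : (1 - _) * a + _ = 0) ?eqxx; last by field.
move/(_ _)/notF; apply; apply/andP; split.
  by rewrite -(pmulr_lgt0 _ (_ : 0 < (a - b) ^+ 2)) ?exprn_even_gt0// expr2 mulrA divfK.
rewrite -subr_ge0 (_ : 1 - _ = - (b * a) / (a * (a - b))); last by field; rewrite a0 d0.
by rewrite divr_ge0 ?oppr_ge0// ltW.
Qed.

(** The chart time may increase with tau on one part of O and decrease on another; this is the part
    where it increases. *)
Definition future_side x := O x /\ 0 < ('d Phi x vup) 0 0.

Lemma future_side_near x : future_side x -> nbhs x future_side.
Proof.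
move=> [Ox d0]; apply: filterI; first exact: lx_nearO.
have c : {for x, continuous (fun y => ('d Phi y vup) 0 0)}.
  apply: (@cvg_coord _ _ (nbhs x) (nbhs_filter x) 1 _ (fun y => 'd Phi y vup) _ 0 0).
  exact: (lx_cont lx).
have := continuous_nbhs c (@open_gt _ 0); exact.
Qed.

Lemma future_cone_out x v : future_side x -> qf x v < 0 -> 0 < v 0 0 ->
  [/\ 0 < ('d Phi x v) 0 0, cone_out ('d Phi x v) & - qf x v <= 2 * ('d Phi x v) 0 0 ^+ 2].
Proof.
move=> [Ox d0] tl v0; have := time_orient Ox tl v0; rewrite pmulr_rgt0// => u0.
have [c1 [_ c3]] := timelike_cone Ox tl; split=> // i.
by apply: le_trans (c1 i) _; rewrite gtr0_norm.
Qed.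

Lemma is_derive_Phi (x : R -> X) s v : O (x s) -> is_derive s 1 x v ->
  is_derive s 1 (Phi \o x) ('d Phi (x s) v).
Proof. by move=> Ox d; apply: is_derive_comp_diff => //; exact: (lx_diff lx). Qed.

Definition ftimelike (x v : R -> X) (s0 s1 : R) := forall s, s0 <= s <= s1 ->
  [/\ is_derive s 1 x (v s), 0 < v s 0 0 & qf (x s) (v s) < 0].

Lemma ftimelike_mono x v s0 s1 : ftimelike x v s0 s1 ->
  (forall s, s0 <= s <= s1 -> future_side (x s)) ->
  forall u0 u1, s0 <= u0 -> u0 <= u1 -> u1 <= s1 -> cone_out (Phi (x u1) - Phi (x u0)).
Proof.
move=> tl fs u0 u1 a b c i; rewrite !mxE mulrBr.
have D s : u0 <= s <= u1 -> is_derive s 1 (Phi \o x) ('d Phi (x s) (v s)).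
  move=> /andP[? ?]; have ss : s0 <= s <= s1 by rewrite (le_trans a)// (le_trans _ c).
  by have [d _ _] := tl s ss; apply: is_derive_Phi => //; exact: (fs s ss).1.
apply: (@derive_norm_sub_le _ (fun s => Phi (x s) 0 i) (fun s => 2 * Phi (x s) 0 0)
  (fun s => ('d Phi (x s) (v s)) 0 i) (fun s => 2 * ('d Phi (x s) (v s)) 0 0)) => [|s ss|s ss|s ss].
- exact: b.
- exact: is_derive_coord (D s ss).
- by have := is_derive_coord 0 0 (D s ss) => ?; exact: is_deriveZ.
have ss' : s0 <= s <= s1 by case/andP: ss => ? ?; rewrite (le_trans a)// (le_trans _ c).
by have [_ v0 q0] := tl s ss'; have [_ c1 _] := future_cone_out (fs s ss') q0 v0; exact: c1.
Qed.

(** The chart time of y exceeds that of y0 by at most 2 rho, so the other coordinates move by at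
    most 4 rho from those of y0, which are within rho of z. *)
Lemma cone_out_between (y0 y y1 z : X) rho : cone_out (y - y0) -> cone_out (y1 - y) ->
  `|y0 - z| <= rho -> `|y1 - z| <= rho -> `|y - z| <= 5 * rho.
Proof.
move=> c0 c1 h0 h1; have r0 : 0 <= rho by apply: le_trans h0.
apply: rV_norm_leP => [|i]; first by rewrite mulr_ge0.
have a1 := coord_le_norm (y0 - z) 0 0; have a2 := coord_le_norm (y1 - z) 0 0.
have a3 := coord_le_norm (y0 - z) 0 i.
have b0 := c0 i; have b1 := c1 0; have b2 := c0 0.
have : `|(y0 - z) 0 0| <= rho by apply: le_trans a1 _.
have : `|(y1 - z) 0 0| <= rho by apply: le_trans a2 _.
have : `|(y0 - z) 0 i| <= rho by apply: le_trans a3 _.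
move: b0 b1 b2; rewrite !mxE !ler_norml.
by move=> /andP[? ?] /andP[? ?] /andP[? ?] /andP[? ?] /andP[? ?] /andP[? ?]; apply/andP; split; lra.
Qed.

(* Moving a timelike curve with end points near z through timelike curves
   cannot make it leave the chart, since inside the chart it is confined by
   the cones of its end points. *)
Lemma confinement (Q dQ : R -> R -> X) (s0 s1 : R) (z : X) (rho : R) :
  s0 <= s1 -> `|z| + 5 * rho < r ->
  (forall k s, 0 <= k <= 1 -> s0 <= s <= s1 ->
     {for (k, s), continuous (fun q : R * R => Q q.1 q.2)}) ->
  (forall k, 0 <= k <= 1 -> ftimelike (Q k) (dQ k) s0 s1) ->
  (forall s, s0 <= s <= s1 -> future_side (Q 0 s)) ->
  (forall k, 0 <= k <= 1 -> `|Phi (Q k s0) - z| <= rho /\ `|Phi (Q k s1) - z| <= rho) ->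
  forall k, 0 <= k <= 1 -> forall s, s0 <= s <= s1 ->
   [/\ future_side (Q k s), `|Phi (Q k s) - z| <= 5 * rho,
      cone_out (Phi (Q k s) - Phi (Q k s0)) & cone_out (Phi (Q k s1) - Phi (Q k s))].
Proof.
move=> s01 zr cQ tQ f0 ends.
have mono k : 0 <= k <= 1 -> (forall s, s0 <= s <= s1 -> future_side (Q k s)) ->
    forall s, s0 <= s <= s1 -> [/\ `|Phi (Q k s) - z| <= 5 * rho,
      cone_out (Phi (Q k s) - Phi (Q k s0)) & cone_out (Phi (Q k s1) - Phi (Q k s))].
  move=> k01 fs s /andP[a b].
  have c0 := ftimelike_mono (tQ k k01) fs (lexx s0) a b.
  have c1 := ftimelike_mono (tQ k k01) fs a b (lexx s1).
  by have [e0 e1] := ends k k01; split=> //; exact: (cone_out_between c0 c1 e0 e1).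
suff fs k : 0 <= k <= 1 -> forall s, s0 <= s <= s1 -> future_side (Q k s).
  by move=> k k01 s ss; have [] := mono k k01 (fs k k01) s ss; have := fs k k01 s ss.
apply: (@real_induction R 0 1 (fun k => forall s, s0 <= s <= s1 -> future_side (Q k s))) => {}k k01 IH.
have fk s : s0 <= s <= s1 -> future_side (Q k s).
  move=> ss; have [->|k0] := eqVneq k 0; first exact: f0.
  have kp : 0 < k by rewrite lt_neqAle eq_sym k0; case/andP: k01.
  have Ek u : 0 <= u < k -> O (Q u s) /\ `|Phi (Q u s)| <= `|z| + 5 * rho.
    move=> /andP[u0 uk]; have u01 : 0 <= u <= 1 by rewrite u0 (le_trans (ltW uk))//; case/andP: k01.
    have fu : forall s, s0 <= s <= s1 -> future_side (Q u s) by apply: IH; rewrite u0.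
    have [b _ _] := mono u u01 fu s ss; split; first exact: (fu s ss).1.
    by rewrite -[Phi _](subrK z) addrC; apply: le_trans (ler_normD _ _) _; rewrite lerD2l.
  have cs : {for k, continuous (fun u => Q u s)}.
    refine (@continuous_comp R (R * R)%type X (fun u => (u, s)) (fun q => Q q.1 q.2) k _ _).
      by apply: (@continuous_pair R R R id (cst s) k); [exact: cvg_id|exact: cst_continuous].
    exact: cQ.
  have left_le : \forall u \near k^'-, 0 <= u < k.
    by near=> u; apply/andP; split; [near: u; exact: nbhs_left_ge|near: u; exact: nbhs_left_lt].
  have csl : (fun u => Q u s) @ k^'- --> Q k s by apply: cvg_at_left_filter; exact: cs.
  (* A limit of points of O cannot leave O while its image stays in a closed ball of radius less
     than r; this is where |z| + 5 rho < r enters. *)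
  have [OQ _] : O (Q k s) /\ `|Phi (Q k s)| <= `|z| + 5 * rho.
    apply: (closed_cvg _ (lx_closed lx zr) _ _ csl).
    by apply: filterS left_le => u /Ek.
  split=> //; rewrite lt_neqAle eq_sym; apply/andP; split.
    by have [_ [+ _]] := timelike_cone OQ (vup_timelike (Q k s)); rewrite normr_gt0.
  have cd : {for Q k s, continuous (fun y => ('d Phi y vup) 0 0)}.
    apply: (@cvg_coord _ _ (nbhs (Q k s)) (nbhs_filter _) 1 _ (fun y => 'd Phi y vup) _ 0 0).
    exact: (lx_cont lx).
  have cdl : (fun u => ('d Phi (Q u s) vup) 0 0) @ k^'- --> ('d Phi (Q k s) vup) 0 0.
    apply: cvg_at_left_filter.
    exact: (@continuous_comp R X R (fun u => Q u s) (fun y => ('d Phi y vup) 0 0) k cs cd).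
  apply: (closed_cvg _ (@closed_ge _ 0) _ _ cdl).
  apply: filterS left_le => u uk; apply: ltW.
  have u01 : 0 <= u <= 1 by case/andP: uk => -> /ltW/le_trans; apply; case/andP: k01.
  by have [] := IH u _ s ss; [|move=> _].
have loc s : s0 <= s <= s1 -> exists2 d : R, 0 < d &
    forall k' s', `|k - k'| < d -> `|s - s'| < d -> future_side (Q k' s').
  move=> ss.
  have n : nbhs (k, s) [set q : R * R | future_side (Q q.1 q.2)].
    pose f (q : R * R) := Q q.1 q.2.
    have cf : {for (k, s), continuous f} := cQ k s k01 ss.
    have nf : nbhs (f (k, s)) future_side := future_side_near (fk s ss).
    exact: continuous_nbhs_pre cf nf.
  have [d d0 Hd] := nbhs_pairP n; exists d; first exact: d0.
  by move=> k' s' hk hs; exact: (Hd k' s' hk hs).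
have [d d0 Hd] := segment_uniform loc.
exists d; first exact: d0.
move=> u /andP[u0 u1] ud s ss; have [uk|ku] := ltP u k.
  by apply: (IH u _ s ss); rewrite u0.
by apply: (Hd u s _ ss); exact: dist_lt_of_le.
Unshelve. all: by end_near. Qed.

(** The derivative of a local inverse: continuity of the lift and invertibility of the differential
    of [Phi] suffice. *)
Lemma lift_derivable (x : R -> X) s y' : {for s, continuous x} -> O (x s) ->
  is_derive s 1 (Phi \o x) y' ->
  is_derive s 1 x (y' *m invmx ('J Phi (x s))) /\ 'd Phi (x s) (y' *m invmx ('J Phi (x s))) = y'.
Proof.
move=> cx Ox dy; set J := 'J Phi (x s); set w := y' *m invmx J.
have uJ : J \in unitmx := lx_unit lx Ox.
split; last by rewrite dJ// mulmxKV.
have [M M0 HM] := @linear_bounded_rV R _ _ (mulmxr (invmx J)).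
apply: is_derive1_bound => e e0.
(* The bound M e1 <= 1/2 lets the linearisation error be absorbed into |D|; the second bound makes
   it at most half of e |h| afterwards. *)
pose e1 := Num.min 2^-1 (e / (4 * M * (1 + `|y'|))) / M.
have e10 : 0 < e1 by rewrite divr_gt0// lt_min invr_gt0 ltr0n/= divr_gt0// !mulr_gt0.
pose e2 := Num.min 1 (e / (2 * M)).
have e20 : 0 < e2 by rewrite lt_min ltr01 divr_gt0// mulr_gt0.
have n1 := is_derive1_boundV dy e20.
have /nbhs_distP[d d0 Hd] := diff_bound (lx_diff lx Ox) e10.
have cs : \forall h \near (0 : R), `|x (s + h) - x s| < d.
  have := continuous_near cx d0; rewrite (near_shift 0) subr0; apply: filterS => h /=.
  by rewrite distrC (addrC h).
apply: filterS2 n1 cs => h n1 n2.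
set D := x (s + h) - x s in n2 *.
have := Hd D; rewrite sub0r normrN => /(_ n2); rewrite dJ// -/J => n3.
rewrite /= in n1; rewrite -(subrKC (x s) (x (s + h))) -/D in n1.
set k := Phi (x s + D) - Phi (x s) in n1 n3.
have n4 : `|k *m invmx J - D| <= M * (e1 * `|D|).
  rewrite -[D in k *m invmx J - D](mulmxK uJ) -mulmxBl; apply: le_trans (HM _) _.
  by rewrite ler_wpM2l// ltW.
have n5 : `|k *m invmx J - h *: w| <= M * (e2 * `|h|).
  rewrite /w scalemxAl -mulmxBl; apply: le_trans (HM _) _.
  by rewrite ler_wpM2l// ltW.
have Me1 : M * e1 = Num.min 2^-1 (e / (4 * M * (1 + `|y'|))).
  by rewrite /e1 mulrC divfK// gt_eqF.
(* An a priori linear bound for the increment of x, obtained by absorption before differentiability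
   is known. *)
have bD : `|D| <= 2 * M * (1 + `|y'|) * `|h|.
  have kb : `|k *m invmx J| <= M * ((1 + `|y'|) * `|h|).
    apply: le_trans (HM _) _; rewrite ler_wpM2l ?(ltW M0)// -(subrK (h *: y') k).
    apply: le_trans (ler_normD _ _) _; rewrite mulrDl mul1r normrZ (mulrC `|y'|) lerD2r.
    by apply: le_trans n1 _; rewrite ler_piMl// ge_min lexx.
  have : `|D| <= `|k *m invmx J| + M * (e1 * `|D|).
    by rewrite -[D in X in X <= _](subKr (k *m invmx J)); apply: le_trans (ler_normB _ _) _; rewrite lerD2l.
  rewrite mulrA Me1; have : Num.min 2^-1 (e / (4 * M * (1 + `|y'|))) * `|D| <= 2^-1 * `|D|.
    by rewrite ler_wpM2r// ge_min lexx.
  move: kb; rewrite -!mulrA; set a := `|D|; set b := `|_ *m _|; set cc := M * _; set q := _ * a; lra.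
rewrite -(subrKA (k *m invmx J)); apply: le_trans (ler_normD _ _) _; rewrite distrC.
rewrite -/D (splitr e) mulrDl; apply: lerD.
  apply: le_trans n4 _; rewrite mulrA Me1.
  apply: (@le_trans _ _ (e / (4 * M * (1 + `|y'|)) * (2 * M * (1 + `|y'|) * `|h|))).
    by apply: ler_pM => //; rewrite ?ge_min ?lexx ?orbT// le_min invr_ge0 ler0n/= ltW// divr_gt0// !mulr_gt0.
  by rewrite le_eqVlt; apply/orP; left; apply/eqP; field; rewrite !gt_eqF.
apply: le_trans n5 _; rewrite mulrA ler_wpM2r//.
apply: (@le_trans _ _ (M * (e / (2 * M)))); first by rewrite ler_wpM2l ?(ltW M0)// ge_min lexx orbT.
by rewrite le_eqVlt; apply/orP; left; apply/eqP; field; rewrite gt_eqF.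
Qed.

End Data.
End LocalExtension.

(** * Timelike curves near the past boundary *)

Lemma continuous_gt0 {R : realType} (b : R -> R) (s : R) : 0 <= s ->
  (forall u, 0 <= u <= s -> {for u, continuous b}) -> (forall u, 0 <= u <= s -> b u != 0) ->
  0 < b 0 -> 0 < b s.
Proof.
move=> s0 cb bn b0; rewrite ltNge; apply/negP => bs.
have [||c] := @IVT R b 0 s 0 s0.
- by apply: continuous_in_subspaceT => u; rewrite inE/= in_itv/=; exact: cb.
- by rewrite ge_min bs orbT le_max (ltW b0).
by rewrite in_itv/= => /bn/eqP.
Qed.

(** Equivalent to 1 <= e^{-ay} (1 + by), which follows from e^{-ay} >= 1 - ay; the smallness
    condition is 1 <= (1 - ay)(1 + by) divided by y. *)
Lemma expR_le_affine {R : realType} (a b y : R) : 0 < a -> a < b -> 0 <= y -> a * b * y <= b - a ->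
  expR (a * y) <= 1 + b * y.
Proof.
move=> a0 ab y0 H.
have b0 : 0 < b := lt_trans a0 ab.
have ay1 : a * y < 1 by nra.
have E : 1 - a * y <= expR (- (a * y)) by rewrite -[- _ in leLHS]/(- (a * y)); exact: expR_ge1Dx.
have P := expR_gt0 (a * y).
have e1 : expR (a * y) * expR (- (a * y)) = 1 by rewrite -expRD subrr expR0.
have h1 : 1 <= (1 - a * y) * (1 + b * y) by nra.
have h2 : expR (a * y) * (1 - a * y) <= 1 by rewrite -[leRHS]e1 (ler_pM2l P).
have : expR (a * y) * (1 - a * y) <= (1 + b * y) * (1 - a * y) by lra.
by rewrite ler_pM2r// subr_gt0.
Qed.

Section HeisenbergBounds.
Context {R : realType} {m : nat}.
Implicit Types h k : 'rV[R]_(hdim m).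

Lemma pairing_bound h k : `|\sum_(r < m) h 0 (ix r) * k 0 (iy r)| <= m%:R * (`|h| * `|k|).
Proof.
apply: le_trans (ler_norm_sum _ _ _) _.
apply: (@le_trans _ _ (\sum_(r < m) `|h| * `|k|)); last by rewrite sumr_const card_ord mulr_natl.
by apply: ler_sum => s _; rewrite normrM ler_pM// coord_le_norm.
Qed.

Lemma hmul_bound h k : `|hmul h k| <= `|h| + `|k| + m%:R * (`|h| * `|k|).
Proof.
have P : 0 <= m%:R * (`|h| * `|k|) by rewrite !mulr_ge0.
apply: rV_norm_leP => [|a]; first by rewrite !addr_ge0.
rewrite hmulE; apply: le_trans (ler_normD _ _) _; apply: lerD.
  by apply: le_trans (ler_normD _ _) _; rewrite lerD// coord_le_norm.
by case: ifP => _; [exact: pairing_bound|rewrite normr0].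
Qed.

Lemma hinv_bound h : `|hinv h| <= `|h| + m%:R * (`|h| * `|h|).
Proof.
have P : 0 <= m%:R * (`|h| * `|h|) by rewrite !mulr_ge0.
apply: rV_norm_leP => [|a]; first by rewrite addr_ge0.
rewrite hinvE; apply: le_trans (ler_normD _ _) _; apply: lerD.
  by rewrite normrN coord_le_norm.
by case: ifP => _; [exact: pairing_bound|rewrite normr0].
Qed.

End HeisenbergBounds.

Section Dilation.
Context {R : realType} {m : nat}.
Implicit Types h k : 'rV[R]_(hdim m).

(** The homogeneous dilations of the Heisenberg group, of weight 2 on the centre; [ddil] is the
    velocity of a dilated curve. *)
Definition dil (l : R) k : 'rV[R]_(hdim m) :=
  \row_a (if a == 0 then l ^+ 2 * k 0 a else l * k 0 a).

Definition ddil (l : R) k (l' : R) k' : 'rV[R]_(hdim m) :=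
  \row_a (if a == 0 then 2 * l * l' * k 0 a + l ^+ 2 * k' 0 a else l' * k 0 a + l * k' 0 a).

Lemma dil0 k : dil 0 k = 0.
Proof. by apply/rowP => a; rewrite !mxE expr0n !mul0r; case: ifP. Qed.

Lemma dil1 k : dil 1 k = k.
Proof. by apply/rowP => a; rewrite !mxE expr1n !mul1r; case: ifP. Qed.

Lemma cow_ddil0 l k l' k' : cow (dil l k) (ddil l k l' k') 0 = l ^+ 2 * cow k k' 0 + l * l' * hzeta k.
Proof.
rewrite !cow0 /hzeta !mxE eqxx.
under eq_bigr do rewrite !mxE ix_neq0 iy_neq0.
have -> : \sum_(i < m) l * k 0 (ix i) * (l' * k 0 (iy i) + l * k' 0 (iy i)) =
    l * l' * (\sum_(r < m) k 0 (ix r) * k 0 (iy r)) + l ^+ 2 * (\sum_(r < m) k 0 (ix r) * k' 0 (iy r)).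
  by rewrite !mulr_sumr -big_split /=; apply: eq_bigr => i _; ring.
by ring.
Qed.

Lemma cow_ddil a l k l' k' : a != 0 -> cow (dil l k) (ddil l k l' k') a = l * cow k k' a + l' * k 0 a.
Proof. by move=> a0; rewrite !cow_neq0// !mxE (negbTE a0) addrC. Qed.

Lemma dil_continuous (T : topologicalType) (l : T -> R) (k : T -> 'rV[R]_(hdim m)) x :
  {for x, continuous l} -> {for x, continuous k} -> {for x, continuous (fun y => dil (l y) (k y))}.
Proof.
move=> cl ck; apply: (@cvg_rVP _ _ (nbhs x)) => a; rewrite mxE.
under eq_fun do rewrite mxE.
have ca : k y 0 a @[y --> x] --> k x 0 a by exact: cvg_coord.
case: ifP => _; last exact: cvgM.
by apply: cvgM => //; apply: (@cvg_comp _ _ _ l (fun z : R => z ^+ 2) _ _ _ cl); exact: exprn_continuous.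
Qed.

Lemma is_derive_dil (l : R -> R) (k : R -> 'rV[R]_(hdim m)) (s l' : R) k' :
  is_derive s 1 l l' -> is_derive s 1 k k' ->
  is_derive s 1 (fun u => dil (l u) (k u)) (ddil (l s) (k s) l' k').
Proof.
move=> dl dk; apply: is_derive_rV => i a; rewrite !ord1 {i} mxE.
under eq_fun do rewrite mxE.
have da := is_derive_coord 0 a dk.
case: ifP => _.
  under eq_fun do rewrite expr2.
  have e1 : is_derive s 1 (fun u => l u * l u) (2 * l s * l').
    by apply: is_derive_eq (is_deriveM dl dl) _; rewrite /GRing.scale /=; ring.
  have e := is_deriveM e1 da.
  by apply: is_derive_eq e _; rewrite /GRing.scale /=; ring.
have e := is_deriveM dl da.
by apply: is_derive_eq e _; rewrite /GRing.scale /=; ring.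
Qed.

Lemma hzeta_continuous (T : topologicalType) (k : T -> 'rV[R]_(hdim m)) x :
  {for x, continuous k} -> {for x, continuous (fun y => hzeta (k y))}.
Proof.
move=> ck; have cc a : k y 0 a @[y --> x] --> k x 0 a by exact: cvg_coord.
apply: cvgB; first by apply: cvgM; [exact: cvg_cst|exact: cc].
by apply: cvg_bigsum => r; apply: cvgM; exact: cc.
Qed.

End Dilation.

(** * Profiles of the delay and of the contraction *)

Section Profile.
Context {R : realType}.
Variables (c e K : R).
Hypotheses (c0 : 0 < c) (e0 : 0 < e) (e1 : e <= 2^-1) (K0 : 0 <= K) (Ke : K * e <= 1).
Hypothesis eK : e * (K * expR 1 + 1) <= c / 2.

(** With v the time elapsed along a curve, [advance] is added to its time coordinate and 1 -
    [shrink] is its dilation factor. Both vanish at v = 0 and as v tends to +oo, so the ends of the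
    curve hardly move, and [shrink] equals 1 at v = 1 / e, where the curve is contracted onto the
    line. *)
Definition advance (v : R) : R := expR (- (e * v)) - expR (- ((c / 2 + e) * v)).
Definition dadvance (v : R) : R := (c / 2 + e) * expR (- ((c / 2 + e) * v)) - e * expR (- (e * v)).
Definition shrink (v : R) : R := e * v * expR (1 - e * v).
Definition dshrink (v : R) : R := e * (1 - e * v) * expR (1 - e * v).

Lemma is_derive_exp_affine (a b v : R) : is_derive v 1 (fun v => expR (a * v + b)) (a * expR (a * v + b)).
Proof.
have d1 := is_deriveD (is_deriveZ a (is_derive_id v (1 : R))) (is_derive_cst b v (1 : R)).
have d2 := is_derive_compR d1 (is_derive_expR _).
by apply: is_derive_eq d2 _; rewrite /GRing.scale /= addr0 mulr1.
Qed.

Lemma is_derive_advance (v : R) : is_derive v (1 : R) advance (dadvance v).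
Proof.
have d1 := is_deriveB (is_derive_exp_affine (- e) 0 v) (is_derive_exp_affine (- (c / 2 + e)) 0 v).
have -> : advance = fun u => expR (- e * u + 0) - expR (- (c / 2 + e) * u + 0).
  by apply/funext => u; rewrite /advance !addr0 !mulNr.
by apply: is_derive_eq d1 _; rewrite /dadvance !addr0 !mulNr opprK addrC.
Qed.

Lemma is_derive_shrink (v : R) : is_derive v (1 : R) shrink (dshrink v).
Proof.
have d1 := is_deriveM (is_deriveZ e (is_derive_id v (1 : R))) (is_derive_exp_affine (- e) 1 v).
have -> : shrink = fun u => e * u * expR (- e * u + 1).
  by apply/funext => u; rewrite /shrink mulNr addrC.
have -> : dshrink v = e * (- e * v + 1) * expR (- e * v + 1) by rewrite /dshrink mulNr addrC.
apply: is_derive_eq d1 _; rewrite /GRing.scale /= -[e *: v]/(e * v).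
by set E := expR _; ring.
Qed.

Lemma advance_ge0 v : 0 <= v -> 0 <= advance v.
Proof.
by move=> v0; rewrite subr_ge0 ler_expR lerN2 ler_wpM2r// lerDr divr_ge0// ltW.
Qed.

Lemma shrink_ge0 v : 0 <= v -> 0 <= shrink v.
Proof. by move=> v0; rewrite mulr_ge0 ?expR_ge0// mulr_ge0// ltW. Qed.

Lemma mulr_expR_le1 (w : R) : w * expR (1 - w) <= 1.
Proof.
have h : w <= expR (w - 1) by have := expR_ge1Dx (w - 1); rewrite addrC subrK.
apply: (@le_trans _ _ (expR (w - 1) * expR (1 - w))); first by rewrite ler_wpM2r// expR_ge0.
by rewrite -expRD addrA subrK subrr expR0.
Qed.

Lemma shrink_le1 v : shrink v <= 1. Proof. exact: mulr_expR_le1. Qed.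

Lemma dadvance_ge v : 0 <= v -> - 2^-1 <= dadvance v.
Proof.
move=> v0; rewrite /dadvance.
have h1 : 0 <= (c / 2 + e) * expR (- ((c / 2 + e) * v)).
  by rewrite mulr_ge0 ?expR_ge0// addr_ge0 ?(ltW e0)// divr_ge0// ltW.
have h2 : e * expR (- (e * v)) <= e.
  by rewrite ler_piMr ?(ltW e0)// -expR0 ler_expR oppr_le0 mulr_ge0// ltW.
by move: e1; lra.
Qed.

(** The part of [profile_cond] linear in kap. The right side is (c/2 - e) e^{-ev} + e e^{-(c/2+e)v};
    since K e <= 1 the left side is at most K e e^{1-ev}, and [eK] compares the two coefficients of
    e^{-ev}. *)
Lemma profile_lt v : 0 <= v -> K * `|dshrink v| - shrink v < c * advance v / 2 + dadvance v.
Proof.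
move=> v0; set w := e * v.
have w0 : 0 <= w by rewrite mulr_ge0// ltW.
have E0 := expR_gt0 (- w).
have E1 : expR (1 - w) = expR 1 * expR (- w) by rewrite expRD.
have E2 := expR_gt0 1 : 0 < expR 1 :> R.
have F0 := expR_gt0 (- ((c / 2 + e) * v)).
have b : `|dshrink v| <= e * (1 + w) * expR (1 - w).
  rewrite /dshrink -/w normrM (ger0_norm (expR_ge0 _)) ler_wpM2r ?expR_ge0//.
  rewrite normrM (gtr0_norm e0) ler_wpM2l ?(ltW e0)//.
  by apply: le_trans (ler_normB _ _) _; rewrite normr1 (ger0_norm w0).
have h1 : K * `|dshrink v| <= K * (e * (1 + w) * expR (1 - w)) by rewrite ler_wpM2l.
have h2 : K * (e * (1 + w) * expR (1 - w)) - shrink v <= K * e * expR (1 - w).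
  rewrite /shrink -/w.
  have : K * e * w * expR (1 - w) <= w * expR (1 - w).
    by rewrite ler_wpM2r ?expR_ge0// ler_piMl.
  by lra.
have h3 : K * e * expR (1 - w) <= (c / 2 - e) * expR (- w).
  rewrite E1 mulrA ler_wpM2r ?expR_ge0//; move: eK; lra.
have h4 : c * advance v / 2 + dadvance v = (c / 2 - e) * expR (- w) + e * expR (- ((c / 2 + e) * v)).
  by rewrite /advance /dadvance -/w; field.
rewrite h4; have : 0 < e * expR (- ((c / 2 + e) * v)) by rewrite mulr_gt0.
by move: h1 h2 h3; lra.
Qed.

(** The inequality required by [dilate_lt]. Only half of c [advance] is spent on the linear part;
    with [dadvance_ge] the other half makes the remaining terms nonnegative. *)
Lemma profile_cond (kap v : R) : 0 < kap <= 1 -> 0 <= v ->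
  1 - kap * shrink v + K * (kap * `|dshrink v|) < (1 + c * (kap * advance v)) * (1 + kap * dadvance v).
Proof.
move=> /andP[k0 k1] v0.
have h1 : kap * (K * `|dshrink v| - shrink v) < kap * (c * advance v / 2 + dadvance v).
  by rewrite ltr_pM2l// profile_lt.
have h2 : 0 <= c * kap * advance v * (2^-1 + kap * dadvance v).
  rewrite mulr_ge0//; first by rewrite !mulr_ge0 ?advance_ge0// ltW.
  have h3 := dadvance_ge v0.
  have : kap * - 2^-1 <= kap * dadvance v by rewrite ler_wpM2l// ltW.
  by lra.
have -> : (1 + c * (kap * advance v)) * (1 + kap * dadvance v) =
  1 + kap * (c * advance v / 2 + dadvance v) + c * kap * advance v * (2^-1 + kap * dadvance v).
  by field.
by lra.
Qed.

Lemma profile_cvg d : 0 < d -> exists2 V, 0 < V & forall v, V <= v -> `|advance v| < d /\ `|shrink v| < d.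
Proof.
move=> d0; exists (4 / (d * e)); first by rewrite divr_gt0// mulr_gt0.
move=> v vV.
have v0 : 0 <= v by apply: le_trans vV; rewrite divr_ge0// mulr_ge0// ltW.
have dv : 4 <= d * (e * v) by move: vV; rewrite ler_pdivrMr ?mulr_gt0// mulrC -mulrA.
have w0 : 0 <= e * v by rewrite mulr_ge0// ltW.
set w := e * v in dv w0.
have wp : 0 < 1 + w / 2 by rewrite ltr_pwDl// divr_ge0.
have h : expR (- (w / 2)) < d / 2.
  have P := expR_gt0 (w / 2).
  have e2 : expR (w / 2) * expR (- (w / 2)) = 1 by rewrite -expRD subrr expR0.
  have h2 := expR_ge1Dx (w / 2).
  have h3 : 1 < d / 2 * expR (w / 2).
    apply: (@lt_le_trans _ _ (d / 2 * (1 + w / 2))); first by lra.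
    by rewrite ler_wpM2l// divr_ge0// ltW.
  by rewrite -(ltr_pM2l P) e2 mulrC.
rewrite ger0_norm ?advance_ge0// ger0_norm ?shrink_ge0//; split.
  have : expR (- w) <= expR (- (w / 2)) by rewrite ler_expR; lra.
  rewrite /advance -/w; have := expR_gt0 (- ((c / 2 + e) * v)); lra.
have := mulr_expR_le1 (w / 2).
have E : expR (1 - w) = expR (1 - w / 2) * expR (- (w / 2)) by rewrite -expRD; congr expR; lra.
rewrite /shrink -/w E mulrA => h4.
apply: (@le_lt_trans _ _ (2 * expR (- (w / 2)))); last by lra.
by rewrite ler_wpM2r ?expR_ge0//; move: h4; lra.
Qed.

End Profile.

(** The estimate is assumed only from each u to its neighbours, at a distance depending on u: the
    form that a first order expansion at u provides. *)
Lemma local_lipschitz {R : realType} (f : R -> R) (C : R) : 0 <= C ->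
  (forall u, 0 <= u <= 1 -> exists2 d : R, 0 < d & forall u', 0 <= u' <= 1 -> `|u - u'| < d ->
     `|f u - f u'| <= C * `|u - u'|) -> `|f 1 - f 0| <= C.
Proof.
move=> C0 H; have u11 : 0 <= (1 : R) <= 1 := introT andP (conj (@ler01 R) (lexx (1 : R))).
suff S : forall u, 0 <= u <= 1 -> `|f u - f 0| <= C * u by have := S 1 u11; rewrite mulr1.
apply: (@real_induction R 0 1 (fun u => `|f u - f 0| <= C * u)) => u u01 IH.
have [u0 u1] := andP u01.
have [d d0 Hd] := H u u01.
have here : `|f u - f 0| <= C * u.
  have [->|un] := eqVneq u 0; first by rewrite subrr normr0 mulr0.
  have up : 0 < u by rewrite lt_neqAle eq_sym un.
  pose w := Num.max 0 (u - d / 2).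
  have w0 : 0 <= w by rewrite le_max lexx.
  have wu : w < u by rewrite gt_max up/=; lra.
  have wd : `|u - w| < d.
    rewrite gtr0_norm ?subr_gt0//; have : u - d / 2 <= w by rewrite le_max lexx orbT.
    by lra.
  have w01 : 0 <= w <= 1 by rewrite w0 (le_trans (ltW wu)).
  have h1 := Hd w w01 wd; have h2 := IH w (introT andP (conj w0 wu)).
  rewrite -(subrKA (f w)); apply: le_trans (ler_normD _ _) _.
  move: h1; rewrite (gtr0_norm (_ : 0 < u - w)) ?subr_gt0//; move: h2; lra.
exists d => // u' u'01 u'd; have [lt|ge] := ltP u' u.
  by apply: IH; rewrite lt andbT; case/andP: u'01.
have [->|ne] := eqVneq u' u; first exact: here.
have gt : u < u' by rewrite lt_neqAle eq_sym ne.
have := Hd u' u'01; rewrite ler0_norm ?subr_le0// => h.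
have h1 : `|f u - f u'| <= C * - (u - u') by apply: h; lra.
rewrite -(subrKA (f u)); apply: le_trans (ler_normD _ _) _.
by rewrite distrC; move: h1 here; lra.
Qed.

Lemma is_derive_continuous_snd {R : realType} {W : normedModType R} (f : R -> W) (u t : R) df :
  is_derive t 1 f df -> {for (u, t), continuous (fun q : R * R => f q.2)}.
Proof.
move=> /is_derive_continuous cf.
exact: (@continuous_comp (R * R)%type R W snd f (u, t) (@cvg_snd _ _ _ _ _) cf).
Qed.

(** * Lifting chart curves, and the exclusion of the future end *)

Section PastBoundary.
Context {R : realType} {m : nat}.
Local Notation X := 'rV[R]_(1 + hdim m).
Variables (Ga : set 'rV[R]_(hdim m)) (A p : 'I_(hdim m) -> R).
Hypothesis dG : discrete_subgroup Ga.
Hypothesis A0 : forall a, 0 < A a.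
Hypothesis chi0 : forall r : 'I_m, 0 < chi p r.
Variables (O : set X) (Phi : X -> X) (r : R).
Hypothesis lx : local_extension Ga A p O Phi r.
Local Notation qf x v := (qform (family_form A p x) v).
Local Notation fs := (future_side O Phi).
Local Notation ratio := (ratio A p).

Lemma pt_continuous (T : topologicalType) (t : T -> R) (h : T -> 'rV[R]_(hdim m)) x :
  {for x, continuous t} -> {for x, continuous h} ->
  {for x, continuous (fun y => pt (t y) (h y))}.
Proof.
move=> ct ch; apply: cvg_rVP => j; rewrite /pt mxE.
under eq_fun do rewrite mxE.
case: (fintype.split j) => i; last exact: cvg_coord.
rewrite !ord1 mxE eqxx mulr1n; under eq_fun do rewrite mxE eqxx mulr1n.
exact: ct.
Qed.

Lemma rsubmx_continuous : continuous (@rsubmx R 1 1 (hdim m)).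
Proof.
move=> x; apply: (@cvg_rVP _ _ (nbhs x)) => j; rewrite mxE.
under eq_fun do rewrite mxE.
exact: coord_continuous.
Qed.

Lemma time_continuous : continuous (fun x : X => x 0 0).
Proof. exact: coord_continuous. Qed.

Lemma is_derive_pt (t : R -> R) (h : R -> 'rV[R]_(hdim m)) (s dt : R) dh :
  is_derive s 1 t dt -> is_derive s 1 h dh -> is_derive s 1 (fun u => pt (t u) (h u)) (pt dt dh).
Proof.
move=> d1 d2; rewrite /pt; apply: is_derive_rV => i j; rewrite !ord1 {i}.
under eq_fun do rewrite mxE.
rewrite mxE; case: (fintype.split j) => i; last exact: is_derive_coord.
by rewrite !ord1 mxE eqxx mulr1n; under eq_fun do rewrite mxE eqxx mulr1n.
Qed.

Lemma is_derive_rsubmx (x : R -> X) (s : R) v :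
  is_derive s 1 x v -> is_derive s 1 (fun u => rsubmx (x u)) (rsubmx v).
Proof.
move=> d; apply: is_derive_rV => i j; rewrite !ord1 {i}.
have := is_derive_coord 0 (rshift 1 j) d; rewrite -rsubmxE.
by under eq_fun do rewrite -rsubmxE.
Qed.

Lemma Phi_continuous x : O x -> {for x, continuous Phi}.
Proof. by move=> Ox; apply: differentiable_continuous; exact: (lx_diff lx Ox). Qed.

Lemma stproj_pt t h : stproj Ga (pt t h) = (t, hproj Ga h).
Proof. by rewrite /stproj row_mxKl row_mxKr mxE eqxx mulr1n. Qed.

Lemma stprojE (x : X) : stproj Ga x = (x 0 0, hproj Ga (rsubmx x)).
Proof. by rewrite -{1}(pt_eta x) stproj_pt. Qed.

Lemma stproj_continuous : continuous (@stproj R m Ga).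
Proof.
move=> x; rewrite (_ : stproj Ga = fun y => (y 0 0, hproj Ga (rsubmx y))); last first.
  by apply/funext => y; rewrite stprojE.
refine (@continuous_pair _ _ _ (fun y : X => y 0 0) (fun y => hproj Ga (rsubmx y)) x _ _); first exact: time_continuous.
by apply: continuous_comp; [exact: rsubmx_continuous|exact: hproj_continuous].
Qed.

(** The choice of preimages [pre] need not be continuous, but its projection to R x (Ga \ H) is,
    because [Phi] is open with fibres over single points there. That projection is then lifted to
    the cover. *)
Lemma lift_chart (V : normedModType R) (D : set V) (a : V) (g : V -> X) (x0 : X) :
  open D -> D a -> (forall y t, D y -> 0 <= t <= 1 -> D (a + t *: (y - a))) ->
  (forall y, D y -> {for y, continuous g}) -> (forall y, D y -> (Phi @` O) (g y)) ->
  O x0 -> Phi x0 = g a ->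
  exists x : V -> X, [/\ forall y, D y -> {for y, continuous x},
    forall y, D y -> O (x y) /\ Phi (x y) = g y & x a = x0].
Proof.
move=> oD Da sD cg gO Ox0 E0.
pose pre y := xget 0 [set x | O x /\ Phi x = g y].
have preP y : D y -> O (pre y) /\ Phi (pre y) = g y.
  by move=> /gO[x Ox e]; apply: (@xgetPex _ 0 [set x | O x /\ Phi x = g y]); exists x.
have cpre y : D y -> {for y, continuous (fun z => stproj Ga (pre z))}.
  move=> Dy B; have [Oy Ey] := preP y Dy; rewrite nbhsE => -[B' [oB' B'y] B'B].
  suff : nbhs y ((fun z => stproj Ga (pre z)) @^-1` B) by [].
  have oU : open (O `&` (stproj Ga @^-1` B')).
    apply: openI; first exact: (lx_open lx).
    by apply: open_comp => // x _; exact: stproj_continuous.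
  have oPU := lx_openmap lx (@subIsetl _ _ _) oU.
  have : nbhs y (g @^-1` (Phi @` (O `&` (stproj Ga @^-1` B')))).
    apply: continuous_nbhs_pre (cg y Dy) _; apply: open_nbhs_nbhs; split=> //.
    by exists (pre y).
  apply: filterS2 (open_nbhs_nbhs (conj oD Dy)) => z Dz [x [Ox B'x] Ex].
  have [Oz Ez] := preP z Dz; apply: B'B.
  by rewrite (lx_fiber lx Oz Ox) // Ez Ex.
have cf y : D y -> {for y, continuous (fun z => hproj Ga (rsubmx (pre z)))}.
  move=> Dy; have := @continuous_comp _ _ _ _ snd y (cpre y Dy).
  rewrite (_ : snd \o _ = fun z => hproj Ga (rsubmx (pre z))); last first.
    by apply/funext => z; exact: (congr1 snd (stprojE (pre z))).
  by apply; exact: cvg_snd.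
have ct y : D y -> {for y, continuous (fun z => (pre z) 0 0)}.
  move=> Dy; have := @continuous_comp _ _ _ _ fst y (cpre y Dy).
  rewrite (_ : fst \o _ = fun z => (pre z) 0 0); last first.
    by apply/funext => z; exact: (congr1 fst (stprojE (pre z))).
  by apply; exact: cvg_fst.
have [Oa Ea] := preP a Da.
have Ep : stproj Ga x0 = stproj Ga (pre a) by apply: (lx_fiber lx) => //; rewrite Ea.
have [Et Eh] : x0 0 0 = (pre a) 0 0 /\ hproj Ga (rsubmx x0) = hproj Ga (rsubmx (pre a)).
  by move: Ep; rewrite !stprojE => -[].
have [h [ch hp ha]] := lifting dG oD Da sD cf Eh.
exists (fun y => pt ((pre y) 0 0) (h y)); split.
- by move=> y Dy; apply: pt_continuous; [exact: ct|exact: ch].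
- move=> y Dy; have [Oy Ey] := preP y Dy; rewrite -Ey; apply: (lx_orbit lx Oy).
  by rewrite stproj_pt hp// -stprojE.
- by rewrite ha -Et pt_eta.
Qed.

(** [Phi] factors through the quotient, so it agrees along the vertical lines through x and x', and
    hence so do its derivatives along them. *)
Lemma fs_orbit x x' : fs x -> stproj Ga x = stproj Ga x' -> fs x'.
Proof.
move=> [Ox d0] e; have [Ox' Ex'] := lx_orbit lx Ox e; split; first exact: Ox'.
suff -> : 'd Phi x' (vup (m := m)) = 'd Phi x (vup (m := m)) by [].
have dE y : O y -> 'd Phi y (vup (m := m)) = 'D_vup Phi y.
  by move=> Oy; rewrite (deriveE _ (lx_diff lx Oy)).
apply: etrans (dE _ Ox') _; apply: etrans _ (esym (dE _ Ox)).
have d y : O y -> is_derive (0 : R) 1 (fun u : R => Phi (y + u *: vup)) ('D_vup Phi y).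
  move=> Oy; have := @is_derive_line _ _ _ Phi y vup 0; rewrite scale0r addr0; apply.
  by apply: diff_derivable; exact: (lx_diff lx).
have ne : \forall u \near (0 : R), Phi (x + u *: vup) = Phi (x' + u *: vup).
  have c : {for 0, continuous (fun u : R => x + u *: (vup (m := m) : X))}.
    apply: cvgD; first exact: cvg_cst.
    by apply: cvgZr_tmp; exact: cvg_id.
  have n : nbhs (0 : R) ((fun u : R => x + u *: (vup (m := m) : X)) @^-1` O).
    by apply: continuous_nbhs_pre c _; rewrite scale0r addr0; exact: (lx_nearO lx).
  apply: filterS n => u Ou; apply/esym; apply: (lx_orbit lx Ou _).2.
  move: e; rewrite !stprojE => -[e1 e2].
  have z : rsubmx (vup (m := m) : X) = 0 by apply/rowP => j; rewrite !mxE.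
  by rewrite !linearD !linearZ /= z !scaler0 !addr0 e2 !mxE e1.
have [_ <-] := d x' Ox'.
by have [_] := near_eq_is_derive ne (d x Ox).
Qed.

Lemma fs_open : open fs.
Proof. by rewrite openE => x /(future_side_near lx). Qed.

Lemma fs_image_open : open (Phi @` fs).
Proof. by apply: (lx_openmap lx) fs_open => x []. Qed.

(* The images of the two sides of O are disjoint open sets. *)
Lemma fs_closed_in x1 : O x1 -> closure (Phi @` fs) (Phi x1) -> fs x1.
Proof.
move=> Ox1 cl; split=> //; rewrite ltNge; apply/negP => le.
pose neg := [set x | O x /\ ('d Phi x vup) 0 0 < 0].
have on : open neg.
  rewrite openE => x [Ox dx]; apply: filterI; first exact: (lx_nearO lx).
  have c : {for x, continuous (fun y => ('d Phi y vup) 0 0)}.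
    apply: (@cvg_coord _ _ (nbhs x) (nbhs_filter x) 1 _ (fun y => 'd Phi y vup) _ 0 0).
    exact: (lx_cont lx).
  have := continuous_nbhs c (@open_lt _ 0); exact.
have n1 : neg x1.
  split=> //; rewrite lt_neqAle le andbT.
  by have [_ [+ _]] := timelike_cone lx Ox1 (vup_timelike A p x1); rewrite normr_gt0.
have oI : open (Phi @` neg) by apply: (lx_openmap lx) on => x [].
have [y [[x fx ex] [x' [Ox' nx'] ex']]] := cl _ (open_nbhs_nbhs (conj oI (ex_intro2 _ _ x1 n1 erefl))).
have fx' : fs x'.
  by apply: fs_orbit (fx) _; apply: (lx_fiber lx (proj1 fx) Ox'); rewrite ex ex'.
by move: nx'; rewrite ltNge ltW// fx'.2.
Qed.

Lemma ftimelike_fcausal (x v : R -> X) s0 s1 : ftimelike A p x v s0 s1 ->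
  fcausal A p (fun s => x s 0 0) (fun s => rsubmx (x s)) (fun s => v s 0 0) (fun s => rsubmx (v s)) s0 s1.
Proof.
move=> H s /H[d v0 q0]; split.
- exact: is_derive_coord.
- apply: is_derive_rV => i j; rewrite !ord1 {i}.
  have := is_derive_coord 0 (rshift 1 j) d; rewrite -rsubmxE.
  by under eq_fun do rewrite -rsubmxE.
- exact: ltW.
move: q0; rewrite qform_family; last by move=> t; exact: lapse_gt0.
by rewrite -[X in _ < X -> _](mulr0 (lapse A p (x s 0 0) ^+ 2)) ltr_pM2l ?exprn_gt0 ?lapse_gt0// subr_lt0 => /ltW.
Qed.

(* A straight segment in the chart, directed by the inner cone, lifts to a
   timelike curve. *)
Lemma lift_segment x0 (w : X) (s1 : R) : fs x0 -> cone_in w -> 0 < s1 ->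
  (forall s : R, 0 <= s < s1 -> (Phi @` O) (Phi x0 + s *: w)) ->
  exists x v : R -> X, [/\ x 0 = x0,
    forall s, 0 <= s < s1 -> {for s, continuous x},
    forall s, 0 <= s < s1 -> fs (x s) /\ Phi (x s) = Phi x0 + s *: w
  & forall s, s < s1 -> ftimelike A p x v 0 s].
Proof.
move=> f0 cw s10 H.
(* The segment is prolonged slightly below s = 0, so the lift lives on an open interval and is
   differentiable at the starting point. *)
have [d d0 Hd] : exists2 d : R, 0 < d & forall s : R, - d < s < s1 -> (Phi @` O) (Phi x0 + s *: w).
  have oO := lx_openmap lx (@subset_refl _ O) (lx_open lx).
  have c : {for 0, continuous (fun s : R => Phi x0 + s *: w)}.
    by apply: cvgD; [exact: cvg_cst|apply: cvgZr_tmp; exact: cvg_id].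
  have n : nbhs (0 : R) ((fun s : R => Phi x0 + s *: w) @^-1` (Phi @` O)).
    apply: continuous_nbhs_pre c _; rewrite scale0r addr0; apply: open_nbhs_nbhs.
    by split=> //; exists x0 => //; exact: f0.1.
  have [d d0 Hd] := nbhs_distP n; exists d => // s /andP[ds ss].
  have [s0|s0] := leP 0 s; first by apply: H; rewrite s0.
  by apply: Hd; rewrite sub0r normrN ltr0_norm// ltrNl.
pose D : set R := [set s | - d < s < s1].
have oD : open D.
  rewrite (_ : D = `]- d, s1[%classic); first exact: interval_open.
  by apply/seteqP; split=> s; rewrite /= in_itv.
have Da : D 0 by rewrite /D /= oppr_lt0 d0.
have sD y t : D y -> 0 <= t <= 1 -> D (0 + t *: (y - 0)).
  rewrite /D /= add0r subr0 => /andP[y1 y2] /andP[t0 t1]; rewrite /GRing.scale /=.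
  have [y0|y0] := leP 0 y.
    apply/andP; split; first by apply: lt_le_trans (_ : 0 <= _); rewrite ?oppr_lt0// mulr_ge0.
    by apply: le_lt_trans y2; rewrite ler_piMl.
  apply/andP; split; last by apply: le_lt_trans s10; rewrite mulr_ge0_le0// ltW.
  by apply: lt_le_trans y1 _; rewrite -[X in X <= _]mul1r ler_wnM2r// ltW.
have cg y : D y -> {for y, continuous (fun s : R => Phi x0 + s *: w)}.
  by move=> _; apply: cvgD; [exact: cvg_cst|apply: cvgZr_tmp; exact: cvg_id].
have Ea : Phi x0 = Phi x0 + 0 *: w by rewrite scale0r addr0.
have [x [cx xP xa]] := lift_chart oD Da sD cg Hd f0.1 Ea.
have DI s : 0 <= s < s1 -> D s.
  by move=> /andP[s0 ss]; rewrite /D /= ss andbT; apply: lt_le_trans s0; rewrite oppr_lt0.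
pose v s := w *m invmx ('J Phi (x s)).
have xd s : 0 <= s < s1 -> is_derive s 1 x (v s) /\ 'd Phi (x s) (v s) = w.
  move=> /DI Ds; apply: (lift_derivable lx); [exact: cx|exact: (xP s Ds).1|].
  have e : is_derive s 1 (fun u : R => Phi x0 + u *: w) w.
    have e1 : is_derive s 1 (fun u : R => u *: w) w.
      apply: is_derive1_bound => e e0; apply: (@filterE _ (nbhs (0 : R)) _) => h.
      by rewrite scalerDl -addrA -opprD subrr normr0 mulr_ge0// ltW.
    have e2 := @is_derive_cst _ _ _ (Phi x0) s (1 : R).
    by apply: is_derive_eq (is_deriveD e2 e1) _; rewrite add0r.
  apply: near_eq_is_derive e.
  by apply: filterS (open_nbhs_nbhs (conj oD Ds)) => u Du; rewrite /= (xP u Du).2.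
have fx s : 0 <= s < s1 -> fs (x s).
  move=> /andP[s0 ss].
  pose b u := ('d Phi (x u) vup) 0 0.
  have ui u : 0 <= u <= s -> 0 <= u < s1 by move=> /andP[-> us]; rewrite (le_lt_trans us).
  have cb u : 0 <= u <= s -> {for u, continuous b}.
    move=> /ui/DI Du; apply: (@continuous_comp R X R x (fun y => ('d Phi y vup) 0 0) u (cx u Du)).
    apply: (@cvg_coord _ _ (nbhs (x u)) (nbhs_filter _) 1 _ (fun y => 'd Phi y vup) _ 0 0).
    by apply: (lx_cont lx); exact: (xP u Du).1.
  have bn u : 0 <= u <= s -> b u != 0.
    move=> /ui/DI Du.
    by have [_ [+ _]] := timelike_cone lx (xP u Du).1 (vup_timelike A p (x u)); rewrite normr_gt0.
  have b0 : 0 < b 0 by rewrite /b xa f0.2.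
  split; first by apply: (xP s (DI s _)).1; rewrite s0.
  exact: (continuous_gt0 s0 cb bn b0).
exists x, v; split; first exact: xa.
- by move=> s /DI; exact: cx.
- by move=> s ss; split; [exact: (fx s ss)|exact: (xP s (DI s ss)).2].
move=> s ss u /andP[u0 us]; have us1 : 0 <= u < s1 by rewrite u0 (le_lt_trans us).
have [d1 d2] := xd u us1.
have tl : qf (x u) (v u) < 0 by apply: (cone_in_timelike lx (fx u us1).1); rewrite d2.
split; [exact: d1| |exact: tl].
have vn0 : v u 0 0 != 0.
  apply: contraTneq tl => e; rewrite qform_family; last by move=> t; exact: lapse_gt0.
  by rewrite e expr0n subr0 -leNgt mulr_ge0 ?sqr_ge0// sumr_ge0// => a _; rewrite sqr_ge0.
(* A past directed velocity would have a future directed opposite, whose image has positive chart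
   time component, contrary to the image w of the velocity. *)
rewrite lt_neqAle eq_sym vn0 leNgt /=; apply/negP => vneg.
have tl' : qf (x u) (- v u) < 0.
  by move: tl; rewrite /qform [(- v u)^T]linearN /= mulmxN !mulNmx opprK.
have vp : 0 < (- v u) 0 0 by rewrite mxE oppr_gt0.
have [+ _ _] := future_cone_out lx (fx u us1) tl' vp.
by rewrite linearN /= d2 mxE oppr_gt0 ltNge ltW// (proj1 cw).
Qed.

Variable c1 : R.
Hypotheses (c1_gt0 : 0 < c1) (c1_le1 : c1 <= 1) (c1p : forall a, c1 <= 1 + p a).
Let N0 t : 0 < lapse A p t. Proof. exact: lapse_gt0. Qed.
Let rg a t : 0 < ratio a t. Proof. exact: ratio_gt0. Qed.
Local Notation chis := (\sum_(r < m) chi p r).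
Let S0 : 0 <= chis. Proof. by apply: sumr_ge0 => s _; rewrite ltW. Qed.
(** [C'] is twice the growth exponent of the lapse. Since 1 + p_a >= c1, every [ratio] varies at
    most at the rate C = C' - c1. [C''] lies halfway: half of the gap pays for replacing an
    exponential by an affine function, the other half makes the warped curve definitely timelike. *)
Let C' := 2 * (1 + chis).
Let C := C' - c1.
Let C'' := C' - c1 / 2.
Let Cpos : 0 < C. Proof. by rewrite /C /C'; move: S0 c1_le1; generalize chis => S; lra. Qed.
Let C'0 : 0 < C'. Proof. by rewrite /C'; move: S0; generalize chis => S; lra. Qed.
Let CC : C < C''. Proof. by rewrite /C''/C; move: c1_gt0; generalize C' => S; lra. Qed.
Let C''0 : 0 < C''. Proof. exact: lt_trans Cpos CC. Qed.
Let rateC a : 1 - p a + 2 * chis <= C.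
Proof. by rewrite /C /C'; move: (c1p a); generalize chis => S; lra. Qed.

(** Moving a vector to the past by D multiplies the spatial speeds by at most 1 + C'' E, while its
    time component is multiplied by 1 + C' E; the difference of the squares is at least c1 E. *)
Lemma warp_timelike t h v0 vh D E : 0 <= D -> D <= E -> C * C'' * E <= c1 / 2 -> 0 < v0 ->
  qf (pt t h) (pt v0 vh) < 0 ->
  qf (pt (t - D) h) (pt (v0 * (1 + C' * E)) vh) < 0 /\
  lapse A p (t - D) ^+ 2 * (v0 ^+ 2 * (c1 * E)) <= - qf (pt (t - D) h) (pt (v0 * (1 + C' * E)) vh).
Proof.
move=> D0 DE HE v00; rewrite !qform_family// !pt_time !pt_space.
set N := lapse A p t; set N' := lapse A p (t - D).
set s := \sum_a _; set s' := \sum_a _.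
have N20 : 0 < N ^+ 2 by rewrite exprn_gt0// /N.
have N'20 : 0 < N' ^+ 2 by rewrite exprn_gt0// /N'.
rewrite pmulr_rlt0// subr_lt0 => ss.
have E0 : 0 <= E := le_trans D0 DE.
set w := 1 + C'' * E.
have w0 : 0 <= w by rewrite addr_ge0// mulr_ge0// ltW.
have s's : s' <= w ^+ 2 * s.
  rewrite mulr_sumr; apply: ler_sum => a _; rewrite [leLHS]exprMn [in leRHS]exprMn [leRHS]mulrA; apply: ler_wpM2r; first exact: sqr_ge0.
  rewrite -exprMn.
  rewrite ler_sqr ?nnegrE; [|exact: ltW|by rewrite mulr_ge0// ltW].
  have g := ratio_growth A0 chi0 a (t - D) D0; rewrite subrK in g.
  apply: le_trans g _; rewrite (ler_wpM2r (ltW (rg _ _)))//.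
  apply: (@le_trans _ _ (expR (C * E))).
    rewrite ler_expR; apply: (@le_trans _ _ (C * D)); last by rewrite ler_wpM2l// ltW.
    by rewrite ler_wpM2r// rateC.
  by apply: expR_le_affine => //; rewrite /C''/C; move: HE; rewrite /C''/C; lra.
have s0 : 0 <= s by apply: sumr_ge0 => a _; rewrite sqr_ge0.
have C'C'' : C' = C'' + c1 / 2 by rewrite /C''; lra.
have w2 : w ^+ 2 + c1 * E <= (1 + C' * E) ^+ 2.
  rewrite C'C'' /w (_ : (1 + (C'' + c1 / 2) * E) ^+ 2 = (1 + C'' * E) ^+ 2 + c1 * E + c1 * E ^+ 2 * (C'' + c1 / 4)); last by field.
  rewrite lerDl; apply: mulr_ge0; first by rewrite mulr_ge0 ?sqr_ge0// ltW.
  by apply: addr_ge0; [exact: ltW C''0|rewrite divr_ge0// ltW].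
have k : v0 ^+ 2 * (c1 * E) < v0 ^+ 2 * (1 + C' * E) ^+ 2 - s'.
  have h1 : w ^+ 2 * s < w ^+ 2 * v0 ^+ 2.
    by rewrite ltr_pM2l// exprn_gt0//; apply: ltr_pwDl => //; exact: mulr_ge0 (ltW C''0) E0.
  have h2 : v0 ^+ 2 * (w ^+ 2 + c1 * E) <= v0 ^+ 2 * (1 + C' * E) ^+ 2.
    by rewrite (ler_wpM2l (sqr_ge0 _)).
  rewrite ltrBrDr; apply: lt_le_trans h2; rewrite mulrDr addrC ltrD2r [X in _ < X]mulrC.
  exact: le_lt_trans s's h1.
have k0 : 0 <= v0 ^+ 2 * (c1 * E).
  exact: mulr_ge0 (sqr_ge0 _) (mulr_ge0 (ltW c1_gt0) E0).
rewrite (exprMn _ v0); split; first by rewrite pmulr_rlt0// -oppr_gt0 opprB; exact: le_lt_trans k0 k.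
by rewrite -mulrN opprB (ler_wpM2l (ltW N'20))// ltW.
Qed.

(* A curve staying in the chart cannot reach arbitrarily late times: warping it
   slightly to the past makes its g-length at least linear in the elapsed time,
   since the lapse grows like the reciprocal square root of the warp. *)
Lemma time_bounded x0 (r1 : R) : fs x0 -> 0 < r1 -> 10 * r1 < r -> `|Phi x0| <= r1 ->
  exists B : R, forall (x v : R -> X) (u1 : R), 0 <= u1 -> x 0 = x0 -> ftimelike A p x v 0 u1 ->
    (forall u, 0 <= u <= u1 -> fs (x u) /\ `|Phi (x u)| <= r1) -> x u1 0 0 <= B.
Proof.
move=> f0 r10 r1r Px0.
have cP := Phi_continuous f0.1.
have [d d0 Hd] : exists2 d : R, 0 < d & forall e : R, `|e| < d -> `|Phi (pt (x0 0 0 - e) (rsubmx x0))| < 2 * r1.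
  have c : {for 0, continuous (fun e : R => pt (x0 0 0 - e) (rsubmx x0))}.
    apply: pt_continuous; last exact: cvg_cst.
    by apply: cvgB; [exact: cvg_cst|exact: cvg_id].
  have n : nbhs (0 : R) ((fun e : R => pt (x0 0 0 - e) (rsubmx x0)) @^-1` [set y | `|Phi y| < 2 * r1]).
    apply: continuous_nbhs_pre c _; rewrite subr0 pt_eta.
    have cn : {for x0, continuous (fun y => `|Phi y|)}.
      exact: (@continuous_comp _ _ _ Phi (fun y => `|y|) x0 cP (@norm_continuous _ _ _)).
    by have := continuous_nbhs cn (@open_lt _ (2 * r1)); apply; rewrite /=; lra.
  by have [d d0 Hd] := nbhs_distP n; exists d => // e ed; apply: Hd; rewrite sub0r normrN.
have CC0 : 0 < C * C'' by rewrite mulr_gt0.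
(* The size of the warp at the start: the moved starting point keeps its image in the ball of radius
   2 r1, and [warp_timelike] applies. *)
pose d1 := Num.min (d / 2) (c1 / 2 / (C * C'')).
have d10 : 0 < d1 by rewrite lt_min divr_gt0// divr_gt0// divr_gt0.
have d1d : d1 < d by rewrite gt_min; apply/orP; left; lra.
have d1C : C * C'' * d1 <= c1 / 2.
  by rewrite mulrC -ler_pdivlMr// ge_min lexx orbT.
set t0 := x0 0 0.
have [k k0 Hk] := lapse_ge A0 chi0.
(* Since E' = - C' E, the curve at time t - D(t) has exactly the time component required by
   [warp_timelike]; and N^2 E is bounded below, because N^2 grows at least like e^{C' t}. *)
pose E (t : R) := d1 * expR (- (C' * (t - t0))).
(* Twice [K2] is the resulting lower bound for N^2 c1 E at the warped time; it does not depend on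
   the curve. *)
pose K2 := k ^+ 2 * expR (- (C' * d1)) * c1 * d1 * expR (C' * t0) / 2.
have K20 : 0 < K2 by rewrite /K2 !mulr_gt0 ?expR_gt0 ?exprn_gt0.
exists (t0 + 4 * r1 / Num.sqrt K2) => x v u1 u10 xx0 tl H.
set t1 := x u1 0 0.
have xt u : 0 <= u <= u1 -> is_derive u 1 (fun s => x s 0 0) (v u 0 0).
  by move=> /tl[dx _ _]; exact: is_derive_coord.
have tmono u u' : 0 <= u -> u <= u' -> u' <= u1 -> x u 0 0 <= x u' 0 0.
  move=> a b c; apply: (@derive_ge0_le _ (fun s => x s 0 0) (fun s => v s 0 0)) => // s /andP[sa sb].
    by apply: xt; rewrite (le_trans a sa) (le_trans sb c).
  by have [|_ /ltW] := tl s _; rewrite ?(le_trans a sa) ?(le_trans sb c).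
(* Normalised to vanish at the end, so that the homotopy [Q] fixes the end point of the curve. *)
pose D t := E t - E t1.
have E_le t : t0 <= t -> E t <= d1.
  move=> tt; rewrite /E ler_piMr//; first exact: ltW.
  by rewrite -expR0 ler_expR oppr_le0 mulr_ge0// ?subr_ge0// ltW.
have E_gt0 t : 0 < E t by rewrite /E mulr_gt0// expR_gt0.
have E_decr t t' : t <= t' -> E t' <= E t.
  by move=> tt; rewrite /E ler_pM2l// ler_expR lerN2 ler_pM2l// lerB.
have dE (u : R) : is_derive u 1 E (- (C' * E u)).
  have d2 : is_derive u 1 (fun t : R => - (C' * (t - t0))) (- C').
    have e0 := is_deriveB (is_derive_id u (1 : R)) (is_derive_cst t0 u (1 : R)).
    by apply: is_derive_eq (is_deriveN (is_deriveZ C' e0)) _; rewrite /GRing.scale /= subr0 mulr1.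
  have d3 := is_derive_compR d2 (is_derive_expR _).
  have d4 := is_deriveZ d1 d3.
  by apply: is_derive_eq d4 _; rewrite /GRing.scale/= /E; ring.
pose Q kk s := pt (x s 0 0 - kk * D (x s 0 0)) (rsubmx (x s)).
pose dQ kk s := pt (v s 0 0 * (1 + C' * (kk * E (x s 0 0)))) (rsubmx (v s)).
have t0x u : 0 <= u <= u1 -> t0 <= x u 0 0 <= t1.
  by move=> /andP[a b]; rewrite /t0 -xx0 !tmono.
have W kk s : 0 <= kk <= 1 -> 0 <= s <= u1 ->
   qf (Q kk s) (dQ kk s) < 0 /\
   lapse A p (x s 0 0 - kk * D (x s 0 0)) ^+ 2 * (v s 0 0 ^+ 2 * (c1 * (kk * E (x s 0 0)))) <= - qf (Q kk s) (dQ kk s).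
  move=> /andP[kk0 kk1] ss; have [a b] := andP (t0x s ss); have [dx v0 q0] := tl s ss.
  apply: warp_timelike => //.
  - by rewrite mulr_ge0// subr_ge0 E_decr.
  - by rewrite ler_wpM2l// lerBlDr lerDl ltW.
  - apply: le_trans d1C; rewrite (ler_wpM2l (ltW CC0))//; apply: le_trans (E_le _ a).
    by rewrite ler_piMl// ltW.
  - by rewrite !pt_eta.
have tlQ kk : 0 <= kk <= 1 -> ftimelike A p (Q kk) (dQ kk) 0 u1.
  move=> k01 s ss; have [q1 _] := W kk s k01 ss; have [dx v0 q0] := tl s ss.
  have [kk0 kk1] := andP k01.
  split; last exact: q1.
    have dx0 := xt s ss.
    have d2 := is_derive_compR dx0 (dE (x s 0 0)).
    have d3 : is_derive s 1 (fun u => x u 0 0 - kk * D (x u 0 0)) (v s 0 0 * (1 + C' * (kk * E (x s 0 0)))).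
      have e1 := is_deriveB d2 (is_derive_cst (E t1) s (1 : R)).
      have e2 := is_deriveB dx0 (is_deriveZ kk e1).
      by apply: is_derive_eq e2 _; rewrite /GRing.scale /=; ring.
    exact: is_derive_pt d3 (is_derive_rsubmx dx).
  rewrite /dQ pt_time; apply: mulr_gt0 (v0) _; apply: ltr_pwDl => //.
  by apply: mulr_ge0 (ltW C'0) _; apply: mulr_ge0 (kk0) (ltW (E_gt0 _)).
have Q0 s : Q 0 s = x s by rewrite /Q mul0r subr0 pt_eta.
have Qu kk : Q kk u1 = x u1 by rewrite /Q -/t1 /D subrr mulr0 subr0 pt_eta.
have cQ kk s : 0 <= kk <= 1 -> 0 <= s <= u1 ->
    {for (kk, s), continuous (fun q : R * R => Q q.1 q.2)}.
  move=> _ ss; have [dx _ _] := tl s ss.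
  have c4 : {for (kk, s), continuous (fun q : R * R => E (x q.2 0 0))}.
    exact: is_derive_continuous_snd (is_derive_compR (xt s ss) (dE (x s 0 0))).
  apply: pt_continuous; last exact: is_derive_continuous_snd (is_derive_rsubmx dx).
  apply: (cvgB (is_derive_continuous_snd (xt s ss))); apply: cvgM; first exact: cvg_fst.
  by apply: (cvgB c4); exact: cvg_cst.
have u00 : 0 <= (0 : R) <= u1 by rewrite lexx.
have u11 : 0 <= u1 <= u1 by rewrite u10 lexx.
have ends kk : 0 <= kk <= 1 -> `|Phi (Q kk 0) - 0| <= 2 * r1 /\ `|Phi (Q kk u1) - 0| <= 2 * r1.
  move=> /andP[kk0 kk1]; rewrite !subr0 Qu; split; last by have [_] := H u1 u11; lra.
  rewrite /Q xx0; apply: ltW; apply: Hd.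
  have D0 : 0 <= D t0 <= d1.
    have [a b] := andP (t0x 0 u00); rewrite xx0 -/t0 in b.
    by rewrite subr_ge0 (E_decr _ _ b)/= lerBlDr (le_trans (E_le t0 (lexx _)))// lerDl ltW.
  have [D1 D2] := andP D0.
  rewrite ger0_norm ?mulr_ge0//; apply: le_lt_trans d1d; apply: le_trans D2.
  by rewrite ler_piMl.
have rr : `|(0 : X)| + 5 * (2 * r1) < r by rewrite normr0; lra.
have fQ0 s : 0 <= s <= u1 -> fs (Q 0 s) by rewrite Q0 => /H[].
have conf := confinement lx u10 rr cQ tlQ fQ0 ends.
have l01 : (0 : R) <= 1 <= 1 := introT andP (conj (@ler01 R) (lexx (1 : R))).
have sK := sqrtr_gt0 K2; rewrite K20 in sK.
have Y : Num.sqrt K2 * (x u1 0 0) - Num.sqrt K2 * (x 0 0 0) <= Phi (Q 1 u1) 0 0 - Phi (Q 1 0) 0 0.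
  apply: (@derive_le_sub _ (fun s => Num.sqrt K2 * (x s 0 0)) (fun s => Phi (Q 1 s) 0 0)
    (fun s => Num.sqrt K2 * v s 0 0) (fun s => ('d Phi (Q 1 s) (dQ 1 s)) 0 0)) => // s ss.
  - have := is_deriveZ (Num.sqrt K2) (xt s ss); exact.
  - have [fQ _ _ _] := conf 1 l01 s ss; have [dq _ _] := tlQ 1 l01 s ss.
    have := is_derive_Phi lx fQ.1 dq; exact: is_derive_coord.
  have [fQ _ _ _] := conf 1 l01 s ss; have [dq vq qq] := tlQ 1 l01 s ss.
  have [b0 _ b1] := future_cone_out lx fQ qq vq.
  have [_ w1] := W 1 s l01 ss; have [_ v0 _] := tl s ss.
  have [ta tb] := andP (t0x s ss).
  rewrite !mul1r in w1.
  have sv : 0 <= Num.sqrt K2 * v s 0 0 by rewrite mulr_ge0// ltW.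
  rewrite -(ler_sqr sv (ltW b0)) exprMn sqr_sqrtr ?(ltW K20)//.
  suff : 2 * K2 <= lapse A p (x s 0 0 - D (x s 0 0)) ^+ 2 * (c1 * E (x s 0 0)).
    move=> h; have : 2 * K2 * v s 0 0 ^+ 2 <= lapse A p (x s 0 0 - D (x s 0 0)) ^+ 2 * (c1 * E (x s 0 0)) * v s 0 0 ^+ 2.
      by rewrite ler_wpM2r// sqr_ge0.
    by move: w1 b1; lra.
  have D1 : D (x s 0 0) <= d1 by rewrite lerBlDr (le_trans (E_le _ ta))// lerDl ltW.
  apply: (@le_trans _ _ ((k * expR ((1 + chis) * (x s 0 0 - d1))) ^+ 2 * (c1 * E (x s 0 0)))); last first.
    apply: ler_wpM2r; first exact: mulr_ge0 (ltW c1_gt0) (ltW (E_gt0 _)).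
    rewrite ler_sqr ?nnegrE; [|by rewrite mulr_ge0 ?expR_ge0// ltW|exact: ltW].
    apply: le_trans (Hk _); rewrite ler_pM2l// ler_expR ler_wpM2l ?lerB// addr_ge0//.
  rewrite le_eqVlt; apply/orP; left; apply/eqP; rewrite exprMn -expRM_natl /K2 /E.
  rewrite (_ : 2%:R * ((1 + chis) * (x s 0 0 - d1)) = - (C' * d1) + C' * t0 + C' * (x s 0 0 - t0)); last by rewrite /C'; ring.
  rewrite !expRD.
  have e1 : expR (C' * (x s 0 0 - t0)) * expR (- (C' * (x s 0 0 - t0))) = 1 by rewrite -expRD subrr expR0.
  by rewrite -[LHS]mulr1 -e1; field; rewrite !gt_eqF ?expR_gt0.
rewrite Qu xx0 -/t0 in Y.
have [q1 _] := ends 1 l01; have [_ q2] := H u1 u11; rewrite subr0 in q1.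
have a1 := le_trans (coord_le_norm (Phi (Q 1 0)) 0 0) q1.
have a2 := le_trans (coord_le_norm (Phi (x u1)) 0 0) q2.
rewrite -lerBlDl ler_pdivlMr// mulrC mulrBr.
move: a1 a2; rewrite !ler_norml => /andP[a1 _] /andP[_ a2]; rewrite /t1.
lra.
Qed.

(** Continuity method along the segment. By [time_bounded] the times on the lift are bounded, so the
    Lipschitz estimates keep the lift in a bounded part of the cover; a cluster point lies in O by
    [lx_closed] and maps to the end of the segment covered so far. *)
Lemma no_future_exit x0 (w : X) (r1 : R) : fs x0 -> cone_in w -> 0 < r1 -> 10 * r1 < r ->
  (forall s : R, 0 <= s <= 1 -> `|Phi x0 + s *: w| <= r1) ->
  forall s : R, 0 <= s <= 1 -> (Phi @` fs) (Phi x0 + s *: w).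
Proof.
move=> f0 cw r10 r1r Hb.
have P0 : `|Phi x0| <= r1 by have := Hb 0; rewrite scale0r addr0 lexx ler01; apply.
have [B HB] := time_bounded f0 r10 r1r P0.
have cl (s : R) : {for s, continuous (fun u : R => Phi x0 + u *: w)}.
  by apply: cvgD; [exact: cvg_cst|apply: cvgZr_tmp; exact: cvg_id].
apply: (@real_induction R 0 1 (fun s => (Phi @` fs) (Phi x0 + s *: w))) => s s01 IH.
suff Fs : (Phi @` fs) (Phi x0 + s *: w).
  have n : nbhs s ((fun u : R => Phi x0 + u *: w) @^-1` (Phi @` fs)).
    apply: continuous_nbhs_pre (cl s) _; apply: open_nbhs_nbhs.
    by split; [exact: (fs_image_open)|exact: Fs].
  have [d d0 Hd] := nbhs_distP n; exists d => // u u01 ud.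
  have [us|su] := ltP u s; last by apply: Hd; exact: dist_lt_of_le.
  by apply: IH; rewrite (proj1 (andP u01)).
have [s0 s1] := andP s01.
have [se|sn0] := eqVneq s 0; first by exists x0; rewrite ?se ?scale0r ?addr0.
have sp : 0 < s by rewrite lt_neqAle eq_sym sn0.
have HO u : 0 <= u < s -> (Phi @` O) (Phi x0 + u *: w).
  by move=> us; have [y fy <-] := IH u us; exists y => //; exact: fy.1.
have [x [v [x00 cx xP tl]]] := lift_segment f0 cw sp HO.
have tB u : 0 <= u < s -> x u 0 0 <= B.
  move=> /andP[u0 us]; apply: (HB x v u u0 x00 (tl u us)) => u' /andP[a b].
  have us' : 0 <= u' < s by rewrite a (le_lt_trans b).
  have [h1 h2] := xP u' us'; split=> //; rewrite h2; apply: Hb.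
  by rewrite a (le_trans b)// (le_trans (ltW us)).
set t0 := x0 0 0.
have fc u : u < s -> fcausal A p (fun s => x s 0 0) (fun s => rsubmx (x s)) (fun s => v s 0 0) (fun s => rsubmx (v s)) 0 u.
  by move=> us; exact: (ftimelike_fcausal (tl u us)).
have t0u u : 0 <= u < s -> t0 <= x u 0 0.
  by move=> /andP[u0 us]; have := fcausal_time_le (fc u us) (lexx 0) u0 (lexx u); rewrite x00.
have [M M0 HM] := fcausal_lipschitz_horizontal A0 chi0 t0 B.
have tt : t0 <= x 0 0 0 by rewrite x00.
pose b1 := `|rsubmx x0| + M * (B - t0).
have hb u a : 0 <= u < s -> a != 0 -> `|rsubmx (x u) 0 a| <= b1.
  move=> us a0; have [u0 us'] := andP us.
  have h1 := HM _ _ _ _ 0 u u0 (fc u us') tt (tB u us) a a0; rewrite /= x00 in h1.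
  have h2 : M * (x u 0 0 - x0 0 0) <= M * (B - t0) by rewrite ler_wpM2l ?(ltW M0)// lerD2r tB.
  have h3 := coord_le_norm (rsubmx x0) 0 a.
  rewrite -[rsubmx (x u) 0 a](subrK (rsubmx x0 0 a)) addrC.
  by apply: le_trans (ler_normD _ _) _; rewrite lerD// (le_trans h1).
have b10 : 0 <= b1.
  have u0 : 0 <= (0 : R) < s by rewrite lexx.
  have := tB 0 u0; rewrite x00 -/t0 => ?.
  by rewrite addr_ge0// mulr_ge0 ?(ltW M0)// subr_ge0.
have [M' M'0 HM'] := fcausal_lipschitz_vertical A0 chi0 t0 B b10.
pose b2 := `|rsubmx x0| + M' * (B - t0).
have hb0 u : 0 <= u < s -> `|rsubmx (x u) 0 0| <= b2.
  move=> us; have [u0 us'] := andP us.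
  have hh u' rr : 0 <= u' <= u -> `|rsubmx (x u') 0 (ix rr)| <= b1.
    by move=> /andP[a b]; apply: hb; rewrite ?ix_neq0// a (le_lt_trans b).
  have h1 := HM' _ _ _ _ 0 u u0 (fc u us') tt (tB u us) hh; rewrite /= x00 in h1.
  have h2 : M' * (x u 0 0 - x0 0 0) <= M' * (B - t0) by rewrite ler_wpM2l ?(ltW M'0)// lerD2r tB.
  have h3 := coord_le_norm (rsubmx x0) 0 0.
  rewrite -[rsubmx (x u) 0 0](subrK (rsubmx x0 0 0)) addrC.
  by apply: le_trans (ler_normD _ _) _; rewrite lerD// (le_trans h1).
pose BB := `|t0| + `|B| + b1 + `|b2|.
have BB0 : 0 <= BB := addr_ge0 (addr_ge0 (addr_ge0 (normr_ge0 _) (normr_ge0 _)) b10) (normr_ge0 _).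
have xb u : 0 <= u < s -> `|x u| <= BB.
  move=> us; apply: rV_norm_leP => [|j]; first exact: BB0.
  rewrite -(pt_eta (x u)) /pt mxE; case: (fintype.split j) => i.
    rewrite !ord1 mxE eqxx mulr1n.
    apply: (@le_trans _ _ (`|t0| + `|B|)); last first.
      by rewrite /BB -[leRHS]addrA lerDl; apply: addr_ge0 (b10) (normr_ge0 _).
    have h1 := t0u u us; have h2 := tB u us; have := ler_norm (- t0); have := ler_norm B.
    have := normr_ge0 t0; have := normr_ge0 B; rewrite normrN ler_norml; lra.
  have [->|i0] := eqVneq i 0.
    apply: le_trans (hb0 u us) _; apply: le_trans (ler_norm _) _.
    by rewrite /BB lerDr; exact: addr_ge0 (addr_ge0 (normr_ge0 _) (normr_ge0 _)) b10.
  apply: le_trans (hb u i us i0) _; rewrite /BB -[leRHS]addrA [b1 + _]addrC addrA lerDr.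
  exact: addr_ge0 (addr_ge0 (normr_ge0 _) (normr_ge0 _)) (normr_ge0 _).
have lefts : \forall u \near s^'-, 0 <= u < s.
  near=> u; apply/andP; split; [near: u; exact: nbhs_left_ge|near: u; exact: nbhs_left_lt].
have PF : ProperFilter (x u @[u --> s^'-]) by apply: fmap_proper_filter.
have [z _ cz] := rV_cluster setT PF (filterS (fun u us => xb u us) lefts).
have clz : [set y | O y /\ `|Phi y| <= r1] z.
  have : closed [set y | O y /\ `|Phi y| <= r1] by apply: (lx_closed lx); lra.
  move/closure_id => ->; move: cz => cz U Uz; apply: cz Uz.
  apply: filterS lefts => u us; have [h1 h2] := xP u us; split; first exact: h1.1.
  rewrite h2; apply: Hb; have [a b] := andP us; rewrite a (le_trans (ltW b))//.
have [Oz Pz] := clz.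
have Pzs : Phi z = Phi x0 + s *: w.
  apply: (@norm_hausdorff _ X) => U V Uz Vz.
  have cPz := Phi_continuous Oz.
  have n1 : nbhs z (Phi @^-1` U) by exact: cPz.
  have n2 : (x u @[u --> s^'-]) (Phi @^-1` V).
    have : (fun u : R => Phi x0 + u *: w) @ s^'- --> Phi x0 + s *: w.
      by apply: cvg_at_left_filter; exact: cl.
    move/(_ V Vz); apply: filterS2 lefts => u us Vu.
    by rewrite /preimage /mkset (xP u us).2.
  have [y [hy1 hy2]] := cz _ _ n2 n1.
  by exists (Phi y).
exists z; last exact: Pzs.
apply: (fs_closed_in Oz).
have cPz := Phi_continuous Oz.
move=> U Uz.
have n1 : nbhs z (Phi @^-1` U) by exact: cPz.
have n2 : (x u @[u --> s^'-]) fs by apply: filterS lefts => u /xP[].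
have [y [hy1 hy2]] := cz _ _ n2 n1.
by exists (Phi y); split=> //; exists y.
Unshelve. all: by end_near. Qed.

Variable c : R.
Hypotheses (c0 : 0 < c) (cp : forall a, c <= 1 - p a).

Definition ltrans (k : 'rV[R]_(hdim m)) (x : X) : X := pt (x 0 0) (hmul k (rsubmx x)).

Lemma stproj_ltrans ga x : Ga ga -> stproj Ga (ltrans ga x) = stproj Ga x.
Proof. by move=> g; rewrite /ltrans stproj_pt hproj_hmul// -stprojE. Qed.

Lemma stproj_eqP (x x' : X) : stproj Ga x = stproj Ga x' ->
  x 0 0 = x' 0 0 /\ exists2 ga, Ga ga & x' = ltrans ga x.
Proof.
rewrite !stprojE => -[e1 /(hproj_eqP dG)[ga g e2]]; split=> //; exists ga => //.
by rewrite /ltrans e1 -e2 pt_eta.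
Qed.

Lemma ftimelike_ltrans k (x v : R -> X) s0 s1 : ftimelike A p x v s0 s1 ->
  ftimelike A p (fun s => ltrans k (x s)) (fun s => pt (v s 0 0) (dhmul k (rsubmx (v s)))) s0 s1.
Proof.
move=> H s ss; have [d v0 q] := H s ss; split.
- by apply: is_derive_pt; [exact: is_derive_coord|apply: is_derive_hmul; exact: is_derive_rsubmx].
- by rewrite pt_time.
move: q; rewrite !qform_family// !pt_time !pt_space.
by under [in X in _ -> X]eq_bigr do rewrite cow_dhmul.
Qed.

(** [lift_up] runs inside the ball of radius 3 r2, and [no_future_exit] needs ten times the radius
    in use. *)
Let r2 := r / 40.

Definition below (x x' : X) : Prop := exists Y V : R -> X,
  [/\ Y 0 = x, Y 1 = x', ftimelike A p Y V 0 1 &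
      forall s : R, 0 <= s <= 1 -> fs (Y s) /\ Phi (Y s) = Phi x + s *: (Phi x' - Phi x)].

Lemma lift_up x0 u : fs x0 -> cone_in u -> `|Phi x0| <= r2 -> `|Phi x0 + u| <= r2 ->
  exists2 x1, below x0 x1 & Phi x1 = Phi x0 + u.
Proof.
move=> f0 cu b0 b1.
have r0 : 0 < r by apply: le_lt_trans (lx_ball lx f0.1).
have r1r : 10 * (3 * r2) < r by rewrite /r2; lra.
have r10 : 0 < 3 * r2 by rewrite /r2; lra.
have b2 : `|Phi x0 + 2 *: u| <= 3 * r2.
  rewrite (_ : Phi x0 + 2 *: u = 2 *: (Phi x0 + u) - Phi x0); last first.
    by apply/rowP => j; rewrite !mxE; ring.
  by apply: le_trans (ler_normB _ _) _; rewrite normrZ ger0_norm//; move: b0 b1; lra.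
(* The segment is followed to twice its length, so the lift is differentiable at parameter 1 as
   well. *)
have cu2 : cone_in (2 *: u) by apply: cone_inZ.
have Hb (s : R) : 0 <= s <= 1 -> `|Phi x0 + s *: (2 *: u)| <= 3 * r2.
  move=> /andP[s0 s1].
  rewrite (_ : Phi x0 + s *: (2 *: u) = (1 - s) *: Phi x0 + s *: (Phi x0 + 2 *: u)); last first.
    by rewrite scalerBl scale1r scalerDr addrA subrK.
  apply: le_trans (ler_normD _ _) _; rewrite !normrZ (ger0_norm s0) ger0_norm ?subr_ge0//.
  have : (1 - s) * `|Phi x0| <= (1 - s) * (3 * r2) by rewrite ler_wpM2l ?subr_ge0//; lra.
  have : s * `|Phi x0 + 2 *: u| <= s * (3 * r2) by rewrite ler_wpM2l.
  by lra.
have E := no_future_exit f0 cu2 r10 r1r Hb.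
have HO (s : R) : 0 <= s < 2 -> (Phi @` O) (Phi x0 + s *: u).
  move=> /andP[s0 s2]; have s01 : 0 <= s / 2 <= 1 by apply/andP; split; lra.
  have [y fy ey] := E _ s01; exists y; first exact: fy.1.
  by rewrite ey scalerA divfK.
have [Y [V [Y0 _ YP tl]]] := lift_segment f0 cu (ltr0n R 2) HO.
have PY (s : R) : 0 <= s <= 1 -> fs (Y s) /\ Phi (Y s) = Phi x0 + s *: u.
  by move=> /andP[s0 s1]; apply: YP; rewrite s0 (le_lt_trans s1)// ltr1n.
have P1 : Phi (Y 1) = Phi x0 + u.
  by have [_ ->] := PY 1 (introT andP (conj ler01 (lexx _))); rewrite scale1r.
exists (Y 1); last exact: P1.
exists Y, V; split; [exact: Y0|by []|by apply: tl; rewrite ltr1n|].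
by move=> s /PY[f e]; split; [exact: f|rewrite e P1 [Phi x0 + u]addrC addrK].
Qed.

Lemma below_fs x x' : below x x' -> fs x /\ fs x'.
Proof.
move=> [Y [V [Y0 Y1 _ H]]]; split.
  by have [+ _] := H 0 (introT andP (conj (lexx _) ler01)); rewrite Y0.
by have [+ _] := H 1 (introT andP (conj ler01 (lexx _))); rewrite Y1.
Qed.

(** Segments can be lifted upwards only. The lift from x0 ends at a point over the same chart point
    as x1, and the element of Ga relating the two is applied to the whole curve. *)
Lemma lift_down x0 x1 : fs x0 -> fs x1 -> cone_in (Phi x1 - Phi x0) ->
  `|Phi x0| <= r2 -> `|Phi x1| <= r2 ->
  exists x0', [/\ below x0' x1, Phi x0' = Phi x0 & stproj Ga x0' = stproj Ga x0].
Proof.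
move=> f0 f1 cu b0 b1; have [|x1' bl e1] := lift_up f0 cu b0; first by rewrite subrKC.
rewrite subrKC in e1; have [_ f1'] := below_fs bl.
have [_ [ga g e]] := stproj_eqP (lx_fiber lx (proj1 f1') (proj1 f1) e1).
move: bl => [Y [V [Y0 Y1 tl H]]].
have tr y : fs y -> fs (ltrans ga y) /\ Phi (ltrans ga y) = Phi y.
  move=> fy; have e2 : stproj Ga y = stproj Ga (ltrans ga y) by rewrite stproj_ltrans.
  by split; [exact: (fs_orbit fy e2)|exact: (proj2 (lx_orbit lx (proj1 fy) e2))].
exists (ltrans ga x0); split; [|exact: (proj2 (tr _ f0))|exact: stproj_ltrans].
exists (fun s => ltrans ga (Y s)), (fun s => pt (V s 0 0) (dhmul ga (rsubmx (V s)))); split.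
- by rewrite Y0.
- by rewrite Y1 e.
- exact: ftimelike_ltrans.
move=> s /H[fy ey]; have [f2 e2] := tr _ fy; split; first exact: f2.
by rewrite e2 ey (proj2 (tr _ f0)) e1.
Qed.

Lemma below_time x x' : below x x' -> x 0 0 < x' 0 0.
Proof.
move=> [Y [V [<- <- tl _]]]; apply: (@derive_gt0_lt _ (fun s => Y s 0 0) (fun s => V s 0 0)) => // s ss.
  by have [d _ _] := tl s ss; exact: is_derive_coord.
by have [] := tl s ss.
Qed.

Lemma time_lt x x' : fs x -> fs x' -> cone_in (Phi x' - Phi x) ->
  `|Phi x| <= r2 -> `|Phi x'| <= r2 -> x 0 0 < x' 0 0.
Proof.
move=> f f' cu b b'; have [y [bl _ e]] := lift_down f f' cu b b'.
by have [<- _] := stproj_eqP e; exact: below_time.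
Qed.

Definition hbound (K : R) (k : 'rV[R]_(hdim m)) (t : R) : Prop :=
  (forall a, `|k 0 a| <= K / ratio a t) /\ `|hzeta k| <= K / ratio 0 t.

Lemma horizon : exists2 K, 0 < K & forall (Y V : R -> X) (s : R), 0 <= s ->
  ftimelike A p Y V 0 s -> hbound K (hmul (hinv (rsubmx (Y 0))) (rsubmx (Y s))) (Y s 0 0).
Proof.
have [K K0 H] := fcausal_horizon A0 chi0 c0 cp; exists K => // Y V s s0 tl.
exact: (H _ _ _ _ 0 s s0 (ftimelike_fcausal tl)).
Qed.

(** Boundary points are approached from the future side only: after [no_future_exit], such a point
    lies at the past end. *)
Definition pbdry (z : X) : Prop := closure (Phi @` fs) z /\ ~ (Phi @` O) z.

Lemma vup_norm (s : R) : 0 <= s -> `|s *: (vup : X)| = s.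
Proof.
rewrite le_eqVlt => /predU1P[<-|s0]; first by rewrite scale0r normr0.
by rewrite (cone_in_norm (cone_inZ s0 cone_in_vup)) mxE vup0 mulr1.
Qed.

(** A narrow cone above z lies in the image: an image point close enough to z is joined to the given
    point by a segment in the inner cone, and this segment lifts. *)
Lemma fs_cone z s u : closure (Phi @` fs) z -> `|z| <= r2 / 2 -> 0 < s -> s <= r2 / 4 ->
  `|u| <= s * theta (R := R) (m := m) / 4 -> (Phi @` fs) (z + s *: vup + u).
Proof.
move=> cz zb s0 sb ub; have th0 := @theta_gt0 R m; have th1 := @theta_le R m.
set th := theta in ub th0 th1 *.
have sth : s * th <= s / 2 by rewrite ler_pM2l.
have d0 : 0 < s * th / 4 by rewrite divr_gt0// mulr_gt0.
have [_ [[y fy <-] yz]] := cz _ (nbhsx_ballx z _ d0).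
rewrite -ball_normE /= in yz.
pose w := s *: vup + (z - Phi y + u).
have wc : cone_in w.
  apply: cone_in_vup_open => //; apply: le_trans (ler_normD _ _) _.
  by move: yz ub; rewrite -/th; lra.
have e : Phi y + w = z + s *: vup + u.
  by apply/rowP => j; rewrite !mxE; ring.
have yb : `|Phi y| <= r2.
  rewrite -[Phi y](subrKC z); apply: le_trans (ler_normD _ _) _; rewrite distrC.
  by move: yz; lra.
have [|x bl ex] := lift_up fy wc yb.
  rewrite e; apply: le_trans (ler_normD _ _) _.
  have := ler_normD z (s *: vup); rewrite (vup_norm (ltW s0)); move: ub; lra.
by exists x; [exact: (proj2 (below_fs bl))|rewrite ex e].
Qed.

Lemma fs_above z s : closure (Phi @` fs) z -> `|z| <= r2 / 2 -> 0 < s -> s <= r2 / 4 ->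
  (Phi @` fs) (z + s *: vup).
Proof.
move=> cz zb s0 sb; rewrite -[z + _]addr0; apply: fs_cone => //.
by rewrite normr0 divr_ge0// mulr_ge0// ltW// theta_gt0.
Qed.

(** A cluster point of the approximating points lies in O by [lx_closed] and is mapped to z. Hence a
    boundary point can only be approached by leaving every bounded set of the cover. *)
Lemma bounded_approach z M : `|z| < r -> (forall d : R, 0 < d ->
   exists x, [/\ O x, `|x| <= M & `|Phi x - z| < d]) -> (Phi @` O) z.
Proof.
move=> zr H.
have /choice[x_ x_P] (n : nat) : exists x, [/\ O x, `|x| <= M & `|Phi x - z| < n.+1%:R^-1].
  by apply: H; rewrite invr_gt0 ltr0n.
have PF : ProperFilter (x_ @ \oo) by apply: fmap_proper_filter.
have fM : (x_ @ \oo) [set x | `|x| <= M].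
  by apply: (@filterE _ \oo _) => n; have [] := x_P n.
have [y _ cy] := rV_cluster setT PF fM.
pose r' := (`|z| + r) / 2.
have zr' : `|z| < r' by rewrite /r'; lra.
have near0 (d : R) : 0 < d -> (x_ @ \oo) [set x | `|Phi x - z| < d].
  move=> d0; have := @near_infty_natSinv_lt R (PosNum d0); apply: filterS => n /= nd.
  by have [_ _ h] := x_P n; apply: lt_trans h nd.
have [Oy Py] : O y /\ `|Phi y| <= r'.
  have : closed [set y | O y /\ `|Phi y| <= r'] by apply: (lx_closed lx); rewrite /r'; lra.
  move/closure_id => E; suff : closure [set y | O y /\ `|Phi y| <= r'] y by rewrite -E.
  move=> U Uy; apply: cy Uy.
  have d0 : 0 < r' - `|z| by rewrite subr_gt0.
  have n1 := near0 _ d0.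
  have n2 : (x_ @ \oo) O by apply: (@filterE _ \oo _) => n; have [] := x_P n.
  apply: filterS2 n1 n2 => x /= h1 h2; split; first exact: h2.
  by rewrite -[Phi x](subrK z); apply: le_trans (ler_normD _ _) _; move: h1; lra.
exists y; first exact: Oy.
apply: (@norm_hausdorff _ X) => U V Uz Vz.
have cPy := Phi_continuous Oy.
have n1 : nbhs y (Phi @^-1` U) by exact: cPy.
have [d d0 Hd] := nbhs_distP Vz.
have [x [hx1 hx2]] := cy _ _ (near0 d d0) n1.
by exists (Phi x); split; [exact: hx2|apply: Hd; rewrite distrC].
Qed.

(** All points over the vertical segment at z can be moved by Ga below one fixed point x1, and the
    horizon estimate at x1 bounds their position in H. *)
Lemma down_bounded z : pbdry z -> `|z| <= r2 / 2 -> 0 < r2 ->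
  exists M t1 : R, forall (s : R) x, 0 < s -> s < r2 / 4 -> fs x -> Phi x = z + s *: vup ->
  exists x', [/\ fs x', Phi x' = Phi x, x' 0 0 = x 0 0, `|rsubmx x'| <= M & x' 0 0 <= t1].
Proof.
move=> [cz nz] zb r20.
have s10 : 0 < r2 / 4 by rewrite divr_gt0.
have [x1 f1 e1] := fs_above cz zb s10 (lexx _).
have [K K0 HK] := horizon.
pose b := \sum_a K / ratio a (x1 0 0).
have bb a : K / ratio a (x1 0 0) <= b.
  rewrite /b (bigD1 a)//= lerDl sumr_ge0// => i _; exact: divr_ge0 (ltW K0) (ltW (rg _ _)).
have b0 : 0 <= b by apply: le_trans (bb 0); exact: divr_ge0 (ltW K0) (ltW (rg _ _)).
pose b' := b + m%:R * (b * b).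
exists (`|rsubmx x1| + b' + m%:R * (`|rsubmx x1| * b')), (x1 0 0) => s x s0 sl fx ex.
have sm : `|z + s *: vup| <= r2.
  by apply: le_trans (ler_normD _ _) _; rewrite (vup_norm (ltW s0)); lra.
have sm1 : `|z + (r2 / 4) *: vup| <= r2.
  by apply: le_trans (ler_normD _ _) _; rewrite (vup_norm (ltW s10)); lra.
have cu : cone_in (Phi x1 - Phi x).
  rewrite e1 ex opprD addrACA subrr add0r -scalerBl; apply: cone_inZ; last exact: cone_in_vup.
  by rewrite subr_gt0.
have [||x' [bl e2 e3]] := lift_down fx f1 cu; rewrite ?ex ?e1//.
have [f' _] := below_fs bl; have [et _] := stproj_eqP e3.
exists x'; split; [exact: f'|exact: (etrans e2 ex)|exact: et| |exact: ltW (below_time bl)].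
move: bl => [Y [V [Y0 Y1 tl _]]].
have [kb _] := HK Y V 1 ler01 tl; rewrite Y0 Y1 in kb; set k := hmul _ _ in kb.
have -> : rsubmx x' = hmul (rsubmx x1) (hinv k).
  have : hmul (rsubmx x') k = rsubmx x1 by rewrite /k hmulKVh.
  by move=> <-; rewrite hmulhK.
have kn : `|k| <= b by apply: rV_norm_leP => // j; apply: le_trans (kb j) (bb j).
have kn' : `|hinv k| <= b'.
  apply: le_trans (hinv_bound _) _; rewrite /b' lerD// ler_wpM2l//; exact: ler_pM.
apply: le_trans (hmul_bound _ _) _; rewrite lerD ?lerD// ler_wpM2l// ler_wpM2l//.
Qed.

(** If times at least B occurred arbitrarily close to z, the points of [down_bounded] would be
    bounded in time as well, and z would be in the image by [bounded_approach]. *)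
Lemma pbdry_time z B : pbdry z -> `|z| <= r2 / 2 -> 0 < r2 -> exists2 s0, 0 < s0 <= r2 / 4 &
  forall (s : R) x, 0 < s -> s <= s0 -> fs x -> Phi x = z + s *: vup -> x 0 0 < B.
Proof.
move=> pz zb r20; have [M [t1 H]] := down_bounded pz zb r20.
apply: contrapT => N; apply: (proj2 pz).
have zr : `|z| < r by move: zb r20; rewrite /r2; lra.
apply: (@bounded_approach z (`|B| + `|t1| + `|M|) zr) => d d0.
apply: contrapT => N'; apply: N.
pose s0 := Num.min (r2 / 8) (d / 2).
have s00 : 0 < s0 by rewrite lt_min; apply/andP; split; rewrite divr_gt0.
have s0r : s0 <= r2 / 8 by rewrite ge_min lexx.
have s0d : s0 <= d / 2 by rewrite ge_min lexx orbT.
exists s0; first by apply/andP; split; [exact: s00|lra].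
move=> s x sp ss fx ex; rewrite ltNge; apply/negP => Bx; apply: N'.
have [|x' [f' e' t' M' T']] := H s x sp _ fx ex; first by lra.
exists x'; split; first exact: (proj1 f').
  apply: rV_norm_leP => [|j]; first by rewrite !addr_ge0.
  rewrite -(pt_eta x') /pt mxE; case: (fintype.split j) => i.
    rewrite !ord1 mxE eqxx mulr1n t'.
    have := ler_norm (- B); have := ler_norm t1; have := normr_ge0 B; have := normr_ge0 t1; have := normr_ge0 M.
    by rewrite normrN ler_norml -t'; move: Bx T'; rewrite t'; lra.
  apply: le_trans (coord_le_norm _ 0 i) _; apply: le_trans M' _; apply: le_trans (ler_norm _) _.
  by rewrite lerDr addr_ge0.
by rewrite e' ex [z + _]addrC addrK (vup_norm (ltW sp)); lra.
Qed.

(* The point k is the trace on the universal cover H of the past boundary point z. *)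
Definition approach (z : X) (k : 'rV[R]_(hdim m)) : Prop := forall d : R, 0 < d ->
  exists y, [/\ fs y, y 0 0 < - d^-1, `|rsubmx y - k| < d & `|Phi y - z| < d].

(** Near an image point the time is bounded below, since the image determines the time
    coordinate. *)
Lemma approach_pbdry z k : approach z k -> pbdry z.
Proof.
move=> H; split.
  move=> U Uz; have [d d0 Hd] := nbhs_distP Uz; have [y [fy _ _ yz]] := H d d0.
  by exists (Phi y); split; [exists y|apply: Hd; rewrite distrC].
move=> [x Ox ex].
pose N := O `&` [set y | x 0 0 - 1 < y 0 0].
have oN : open N.
  apply: openI; first exact: (lx_open lx).
  by apply: open_comp (@open_gt _ (x 0 0 - 1)) => y _; exact: time_continuous.
have oI : open (Phi @` N) by apply: (lx_openmap lx) oN => y [].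
have Nx : N x by split; [exact: Ox|rewrite /=; lra].
have [d d0 Hd] := nbhs_distP (open_nbhs_nbhs (conj oI (ex_intro2 _ _ x Nx ex))).
have e0 : 0 < `|x 0 0| + 1 by rewrite ltr_wpDl.
have [|y [fy yt _ yz]] := H (Num.min d (`|x 0 0| + 1)^-1); first by rewrite lt_min d0 invr_gt0.
move: yz; rewrite lt_min => /andP[yz _].
have [|x' [Ox' tx'] ex'] := Hd (Phi y); first by rewrite distrC.
have [et _] := stproj_eqP (lx_fiber lx Ox' (proj1 fy) ex').
have : `|x 0 0| + 1 <= (Num.min d (`|x 0 0| + 1)^-1)^-1.
  by rewrite -[leLHS]invrK lef_pV2 ?posrE ?lt_min ?invr_gt0 ?d0// ge_min lexx orbT.
move: yt tx'; rewrite /= et; have := ler_norm (- x 0 0); rewrite normrN; lra.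
Qed.

(** The positions in H of points over z + s vup are bounded by [down_bounded], while their times
    tend to -oo by [pbdry_time]; k is a cluster point of these positions. *)
Lemma approach_exists z : pbdry z -> `|z| <= r2 / 2 -> 0 < r2 -> exists k, approach z k.
Proof.
move=> pz zb r20; have [M [t1 H]] := down_bounded pz zb r20.
have /choice[y_ y_P] (n : nat) : exists y, [/\ fs y, y 0 0 < - n%:R, `|rsubmx y| <= M & `|Phi y - z| < n.+1%:R^-1].
  have [s0 /andP[s00 s0r] Hs] := pbdry_time (- n%:R) pz zb r20.
  pose s := Num.min (s0 / 2) (n.+1%:R^-1 / 2).
  have n0 : 0 < n.+1%:R^-1 :> R by rewrite invr_gt0 ltr0n.
  have sp : 0 < s by rewrite lt_min; apply/andP; split; rewrite divr_gt0.
  have ss : s <= s0 / 2 by rewrite ge_min lexx.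
  have sn : s <= n.+1%:R^-1 / 2 by rewrite ge_min lexx orbT.
  have [|x fx ex] := fs_above (proj1 pz) zb sp; first by lra.
  have [|x' [f' e' t' M' T']] := H s x sp _ fx ex; first by lra.
  exists x'; split; [exact: f'| |exact: M'|].
    by rewrite t'; apply: (Hs s) => //; lra.
  rewrite e' ex [z + _]addrC addrK (vup_norm (ltW sp)); apply: le_lt_trans sn _.
  by rewrite ltr_pdivrMr// ltr_pMr// ltr1n.
have PF : ProperFilter ((fun n => rsubmx (y_ n)) @ \oo) by apply: fmap_proper_filter.
have fM : ((fun n => rsubmx (y_ n)) @ \oo) [set x | `|x| <= M].
  by apply: (@filterE _ \oo _) => n; have [] := y_P n.
have [k _ ck] := rV_cluster setT PF fM.
exists k => d d0.
have n1 : \forall n \near \oo, n.+1%:R^-1 < d by exact: (@near_infty_natSinv_lt R (PosNum d0)).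
have n2 : ((fun n => rsubmx (y_ n)) @ \oo)
    [set h | exists n, [/\ h = rsubmx (y_ n), d^-1 <= n%:R & n.+1%:R^-1 < d]].
  have n3 : \forall n \near \oo, d^-1 <= n%:R by exact: nbhs_infty_ger.
  by apply: filterS2 n1 n3 => n h1 h2; exists n.
have nk : nbhs k [set h | `|h - k| < d].
  by apply: (@dist_nbhs _ _ _ _ d) => // h; rewrite /= distrC.
have [h [[n [eh h1 h2]] hk]] := ck _ _ n2 nk.
have [fy yt _ yz] := y_P n; exists (y_ n); split; [exact: fy| |by rewrite -eh|].
  by apply: lt_le_trans yt _; rewrite lerN2.
exact: lt_trans yz h2.
Qed.

(** Two factors instead of a distance: one for a displacement from k0, one for a horizon
    displacement after it. Such displacements then combine by multiplication in H, without comparing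
    norms of products. *)
Definition near_line (k0 : 'rV[R]_(hdim m)) (d : R) (h : 'rV[R]_(hdim m)) : Prop :=
  exists e l, [/\ `|e| < d, `|l| < d & h = hmul (hmul k0 e) l].

(** Removes the ambiguity by Ga: near the line over k a point of the cover is determined by its
    chart image. *)
Lemma near_line_unique k : exists2 d : R, 0 < d & forall x x', fs x -> fs x' ->
  Phi x = Phi x' -> near_line k d (rsubmx x) -> near_line k d (rsubmx x') -> x = x'.
Proof.
have [U [oU Uk Uinj]] := hproj_locally_injective dG k.
have cm : {for (0, 0), continuous (fun q : 'rV[R]_(hdim m) * 'rV[R]_(hdim m) => hmul (hmul k q.1) q.2)}.
  apply: hmul_continuous; last exact: cvg_snd.
  by apply: hmul_continuous; [exact: cvg_cst|exact: cvg_fst].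
have n : nbhs (0 : 'rV[R]_(hdim m), 0 : 'rV[R]_(hdim m)) [set q | U (hmul (hmul k q.1) q.2)].
  by apply: (continuous_nbhs_pre cm); rewrite /= !hmulh0; exact: open_nbhs_nbhs.
have [d d0 Hd] := nbhs_pairP n.
exists d => // x x' fx fx' ex [e [l [he hl E]]] [e' [l' [he' hl' E']]].
have := lx_fiber lx (proj1 fx) (proj1 fx') ex; rewrite !stprojE => -[tt hh].
rewrite -(pt_eta x) -(pt_eta x') tt; congr pt; move: hh; apply: Uinj; rewrite inE ?E ?E'.
  by apply: (Hd e l); rewrite sub0r normrN.
by apply: (Hd e' l'); rewrite sub0r normrN.
Qed.

Lemma ratio_small (K d : R) : 0 < K -> 0 < d -> exists T, forall t, t <= T -> forall a, K / ratio a t < d.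
Proof.
move=> K0 d0; have dK : 0 < d / K by rewrite divr_gt0.
have /choice[T HT] a : exists T, forall t, t <= T -> (ratio a t)^-1 < d / K.
  exact: (ratio_inv_cvg A0 chi0 c0 cp a dK).
exists (- \sum_a `|T a|) => t tT a.
rewrite mulrC -ltr_pdivlMr//; apply: HT; apply: le_trans tT _.
rewrite lerNl; apply: (@le_trans _ _ `|T a|); first by rewrite -normrN ler_norm.
by rewrite (bigD1 a)//= lerDl sumr_ge0.
Qed.

Lemma below_horizon : exists2 K, 0 < K & forall (x x' : X), below x x' ->
  hbound K (hmul (hinv (rsubmx x)) (rsubmx x')) (x' 0 0).
Proof.
have [K K0 HK] := horizon; exists K => // x x' [Y [V [<- <- tl _]]].
exact: (HK Y V 1 ler01 tl).
Qed.

Lemma hbound_small K k t d : 0 < d -> (forall a, K / ratio a t < d) -> hbound K k t -> `|k| < d.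
Proof. by move=> d0 H [kb _]; apply: rV_norm_ltP => // j; exact: le_lt_trans (kb j) (H j). Qed.

(** The vertical segment ending at z is lifted to a timelike curve S whose distance from the line
    over k is within the horizon. S(s) is the unique lift near that line, so lifts obtained from
    different starting points fit together. *)
Lemma approach_track z k : approach z k -> `|z| <= r2 / 2 -> 0 < r2 ->
  exists (K s1 : R) (S : R -> X), [/\ 0 < K, 0 < s1, s1 <= r2 / 4,
    forall s : R, 0 < s -> s <= s1 ->
      [/\ fs (S s), Phi (S s) = z + s *: vup & hbound K (hmul (hinv k) (rsubmx (S s))) (S s 0 0)] &
    forall sa sb : R, 0 < sa -> sa < sb -> sb <= s1 -> exists Y V : R -> X,
      [/\ Y 0 = S sa, Y 1 = S sb, ftimelike A p Y V 0 1 &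
          forall s : R, 0 <= s <= 1 -> Y s = S (sa + s * (sb - sa))]].
Proof.
move=> ap zb r20; have pz := approach_pbdry ap.
have [K K0 HK] := horizon.
have [d d0 Hd] := near_line_unique k.
have [T HT] := ratio_small K0 d0.
have [s1 /andP[s10 s1r] Hs1] := pbdry_time T pz zb r20.
rewrite -/r2 in s1r.
have vn := vup_norm.
have th0 := @theta_gt0 R m; have th1 := @theta_le R m.
pose P (s : R) (x : X) := [/\ fs x, Phi x = z + s *: vup & near_line k d (rsubmx x)].
have tm (s : R) x : 0 < s -> s <= s1 -> fs x -> Phi x = z + s *: vup -> forall a, K / ratio a (x 0 0) < d.
  by move=> sp sl fx ex; apply: HT; apply: ltW; exact: (Hs1 s).
have uniq s x x' : P s x -> P s x' -> x = x'.
  by move=> [fx ex n] [fx' ex' n']; apply: Hd; rewrite ?ex.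
have zs (s : R) : 0 < s -> s <= s1 -> `|z + s *: vup| <= r2.
  by move=> sp sl; apply: le_trans (ler_normD _ _) _; rewrite (vn s (ltW sp)); lra.
have cinv : {for k, continuous (fun h => hmul (hinv k) h)}.
  refine (@hmul_continuous R m _ (fun=> hinv k) id k _ _); [exact: cst_continuous|exact: cvg_id].
have [d2 d20 Hd2] : exists2 d2 : R, 0 < d2 & forall h, `|h - k| < d2 -> `|hmul (hinv k) h| < d.
  have n : nbhs k ((fun h => hmul (hinv k) h) @^-1` [set h | `|h| < d]).
    apply: continuous_nbhs_pre cinv _; rewrite hmulVh.
    by apply: (@dist_nbhs _ _ _ _ d) => // h; rewrite /= sub0r normrN.
  by have [d2 d20 H] := nbhs_distP n; exists d2 => // h hk; apply: H; rewrite distrC.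
(* A point y provided by [approach] is taken so close to z that the segment from its image to z + s
   vup lies in the inner cone. *)
have ex (s eta : R) : 0 < s -> s <= s1 -> 0 < eta -> exists y x,
    [/\ `|rsubmx y - k| < eta, below y x & P s x].
  move=> sp sl eta0.
  pose dd := Num.min (Num.min eta d2) (Num.min (s * theta (R := R) (m := m) / 2) (r2 / 2)).
  have dd0 : 0 < dd.
    rewrite !lt_min eta0 d20 /=; apply/andP; split; last by rewrite divr_gt0.
    by rewrite divr_gt0// mulr_gt0.
  have [y [fy yt yk yz]] := ap dd dd0.
  move: yk yz; rewrite !lt_min => /andP[/andP[yk1 yk2] _] /andP[_ /andP[yz1 yz2]].
  have cu : cone_in (z + s *: vup - Phi y).
    rewrite addrAC addrC; apply: cone_in_vup_open => //; rewrite distrC; exact: ltW.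
  have yb : `|Phi y| <= r2.
    by rewrite -[Phi y](subrK z); apply: le_trans (ler_normD _ _) _; lra.
  have [|x bl ex] := lift_up fy cu yb.
    by rewrite subrKC; exact: zs.
  rewrite subrKC in ex; have [_ fx] := below_fs bl.
  exists y, x; split => //; split => //.
  exists (hmul (hinv k) (rsubmx y)), (hmul (hinv (rsubmx y)) (rsubmx x)); split.
  - exact: Hd2.
  - have [Y [V [Y0 Y1 tl _]]] := bl.
    have hb := HK Y V 1 ler01 tl; rewrite Y0 Y1 in hb.
    exact: (hbound_small d0 (tm s x sp sl fx ex) hb).
  - by rewrite hmulKVh hmulKVh.
have /choice[S HS] : forall s : R, exists x, 0 < s -> s <= s1 -> P s x.
  move=> s; have [sp|sn] := ltP 0 s; last by exists 0 => h; exfalso.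
  have [sl|sl] := leP s s1; last by exists 0 => _ h; exfalso.
  by have [y [x [_ _ Px]]] := ex s 1 sp sl ltr01; exists x.
(* Horizon bounds relative to points y below S(s) pass to the limit k, although no curve starts at k
   itself. *)
have lim (s : R) (f : 'rV[R]_(hdim m) -> R) (B : R) : 0 < s -> s <= s1 -> {for k, continuous f} ->
    (forall y, below y (S s) -> f (rsubmx y) <= B) -> f k <= B.
  move=> sp sl cf H; rewrite leNgt; apply/negP => Bf.
  have n : nbhs k (f @^-1` [set u | B < u]) by have := continuous_nbhs cf (@open_gt _ B); exact.
  have [et et0 He] := nbhs_distP n.
  have [y [x [yk bl Px]]] := ex s et sp sl et0.
  have e := uniq s x (S s) Px (HS s sp sl).
  have : B < f (rsubmx y) by apply: He; rewrite distrC.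
  by rewrite ltNge H// -e.
have hb (s : R) : 0 < s -> s <= s1 -> hbound K (hmul (hinv k) (rsubmx (S s))) (S s 0 0).
  move=> sp sl.
  have cm : {for k, continuous (fun h => hmul (hinv h) (rsubmx (S s)))}.
    refine (@hmul_continuous R m _ (@hinv R m) (fun=> rsubmx (S s)) k _ _).
      exact: hinv_continuous.
    exact: cst_continuous.
  have bb y : below y (S s) -> hbound K (hmul (hinv (rsubmx y)) (rsubmx (S s))) (S s 0 0).
    by move=> [Y [V [Y0 Y1 tl _]]]; have := HK Y V 1 ler01 tl; rewrite Y0 Y1.
  split=> [a|].
    apply: (lim s (fun h => `|hmul (hinv h) (rsubmx (S s)) 0 a|) _ sp sl).
      have ca : {for k, continuous (fun h => hmul (hinv h) (rsubmx (S s)) 0 a)}.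
        by apply: (@cvg_coord _ _ (nbhs k) (nbhs_filter k) 1 _ (fun h => hmul (hinv h) (rsubmx (S s))) _ 0 a).
      exact: (cvg_norm ca).
    by move=> y /bb[].
  apply: (lim s (fun h => `|hzeta (hmul (hinv h) (rsubmx (S s)))|) _ sp sl).
    exact: (cvg_norm (hzeta_continuous cm)).
  by move=> y /bb[].
exists K, s1, S; split => //.
  by move=> s sp sl; have [f e _] := HS s sp sl; split => //; exact: hb.
move=> sa sb sa0 sab sb1.
have sa1 : sa <= s1 by apply: le_trans (ltW sab) sb1.
have sb0 : 0 < sb := lt_trans sa0 sab.
have [fa ea _] := HS sa sa0 sa1.
have cu : cone_in ((sb - sa) *: vup : X) by apply: cone_inZ; [rewrite subr_gt0|exact: cone_in_vup].
have [||xb bl eb] := lift_up fa cu.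
- by rewrite ea; exact: zs.
- by rewrite ea -addrA -scalerDl subrKC; exact: zs.
have [Y [V [Y0 Y1 tl H]]] := bl.
have YS (s : R) : 0 <= s <= 1 -> Y s = S (sa + s * (sb - sa)).
  move=> /andP[s0 s1']; have ss : 0 <= s <= 1 by rewrite s0.
  have [fY eY] := H s ss.
  have q0 : 0 < sa + s * (sb - sa) by rewrite ltr_wpDr// mulr_ge0// subr_ge0 ltW.
  have q1 : sa + s * (sb - sa) <= s1.
    by apply: le_trans sb1; rewrite -lerBrDl ler_piMl// subr_ge0 ltW.
  have eY' : Phi (Y s) = z + (sa + s * (sb - sa)) *: vup.
    by rewrite eY ea eb ea; apply/rowP => j; rewrite !mxE; ring.
  apply: (uniq (sa + s * (sb - sa))); last exact: HS.
  split => //.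
  exists (hmul (hinv k) (rsubmx (S sa))), (hmul (hinv (rsubmx (S sa))) (rsubmx (Y s))); split.
  - exact: (hbound_small d0 (tm sa (S sa) sa0 sa1 fa ea) (hb sa sa0 sa1)).
  - have tls : ftimelike A p Y V 0 s by move=> u /andP[u0 us]; apply: tl; rewrite u0 (le_trans us).
    have hbs := HK Y V s s0 tls; rewrite Y0 in hbs.
    exact: (hbound_small d0 (tm _ (Y s) q0 q1 fY eY') hbs).
  - by rewrite hmulKVh hmulKVh.
exists Y, V; split => //.
have := YS 1 (introT andP (conj ler01 (lexx _))).
by rewrite mul1r subrKC.
Qed.

(** The dilated velocity is the contracted original one plus that of the dilation itself. Each
    component of the latter is at most K |l'| by [hbound]: horizontally through k, centrally through
    [hzeta]. The delay D shrinks each [ratio] by at least the factor 1 + c D. *)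
Lemma dilate_lt (t D l l' v0 V0 K : R) (k k' : 'rV[R]_(hdim m)) :
  0 < v0 -> 0 <= D -> 0 <= l <= 1 -> 0 <= K -> hbound K k t ->
  \sum_a (ratio a t * cow k k' a) ^+ 2 < v0 ^+ 2 ->
  l * v0 + (hdim m)%:R * K * `|l'| < (1 + c * D) * V0 ->
  \sum_a (ratio a (t + D) * cow (dil l k) (ddil l k l' k') a) ^+ 2 < V0 ^+ 2.
Proof.
move=> v00 D0 /andP[l0 l1] K0 [kb kz] H1 H2.
pose n : R := (hdim m)%:R.
have n1 : 1 <= n by rewrite ler1n.
have cD : 0 < 1 + c * D by rewrite ltr_pwDl// mulr_ge0// ltW.
have W0 : 0 <= l * v0 + n * K * `|l'|.
  by rewrite addr_ge0// ?mulr_ge0// ?ltW// (le_trans ler01 n1).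
have V00 : 0 < V0 by rewrite -(pmulr_rgt0 V0 cD); exact: le_lt_trans W0 H2.
pose u a := l * (if a == 0 then l else 1) * (ratio a t * cow k k' a).
pose w a := ratio a t * (if a == 0 then l * l' * hzeta k else l' * k 0 a).
have E a : ratio a t * cow (dil l k) (ddil l k l' k') a = u a + w a.
  rewrite /u /w; case: eqP => [->|/eqP a0]; first by rewrite cow_ddil0; ring.
  by rewrite cow_ddil//; ring.
have Su : \sum_a u a ^+ 2 <= (l * v0) ^+ 2.
  apply: (@le_trans _ _ (l ^+ 2 * \sum_a (ratio a t * cow k k' a) ^+ 2)); last first.
    by rewrite exprMn (ler_wpM2l (sqr_ge0 _))// ltW.
  rewrite mulr_sumr; apply: ler_sum => a _; rewrite /u; set q := ratio a t * _.
  rewrite [leLHS]exprMn (ler_wpM2r (sqr_ge0 q))//.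
  case: ifP => _; last by rewrite mulr1.
  by rewrite ler_sqr ?nnegrE ?mulr_ge0// ler_piMl.
have wb a : w a ^+ 2 <= (K * `|l'|) ^+ 2.
  have Kl : 0 <= K * `|l'| by rewrite mulr_ge0.
  rewrite -[w a ^+ 2]real_normK ?num_real// ler_sqr ?nnegrE//.
  rewrite /w normrM (gtr0_norm (rg a t)).
  have L x y : `|x| <= K / ratio a t -> `|y| <= `|l'| -> ratio a t * `|y * x| <= K * `|l'|.
    move=> hx hy; rewrite normrM mulrCA mulrC; apply: ler_pM => //; first by rewrite mulr_ge0// ltW.
    by rewrite mulrC -ler_pdivlMr.
  case: ifP => [/eqP a0|_]; last by apply: L => //; exact: kb.
  apply: L; first by rewrite a0; exact: kz.
  by rewrite normrM ler_piMl// ger0_norm.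
have Sw : \sum_a w a ^+ 2 <= (n * K * `|l'|) ^+ 2.
  apply: (@le_trans _ _ (\sum_(a : 'I_(hdim m)) (K * `|l'|) ^+ 2)); first exact: ler_sum.
  rewrite sumr_const card_ord -[leLHS]mulr_natl -/n -mulrA [leRHS]exprMn.
  rewrite (ler_wpM2r (sqr_ge0 _))// expr2 ler_peMl//; exact: le_trans ler01 n1.
have lv0 : 0 <= l * v0 by rewrite mulr_ge0// ltW.
have nK0 : 0 <= n * K * `|l'| by rewrite !mulr_ge0// (le_trans ler01 n1).
have S := sum_sqr_add lv0 nK0 Su Sw.
have q a : ratio a (t + D) * (1 + c * D) <= ratio a t.
  have h1 := ratio_decay_le A0 chi0 cp a t D0.
  have P := expR_gt0 (c * D).
  have e1 : expR (c * D) * expR (- (c * D)) = 1 by rewrite -expRD subrr expR0.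
  apply: (@le_trans _ _ (expR (- (c * D)) * ratio a t * (1 + c * D))).
    by rewrite ler_pM2r.
  apply: (@le_trans _ _ (expR (- (c * D)) * ratio a t * expR (c * D))).
    by rewrite ler_wpM2l ?expR_ge1Dx// mulr_ge0 ?expR_ge0// ltW.
  by rewrite mulrAC [expR (- _) * _]mulrC e1 mul1r.
have T : (1 + c * D) ^+ 2 * \sum_a (ratio a (t + D) * cow (dil l k) (ddil l k l' k') a) ^+ 2
   <= (l * v0 + n * K * `|l'|) ^+ 2.
  apply: le_trans S; rewrite mulr_sumr; apply: ler_sum => a _; rewrite -E.
  rewrite [X in _ * X]exprMn mulrA [leRHS]exprMn (ler_wpM2r (sqr_ge0 _))// -exprMn ler_sqr ?nnegrE.
  - by rewrite mulrC q.
  - by rewrite mulr_ge0// ltW.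
  - exact: ltW.
rewrite -(ltr_pM2l (_ : 0 < (1 + c * D) ^+ 2)) ?exprn_gt0//.
apply: le_lt_trans T _; rewrite -[ltRHS]exprMn ltr_sqr ?nnegrE//.
by rewrite mulr_ge0// ltW.
Qed.

Lemma time_ivt (Y V : R -> X) (t : R) : ftimelike A p Y V 0 1 -> Y 0 0 0 <= t <= Y 1 0 0 ->
  exists2 s : R, 0 <= s <= 1 & Y s 0 0 = t.
Proof.
move=> tl tt; have cY (s : R) : 0 <= s <= 1 -> {for s, continuous (fun u => Y u 0 0)}.
  by move=> ss; have [d _ _] := tl s ss; exact: is_derive_continuous (is_derive_coord 0 0 d).
have [||s] := @IVT R (fun u => Y u 0 0) 0 1 t ler01.
- by apply: continuous_in_subspaceT => u; rewrite inE/= in_itv/=; exact: cY.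
- case/andP: tt => a b; have le := le_trans a b.
  by rewrite (min_idPl le) (max_idPr le) a b.
by rewrite in_itv/= => ss e; exists s.
Qed.

Lemma time_nondecr (Y V : R -> X) (s : R) : ftimelike A p Y V 0 1 -> 0 <= s <= 1 -> Y 0 0 0 <= Y s 0 0.
Proof.
move=> tl /andP[s0 s1]; apply: (@derive_ge0_le _ (fun s => Y s 0 0) (fun s => V s 0 0)) => // u /andP[u0 us].
  by have [|d _ _] := tl u _; [rewrite u0 (le_trans us)|exact: is_derive_coord].
by have [|_ v _] := tl u _; [rewrite u0 (le_trans us)|exact: ltW].
Qed.

(* Squeezing a timelike curve near the boundary towards the vertical line over
   k, by a dilation centred at k, while delaying it slightly, keeps it
   timelike; confinement then shows that the line ends at the same point. *)
Lemma approach_line z k rho : approach z k -> `|z| <= r2 / 2 -> 0 < r2 -> 0 < rho ->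
  exists T : R, forall t, t <= T -> fs (pt t k) /\ `|Phi (pt t k) - z| <= rho.
Proof.
move=> ap zb r20 rho0.
have [K [s1 [S [K0 s10 s1r HS HY]]]] :=
  approach_track ap zb r20.
have pz := approach_pbdry ap.
pose rho1 := Num.min (rho / 5) (r / 10).
have r0 : 0 < r by move: r20; rewrite /r2; lra.
have rho10 : 0 < rho1 by rewrite lt_min; apply/andP; split; rewrite divr_gt0.
have rho1r : rho1 <= r / 10 by rewrite ge_min lexx orbT.
have rho1p : 5 * rho1 <= rho.
  have : rho1 <= rho / 5 by rewrite ge_min lexx.
  by lra.
pose st := Num.min s1 (rho1 / 2).
have st0 : 0 < st by rewrite lt_min s10 divr_gt0.
have sts1 : st <= s1 by rewrite ge_min lexx.
have strho : st <= rho1 / 2 by rewrite ge_min lexx orbT.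
have vn := vup_norm.
pose n : R := (hdim m)%:R.
have n0 : 0 <= n by [].
pose K2 := n * K.
have K20 : 0 <= K2 by rewrite mulr_ge0// ltW.
have E1 := expR_gt0 1 : 0 < expR 1 :> R.
have KE : 0 < K2 * expR 1 + 1 by rewrite ltr_wpDl// mulr_ge0// ltW.
(* The three smallness conditions of the profiles, with [K2] the dimension times the horizon
   constant. *)
pose e := Num.min 2^-1 (Num.min (K2 + 1)^-1 (c / 2 / (K2 * expR 1 + 1))).
have e0 : 0 < e.
  by rewrite !lt_min invr_gt0 ltr0n/= invr_gt0 ltr_wpDl//= divr_gt0// divr_gt0.
have e1 : e <= 2^-1 by rewrite ge_min lexx.
have Ke : K2 * e <= 1.
  have : e <= (K2 + 1)^-1 by rewrite !ge_min lexx !orbT.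
  move=> h; apply: (@le_trans _ _ ((K2 + 1) * e)); first by rewrite ler_wpM2r ?(ltW e0)// lerDl.
  by rewrite mulrC -ler_pdivlMr ?div1r// ltr_wpDl.
have eK : e * (K2 * expR 1 + 1) <= c / 2.
  by rewrite -ler_pdivlMr// !ge_min lexx !orbT.
have [ft et hbt] := HS st st0 sts1.
set x1 := S st in ft et hbt; set k1 := hmul (hinv k) (rsubmx x1) in hbt.
have [d d0 Hd] : exists2 d : R, 0 < d & forall eta l : R, `|eta| < d -> `|l| < d ->
    `|Phi (pt (x1 0 0 + eta) (hmul k (dil (1 - l) k1))) - z| < rho1.
  pose f (q : R * R) := pt (x1 0 0 + q.1) (hmul k (dil (1 - q.2) k1)).
  have f0 : f (0, 0) = x1.
    by rewrite /f /= addr0 subr0 dil1 /k1 hmulKVh pt_eta.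
  have cf : {for (0, 0), continuous f}.
    apply: pt_continuous; first by apply: cvgD; [exact: cvg_cst|exact: cvg_fst].
    refine (@hmul_continuous R m _ (fun=> k) (fun q : R * R => dil (1 - q.2) k1) (0, 0) _ _).
      exact: cst_continuous.
    apply: dil_continuous; last exact: cst_continuous.
    by apply: cvgB; [exact: cvg_cst|exact: cvg_snd].
  have nx : nbhs (f (0, 0)) [set y | `|Phi y - z| < rho1].
    rewrite f0; have cP := Phi_continuous (proj1 ft).
    have cn : {for x1, continuous (fun y => `|Phi y - z|)}.
      have cb : {for x1, continuous (fun y => Phi y - z)} by apply: (cvgB cP); exact: cvg_cst.
      exact: (cvg_norm cb).
    have := continuous_nbhs cn (@open_lt _ rho1); apply.
    by rewrite /= et [z + _]addrC addrK (vn _ (ltW st0)); lra.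
  have [d d0 Hd] := nbhs_pairP (continuous_nbhs_pre cf nx).
  by exists d => // eta l h1 h2; apply: (Hd eta l); rewrite sub0r normrN.
have [V0 V00 HV] := profile_cvg c0 e0 d0.
have iv0 : 0 < e^-1 by rewrite invr_gt0.
(* The deformed curve meets the line at elapsed time 1 / e and is then delayed by [advance] at 1 /
   e, so starting at t0 - [del] makes it meet the line at time t0. *)
pose del := e^-1 + advance c e e^-1.
pose V1 := V0 + e^-1.
exists (x1 0 0 - V1 + del) => t0 t0T.
pose ta := t0 - del.
have taV : ta <= x1 0 0 - V1.
  by rewrite /ta lerBlDr.
have [sb /andP[sb0 sbr] Hsb] :=
  pbdry_time ta pz zb r20.
pose s0 := Num.min sb (st / 2).
have s00 : 0 < s0 by rewrite lt_min sb0 divr_gt0.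
have s0b : s0 <= sb by rewrite ge_min lexx.
have s0t : s0 < st by rewrite gt_min; apply/orP; right; lra.
have V10 : 0 < V1 by rewrite addr_gt0.
have [sa [sa0 sat eta_]] : exists sa : R, [/\ 0 < sa, sa < st & S sa 0 0 = ta].
  have [Y [V [Y0 Y1 tl YS]]] := HY s0 st s00 s0t sts1.
  have [f0 e0' _] := HS s0 s00 (le_trans (ltW s0t) sts1).
  have l0 : S s0 0 0 < ta by apply: (Hsb s0).
  have [s ss es] : exists2 s : R, 0 <= s <= 1 & Y s 0 0 = ta.
    apply: (time_ivt tl); rewrite Y0 Y1 (ltW l0)/= -/x1.
    by apply: le_trans taV _; rewrite gerBl ltW.
  exists (s0 + s * (st - s0)); rewrite -YS//; split => //.
    by rewrite ltr_wpDr// mulr_ge0 ?subr_ge0 ?(ltW s0t)//; case/andP: ss.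
  rewrite -ltrBrDl -[ltRHS]mul1r ltr_pM2r ?subr_gt0//.
  have [_ s1'] := andP ss; rewrite lt_neqAle s1' andbT.
  apply: contraTneq taV => s1e; rewrite -es s1e Y1 -/x1 -ltNge gtrBl.
  exact: V10.
have sas1 : sa <= s1 by apply: le_trans (ltW sat) sts1.
have [Y [V [Y0 Y1 tl YS]]] := HY sa st sa0 sat sts1.
have [fa ea _] := HS sa sa0 sas1.
pose v s := Y s 0 0 - ta.
have v_ge0 (s : R) : 0 <= s <= 1 -> 0 <= v s.
  by move=> ss; rewrite subr_ge0 -eta_ -Y0; exact: (time_nondecr tl ss).
have YP (s : R) : 0 <= s <= 1 -> fs (Y s) /\ hbound K (hmul (hinv k) (rsubmx (Y s))) (Y s 0 0).
  move=> ss; rewrite (YS s ss); have [s0' s1'] := andP ss.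
  have q0 : 0 < sa + s * (st - sa) by rewrite ltr_wpDr// mulr_ge0// subr_ge0 ltW.
  have q1 : sa + s * (st - sa) <= s1.
    by apply: le_trans sts1; rewrite -lerBrDl ler_piMl// subr_ge0 ltW.
  by have [f _ hb] := HS _ q0 q1.
pose kk s := hmul (hinv k) (rsubmx (Y s)).
pose kk' s := dhmul (hinv k) (rsubmx (V s)).
pose D := advance c e; pose dD := dadvance c e; pose mu := shrink e; pose dmu := dshrink e.
pose l kap s := 1 - kap * mu (v s).
pose l' kap s := - (kap * (dmu (v s) * V s 0 0)).
pose Q kap s := pt (Y s 0 0 + kap * D (v s)) (hmul k (dil (l kap s) (kk s))).
pose dQ kap s := pt (V s 0 0 * (1 + kap * dD (v s))) (dhmul k (ddil (l kap s) (kk s) (l' kap s) (kk' s))).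
have dv (s : R) : 0 <= s <= 1 -> is_derive s 1 v (V s 0 0).
  move=> ss; have [dY _ _] := tl s ss.
  have := is_deriveB (is_derive_coord 0 0 dY) (is_derive_cst ta s (1 : R)).
  by move=> h; apply: is_derive_eq h _; rewrite subr0.
have dcomp (f : R -> R) (s df : R) : 0 <= s <= 1 -> is_derive (v s) 1 f df ->
    is_derive s 1 (fun u => f (v u)) (V s 0 0 * df).
  by move=> ss h; exact: (is_derive_compR (dv s ss) h).
(* All stages of the deformation are timelike, as [confinement] demands: delay and contraction are
   scaled by the same factor kap. *)
have tlQ kap : 0 <= kap <= 1 -> ftimelike A p (Q kap) (dQ kap) 0 1.
  move=> k01 s ss; have [dY vY qY] := tl s ss; have [kp0 kp1] := andP k01.
  have vs := v_ge0 s ss; have [_ hb] := YP s ss.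
  have D0 : 0 <= D (v s) by apply: advance_ge0.
  have mu0 : 0 <= mu (v s) by apply: shrink_ge0.
  have mu1 : mu (v s) <= 1 by apply: shrink_le1.
  have dD1 : - 2^-1 <= dD (v s) by apply: dadvance_ge.
  have V0' : 0 < 1 + kap * dD (v s).
    have : kap * - 2^-1 <= kap * dD (v s) by rewrite ler_wpM2l.
    move=> h; apply: (@lt_le_trans _ _ (1 + kap * - 2^-1)); last by rewrite lerD2l.
    rewrite mulrN subr_gt0; apply: (@le_lt_trans _ _ 2^-1); first by rewrite ler_piMl.
    by rewrite invf_lt1// ltr1n.
  split; last 2 first.
  - by rewrite /dQ pt_time; exact: mulr_gt0 vY V0'.
  - rewrite qform_family// !pt_time !pt_space pmulr_rlt0 ?exprn_gt0// subr_lt0.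
    under eq_bigr do rewrite cow_dhmul.
    move: qY; rewrite qform_family// pmulr_rlt0 ?exprn_gt0// subr_lt0 => qY.
    have qY' : \sum_a (ratio a (Y s 0 0) * cow (kk s) (kk' s) a) ^+ 2 < V s 0 0 ^+ 2.
      by under eq_bigr do rewrite cow_dhmul.
    (* At kap = 0 the deformed curve is the original one; [profile_cond] is strict and asks for kap
       > 0. *)
    have [kz|kn0] := eqVneq kap 0.
      rewrite /l /l' kz !mul0r oppr0 !addr0 mulr1 dil1.
      have -> : ddil 1 (kk s) 0 (kk' s) = kk' s.
        apply/rowP => a; rewrite mxE expr1n !mul1r mulr0 !mul0r !add0r; by case: ifP.
      exact: qY'.
    have kp : 0 < kap <= 1 by rewrite lt_neqAle eq_sym kn0 kp0.
    apply: (dilate_lt (K := K) (v0 := V s 0 0)) => //.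
    + by rewrite mulr_ge0.
    + rewrite /l subr_ge0 lerBlDr lerDl mulr_ge0// andbT; exact: mulr_ile1.
    + exact: ltW.
    have h : 1 - kap * mu (v s) + K2 * (kap * `|dmu (v s)|) < (1 + c * (kap * D (v s))) * (1 + kap * dD (v s)).
      by apply: profile_cond.
    have nl : `|l' kap s| = kap * (`|dmu (v s)| * V s 0 0).
      by rewrite /l' normrN normrM (ger0_norm kp0) (normrM (dmu _)) (gtr0_norm vY).
    rewrite nl [ltRHS]mulrCA.
    rewrite -/n -/K2.
    have -> : l kap s * V s 0 0 + K2 * (kap * (`|dmu (v s)| * V s 0 0)) =
      V s 0 0 * (1 - kap * mu (v s) + K2 * (kap * `|dmu (v s)|)) by rewrite /l; ring.
    by rewrite (ltr_pM2l vY).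
  rewrite /Q /dQ; apply: is_derive_pt.
    have h1 := dcomp D s _ ss (is_derive_advance c e (v s)).
    have h2 := is_deriveD (is_derive_coord 0 0 dY) (is_deriveZ kap h1).
    by apply: is_derive_eq h2 _; rewrite /GRing.scale /= /dD; ring.
  apply: is_derive_hmul; apply: is_derive_dil; last first.
    by apply: is_derive_hmul; exact: is_derive_rsubmx.
  have h1 := dcomp mu s _ ss (is_derive_shrink e (v s)).
  have h2 := is_deriveB (is_derive_cst (1 : R) s (1 : R)) (is_deriveZ kap h1).
  by apply: is_derive_eq h2 _; rewrite /GRing.scale /= /l' /dmu; ring.
have Q0 s : Q 0 s = Y s by rewrite /Q /l !mul0r addr0 subr0 dil1 /kk hmulKVh pt_eta.
have v0e : v 0 = 0 by rewrite /v Y0 eta_ subrr.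
have Qs kap : Q kap 0 = S sa.
  rewrite /Q /l v0e /D /advance /mu /shrink !mulr0 oppr0 expR0 subrr mul0r !mulr0 subr0 dil1 addr0.
  by rewrite /kk Y0 hmulKVh pt_eta.
have cQ kap (s : R) : 0 <= kap <= 1 -> 0 <= s <= 1 ->
    {for (kap, s), continuous (fun q : R * R => Q q.1 q.2)}.
  move=> _ ss; have [dY _ _] := tl s ss.
  have c1' : {for (kap, s), continuous (@fst R R)} by exact: cvg_fst.
  have c4 : {for (kap, s), continuous (fun q : R * R => Y q.2 0 0)}.
    exact: is_derive_continuous_snd (is_derive_coord 0 0 dY).
  have c5 : {for (kap, s), continuous (fun q : R * R => D (v q.2))}.
    exact: is_derive_continuous_snd (dcomp D s _ ss (is_derive_advance c e (v s))).
  have c6 : {for (kap, s), continuous (fun q : R * R => mu (v q.2))}.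
    exact: is_derive_continuous_snd (dcomp mu s _ ss (is_derive_shrink e (v s))).
  have c7 : {for (kap, s), continuous (fun q : R * R => kk q.2)}.
    exact: is_derive_continuous_snd (is_derive_hmul (hinv k) (is_derive_rsubmx dY)).
  apply: pt_continuous; first by apply: (cvgD c4); exact: (cvgM c1' c5).
  refine (@hmul_continuous R m _ (fun=> k) (fun q : R * R => dil (l q.1 q.2) (kk q.2)) (kap, s) _ _).
    exact: cst_continuous.
  apply: dil_continuous c7.
  by apply: cvgB; [exact: cvg_cst|exact: (cvgM c1' c6)].
have u01 : 0 <= (1 : R) <= 1 := introT andP (conj (@ler01 R) (lexx (1 : R))).
have v1 : V1 <= v 1.
  by rewrite /v Y1 -/x1; move: taV; lra.
have ends kap : 0 <= kap <= 1 -> `|Phi (Q kap 0) - z| <= rho1 /\ `|Phi (Q kap 1) - z| <= rho1.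
  move=> /andP[kp0 kp1]; rewrite Qs ea [z + _]addrC addrK (vn _ (ltW sa0)).
  split; first by move: strho sat; lra.
  have [h1 h2] : `|D (v 1)| < d /\ `|mu (v 1)| < d by apply: HV; move: v1; rewrite /V1; lra.
  rewrite /Q /l /kk Y1 -/x1 -/k1; apply: ltW; apply: Hd.
    by rewrite normrM (ger0_norm kp0); apply: le_lt_trans h1; rewrite ler_piMl.
  by rewrite normrM (ger0_norm kp0); apply: le_lt_trans h2; rewrite ler_piMl.
have rr : `|z| + 5 * rho1 < r by move: zb rho1r; rewrite /r2; lra.
have fQ0 (s : R) : 0 <= s <= 1 -> fs (Q 0 s) by move=> ss; rewrite Q0; have [] := YP s ss.
have conf := confinement lx ler01 rr cQ tlQ fQ0 ends.
(* The parameter of elapsed time 1 / e, where the contraction is complete. *)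
have [s ss es] : exists2 s : R, 0 <= s <= 1 & Y s 0 0 = ta + e^-1.
  apply: (time_ivt tl); rewrite Y0 Y1 eta_ -/x1; apply/andP; split; first by rewrite lerDl ltW.
  by move: taV; rewrite /V1; lra.
have [f b _ _] := conf 1 u01 s ss.
have vs : v s = e^-1 by rewrite /v es [ta + _]addrC addrK.
have EQ : Q 1 s = pt t0 k.
  have m1 : mu e^-1 = 1 by rewrite /mu /shrink mulfV ?gt_eqF// subrr expR0 mul1r.
  rewrite /Q /l vs m1 !mul1r subrr dil0 hmulh0 es; congr pt.
  by rewrite /ta /del -/D; ring.
by rewrite -EQ; split; [exact: f|exact: le_trans b rho1p].
Qed.

(** * Slices of constant time near the boundary *)

Local Notation theta := (theta (R := R) (m := m)).
(* The integral curve through k0 of the left-invariant field dual to w^i. *)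
Definition kline (k0 : 'rV[R]_(hdim m)) i (u : R) : 'rV[R]_(hdim m) := hmul k0 (u *: delta_mx 0 i).

Lemma kline0 k0 i : kline k0 i 0 = k0.
Proof. by rewrite /kline scale0r hmulh0. Qed.

Lemma kline_coord k0 i u : i != 0 -> kline k0 i u 0 i = k0 0 i + u.
Proof. by move=> i0; rewrite hmulhE// !mxE !eqxx mulr1. Qed.

Lemma kline_continuous k0 i (T : topologicalType) (f : T -> R) x : {for x, continuous f} ->
  {for x, continuous (fun y => kline k0 i (f y))}.
Proof.
move=> cf; refine (@hmul_continuous R m _ (fun=> k0) (fun y => f y *: delta_mx 0 i) x _ _).
  exact: cst_continuous.
by apply: cvgZr_tmp; exact: cf.
Qed.

Lemma Phi_norm_open x rho : O x -> `|Phi x| < rho -> nbhs x [set y | `|Phi y| < rho].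
Proof.
move=> Ox; have cn : {for x, continuous (fun y => `|Phi y|)}.
  exact: (cvg_norm (Phi_continuous Ox)).
by have := continuous_nbhs cn (@open_lt _ rho); apply.
Qed.

Lemma kline_exit k0 i t (u1 rho : R) : 0 <= u1 -> rho < r ->
  fs (pt t k0) -> `|Phi (pt t k0)| < rho ->
  (forall u : R, 0 <= u <= u1 -> fs (pt t (kline k0 i u)) -> `|Phi (pt t (kline k0 i u))| <> rho) ->
  forall u : R, 0 <= u <= u1 -> fs (pt t (kline k0 i u)) /\ `|Phi (pt t (kline k0 i u))| < rho.
Proof.
move=> u10 rr f0 b0 H.
pose x u := pt t (kline k0 i u).
have cx (u : R) : {for u, continuous x}.
  by apply: pt_continuous; [exact: cst_continuous|apply: kline_continuous; exact: cvg_id].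
apply: (@real_induction R 0 u1 (fun u => fs (x u) /\ `|Phi (x u)| < rho)) => u u01 IH.
have [u0 uu] := andP u01.
have here : fs (x u) /\ `|Phi (x u)| < rho.
  have [->|un] := eqVneq u 0; first by rewrite /x kline0.
  have up : 0 < u by rewrite lt_neqAle eq_sym un.
  have lefts : \forall v \near u^'-, 0 <= v < u.
    by near=> v; apply/andP; split; [near: v; exact: nbhs_left_ge|near: v; exact: nbhs_left_lt].
  have csl : x @ u^'- --> x u by apply: cvg_at_left_filter; exact: cx.
  have [Ou bu] : O (x u) /\ `|Phi (x u)| <= rho.
    apply: (closed_cvg _ (lx_closed lx rr) _ _ csl).
    by apply: filterS lefts => v /IH[[Ov _] bv]; split; [exact: Ov|exact: ltW].
  have fu : fs (x u).
    apply: (fs_closed_in Ou) => U Uz.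
    have n1 : nbhs (x u) (Phi @^-1` U) := Phi_continuous Ou Uz.
    have n2 : \forall v \near u^'-, U (Phi (x v)) := csl _ n1.
    have [v [v1 v2]] := filter_ex (filterI lefts n2).
    exists (Phi (x v)); split; last exact: v2.
    by exists (x v); [exact: (proj1 (IH v v1))|].
  split; [exact: fu|rewrite lt_neqAle bu andbT; apply/eqP; exact: H].
have n : nbhs u (x @^-1` (fs `&` [set y | `|Phi y| < rho])).
  apply: (continuous_nbhs_pre (cx u)); apply: filterI.
    exact: (future_side_near lx (proj1 here)).
  by apply: Phi_norm_open; [exact: (proj1 (proj1 here))|exact: (proj2 here)].
have [d d0 Hd] := nbhs_distP n; exists d; first exact: d0.
move=> v v01 vd; have [vu|uv] := ltP v u; last exact: (Hd v (dist_lt_of_le uv vd)).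
by apply: IH; rewrite vu andbT; case/andP: v01.
Unshelve. all: by end_near. Qed.

(* Near the boundary the lines over all points close to k0 end close to each
   other: otherwise some other boundary point would be the end of the line
   over k0. *)
Lemma kline_uniform k0 i rho : approach 0 k0 -> 0 < r2 -> 0 < rho -> rho <= r2 / 2 ->
  forall d : R, 0 < d -> exists u1 T : R, [/\ 0 < u1, u1 < d & forall t u : R, t <= T -> 0 <= u <= u1 ->
    fs (pt t (kline k0 i u)) /\ `|Phi (pt t (kline k0 i u))| < rho].
Proof.
move=> ap r20 rho0 rhor d d0.
have z0 : `|0 : X| <= r2 / 2 by rewrite normr0 divr_ge0// ltW.
have rr : rho < r by move: r20 rhor; rewrite /r2; lra.
have rho20 : 0 < rho / 2 by rewrite divr_gt0.
have [T HT] := approach_line ap z0 r20 rho20.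
have HT' t : t <= T -> fs (pt t k0) /\ `|Phi (pt t k0)| < rho.
  by move=> /HT[f b]; split; [exact: f|rewrite -[Phi _]subr0; lra].
apply: contrapT => N.
(* Over a compact time interval the claim holds by uniformity, so a failure can only occur at times
   tending to -oo. *)
have near_cpt B : exists2 u1 : R, 0 < u1 & forall t u : R, B <= t <= T -> 0 <= u <= u1 ->
    `|Phi (pt t (kline k0 i u))| < rho.
  have [|d1 d10 Hd1] := @segment_uniform R B T 0 (fun u t => `|Phi (pt t (kline k0 i u))| < rho).
    move=> t /andP[_ tT]; have [f b] := HT' t tT.
    pose g (q : R * R) := pt q.2 (kline k0 i q.1).
    have cg : {for (0, t), continuous g}.
      by apply: pt_continuous; [exact: cvg_snd|apply: kline_continuous; exact: cvg_fst].
    have ng : nbhs (g (0, t)) [set y | `|Phi y| < rho].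
      by rewrite /g /= kline0; apply: Phi_norm_open; [exact: (proj1 f)|exact: b].
    have [d2 d20 Hd2] := nbhs_pairP (continuous_nbhs_pre cg ng).
    by exists d2 => // u' t' hu ht; exact: (Hd2 u' t' hu ht).
  exists (d1 / 2); first by rewrite divr_gt0.
  move=> t u tt /andP[u0 u1]; apply: Hd1 => //; rewrite sub0r normrN ger0_norm//; lra.
(* If the claim fails, curves issuing from the line over k0 reach the sphere of radius rho at times
   tending to -oo and parameters tending to 0. A cluster point z of their images is again approached
   over k0. *)
have ex (n : nat) : exists q : R * R, [/\ q.1 < - n%:R, 0 <= q.2, q.2 < n.+1%:R^-1,
    fs (pt q.1 (kline k0 i q.2)) & `|Phi (pt q.1 (kline k0 i q.2))| = rho].
  have [u1 u10 Hu1] := near_cpt (- n%:R).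
  have n0 : 0 < n.+1%:R^-1 :> R by rewrite invr_gt0 ltr0n.
  pose u2 := Num.min u1 (Num.min (d / 2) (n.+1%:R^-1 / 2)).
  have u20 : 0 < u2.
    by rewrite !lt_min u10 /=; apply/andP; split; rewrite divr_gt0.
  have u21 : u2 <= u1 by rewrite ge_min lexx.
  have u2d : u2 <= d / 2 by rewrite !ge_min lexx !orbT.
  have u2n : u2 <= n.+1%:R^-1 / 2 by rewrite !ge_min lexx !orbT.
  apply: contrapT => N'; apply: N; exists u2, T; split; [exact: u20|lra|].
  move=> t u tT uu; have [f b] := HT' t tT.
  apply: (@kline_exit k0 i t u2 rho (ltW u20) rr f b) => // v vv fv bv; apply: N'.
  have [v0 v1] := andP vv.
  exists (t, v); split => //=; last first.
    apply: (le_lt_trans (le_trans v1 u2n)).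
    by rewrite ltr_pdivrMr// ltr_pMr// ltr1n.
  rewrite ltNge; apply/negP => tn.
  have : `|Phi (pt t (kline k0 i v))| < rho.
    by apply: Hu1; [rewrite tn tT|rewrite v0 (le_trans v1)].
  by rewrite bv ltxx.
have /choice[q Hq] := ex.
pose y n := pt (q n).1 (kline k0 i (q n).2).
have PF : ProperFilter ((fun n => Phi (y n)) @ \oo) by apply: fmap_proper_filter.
have fM : ((fun n => Phi (y n)) @ \oo) [set x | `|x| <= rho].
  by apply: (@filterE _ \oo _) => n; have [_ _ _ _ b] := Hq n; rewrite /= b.
have [z zb cz] := rV_cluster setT PF fM.
have near_z (e : R) : 0 < e -> exists n : nat, [/\ `|Phi (y n) - z| < e, e^-1 <= n%:R & n.+1%:R^-1 < e].
  move=> e0.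
  have n1 : \forall n \near \oo, n.+1%:R^-1 < e by exact: (@near_infty_natSinv_lt R (PosNum e0)).
  have n3 : \forall n \near \oo, e^-1 <= n%:R :> R by exact: nbhs_infty_ger.
  have n2 : ((fun n => Phi (y n)) @ \oo)
      [set w | exists n, [/\ w = Phi (y n), e^-1 <= n%:R & n.+1%:R^-1 < e]].
    by apply: filterS2 n1 n3 => n h1 h2; exists n.
  have nk : nbhs z [set w | `|w - z| < e].
    by apply: (@dist_nbhs _ _ _ _ e) => // h; rewrite /= distrC.
  by have [h [[n [-> h1 h2]] hk]] := cz _ _ n2 nk; exists n.
have ck : {for 0, continuous (fun u : R => kline k0 i u)} by apply: kline_continuous; exact: cvg_id.
have apz : approach z k0.
  move=> e e0.
  have nk : nbhs (0 : R) ((fun u : R => kline k0 i u) @^-1` [set h | `|h - k0| < e]).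
    apply: (continuous_nbhs_pre ck); rewrite kline0.
    by apply: (@dist_nbhs _ _ _ _ e) => // h; rewrite /= distrC.
  have [e1 e10 He1] := nbhs_distP nk.
  have [|n [n1 n2 n3]] := near_z (Num.min e e1); first by rewrite lt_min e0.
  have [q1 q2 q3 fq bq] := Hq n.
  exists (y n); split.
  - exact: fq.
  - rewrite /y pt_time; apply: lt_le_trans q1 _; rewrite lerN2; apply: le_trans n2.
    by rewrite lef_pV2 ?posrE ?lt_min ?e0// ge_min lexx.
  - rewrite /y pt_space; apply: He1; rewrite sub0r normrN ger0_norm//.
    by apply: lt_trans q3 _; apply: lt_le_trans n3 _; rewrite ge_min lexx orbT.
  - by apply: lt_le_trans n1 _; rewrite ge_min lexx.
have zrho : rho <= `|z|.
  apply/ler_addgt0Pl => e e0; have [n [n1 _ _]] := near_z e e0.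
  have [_ _ _ _ bq] := Hq n; rewrite -bq -/(y n) -[Phi (y n)](subrK z) addrC.
  by apply: le_trans (ler_normD _ _) _; rewrite addrC lerD2r ltW.
have zb' : `|z| <= r2 / 2 := le_trans zb rhor.
have rho80 : 0 < rho / 8 by rewrite divr_gt0.
(* The line over k0 would finally be within rho / 2 of 0 and within rho / 8 of z, although |z| >=
   rho. *)
have [T' HT''] := approach_line apz zb' r20 rho80.
pose t := Num.min T T'.
have [|_ b1] := HT t; first by rewrite ge_min lexx.
have [|_ b2] := HT'' t; first by rewrite ge_min lexx orbT.
rewrite subr0 in b1.
have := ler_normD (z - Phi (pt t k0)) (Phi (pt t k0)); rewrite subrK distrC.
by move: zrho b1 b2; lra.
Qed.

Lemma near_line_open k0 d h : near_line k0 d h -> nbhs h (near_line k0 d).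
Proof.
move=> [e [l [he hl E]]].
have cm : {for h, continuous (fun h' => hmul (hinv (hmul k0 e)) h')}.
  refine (@hmul_continuous R m _ (fun=> hinv (hmul k0 e)) id h _ _); [exact: cst_continuous|exact: cvg_id].
have d0 : 0 < d - `|l| by rewrite subr_gt0.
have n : nbhs (hmul (hinv (hmul k0 e)) h) [set l' | `|l'| < d].
  rewrite E hmulKh; apply: (@dist_nbhs _ _ _ _ (d - `|l|)) => // l' h1; rewrite /=.
  have := ler_normD (l' - l) l; rewrite subrK distrC; move: h1; lra.
apply: filterS (continuous_nbhs_pre cm n) => h' h1.
by exists e, (hmul (hinv (hmul k0 e)) h'); rewrite hmulKVh.
Qed.

Lemma cone_in_opp (a : R) (u : X) : 0 < a -> `|u| <= a * theta / 2 -> cone_in (a *: vup - u).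
Proof. by move=> a0 ub; apply: cone_in_vup_open => //; rewrite normrN. Qed.

Lemma back_step (w e : R) : 0 < w -> 0 < e -> exists w', [/\ 0 <= w', w' < w & `|w - w'| < e].
Proof.
move=> w0 e0; exists (Num.max 0 (w - e / 2)); have h : w - e / 2 < w by rewrite gtrBl divr_gt0.
have l : Num.max 0 (w - e / 2) < w by rewrite gt_max w0.
split; [by rewrite le_max lexx|exact: l|rewrite gtr0_norm ?subr_gt0//].
rewrite ltrBlDr -ltrBlDl; apply: (@lt_le_trans _ _ (w - e / 2)); last by rewrite le_max lexx orbT.
by rewrite ltrD2l ltrN2 ltr_pdivrMr// ltr_pMr// ltr1n.
Qed.

(* Going down a vertical line, the slice is met before the image is left, since
   the time tends to -oo there. *)
Lemma slice_meets x0 (u : X) (L : R) : 0 < r2 -> fs x0 -> `|Phi x0| <= r2 -> 0 < L -> `|u| <= L * theta / 2 ->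
  (forall v : R, `|v| <= L -> `|Phi x0 + u + v *: vup| <= r2 / 2) ->
  exists v x, [/\ `|v| <= L, fs x, Phi x = Phi x0 + u + v *: vup & x 0 0 = x0 0 0].
Proof.
move=> r20 f0 b0 L0 ub Hb; apply: contrapT => N; set t1 := x0 0 0 in N.
have r2h : r2 / 2 <= r2 by rewrite ler_pdivrMr// ler_peMr ?ler1n// ltW.
pose g (w : R) := Phi x0 + u + (L - w) *: (vup : X).
have L2 : 0 <= 2 * L by rewrite mulr_ge0// ltW.
have gb (w : R) : 0 <= w <= 2 * L -> `|g w| <= r2 / 2.
  move=> /andP[w0 w2]; apply: Hb; rewrite ler_norml lerBlDr lerDl w0 andbT.
  by rewrite lerBrDl lerBlDr -mulr2n -mulr_natl.
have cg (w : R) : {for w, continuous g}.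
  apply: cvgD; first exact: cvg_cst.
  by apply: cvgZr_tmp; apply: cvgB; [exact: cvg_cst|exact: cvg_id].
have l22 : 0 <= 2 * L <= 2 * L by rewrite L2 lexx.
have top : cone_in (g 0 - Phi x0).
  rewrite (_ : g 0 - Phi x0 = L *: vup + u); first exact: cone_in_vup_open.
  by rewrite /g; apply/rowP => j; rewrite !mxE; ring.
pose P w := exists x, [/\ fs x, Phi x = g w & t1 < x 0 0].
have olt : open (fs `&` [set y | y 0 0 < t1]).
  apply: openI; first exact: (fs_open).
  by apply: open_comp (@open_lt _ t1) => y _; exact: time_continuous.
have ogt : open (fs `&` [set y | t1 < y 0 0]).
  apply: openI; first exact: (fs_open).
  by apply: open_comp (@open_gt _ t1) => y _; exact: time_continuous.
have img Q : open (fs `&` Q) -> open (Phi @` (fs `&` Q)).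
  by move=> oQ; apply: (lx_openmap lx) oQ => y [[]].
have all w : 0 <= w <= 2 * L -> P w.
  apply: (@real_induction R 0 (2 * L) P) => {}w ww IH.
  have [w0 w2] := andP ww.
  have IH' w' : 0 <= w' -> w' < w -> P w' by move=> h1 h2; apply: IH; rewrite h1 h2.
  have [x fx ex] : exists2 x, fs x & Phi x = g w.
    have [wz|wn] := eqVneq w 0.
      have [|x bl ex] := lift_up f0 top b0.
        by rewrite subrKC -wz; exact: le_trans (gb w ww) r2h.
      by exists x; [exact: (proj2 (below_fs bl))|rewrite ex subrKC wz].
    have wp : 0 < w by rewrite lt_neqAle eq_sym wn.
    have clg : closure (Phi @` fs) (g w).
      move=> V Vg; have [e e0 He] := nbhs_distP (continuous_nbhs_pre (cg w) Vg).
      have [w' [w'0 w'w w'e]] := back_step wp e0.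
      have [x [fx ex _]] := IH' w' w'0 w'w.
      by exists (g w'); split; [exists x|exact: He].
    have [x Ox ex] : (Phi @` O) (g w).
      apply: contrapT => ng.
      have pg : pbdry (g w) by split.
      have [sg /andP[sg0 _] Hsg] := pbdry_time t1 pg (gb w ww) r20.
      have [w' [w'0 w'w w'e]] := back_step wp sg0.
      have [x [fx ex tx]] := IH' w' w'0 w'w.
      have ww' : 0 < w - w' by rewrite subr_gt0.
      have le' : w - w' <= sg by rewrite -(gtr0_norm ww'); exact: ltW.
      have : x 0 0 < t1.
        apply: (Hsg (w - w') x ww' le' fx); rewrite ex /g.
        by apply/rowP => j; rewrite !mxE; ring.
      by move=> h; have := lt_trans h tx; rewrite ltxx.
    by exists x; [apply: (fs_closed_in Ox); rewrite ex|].
  have tx : t1 < x 0 0.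
    rewrite lt_neqAle eq_sym; apply/andP; split.
      apply/eqP => e; apply: N; exists (L - w), x; split; [|exact: fx|exact: ex|exact: e].
      have [h1 h2] := andP ww; rewrite ler_norml lerBlDr lerDl h1 andbT.
      by rewrite lerBrDl lerBlDr -mulr2n -mulr_natl.
    rewrite leNgt; apply/negP => xt.
    have [wz|wn] := eqVneq w 0.
      have cu : cone_in (Phi x - Phi x0) by rewrite ex wz.
      have bx : `|Phi x| <= r2 by rewrite ex; exact: le_trans (gb w ww) r2h.
      have h := time_lt f0 fx cu b0 bx.
      by have := lt_trans h xt; rewrite ltxx.
    have wp : 0 < w by rewrite lt_neqAle eq_sym wn.
    have ng : nbhs (g w) (Phi @` (fs `&` [set y | y 0 0 < t1])).
      by apply: open_nbhs_nbhs; split; [exact: img|exists x].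
    have [e e0 He] := nbhs_distP (continuous_nbhs_pre (cg w) ng).
    have [w' [w'0 w'w w'e]] := back_step wp e0.
    have [y [fy ey ty]] := IH' w' w'0 w'w.
    have [x' [fx' tx'] ex'] := He w' w'e.
    have st := lx_fiber lx (proj1 fy) (proj1 fx') (etrans ey (esym ex')).
    have [et _] := stproj_eqP st.
    by move: ty tx'; rewrite /= et => h1 h2; have := lt_trans h1 h2; rewrite ltxx.
  have ng : nbhs (g w) (Phi @` (fs `&` [set y | t1 < y 0 0])).
    by apply: open_nbhs_nbhs; split; [exact: img|exists x].
  have [e e0 He] := nbhs_distP (continuous_nbhs_pre (cg w) ng).
  exists e; first exact: e0.
  move=> w' /andP[w'0 w'2] w'e; have [lt|ge] := ltP w' w; first exact: IH'.
  by have [x' [fx' tx'] ex'] := He w' (dist_lt_of_le ge w'e); exists x'.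
have [x [fx ex tx]] := all _ l22.
have cu : cone_in (Phi x0 - Phi x).
  rewrite ex /g (_ : Phi x0 - _ = L *: vup - u); last by apply/rowP => j; rewrite !mxE; ring.
  exact: cone_in_opp.
have bx : `|Phi x| <= r2 by rewrite ex; exact: le_trans (gb _ l22) r2h.
have h := time_lt fx f0 cu bx b0.
by have := lt_trans h tx; rewrite ltxx.
Qed.

(** Otherwise the difference of the images, or its opposite, is in the inner cone, and [time_lt]
    separates the two times. So slices are Lipschitz graphs over the spatial directions of the
    chart. *)
Lemma slice_achronal x x' : fs x -> fs x' -> x 0 0 = x' 0 0 -> `|Phi x| <= r2 -> `|Phi x'| <= r2 ->
  forall (a : R) (u : X), Phi x' = Phi x + a *: vup + u -> `|a| * theta <= 2 * `|u|.
Proof.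
move=> fx fx' tt bx bx' a u E; rewrite leNgt; apply/negP => au.
have an0 : a != 0.
  by apply: contraTneq au => ->; rewrite normr0 mul0r -leNgt mulr_ge0.
have ub : `|u| <= `|a| * theta / 2 by rewrite ler_pdivlMr// mulrC ltW.
have [ap'|an] := ltP 0 a.
  have cu : cone_in (Phi x' - Phi x).
    rewrite E (_ : _ - _ = a *: vup + u); last by apply/rowP => j; rewrite !mxE; ring.
    by apply: cone_in_vup_open => //; rewrite -(gtr0_norm ap').
  by have := time_lt fx fx' cu bx bx'; rewrite tt ltxx.
have an' : a < 0 by rewrite lt_neqAle an0.
have cu : cone_in (Phi x - Phi x').
  rewrite E (_ : _ - _ = (- a) *: vup - u); last by apply/rowP => j; rewrite !mxE; ring.
  apply: cone_in_opp; first by rewrite oppr_gt0.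
  by rewrite -(ltr0_norm an').
by have := time_lt fx' fx cu bx' bx; rewrite tt ltxx.
Qed.

Let n : R := (1 + hdim m).+1%:R.

(** Within a slice g(w, w) >= (a_i w_i)^2, whereas g(w, w) is at most n times the squared chart
    length of w. The factor 2 absorbs the error of the linearisation of [Phi]. *)
Lemma slice_stretch x i : i != 0 -> O x -> exists2 d : R, 0 < d & forall x', `|x - x'| < d ->
  x' 0 0 = x 0 0 -> scale A p i (x 0 0) * `|rsubmx x 0 i - rsubmx x' 0 i| <= n * 2 * `|Phi x' - Phi x|.
Proof.
move=> i0 Ox; have n1 : 1 <= n by rewrite ler1n.
have uJ := lx_unit lx Ox.
have [M' M'0 HM'] := @linear_bounded_rV R _ _ (mulmxr (invmx ('J Phi x))).
have dJ w : 'd Phi x w = w *m 'J Phi x.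
  by rewrite -deriveEjacobian ?deriveE//; exact: (lx_diff lx Ox).
have eps0 : 0 < (2 * M')^-1 by rewrite invr_gt0 mulr_gt0.
have /nbhs_distP[d1 d10 Hd1] := diff_bound (lx_diff lx Ox) eps0.
exists d1 => // x' xd tt; pose w := x' - x.
have wd : `|w| < d1 by rewrite /w distrC.
have := Hd1 w; rewrite sub0r normrN => /(_ wd).
rewrite /w subrKC -/w => hd.
have wM : `|w| <= M' * `|'d Phi x w|.
  by rewrite -[w in leLHS](mulmxK uJ) -dJ; exact: HM'.
have h1 : `|'d Phi x w| <= 2 * `|Phi x' - Phi x|.
  have := ler_normB (Phi x' - Phi x) (Phi x' - Phi x - 'd Phi x w).
  rewrite subKr => h; have h2 : (2 * M')^-1 * `|w| <= 2^-1 * `|'d Phi x w|.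
    by rewrite invfM -mulrA ler_pM2l ?invr_gt0// mulrC ler_pdivrMr// mulrC.
  by move: hd h h2; set a := `|'d Phi x w|; set b := (2 * M')^-1 * _; lra.
have h2 := spacelike_le lx w Ox; rewrite -/n in h2.
have w0 : w 0 0 = 0 by rewrite /w !mxE tt subrr.
have wi : rsubmx w 0 i = rsubmx x' 0 i - rsubmx x 0 i by rewrite /w linearB !mxE.
have sc0 : 0 < scale A p i (x 0 0) by exact: scale_gt0.
have h3 : (scale A p i (x 0 0) * (rsubmx x' 0 i - rsubmx x 0 i)) ^+ 2 <= qf x w.
  rewrite qform_family// w0 expr0n subr0 mulr_sumr (bigD1 i)//=.
  rewrite cow_neq0// wi -exprMn mulrA.
  have -> : lapse A p (x 0 0) * ratio i (x 0 0) = scale A p i (x 0 0).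
    by rewrite /ratio mulrC divfK// gt_eqF.
  by rewrite lerDl sumr_ge0// => a _; rewrite mulr_ge0 ?sqr_ge0.
have b0 : 0 <= 2 * `|Phi x' - Phi x| by rewrite mulr_ge0.
have h4 : (scale A p i (x 0 0) * (rsubmx x' 0 i - rsubmx x 0 i)) ^+ 2 <= (n * 2 * `|Phi x' - Phi x|) ^+ 2.
  apply: le_trans h3 _; apply: le_trans h2 _.
  apply: (@le_trans _ _ (n * (2 * `|Phi x' - Phi x|) ^+ 2)).
    by rewrite ler_wpM2l ?(le_trans ler01 n1)// ler_sqr ?nnegrE.
  rewrite -mulrA [leRHS]exprMn (ler_wpM2r (sqr_ge0 _))// expr2 ler_peMl// (le_trans ler01 n1)//.
have a1 : 0 <= scale A p i (x 0 0) * `|rsubmx x' 0 i - rsubmx x 0 i| by rewrite mulr_ge0// ltW.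
have a2 : 0 <= n * 2 * `|Phi x' - Phi x| by rewrite -mulrA mulr_ge0// (le_trans ler01 n1).
rewrite distrC -(ler_sqr a1 a2); apply: le_trans h4.
by rewrite !exprMn real_normK ?num_real.
Qed.

(** Points of the chart ball of radius s th / 2 are below the reference point at height s. Two
    points of the ball of radius rho are 2 rho = L th / 2 apart, as [slice_meets] requires, and rho
    + L stays in the larger ball. *)
Lemma slice_constants (s th b : R) : 0 < s -> 0 < th -> th <= 2^-1 -> s <= b / 4 ->
  let rho := s * th ^+ 2 / 20 in let L := 4 * rho / th in
  [/\ 0 < rho, rho <= b / 2, 0 < L, L * th = 4 * rho & rho + L <= s * th / 2] /\ s * th / 2 <= b / 2.
Proof.
move=> s0 th0 th1 sb rho L.
have sth : 0 < s * th by rewrite mulr_gt0.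
have sth1 : s * th <= s / 2 by rewrite ler_pM2l.
have rho0 : 0 < rho by rewrite divr_gt0// mulr_gt0// exprn_gt0.
have rhos : rho <= s * th / 40.
  by rewrite /rho expr2; have : s * th * th <= s * th * 2^-1; [rewrite ler_pM2l|lra].
have L0 : 0 < L by rewrite divr_gt0// mulr_gt0.
have E : L = s * th / 5 by rewrite /L /rho; field; rewrite gt_eqF.
split; last by lra.
split=> //; [lra|by rewrite /L divfK// gt_eqF|lra].
Qed.

Lemma oriented_contradiction i : i != 0 -> p i < 0 -> 0 < r ->
  closure (Phi @` fs) 0 -> ~ (Phi @` O) 0 -> False.
Proof.
move=> i0 pi0 r0 cl nW.
have th0 := @theta_gt0 R m; have th1 := @theta_le R m.
have r20 : 0 < r2 by rewrite divr_gt0.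
have z0 : `|0 : X| <= r2 / 2 by rewrite normr0 divr_ge0// ltW.
have pz : pbdry 0 by split.
have [k0 ap] := approach_exists pz z0 r20.
have [K [s1 [S [K0 s10 s1r HS _]]]] :=
  approach_track ap z0 r20.
rewrite -/r2 in s1r.
have [K' K'0 HK'] := below_horizon.
have [d d0 Hd] := near_line_unique k0.
have [d' d'0 Hd'] : exists2 d' : R, 0 < d' & forall k : 'rV[R]_(hdim m), `|k| < d' -> `|hinv k| < d.
  have nh : nbhs (0 : 'rV[R]_(hdim m)) (@hinv R m @^-1` [set k | `|k| < d]).
    apply: (continuous_nbhs_pre (@hinv_continuous R m 0)).
    have -> : hinv 0 = 0 :> 'rV[R]_(hdim m) by rewrite -[LHS]hmulh0 hmulVh.
    by apply: (@dist_nbhs _ _ _ _ d) => // h; rewrite /= sub0r normrN.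
  have [d' d'0 Hd'] := nbhs_distP nh; exists d' => // k kd; apply: Hd'.
  by rewrite sub0r normrN.
have [T1 HT1] := ratio_small K0 d0.
have [T2 HT2] := ratio_small K'0 d'0.
have [sb /andP[sb0 sbr] Hsb] :=
  pbdry_time (Num.min T1 T2) pz z0 r20.
rewrite -/r2 in sbr.
pose s := Num.min s1 sb.
have s0 : 0 < s by rewrite lt_min s10.
have ss1 : s <= s1 by rewrite ge_min lexx.
have ssb : s <= sb by rewrite ge_min lexx orbT.
have sr : s <= r2 / 4 := le_trans ss1 s1r.
have [fa ea hba] := HS s s0 ss1.
(* The reference point: everything over the small ball can be moved by Ga below it, hence near the
   line over k0, where [near_line_unique] holds. *)
set xa := S s in fa ea hba.
have ta : xa 0 0 < Num.min T1 T2 by apply: (Hsb s).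
have [ta1 ta2] : xa 0 0 <= T1 /\ xa 0 0 <= T2.
  by move: ta; rewrite lt_min => /andP[/ltW -> /ltW ->].
have eka := hbound_small d0 (HT1 _ ta1) hba.
rewrite add0r in ea.
pose U := near_line k0 d.
have [[rho0 rhor L0 Lth Ls] sthr] := slice_constants s0 th0 th1 sr.
set rho := s * theta ^+ 2 / 20 in rho0 rhor L0 Lth Ls; set L := 4 * rho / theta in L0 Lth Ls.
have r2h : r2 / 2 <= r2 by rewrite ler_pdivrMr// ler_peMr ?ler1n// ltW.
have sthr2 : s * theta / 2 <= r2 := le_trans sthr r2h.
have rr2 : rho <= r2 := le_trans rhor r2h.
have vn := vup_norm.
have nv : `|vup : X| = 1 by rewrite -[RHS](vn 1 ler01) scale1r.
have ba : `|Phi xa| <= r2.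
  by rewrite ea (vn _ (ltW s0)); apply: le_trans sr _; rewrite ler_pdivrMr// ler_peMr ?ler1n// ltW.
have lower x : fs x -> `|Phi x| <= s * theta / 2 ->
    exists x', [/\ fs x', Phi x' = Phi x, x' 0 0 = x 0 0 & U (rsubmx x')].
  move=> fx bx; have bx2 : `|Phi x| <= r2 := le_trans bx sthr2.
  have cu : cone_in (Phi xa - Phi x) by rewrite ea; exact: cone_in_opp.
  have [x' [bl e1 e2]] := lift_down fx fa cu bx2 ba.
  have [f' _] := below_fs bl; have [et _] := stproj_eqP e2.
  exists x'; split => //.
  have hb := HK' _ _ bl; set k := hmul _ _ in hb.
  have kd := hbound_small d'0 (HT2 _ ta2) hb.
  exists (hmul (hinv k0) (rsubmx xa)), (hinv k); split => //; first exact: Hd'.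
  rewrite hmulKVh; have <- : hmul (rsubmx x') k = rsubmx xa by rewrite /k hmulKVh.
  by rewrite hmulhK.
have [u1 [T [u10 u1d HT]]] := kline_uniform i ap r20 rho0 rhor d0.
pose M := 5 * rho / theta.
have M0 : 0 < M by rewrite divr_gt0// mulr_gt0.
have n1 : 1 <= n by rewrite ler1n.
pose C1 := n * (2 * M).
have n0 : 0 < n := lt_le_trans ltr01 n1.
have C10 : 0 < C1 by apply: mulr_gt0 => //; exact: mulr_gt0.
have Ai := A0 i.
(* The only use of p_i < 0: a_i(t1) >= A_i e^{p_i t1} exceeds any bound for t1 negative enough, and
   t1 <= w / p_i makes it at least A_i (1 + w). *)
have [t1 t1T big] : exists2 t1 : R, t1 <= T & C1 / scale A p i t1 < u1.
  have Au : 0 < A i * u1 by rewrite mulr_gt0.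
  pose w := C1 / (A i * u1).
  have w0 : 0 < w by rewrite divr_gt0.
  exists (Num.min T (w / p i)); first by rewrite ge_min lexx.
  have h1 : w <= p i * Num.min T (w / p i).
    rewrite -[leLHS](@mulfVK _ (p i)) ?lt_eqF// [w / p i * _]mulrC.
    by rewrite (ler_nM2l pi0) ge_min lexx orbT.
  have h2 := scale_ge p A0 (Num.min T (w / p i)) i0.
  have h3 : A i * (1 + w) <= scale A p i (Num.min T (w / p i)).
    apply: le_trans h2; rewrite ler_pM2l//; apply: le_trans (expR_ge1Dx _) _.
    by rewrite ler_expR.
  have Aw : 0 < A i * (1 + w) by rewrite mulr_gt0// ltr_pwDl// ltW.
  rewrite ltr_pdivrMr; last exact: lt_le_trans Aw h3.
  apply: (@lt_le_trans _ _ (u1 * (A i * (1 + w)))); last by rewrite ler_pM2l.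
  have -> : u1 * (A i * (1 + w)) = A i * u1 + C1 by rewrite /w; field; rewrite !gt_eqF.
  by rewrite ltrDr.
have u1u1 : 0 <= u1 <= u1 by rewrite lexx ltW.
have u00 : 0 <= (0 : R) <= u1 by rewrite lexx ltW.
have [f0 b0] := HT t1 0 t1T u00; rewrite kline0 in f0 b0.
have [f1 b1] := HT t1 u1 t1T u1u1.
pose x0 := pt t1 k0; pose x1 := pt t1 (kline k0 i u1).
pose q0 := Phi x0; pose q1 := Phi x1.
rewrite -/x0 -/q0 in f0 b0; rewrite -/x1 -/q1 in f1 b1.
have q01 : `|q1 - q0| <= 2 * rho.
  by apply: le_trans (ler_normB _ _) _; rewrite mulr_natl mulr2n lerD// ltW.
pose yl (la : R) := q0 + la *: (q1 - q0).
have ylb (la : R) : 0 <= la <= 1 -> `|yl la| <= rho.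
  move=> /andP[la0 la1].
  rewrite (_ : yl la = (1 - la) *: q0 + la *: q1); last by apply/rowP => j; rewrite !mxE; ring.
  apply: le_trans (ler_normD _ _) _; rewrite !normrZ (ger0_norm la0) ger0_norm ?subr_ge0//.
  rewrite (_ : rho = (1 - la) * rho + la * rho); last by ring.
  apply: lerD; first by rewrite ler_wpM2l ?subr_ge0// ltW.
  by rewrite ler_wpM2l// ltW.
have yq0 (la : R) : 0 <= la <= 1 -> `|la *: (q1 - q0)| <= L * theta / 2.
  move=> /andP[la0 la1]; rewrite normrZ (ger0_norm la0) Lth.
  apply: (@le_trans _ _ `|q1 - q0|); first by rewrite ler_piMl.
  by apply: le_trans q01 _; rewrite ler_pdivlMr// mulrAC -natrM.
have pb (la v : R) : 0 <= la <= 1 -> `|v| <= L -> `|yl la + v *: vup| <= s * theta / 2.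
  move=> ll vL; apply: le_trans (ler_normD _ _) _; have := ylb la ll.
  have -> : `|v *: (vup : X)| = `|v| by rewrite normrZ nv mulr1.
  by move=> h; apply: le_trans Ls; exact: lerD.
have b0' : `|q0| <= r2 := le_trans (ltW b0) rr2.
have slice (la : R) : 0 <= la <= 1 -> exists v x, [/\ `|v| <= L, fs x, Phi x = yl la + v *: vup & x 0 0 = t1].
  move=> ll; have [|v [x [v1 v2 v3 v4]]] := slice_meets r20 f0 b0' L0 (yq0 la ll).
    by move=> v vL; apply: le_trans sthr; exact: (pb la v ll vL).
  by exists v, x; split; [exact: v1|exact: v2|exact: v3|rewrite v4 /x0 pt_time].
(* Over each point of the chart segment from q0 to q1 a point of the slice t1 is chosen near the
   line over k0; continuity follows from achronality and uniqueness. *)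
have /choice[xs Hxs] (la : R) : exists x, 0 <= la <= 1 -> exists v, [/\ `|v| <= L, fs x,
    Phi x = yl la + v *: vup, x 0 0 = t1 & U (rsubmx x)].
  have [ll|nl] := boolP (0 <= la <= 1); last by exists 0 => h; exfalso.
  have [v [x [vL fx ex tx]]] := slice la ll.
  have [|x' [fx' ex' tx' Ux']] := lower x fx; first by rewrite ex; exact: pb.
  by exists x' => _; exists v; rewrite ex' tx'.
have endpoint (la : R) x : 0 <= la <= 1 -> fs x -> x 0 0 = t1 -> U (rsubmx x) -> `|Phi x| < rho ->
    Phi x = yl la -> xs la = x.
  move=> ll fx tx Ux bx ex; have [v [vL fv ev tv Uv]] := Hxs la ll.
  have h1 : `|Phi x| <= r2 := le_trans (ltW bx) rr2.
  have h2 : `|Phi (xs la)| <= r2 by rewrite ev; apply: le_trans sthr2; exact: pb.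
  have h3 : Phi (xs la) = Phi x + v *: vup + 0 by rewrite addr0 ex.
  have := slice_achronal fx fv (etrans tx (esym tv)) h1 h2 h3; rewrite normr0 mulr0.
  rewrite pmulr_lle0// normr_le0 => /eqP v0.
  by apply: Hd => //; rewrite ev v0 scale0r addr0.
have l00 : 0 <= (0 : R) <= 1 := introT andP (conj (lexx (0 : R)) (@ler01 R)).
have l11 : 0 <= (1 : R) <= 1 := introT andP (conj (@ler01 R) (lexx (1 : R))).
have e0 : xs 0 = x0.
  apply: (endpoint 0) => //; first exact: pt_time.
    by rewrite /x0 pt_space; exists 0, 0; rewrite normr0 !hmulh0.
  by rewrite /yl scale0r addr0.
have e1 : xs 1 = x1.
  apply: (endpoint 1) => //; first exact: pt_time.
    rewrite /x1 pt_space; exists (u1 *: delta_mx 0 i), 0; rewrite normr0 hmulh0; split => //.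
    apply: le_lt_trans u1d; apply: rV_norm_leP => [|j]; first exact: ltW.
    by rewrite !mxE eqxx; case: eqP => _; rewrite ?mulr1 ?mulr0 ?normr0 ?gtr0_norm// ltW.
  by rewrite /yl scale1r subrKC.
(* Achronality bounds the vertical part by 4 rho / theta, and the spatial part 2 rho is at most rho
   / theta because theta <= 1/2; the sum is M. *)
have lip (la la' : R) : 0 <= la <= 1 -> 0 <= la' <= 1 ->
    `|Phi (xs la') - Phi (xs la)| <= M * `|la - la'|.
  move=> ll ll'; have [v [vL fv ev tv _]] := Hxs la ll; have [v' [vL' fv' ev' tv' _]] := Hxs la' ll'.
  have h1 : `|Phi (xs la)| <= r2 by rewrite ev; apply: le_trans sthr2; exact: pb.
  have h2 : `|Phi (xs la')| <= r2 by rewrite ev'; apply: le_trans sthr2; exact: pb.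
  have E : Phi (xs la') = Phi (xs la) + (v' - v) *: vup + (la' - la) *: (q1 - q0).
    by rewrite ev ev' /yl; apply/rowP => j; rewrite !mxE; ring.
  have h3 := slice_achronal fv fv' (etrans tv (esym tv')) h1 h2 E.
  have h4 : `|(la' - la) *: (q1 - q0)| <= `|la - la'| * (2 * rho).
    by rewrite normrZ distrC ler_wpM2l.
  rewrite E (_ : _ - _ = (v' - v) *: vup + (la' - la) *: (q1 - q0)); last first.
    by apply/rowP => j; rewrite !mxE; ring.
  apply: le_trans (ler_normD _ _) _.
  have -> : `|(v' - v) *: (vup : X)| = `|v' - v|.
    by rewrite normrZ nv mulr1.
  rewrite -(ler_pM2r th0) mulrDl /M mulrAC divfK ?gt_eqF//.
  set D := `|_ *: (q1 - q0)| in h3 h4 *.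
  have : D * theta <= D * 2^-1 by rewrite ler_wpM2l// normr_ge0.
  by move: h3 h4; set B := `|la - la'|; lra.
pose f la := rsubmx (xs la) 0 i.
have ff : f 1 - f 0 = u1.
  by rewrite /f e1 e0 /x0 /x1 !pt_space kline_coord// [k0 0 i + _]addrC addrK.
have sc0 : 0 < scale A p i t1 by exact: scale_gt0.
have C1'0 : 0 <= C1 / scale A p i t1 by rewrite divr_ge0// ltW.
(* The i-th coordinate would change by u1 along a slice curve of chart length at most M, although
   a_i(t1) u1 > C1. *)
have : `|f 1 - f 0| <= C1 / scale A p i t1.
  apply: local_lipschitz => // la ll.
  have [v [vL fv ev tv Uv]] := Hxs la ll; set x := xs la in fv ev tv Uv *.
  have Ox := proj1 fv.
  have [d1 d10 Hd1] := slice_stretch i0 Ox.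
  pose Nn := fs `&` [set y | U (rsubmx y)] `&` [set y | `|x - y| < d1].
  have nN : nbhs x Nn.
    apply: filterI; first apply: filterI.
    - exact: (future_side_near lx fv).
    - have := near_line_open Uv => n2.
      exact: (continuous_nbhs_pre (@rsubmx_continuous x) n2).
    - exact: (@dist_nbhs _ _ _ _ d1).
  pose No := interior Nn.
  have oI : open (Phi @` No).
    apply: (lx_openmap lx); last exact: open_interior.
    by move=> y /interior_subset[[[]]].
  have ng : nbhs (Phi x) (Phi @` No) by apply: open_nbhs_nbhs; split; [exact: oI|exists x].
  have [d2 d20 Hd2] := nbhs_distP ng.
  exists (d2 / M); first by rewrite divr_gt0.
  move=> la' ll' lad; have lp := lip la la' ll ll'; rewrite -/x in lp.
  have [|x' /interior_subset[[fx' Ux'] nx'] ex'] := Hd2 (Phi (xs la')).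
    by rewrite distrC; apply: le_lt_trans lp _; rewrite mulrC -ltr_pdivlMr.
  have [v' [_ fv' _ tv' Uv']] := Hxs la' ll'.
  have exx : xs la' = x' by apply: Hd.
  rewrite -exx in nx'.
  have := Hd1 (xs la') nx' (etrans tv' (esym tv)); rewrite tv => h1.
  rewrite mulrAC ler_pdivlMr// mulrC; apply: le_trans h1 _.
  rewrite /C1 -[n * 2 * _]mulrA -[n * (2 * M) * _]mulrA (ler_pM2l n0) -[2 * M * _]mulrA ler_pM2l//.
rewrite ff gtr0_norm// => h; have := le_lt_trans h big; by rewrite ltxx.
Qed.

End PastBoundary.

(** * Inextendibility *)

Lemma diff_jacobian {R : realType} n k (f : 'rV[R]_n -> 'rV[R]_k) x v :
  differentiable f x -> 'd f x v = v *m 'J f x.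
Proof. by move=> df; apply: etrans (esym (deriveE v df)) _; exact: deriveEjacobian. Qed.

Section Flip.
Context {R : realType} {m : nat}.
Local Notation X := 'rV[R]_(1 + hdim m).
Variables (Ga : set 'rV[R]_(hdim m)) (A p : 'I_(hdim m) -> R).
Variables (O : set X) (Phi : X -> X) (r : R).
Hypothesis lx : local_extension Ga A p O Phi r.

Definition flipM : 'M[R]_(1 + hdim m) := diag_mx (\row_i (if i == 0 then -1 else 1)).

Lemma flipE (u : X) i : (u *m flipM) 0 i = if i == 0 then - u 0 i else u 0 i.
Proof. by rewrite mul_mx_diag !mxE; case: ifP => _; rewrite ?mulrN ?mulr1. Qed.

Lemma flipK (u : X) : u *m flipM *m flipM = u.
Proof. by apply/rowP => i; rewrite flipE flipE; case: (i == 0); rewrite ?opprK. Qed.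

Lemma flip_norm (u : X) : `|u *m flipM| = `|u|.
Proof.
have le (w : X) : `|w *m flipM| <= `|w|.
  by apply: rV_norm_leP => // j; rewrite flipE; case: ifP => _; rewrite ?normrN coord_le_norm.
by apply/eqP; rewrite eq_le le /= -[leLHS]/(`|u|) -{1}(flipK u) le.
Qed.

Lemma flip_eta (u : X) : eta (u *m flipM) = eta u.
Proof.
rewrite /eta flipE eqxx sqrrN; congr (_ - _); apply: eq_bigr => i i0.
by rewrite flipE (negbTE i0).
Qed.

Lemma flip_continuous : continuous (fun u : X => u *m flipM).
Proof. exact: (@linear_continuous_rV R (1 + hdim m) X (mulmxr flipM)). Qed.

Lemma flip_diff x : O x -> differentiable (fun y => Phi y *m flipM) x /\
  forall v, 'd (fun y => Phi y *m flipM) x v = 'd Phi x v *m flipM.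
Proof.
move=> Ox; have dP := lx_diff lx Ox.
have dl : differentiable (mulmxr flipM : X -> X) (Phi x).
  by apply: linear_differentiable; exact: flip_continuous.
split; first exact: (differentiable_comp dP dl).
move=> v; have e := @diff_comp _ _ _ _ Phi (mulmxr flipM : X -> X) x dP dl.
have e2 : 'd (mulmxr flipM : X -> X) (Phi x) = mulmxr flipM :> (X -> X).
  by apply: diff_lin; exact: flip_continuous.
apply: etrans (congr1 (fun k : X -> X => k v) e) _.
exact: (congr1 (fun k : X -> X => k ('d Phi x v)) e2).
Qed.

Lemma local_extension_flip : local_extension Ga A p O (fun x => Phi x *m flipM) r.
Proof.
split.
- exact: (lx_open lx).
- by move=> x /flip_diff[].
- move=> v x Ox.
  have c1 : {for x, continuous (fun y => 'd Phi y v *m flipM)}.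
    have cv : {for x, continuous (fun y => 'd Phi y v)} by exact: (lx_cont lx).
    exact: (@mulmx_continuous_at R _ _ _ _ (fun y => 'd Phi y v) (fun=> flipM) x cv (@cst_continuous _ _ _ _)).
  apply: continuous_near_eq c1 _.
  apply: filterS (lx_nearO lx Ox) => y Oy; exact: (esym (proj2 (flip_diff Oy) v)).
- move=> x Ox; have -> : 'J (fun y => Phi y *m flipM) x = 'J Phi x *m flipM.
    have dP := lx_diff lx Ox; have [d e] := flip_diff Ox.
    apply/row_matrixP => i; rewrite !rowE; apply: etrans (esym (diff_jacobian _ d)) _.
    by apply: etrans (e _) _; rewrite mulmxA; congr (_ *m _); exact: diff_jacobian.
  rewrite unitmx_mul (lx_unit lx Ox) /=.
  suff E : flipM *m flipM = 1%:M by case: (mulmx1_unit E).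
  by apply/row_matrixP => i; rewrite !rowE mulmxA flipK mulmx1.
- move=> x v Ox; rewrite (proj2 (flip_diff Ox)) flip_norm flip_eta; exact: (lx_metric lx v Ox).
- by move=> r' r'r; under eq_set do rewrite flip_norm; exact: (lx_closed lx r'r).
- move=> U UO oU.
  rewrite (_ : _ @` U = (fun u : X => u *m flipM) @^-1` (Phi @` U)); last first.
    apply/seteqP; split=> [_ [x Ux <-]|u [x Ux e]]; first by exists x; rewrite // flipK.
    by exists x; rewrite // e flipK.
  by apply: open_comp (lx_openmap lx UO oU) => u _; exact: flip_continuous.
- move=> x x' Ox Ox' e; apply: (lx_fiber lx Ox Ox').
  by rewrite -(flipK (Phi x)) e flipK.
- by move=> x x' Ox e; have [Ox' ->] := lx_orbit lx Ox e.
- by move=> x Ox; rewrite flip_norm; exact: (lx_ball lx Ox).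
Qed.

(** The chart point 0 is in the closure of the image of the side where tau and chart time agree, or
    of the other side; reversing chart time exchanges the two. *)
Lemma no_local_extension c c1 i : discrete_subgroup Ga -> (forall a, 0 < A a) ->
  (forall s : 'I_m, 0 < chi p s) -> 0 < c -> (forall a, c <= 1 - p a) ->
  0 < c1 -> c1 <= 1 -> (forall a, c1 <= 1 + p a) -> i != 0 -> p i < 0 -> 0 < r ->
  closure (Phi @` O) 0 -> ~ (Phi @` O) 0 -> False.
Proof.
move=> dG A0 chi0 c0 cp c10 c11 c1p i0 pi0 r0 cl nO.
pose Om := [set x | O x /\ ('d Phi x vup) 0 0 < 0].
have E : Phi @` O = Phi @` (future_side O Phi) `|` Phi @` Om.
  rewrite -image_setU; congr (_ @` _); apply/seteqP; split=> x; last by case=> -[].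
  move=> Ox; have [_ [+ _]] := timelike_cone lx Ox (vup_timelike A p x).
  by rewrite normr_gt0 neq_lt => /orP[h|h]; [right|left].
move: cl; rewrite E closureU => -[cl|cl].
  exact: (oriented_contradiction dG A0 chi0 lx c10 c11 c1p c0 cp i0 pi0 r0 cl nO).
apply: (oriented_contradiction dG A0 chi0 local_extension_flip c10 c11 c1p c0 cp i0 pi0 r0).
  move=> U U0; have n0 : nbhs (0 : X) ((fun u : X => u *m flipM) @^-1` U).
    by apply: (continuous_nbhs_pre (@flip_continuous 0)); rewrite mul0mx.
  have [_ [[x [Ox dx] <-] Ux]] := cl _ n0.
  exists (Phi x *m flipM); split; last exact: Ux.
  exists x => //; split; first exact: Ox.
  by rewrite (proj2 (flip_diff Ox)) flipE eqxx oppr_gt0.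
move=> [x Ox e]; apply: nO; exists x => //.
by rewrite -(flipK (Phi x)) e mul0mx.
Qed.

End Flip.

Section FamilyUnit.
Context {R : realType} {m : nat}.
Variables (A p : 'I_(hdim m) -> R).
Hypothesis A0 : forall a, 0 < A a.
Hypothesis chi0 : forall r : 'I_m, 0 < chi p r.

Lemma hcoframe_det (h : 'rV[R]_(hdim m)) : \det (hcoframe h) = 1.
Proof.
rewrite det_trig; last first.
  apply/is_trig_mxP => i j ij; rewrite mxE.
  have j0 : (j == 0) = false by apply/negP => /eqP e; rewrite e ltn0 in ij.
  by rewrite j0 subr0 (_ : (i == j) = false)//; apply/negP => /eqP e; rewrite e ltnn in ij.
rewrite big1// => i _; rewrite mxE eqxx; case: eqP => [->|_]; last by rewrite subr0.
by rewrite big_pred0 ?subr0// => s; rewrite eq_sym iy_neq0.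
Qed.

Lemma family_form_unit x : family_form A p x \in unitmx.
Proof.
rewrite unitmxE /family_form det_ublock !det_mulmx det_tr hcoframe_det mul1r mulr1 det_diag.
rewrite unitfE det_scalar1 mulf_neq0// ?oppr_eq0 ?expf_eq0/=; first by rewrite gt_eqF// lapse_gt0.
by apply/prodf_neq0 => i _; rewrite mxE expf_eq0/= gt_eqF// scale_gt0.
Qed.

End FamilyUnit.

(** * From a C^0 extension to a nearly Minkowskian chart *)

Section FromExtension.
Context {R : realType} {m : nat}.
Local Notation X := 'rV[R]_(1 + hdim m).
Variables (Ga : set 'rV[R]_(hdim m)) (A p : 'I_(hdim m) -> R).
Hypothesis dG : discrete_subgroup Ga.
Hypothesis A0 : forall a, 0 < A a.
Hypothesis chi0 : forall r : 'I_m, 0 < chi p r.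

Lemma stproj_surj (q : spacetime Ga) : exists x, stproj Ga x = q.
Proof.
case: q => t q; have [h <-] := hproj_surj q.
by exists (pt t h); rewrite stproj_pt.
Qed.

Lemma stproj_open (U : set X) : open U -> open (stproj Ga @` U : set (spacetime Ga)).
Proof.
move=> oU; rewrite openE => _ [x Ux <-]; rewrite /interior.
have cp : {for (x 0 0, rsubmx x), continuous (fun q : R * 'rV[R]_(hdim m) => pt q.1 q.2)}.
  by apply: pt_continuous; [exact: cvg_fst|exact: cvg_snd].
have n : nbhs (pt (x 0 0) (rsubmx x)) U by rewrite pt_eta; exact: open_nbhs_nbhs.
have [d d0 Hd] := nbhs_pairP (continuous_nbhs_pre cp n).
have oB : open (hproj Ga @` [set h | `|rsubmx x - h| < d]).
  apply: (hproj_open dG).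
  by rewrite (_ : [set h | _] = ball (rsubmx x) d); [exact: ball_open|rewrite -ball_normE].
rewrite stprojE; exists ([set t | `|x 0 0 - t| < d], hproj Ga @` [set h | `|rsubmx x - h| < d]) => /=.
  split; first exact: (@dist_nbhs _ _ _ _ d).
  apply: (@open_nbhs_nbhs (hquot Ga)); split; first exact: oB.
  by exists (rsubmx x) => //=; rewrite subrr normr0.
move=> [t q] /= [ht [h hh <-]]; exists (pt t h); last by rewrite stproj_pt.
exact: (Hd t h).
Qed.

Lemma stproj_locally_injective x : exists W : set X, [/\ open W, W x & {in W &, injective (stproj Ga)}].
Proof.
have [U [oU Ux Uinj]] := hproj_locally_injective dG (rsubmx x).
exists (rsubmx @^-1` U); split => //; first by apply: open_comp oU => y _; exact: rsubmx_continuous.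
move=> y y'; rewrite !inE => Uy Uy'; rewrite !stprojE => -[e1 e2].
by rewrite -(pt_eta y) -(pt_eta y') e1 (Uinj _ _ _ _ e2)// inE.
Qed.

Lemma coordK n (M : Type) (c : chart R n M) y : {in cdom c &, injective (cmap c)} -> cdom c y ->
  Defs.coord c (cmap c y) = y.
Proof.
move=> inj cy; have [h1 h2] : [set x | cdom c x /\ cmap c x = cmap c y] (Defs.coord c (cmap c y)).
  by rewrite /Defs.coord; apply: xgetPex; exists y.
by apply: inj => //; rewrite inE.
Qed.

Lemma coord_cran n (M : Type) (c : chart R n M) q : cran c q -> cdom c (Defs.coord c q) /\ cmap c (Defs.coord c q) = q.
Proof. by move=> [y cy e]; rewrite /Defs.coord; apply: (@xgetPex _ 0 [set x | cdom c x /\ cmap c x = q]); exists y. Qed.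

Variables (N : manifold R (1 + hdim m)) (h : bfield N) (F : spacetime Ga -> N).
Hypotheses (sN : smooth_manifold N) (hN : hausdorff_space N).
Hypothesis clm : continuous_lorentz_metric h.
Hypothesis ioe : isometric_open_embedding (family_metric A p Ga) h F.
Variables (c' : chart R (1 + hdim m) N) (yq : X).
Hypotheses (ac' : atlas N c') (cyq : cdom c' yq).

Let f (x : X) : X := Defs.coord c' (F (stproj Ga x)).
Let D1 : set X := [set x | cran c' (F (stproj Ga x))].

Let Fst_continuous : continuous (fun x : X => F (stproj Ga x)).
Proof.
move=> x; apply: (@continuous_comp _ _ _ (stproj Ga) F); first exact: stproj_continuous.
exact: (proj1 (ioe_smooth ioe)).
Qed.

Let cran_open U : U `<=` cdom c' -> open U -> open (cmap c' @` U).
Proof. exact: (chart_open_map sN ac'). Qed.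

Let D1_open : open D1.
Proof.
apply: (@open_comp _ _ (fun x : X => F (stproj Ga x)) (cran c')) => [x _|]; first exact: Fst_continuous.
by apply: cran_open => //; exact: (chart_open sN ac').
Qed.

Let local_chart x : exists c : chart R (1 + hdim m) (spacetime Ga),
  [/\ atlas (spacetime Ga) c, cdom c x & cmap c = stproj Ga].
Proof.
have [W [oW Wx Winj]] := stproj_locally_injective x.
by exists (Chart W (stproj Ga : X -> spacetime Ga)).
Qed.

Let f_C1 x : D1 x -> exists W : set X, [/\ open W, W x, W `<=` D1, forall y, W y -> {for y, continuous f} &
  forall v y, W y -> derivable f y v /\ {for y, continuous (fun z => 'D_v f z)}].
Proof.
move=> Dx; have [c [ac cx cE]] := local_chart x.
have sm := proj2 (ioe_smooth ioe) c c' ac ac'.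
have lE : locdom F c c' = cdom c `&` D1 by rewrite /locdom cE.
have fE : locrep F c c' = f by rewrite /locrep cE.
have [oc _ _] := ac.
rewrite lE fE in sm; have [s0 s1] := sm 1%N.
exists (cdom c `&` D1); split => //; first exact: (openI oc D1_open).
move=> v y Wy; have [s2 [s3 _]] := s1 v; split; [exact: s2|exact: s3].
Qed.

Let f_diff x : D1 x -> differentiable f x.
Proof.
move=> /f_C1[W [oW Wx _ _ H]].
by apply: (@is_diff_C1 R _ _ W f x oW).
Qed.

Let f_iso x : D1 x -> family_form A p x = 'J f x *m h c' (f x) *m ('J f x)^T.
Proof.
move=> Dx; have [c [ac cx cE]] := local_chart x.
have lx : locdom F c c' x by split => //; rewrite cE.
have := ioe_isometric ioe ac ac' lx; rewrite /family_metric.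
by rewrite (_ : locrep F c c' = f)// /locrep cE.
Qed.

Let f_unit x : D1 x -> 'J f x \in unitmx.
Proof.
move=> Dx; have := @family_form_unit R m A p A0 x; rewrite f_iso//.
by rewrite !unitmx_mul => /andP[/andP[]].
Qed.

Let coordK' y : cdom c' y -> Defs.coord c' (cmap c' y) = y.
Proof. exact: coordK (chart_inj sN ac'). Qed.

Let fK x : D1 x -> cdom c' (f x) /\ cmap c' (f x) = F (stproj Ga x).
Proof. exact: coord_cran. Qed.

Let f_of_cmap x y : cdom c' y -> cmap c' y = F (stproj Ga x) -> D1 x /\ f x = y.
Proof. by move=> cy e; split; [exists y|rewrite /f -e coordK']. Qed.

Let minkM : 'M[R]_(1 + hdim m) := diag_mx (\row_i (if i == 0%N :> nat then -1 else 1)).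

Let etaE (u : X) : eta u = (u *m minkM *m u^T) 0 0.
Proof.
rewrite /eta /minkM mul_mx_diag mxE [in RHS](bigD1 0)//= !mxE/= mulrN1 mulNr -expr2 [RHS]addrC.
congr (_ - _); apply: eq_bigr => i i0.
by rewrite !mxE (_ : (i == 0%N :> nat) = false) ?mulr1 -?expr2//; exact: negbTE.
Qed.

Variable P : 'M[R]_(1 + hdim m).
Hypotheses (uP : P \in unitmx) (hP : P *m h c' yq *m P^T = minkM).

Let aff (w : X) : X := yq + w *m P.
Let ainv (y : X) : X := (y - yq) *m invmx P.

Let affK w : ainv (aff w) = w.
Proof. by rewrite /ainv /aff [yq + _]addrC addrK mulmxK. Qed.

Let ainvK y : aff (ainv y) = y.
Proof. by rewrite /ainv /aff mulmxKV// subrKC. Qed.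

Let aff_continuous : continuous aff.
Proof.
move=> w; have c2 := @linear_continuous_rV R (1 + hdim m) X (mulmxr P) w.
exact: (@continuousD R X X (fun=> yq) (fun w => w *m P) w (@cst_continuous _ _ _ _) c2).
Qed.

Let ainv_continuous : continuous ainv.
Proof.
move=> y; have c1 : {for y, continuous (fun y : X => y - yq)}.
  exact: (@continuousB R X X id (fun=> yq) y (@cvg_id _ _) (@cst_continuous _ _ _ _)).
exact: (@mulmx_continuous_at R X _ _ _ (fun y : X => y - yq) (fun=> invmx P) y c1 (@cst_continuous _ _ _ _)).
Qed.

Let qform_small (B : 'M[R]_(1 + hdim m)) (e : R) (u : X) : (forall i j, `|B i j| <= e) ->
  `|(u *m B *m u^T) 0 0| <= (1 + hdim m)%:R * ((1 + hdim m)%:R * (e * `|u| ^+ 2)).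
Proof.
move=> Be; rewrite mxE; apply: le_trans (ler_norm_sum _ _ _) _.
apply: (@le_trans _ _ (\sum_(j : 'I_(1 + hdim m)) (1 + hdim m)%:R * (e * `|u| ^+ 2))); last first.
  by rewrite sumr_const card_ord [leRHS]mulr_natl.
apply: ler_sum => j _; rewrite mxE mulr_suml; apply: le_trans (ler_norm_sum _ _ _) _.
apply: (@le_trans _ _ (\sum_(k : 'I_(1 + hdim m)) (e * `|u| ^+ 2))); last first.
  by rewrite sumr_const card_ord [leRHS]mulr_natl.
apply: ler_sum => k _; rewrite !normrM [u^T _ _]mxE.
apply: (@le_trans _ _ (`|u| * e * `|u|)); last by rewrite [`|u| * e]mulrC -mulrA expr2.
apply: ler_pM; rewrite ?mulr_ge0// ?coord_le_norm//.
by apply: ler_pM; rewrite ?coord_le_norm ?Be.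
Qed.

(** A linear change of chart makes the metric Minkowskian at the given point, and its continuity
    keeps it nearly so on a ball. *)
Lemma extension_chart : exists r O Phi, [/\ 0 < r, local_extension Ga A p O Phi r,
  (cmap c' yq \in closure (range F) -> closure (Phi @` O) 0) & (~ range F (cmap c' yq) -> ~ (Phi @` O) 0)].
Proof.
pose n : R := (1 + hdim m)%:R.
(* A quadratic form with entries at most e0 is at most n^2 e0 |u|^2 = |u|^2 / 4. *)
pose e0 := (4 * (n * n))^-1.
have e00 : 0 < e0 by rewrite invr_gt0 !mulr_gt0.
have [r r0 Hr] : exists2 r : R, 0 < r & forall w, `|w| < r -> cdom c' (aff w) /\
    forall i j, `|(P *m h c' (aff w) *m P^T - minkM) i j| <= e0.
  have ch : {for yq, continuous (h c')} := proj2 clm c' ac' yq cyq.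
  have a0 : aff 0 = yq by rewrite /aff mul0mx addr0.
  have n1 : nbhs (0 : X) (aff @^-1` cdom c').
    apply: (continuous_nbhs_pre (@aff_continuous 0)); rewrite a0.
    by apply: open_nbhs_nbhs; split; [exact: (chart_open sN ac')|].
  have ca : {for 0, continuous (fun w => h c' (aff w))}.
    by apply: (@continuous_comp X X _ aff (h c') 0 (@aff_continuous 0)); rewrite a0.
  have cB : {for 0, continuous (fun w => P *m h c' (aff w) *m P^T)}.
    apply: (@mulmx_continuous_at R X _ _ _ (fun w => P *m h c' (aff w)) (fun=> P^T) 0 _ (@cst_continuous _ _ _ _)).
    exact: (@mulmx_continuous_at R X _ _ _ (fun=> P) (fun w => h c' (aff w)) 0 (@cst_continuous _ _ _ _) ca).
  have n2 : nbhs (0 : X) [set w | `|P *m h c' (aff w) *m P^T - minkM| < e0].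
    have := continuous_near cB e00; rewrite a0 hP; apply: filterS => w /=.
    by rewrite distrC.
  have [r r0 Hr] := nbhs_distP (filterI n1 n2); exists r => // w wr.
  have [|h1 h2] := Hr w; first by rewrite sub0r normrN.
  by split; [exact: h1|move=> i j; apply: le_trans (coord_le_norm _ i j) _; exact: ltW].
pose O : set X := [set x | D1 x /\ `|ainv (f x)| < r].
pose Phi x := ainv (f x).
pose Kr (B : set X) := cmap c' @` (aff @` B).
have Oin x w : `|w| < r -> cmap c' (aff w) = F (stproj Ga x) -> O x /\ Phi x = w.
  move=> wr e; have [cw _] := Hr w wr; have [D1x fx] := f_of_cmap cw e.
  by rewrite /O /Phi /= fx affK.
have OE : O = (fun x => F (stproj Ga x)) @^-1` Kr [set w | `|w| < r].
  apply/seteqP; split=> [x [Dx bx]|x [_ [w wr <-] e]]; last by have [] := Oin x w wr e.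
  have [h1 h2] := fK Dx; exists (f x); last exact: h2.
  by exists (Phi x); rewrite // ainvK.
have affO (B : set X) : open B -> open (aff @` B).
  move=> oB; rewrite (_ : aff @` B = ainv @^-1` B); last first.
    by apply/seteqP; split=> [_ [w Bw <-]|y By]; [rewrite /= affK|exists (ainv y); rewrite ?ainvK].
  by apply: open_comp oB => y _; exact: ainv_continuous.
have nb : open [set w : X | `|w| < r].
  rewrite (_ : [set w : X | `|w| < r] = ball 0 r); first exact: ball_open.
  by apply/seteqP; split=> w; rewrite -ball_normE /= sub0r normrN.
have oO : open O.
  rewrite OE; apply: open_comp; first by move=> x _; exact: Fst_continuous.
  by apply: cran_open (affO _ nb) => _ [w wr <-]; have [] := Hr w wr.
have dainv y : is_diff y ainv (mulmxr (invmx P)).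
  apply: is_diff_bound.
    exact: (@linear_continuous_rV R (1 + hdim m) X (mulmxr (invmx P))).
  move=> e ep; apply: (@filterE _ (nbhs (0 : X)) _) => k.
  rewrite (_ : ainv (y + k) - ainv y - _ = 0) ?normr0 ?mulr_ge0 ?(ltW ep)//.
  by rewrite /ainv /= -mulmxBl -mulmxBl opprB addrA subrK [y + k]addrC addrK subrr mul0mx.
have dPhi x : D1 x -> differentiable Phi x /\ forall v, 'd Phi x v = 'd f x v *m invmx P.
  move=> Dx; have df := f_diff Dx; have [da ea] := dainv (f x).
  split; first exact: (differentiable_comp df da).
  move=> v; have e := @diff_comp _ _ _ _ f ainv x df da.
  apply: etrans (congr1 (fun k : X -> X => k v) e) _.
  exact: (congr1 (fun k : X -> X => k ('d f x v)) ea).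
have dJ x v : D1 x -> 'd f x v = v *m 'J f x.
  by move=> Dx; apply: diff_jacobian; exact: f_diff.
exists r, O, Phi; split=> //; first split.
- exact: oO.
- by move=> x [/dPhi[]].
- move=> v x [Dx bx]; have [W [oW Wx WD _ H]] := f_C1 Dx.
  have cv : {for x, continuous (fun y => 'D_v f y *m invmx P)}.
    refine (@mulmx_continuous_at R X _ _ _ (fun y => 'D_v f y) (fun=> invmx P) x _ _).
      exact: (proj2 (H v x Wx)).
    exact: cst_continuous.
  apply: continuous_near_eq cv _.
  apply: filterS (open_nbhs_nbhs (conj oW Wx)) => y Wy.
  rewrite (proj2 (dPhi y (WD y Wy))); congr (_ *m _).
  by apply: deriveE; apply: f_diff; exact: WD.
- move=> x [Dx bx]; have -> : 'J Phi x = 'J f x *m invmx P.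
    have [d e] := dPhi x Dx.
    apply/row_matrixP => i; rewrite !rowE; apply: etrans (esym (diff_jacobian _ d)) _; apply: etrans (e _) _.
    by rewrite mulmxA; congr (_ *m _); exact: dJ.
  by rewrite unitmx_mul f_unit// unitmx_inv.
- move=> x v [Dx bx]; have [_ Hw] := Hr (Phi x) bx.
  rewrite (proj2 (dPhi x Dx)); set u := 'd f x v *m invmx P.
  have -> : qform (family_form A p x) v = (u *m (P *m h c' (aff (Phi x)) *m P^T) *m u^T) 0 0.
    have e : v *m 'J f x = u *m P by rewrite -(dJ x v Dx) /u mulmxKV.
    rewrite /qform (f_iso Dx) /Phi ainvK.
    suff -> : v *m ('J f x *m h c' (f x) *m ('J f x)^T) *m v^T = u *m (P *m h c' (f x) *m P^T) *m u^T by [].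
    by rewrite !mulmxA e -(mulmxA _ ('J f x)^T v^T) -trmx_mul e trmx_mul !mulmxA.
  rewrite etaE.
  have -> : forall B C : 'M[R]_(1 + hdim m), (u *m B *m u^T) 0 0 - (u *m C *m u^T) 0 0 = (u *m (B - C) *m u^T) 0 0.
    by move=> B C; rewrite mulmxBr mulmxBl [in RHS]mxE [(- (u *m C *m u^T)) 0 0]mxE.
  apply: le_trans (qform_small u Hw) _; rewrite -/n /e0 !mulrA ler_wpM2r ?sqr_ge0//.
  by rewrite le_eqVlt; apply/orP; left; apply/eqP; field; rewrite gt_eqF.
(* A closed ball of the chart is compact, so its image is closed in the Hausdorff space N: the
   preimage has no limit points outside O. *)
- move=> r' r'r.
  have E : [set x | O x /\ `|Phi x| <= r'] = (fun x => F (stproj Ga x)) @^-1` Kr [set w | `|w| <= r'].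
    apply/seteqP; split=> [x [[Dx bx] bx']|x [_ [w /= wr <-] e]].
      have [h1 h2] := fK Dx; exists (f x); last exact: h2.
      by exists (Phi x); rewrite // ainvK.
    by have [Ox ex] := Oin x w (le_lt_trans wr r'r) e; split=> //=; rewrite ex.
  rewrite E; apply: preimage_closed => [x _|]; first exact: Fst_continuous.
  apply: compact_closed; first exact: hN.
  rewrite /Kr; have -> : cmap c' @` (aff @` [set w | `|w| <= r']) = (cmap c' \o aff) @` [set w | `|w| <= r'].
    by rewrite image_comp.
  apply: continuous_compact.
    apply: continuous_in_subspaceT => w; rewrite inE /= => wr.
    have [cw _] := Hr w (le_lt_trans wr r'r).
    apply: (@continuous_comp X X N aff (cmap c') w (@aff_continuous w)).
    exact: (chart_continuous sN ac' cw).
  apply: bounded_closed_compact.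
    exists r'; split; first exact: num_real.
    by move=> y My x /= /le_trans; apply; exact: ltW.
  have := @closed_closed_ball_ R X 0 r'.
  by congr closed; apply/seteqP; split => x /=; rewrite /closed_ball_/= sub0r normrN.
- move=> U UO oU.
  pose V := F @` (stproj Ga @` U).
  have oV : open V by apply: (ioe_open ioe); exact: stproj_open.
  have E : Phi @` U = (aff @^-1` (cdom c' `&` cmap c' @^-1` V)).
    apply/seteqP; split=> [_ [x Ux <-]|w [cw [_ [x Ux <-] e]]].
      have [Dx _] := UO x Ux; have [h1 h2] := fK Dx; rewrite /= /Phi ainvK; split; first exact: h1.
      by rewrite h2; exists (stproj Ga x) => //; exists x.
    exists x => //; have [_ fx] := f_of_cmap cw (esym e).
    by rewrite /Phi fx affK.
  rewrite E; apply: open_comp => [w _|]; first exact: aff_continuous.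
  rewrite openE => y [cy Vy]; apply: filterI.
    by apply: open_nbhs_nbhs; split; [exact: (chart_open sN ac')|].
  apply: (continuous_nbhs_pre (chart_continuous sN ac' cy)).
  exact: open_nbhs_nbhs.
- move=> x x' [Dx _] [Dx' _] e.
  have fe : f x = f x' by rewrite -(ainvK (f x)) -(ainvK (f x')) -/(Phi x) e.
  apply: (ioe_inj ioe); have [_ <-] := fK Dx; have [_ <-] := fK Dx'.
  by rewrite fe.
- move=> x x' [Dx bx] e; have fe : f x' = f x by rewrite /f e.
  by rewrite /O /Phi /= fe /D1 /= -e.
- by move=> x [_].
- rewrite inE => cl U U0.
  have b00 : [set w : X | `|w| < r] 0 by rewrite /= normr0.
  have [d d0 Hd] := nbhs_distP (filterI U0 (open_nbhs_nbhs (conj nb b00))).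
  have oB : open (Kr [set w | `|w| < Num.min d r]).
    apply: cran_open.
      by move=> _ [w /= + <-]; rewrite lt_min => /andP[_ wr]; have [] := Hr w wr.
    apply: affO; rewrite (_ : [set w : X | _] = ball 0 (Num.min d r)).
      by apply: ball_open; rewrite lt_min d0.
    by apply/seteqP; split=> w; rewrite -ball_normE /= sub0r normrN.
  have Bq : Kr [set w | `|w| < Num.min d r] (cmap c' yq).
    exists yq => //; exists 0; first by rewrite /= normr0 lt_min d0.
    by rewrite /aff mul0mx addr0.
  have [_ [[st _ <-] [_ [w /= wd <-] ew]]] := cl _ (open_nbhs_nbhs (conj oB Bq)).
  have [x ex] := stproj_surj st.
  move: wd; rewrite lt_min => /andP[wd wr].
  rewrite -ex in ew; have [Ox ePhi] := Oin x w wr ew.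
  exists w; split; first by exists x.
  by have [|Uw _] := Hd w; [rewrite sub0r normrN|].
- move=> nr [x [Dx _] e]; apply: nr; exists (stproj Ga x) => //.
  have [_ <-] := fK Dx; congr cmap.
  by rewrite -(ainvK (f x)) -/(Phi x) e /aff mul0mx addr0.
Qed.

End FromExtension.

(** In a connected manifold a nonempty open proper subset is not closed, so its boundary contains a
    point, to which [no_local_extension] applies. *)
Lemma family_inextendible {R : realType} {m : nat} (A p : 'I_(hdim m) -> R)
    (Ga : set 'rV[R]_(hdim m)) (c c1 : R) i : discrete_subgroup Ga -> (forall a, 0 < A a) ->
  (forall s : 'I_m, 0 < chi p s) -> 0 < c -> (forall a, c <= 1 - p a) ->
  0 < c1 -> c1 <= 1 -> (forall a, c1 <= 1 + p a) -> i != 0 -> p i < 0 ->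
  C0_inextendible (family_metric A p Ga).
Proof.
move=> dG A0 chi0 c0 cp c10 c11 c1p i0 pi0 [N [h [F [[sN coN hN _] [clm ioe nF]]]]].
apply: nF; apply: coN; first by exists (F (stproj Ga 0)); exists (stproj Ga 0).
  exists (range F); last by rewrite setTI.
  exact: (ioe_open ioe openT).
exists (range F); last by rewrite setTI.
move=> q cl; apply: contrapT => nq.
have [c' ac' [yq cyq eq]] := chart_cover sN q.
have [P uP hP] := (proj1 (proj1 clm)) c' yq ac' cyq.
have [r [OO [Phi [r0 lx h1 h2]]]] := extension_chart dG A0 sN hN clm ioe ac' cyq uP hP.
apply: (no_local_extension lx dG A0 chi0 c0 cp c10 c11 c1p i0 pi0 r0).
  by apply: h1; rewrite inE eq.
by apply: h2; rewrite eq.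
Qed.

(** * Ricci curvature of the extended metric *)

Section LineDerivative.
Context {R : realType}.

Lemma is_derive_lineP (V W : normedModType R) (f : V -> W) (x v : V) (l : W) :
  is_derive (0 : R) 1 (fun t : R => f (x + t *: v)) l -> is_derive x v f l.
Proof.
have E : (fun h : R => h^-1 *: (((fun t : R => f (x + t *: v)) \o shift (0 : R)) (h *: (1 : R)) - f (x + (0 : R) *: v))) =
    (fun h : R => h^-1 *: ((f \o shift x) (h *: v) - f x)).
  apply/funext => h /=; have -> : h%:A + 0 = h :> R by rewrite addr0 -[LHS]/(h * 1) mulr1.
  by rewrite scale0r addr0 [x + _]addrC.
case=> d e; apply: DeriveDef.
  by move: d; rewrite /derivable E.
by move: e; rewrite /derive E.
Qed.

(** Lets the metric be handled as a bilinear form in the left-invariant frame; its coordinate matrix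
    is only read off at the end. *)
Lemma bilinear_matrix n (B : 'rV[R]_n -> 'rV[R]_n -> R) :
  (forall a u v w, B (a *: u + v) w = a * B u w + B v w) -> (forall u v, B u v = B v u) ->
  forall u v, (u *m (\matrix_(i, j) B (delta_mx 0 i) (delta_mx 0 j)) *m v^T) 0 0 = B u v.
Proof.
move=> lin sym.
have B0 w : B 0 w = 0 by have := lin (-1) 0 0 w; rewrite scaler0 addr0 => h; lra.
have ex u w : B u w = \sum_i u 0 i * B (delta_mx 0 i) w.
  rewrite {1}[u]row_sum_delta.
  elim/big_rec2 : _ => [|i a b _ IH]; first by rewrite B0.
  by rewrite lin IH.
move=> u v; rewrite mxE; under eq_bigr do rewrite mxE mulr_suml.
rewrite exchange_big /= ex; apply: eq_bigr => i _.
rewrite sym ex mulr_sumr; apply: eq_bigr => j _.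
by rewrite !mxE sym; ring.
Qed.

Lemma bilinear_matrix_ext n (G H : 'M[R]_n) :
  (forall u v : 'rV[R]_n, (u *m G *m v^T) 0 0 = (u *m H *m v^T) 0 0) -> G = H.
Proof.
move=> E; apply/matrixP => i j; have := E (delta_mx 0 i) (delta_mx 0 j).
by rewrite trmx_delta -!rowE -!colE !mxE.
Qed.

End LineDerivative.

Section HorizontalSums.
Context {V : nmodType} {m : nat}.
Implicit Types (r : 'I_m) (f : 'I_m -> V).

Lemma sum_ix r f : \sum_(i | ix r == ix i) f i = f r.
Proof. by rewrite (big_pred1 r) => // i; rewrite /= (inj_eq (@ix_inj m)) eq_sym. Qed.

Lemma sum_iy r f : \sum_(i | iy r == iy i) f i = f r.
Proof. by rewrite (big_pred1 r) => // i; rewrite /= (inj_eq (@iy_inj m)) eq_sym. Qed.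

Lemma sum_ix_iy r f : \sum_(i | ix r == iy i) f i = 0.
Proof. by rewrite big_pred0// => i; rewrite ix_neq_iy. Qed.

Lemma sum_iy_ix r f : \sum_(i | iy r == ix i) f i = 0.
Proof. by rewrite big_pred0// => i; rewrite eq_sym ix_neq_iy. Qed.

End HorizontalSums.

Section Curvature.
Context {R : realType} {m : nat}.
Local Notation X := 'rV[R]_(1 + hdim m).
Variables (b : R) (ax ay : 'I_m -> R).
Hypotheses (b0 : b != 0) (ax0 : forall r, ax r != 0) (ay0 : forall r, ay r != 0).

(* hbil is the extended metric in the coordinate s = e^{2 tau}, with b = +/- A_0 / 2;
   vs, wz, vx, vy are the components of a vector on ds, w^0, w^{2r-1}, w^{2r}. *)
Definition kq r : R := b ^+ 2 / (4 * (ax r ^+ 2 * ay r ^+ 2)).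
Definition FF r (s : R) : R := 1 + kq r * s ^+ 2.
Definition PP (s : R) : R := \prod_r FF r s.
Definition cc (s : R) : R := 4 * b ^+ 2 * s / PP s.

Definition vs (u : X) : R := u 0 0.
Definition wz (x u : X) : R := cow (rsubmx x) (rsubmx u) 0.
Definition vx (r : 'I_m) (u : X) : R := rsubmx u 0 (ix r).
Definition vy (r : 'I_m) (u : X) : R := rsubmx u 0 (iy r).

Definition hbil (x u v : X) : R :=
  b * (vs u * wz x v + vs v * wz x u) + cc (vs x) * (wz x u * wz x v)
  + \sum_r FF r (vs x) * (ax r ^+ 2 * (vx r u * vx r v) + ay r ^+ 2 * (vy r u * vy r v)).

Definition hform (x : X) : 'M[R]_(1 + hdim m) := \matrix_(i, j) hbil x (delta_mx 0 i) (delta_mx 0 j).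

Lemma FF_gt0 r s : 0 < FF r s.
Proof. by rewrite ltr_pwDl// mulr_ge0 ?sqr_ge0// divr_ge0 ?sqr_ge0// mulr_ge0// mulr_ge0 ?sqr_ge0. Qed.

Lemma FF_neq0 r s : FF r s != 0. Proof. by rewrite gt_eqF// FF_gt0. Qed.

Lemma PP_gt0 s : 0 < PP s. Proof. by apply: prodr_gt0 => r _; exact: FF_gt0. Qed.

Lemma vs_lin a u v : vs (a *: u + v) = a * vs u + vs v. Proof. by rewrite /vs !mxE. Qed.
Lemma vx_lin r a u v : vx r (a *: u + v) = a * vx r u + vx r v. Proof. by rewrite /vx !mxE. Qed.
Lemma vy_lin r a u v : vy r (a *: u + v) = a * vy r u + vy r v. Proof. by rewrite /vy !mxE. Qed.

Lemma wzE x u : wz x u = rsubmx u 0 0 - \sum_r vx r x * vy r u.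
Proof. by rewrite /wz cow0. Qed.

Lemma wz_lin x a u v : wz x (a *: u + v) = a * wz x u + wz x v.
Proof.
rewrite !wzE; under eq_bigr do rewrite vy_lin mulrDr mulrCA.
by rewrite big_split -mulr_sumr /= linearD linearZ /= 2!mxE; ring.
Qed.

Lemma hbil_lin x a u v w : hbil x (a *: u + v) w = a * hbil x u w + hbil x v w.
Proof.
rewrite /hbil vs_lin wz_lin.
have -> : \sum_r FF r (vs x) * (ax r ^+ 2 * (vx r (a *: u + v) * vx r w) + ay r ^+ 2 * (vy r (a *: u + v) * vy r w)) =
  a * (\sum_r FF r (vs x) * (ax r ^+ 2 * (vx r u * vx r w) + ay r ^+ 2 * (vy r u * vy r w)))
  + \sum_r FF r (vs x) * (ax r ^+ 2 * (vx r v * vx r w) + ay r ^+ 2 * (vy r v * vy r w)).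
  by rewrite mulr_sumr -big_split /=; apply: eq_bigr => r _; rewrite vx_lin vy_lin; ring.
by ring.
Qed.

Lemma hbil_sym x u v : hbil x u v = hbil x v u.
Proof.
rewrite /hbil; congr (_ + _ + _); [ring|ring|].
by apply: eq_bigr => r _; ring.
Qed.

Lemma hformE x u v : (u *m hform x *m v^T) 0 0 = hbil x u v.
Proof. exact: (bilinear_matrix (hbil_lin x) (hbil_sym x)). Qed.

Definition rho r (s : R) : R := kq r * s / FF r s.
Definition srho (s : R) : R := \sum_r rho r s.
Definition dcc (s : R) : R := 4 * b ^+ 2 / PP s - 2 * cc s * srho s.
Definition drho r (s : R) : R := kq r / FF r s - 2 * rho r s ^+ 2.
Definition ddcc (s : R) : R :=
  - (8 * b ^+ 2 / PP s * srho s) - 2 * (dcc s * srho s + cc s * \sum_r drho r s).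
Definition gam (s : R) : R := dcc s / (2 * b).

Lemma is_derive_FF r (s : R) : is_derive s (1 : R) (FF r) (2 * (kq r * s)).
Proof.
have d1 := is_deriveD (is_derive_cst (1 : R) s (1 : R)) (is_deriveZ (kq r) (is_deriveM (is_derive_id s (1 : R)) (is_derive_id s (1 : R)))).
have -> : FF r = fun s => 1 + kq r * (s * s) by apply/funext => u; rewrite /FF expr2.
by apply: is_derive_eq d1 _; rewrite /GRing.scale /=; ring.
Qed.

Lemma is_derive_rho r (s : R) : is_derive s (1 : R) (rho r) (drho r s).
Proof.
have F0 := FF_neq0 r s.
have d1 := is_deriveM (is_deriveZ (kq r) (is_derive_id s (1 : R))) (is_deriveV F0 (is_derive_FF r s)).
apply: is_derive_eq d1 _; rewrite /GRing.scale /= /drho /rho -[kq r *: s]/(kq r * s).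
by field.
Qed.

Lemma is_derive_PP (s : R) : is_derive s (1 : R) PP (PP s * (2 * srho s)).
Proof.
have H (l : seq 'I_m) : is_derive s (1 : R) (fun s => \prod_(r <- l) FF r s)
    (\prod_(r <- l) FF r s * (2 * \sum_(r <- l) rho r s)).
  elim: l => [|r l IH].
    under eq_fun do rewrite big_nil.
    by rewrite !big_nil !mulr0; exact: is_derive_cst.
  under eq_fun do rewrite big_cons.
  rewrite !big_cons; apply: is_derive_eq (is_deriveM (is_derive_FF r s) IH) _.
  rewrite /GRing.scale /= /rho; set Q := \prod_(_ <- _) _; set S := \sum_(_ <- _) _.
  by field; exact: FF_neq0.
by have := H (index_enum 'I_m).
Qed.

Lemma is_derive_PPV (s : R) : is_derive s (1 : R) (fun s => (PP s)^-1) (- (2 * srho s / PP s)).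
Proof.
have P0 : PP s != 0 by rewrite gt_eqF// PP_gt0.
apply: is_derive_eq (is_deriveV P0 (is_derive_PP s)) _; rewrite /GRing.scale /=; by field.
Qed.

Lemma is_derive_cc (s : R) : is_derive s (1 : R) cc (dcc s).
Proof.
have d := is_deriveM (is_deriveZ (4 * b ^+ 2) (is_derive_id s (1 : R))) (is_derive_PPV s).
by apply: is_derive_eq d _; rewrite /GRing.scale /= /dcc /cc -[(4 * b ^+ 2) *: s]/(4 * b ^+ 2 * s); ring.
Qed.

Lemma is_derive_sum_ord (f : 'I_m -> R -> R) (df : 'I_m -> R) (s : R) :
  (forall r, is_derive s (1 : R) (f r) (df r)) -> is_derive s (1 : R) (fun s => \sum_r f r s) (\sum_r df r).
Proof.
move=> H; have := @is_derive_sum R R R m f s 1 df H.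
by rewrite (_ : \sum_i f i = fun s => \sum_r f r s)//; apply/funext => u; rewrite fct_sumE.
Qed.

Lemma is_derive_srho (s : R) : is_derive s (1 : R) srho (\sum_r drho r s).
Proof. by apply: is_derive_sum_ord => r; exact: is_derive_rho. Qed.

Lemma is_derive_dcc (s : R) : is_derive s (1 : R) dcc (ddcc s).
Proof.
have d1 := is_deriveZ (4 * b ^+ 2) (is_derive_PPV s).
have d2 := is_deriveZ (2 : R) (is_deriveM (is_derive_cc s) (is_derive_srho s)).
have d := is_deriveB d1 d2.
have -> : dcc = fun s => 4 * b ^+ 2 * (PP s)^-1 - 2 * (cc s * srho s).
  by apply/funext => u; rewrite /dcc mulrA.
by apply: is_derive_eq d _; rewrite /GRing.scale /= /ddcc /dcc; ring.
Qed.

Lemma is_derive_gam (s : R) : is_derive s (1 : R) gam (ddcc s / (2 * b)).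
Proof.
have d := is_deriveZ (2 * b)^-1 (is_derive_dcc s).
have -> : gam = fun s => (2 * b)^-1 * dcc s by apply/funext => u; rewrite /gam mulrC.
by apply: is_derive_eq d _; rewrite /GRing.scale /= mulrC.
Qed.

(** The scalar equation behind Ricci-flatness; [ricci_identity] uses it to eliminate the second
    derivative of [cc]. *)
Lemma cc_ode s : ddcc s + 2 * dcc s * srho s + 4 * cc s * \sum_r (kq r / FF r s ^+ 2) = 0.
Proof.
have P0 : PP s != 0 by rewrite gt_eqF// PP_gt0.
rewrite /ddcc.
have e1 : 8 * b ^+ 2 / PP s * srho s = 2 * cc s * \sum_r (kq r / FF r s).
  rewrite /srho !mulr_sumr; apply: eq_bigr => r _; rewrite /rho /cc.
  by field; rewrite P0 FF_neq0.
have e2 : \sum_r drho r s = 2 * (\sum_r (kq r / FF r s ^+ 2)) - \sum_r kq r / FF r s.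
  rewrite mulr_sumr -sumrB; apply: eq_bigr => r _; rewrite /drho /rho /FF.
  by field; rewrite -/(FF r s) FF_neq0.
by rewrite e1 e2; ring.
Qed.

(** [al] and [be] are half the inverse metric coefficients on the pair r, 2 b [EE] is the
    s-derivative of the horizontal part of the metric, [nn] is the metric pairing with the central
    field, and [SS] stems from dw^0. *)
Definition al r (s : R) : R := (2 * ax r ^+ 2 * FF r s)^-1.
Definition be r (s : R) : R := (2 * ay r ^+ 2 * FF r s)^-1.
Definition EE (x u v : X) : R :=
  \sum_r kq r * vs x / b * (ax r ^+ 2 * (vx r u * vx r v) + ay r ^+ 2 * (vy r u * vy r v)).
Definition nn (x u : X) : R := b * vs u + cc (vs x) * wz x u.
Definition SS (u v : X) : R := \sum_r (vx r u * vy r v + vy r u * vx r v).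

Definition Gs (x u v : X) : R :=
  gam (vs x) * (vs u * wz x v + vs v * wz x u) + cc (vs x) * gam (vs x) / b * (wz x u * wz x v)
  + cc (vs x) / b * EE x u v.
Definition Gth (x u v : X) : R := - (SS u v / 2) - gam (vs x) * (wz x u * wz x v) - EE x u v.
Definition Gx r (x u v : X) : R :=
  rho r (vs x) * (vs u * vx r v + vs v * vx r u) + al r (vs x) * (nn x v * vy r u + nn x u * vy r v).
Definition Gy r (x u v : X) : R :=
  rho r (vs x) * (vs u * vy r v + vs v * vy r u) - be r (vs x) * (nn x v * vx r u + nn x u * vx r v).

(* The Christoffel symbols as a bilinear map; Gs, Gth, Gx, Gy are its values
   on ds, w^0, dx_r and dy_r. *)
Definition Gam (x u v : X) : X := pt (Gs x u v)
  (\row_a (if a == 0 then Gth x u v + \sum_r vx r x * Gy r x u v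
           else \sum_(r | a == ix r) Gx r x u v + \sum_(r | a == iy r) Gy r x u v)).

Lemma vs_Gam x u v : vs (Gam x u v) = Gs x u v. Proof. exact: pt_time. Qed.

Lemma vx_Gam r x u v : vx r (Gam x u v) = Gx r x u v.
Proof.
by rewrite /vx pt_space mxE ix_neq0 sum_ix sum_ix_iy addr0.
Qed.

Lemma vy_Gam r x u v : vy r (Gam x u v) = Gy r x u v.
Proof.
by rewrite /vy pt_space mxE iy_neq0 sum_iy sum_iy_ix add0r.
Qed.

Lemma wz_Gam x u v : wz x (Gam x u v) = Gth x u v.
Proof.
rewrite wzE pt_space mxE eqxx; under [X in _ - X]eq_bigr do rewrite vy_Gam.
by rewrite addrK.
Qed.

Lemma frame_eqP x (u v : X) : vs u = vs v -> wz x u = wz x v -> (forall r, vx r u = vx r v) ->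
  (forall r, vy r u = vy r v) -> u = v.
Proof.
move=> e1 e2 e3 e4; rewrite -(pt_eta u) -(pt_eta v); congr pt; first exact: e1.
apply/rowP => a; case: (hindexP a) => [->|[r ->]|[r ->]]; [|exact: e3|exact: e4].
move: e2; rewrite !wzE; under eq_bigr do rewrite e4.
by move=> /addIr.
Qed.

(* The derivatives of wz and of hbil at x in the direction d. *)
Definition dw (d u : X) : R := - \sum_r vx r d * vy r u.
Definition dh (x d u v : X) : R :=
  nn x u * dw d v + nn x v * dw d u + vs d * (dcc (vs x) * (wz x u * wz x v)
  + \sum_r 2 * (kq r * vs x) * (ax r ^+ 2 * (vx r u * vx r v) + ay r ^+ 2 * (vy r u * vy r v))).

Lemma vs_line x d t : vs (x + t *: d) = vs x + t * vs d.
Proof. by rewrite addrC vs_lin addrC. Qed.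

Lemma wz_line x d u t : wz (x + t *: d) u = wz x u + t * dw d u.
Proof.
rewrite !wzE /dw mulrN mulr_sumr -addrA -opprD -big_split /=; congr (_ - _).
by apply: eq_bigr => r _; rewrite [x + _]addrC vx_lin; ring.
Qed.

Lemma is_derive_affine (a c : R) (t : R) : is_derive t (1 : R) (fun t => a + t * c) c.
Proof.
have d := is_deriveD (is_derive_cst a t (1 : R)) (is_deriveM (is_derive_id t (1 : R)) (is_derive_cst c t (1 : R))).
by apply: is_derive_eq d _; rewrite /GRing.scale /=; ring.
Qed.

Lemma is_derive_of_vs (g : R -> R) dg x d : is_derive (vs x) (1 : R) g dg ->
  is_derive (0 : R) (1 : R) (fun t => g (vs (x + t *: d))) (vs d * dg).
Proof.
move=> H; under eq_fun do rewrite vs_line.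
have a := is_derive_affine (vs x) (vs d) 0.
apply: is_derive_eq (is_derive_compR a _) _; last by [].
by rewrite mul0r addr0.
Qed.

Lemma is_derive_wz x d u : is_derive (0 : R) (1 : R) (fun t => wz (x + t *: d) u) (dw d u).
Proof. by under eq_fun do rewrite wz_line; exact: is_derive_affine. Qed.

Lemma is_derive_hbil x d u v : is_derive x d (fun y => hbil y u v) (dh x d u v).
Proof.
apply: is_derive_lineP; rewrite /hbil.
have d1 := is_derive_wz x d u; have d2 := is_derive_wz x d v.
have d3 := is_derive_of_vs d (is_derive_cc (vs x)).
have d4 := is_derive_sum_ord (fun r => is_deriveM (is_derive_of_vs d (is_derive_FF r (vs x)))
  (is_derive_cst (ax r ^+ 2 * (vx r u * vx r v) + ay r ^+ 2 * (vy r u * vy r v)) (0 : R) (1 : R))).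
have e := is_deriveD (is_deriveD (is_deriveZ b (is_deriveD (is_deriveZ (vs u) d2) (is_deriveZ (vs v) d1)))
  (is_deriveM d3 (is_deriveM d1 d2))) d4.
have z : x + (0 : R) *: d = x by rewrite scale0r addr0.
apply: is_derive_eq e _; rewrite !z /GRing.scale /= /dh /nn.
have -> : ((fun t : R => wz (x + t *: d) u) * (fun t : R => wz (x + t *: d) v)) 0 = wz x u * wz x v.
  by rewrite /GRing.mul /= z.
have -> : \sum_(r < m) (FF r (vs x) * 0 + (ax r ^+ 2 * (vx r u * vx r v) + ay r ^+ 2 * (vy r u * vy r v)) * (vs d * (2 * (kq r * vs x)))) =
  vs d * \sum_r 2 * (kq r * vs x) * (ax r ^+ 2 * (vx r u * vx r v) + ay r ^+ 2 * (vy r u * vy r v)).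
  by rewrite mulr_sumr; apply: eq_bigr => r _; ring.
ring.
Qed.

(** The connection is verified against the Koszul formula for constant coordinate fields; with
    nondegeneracy this determines the Christoffel symbols without inverting the metric. *)
Lemma koszul x u v l : hbil x (Gam x u v) l = (dh x u v l + dh x v u l - dh x l u v) / 2.
Proof.
rewrite /hbil vs_Gam wz_Gam.
under [X in _ + X = _]eq_bigr do rewrite vx_Gam vy_Gam.
rewrite /dh /Gs /Gth /dw.
set s := vs x; set us := vs u; set vs' := vs v; set ls := vs l.
set wu := wz x u; set wv := wz x v; set wl := wz x l.
set E := EE x u v; set g := gam s; set c := cc s.
have e1 : dcc s = 2 * b * g by rewrite /g /gam; field.
rewrite e1.
have sumE (p q : X) : \sum_r 2 * (kq r * s) * (ax r ^+ 2 * (vx r p * vx r q) + ay r ^+ 2 * (vy r p * vy r q)) = 2 * b * EE x p q.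
  by rewrite /EE mulr_sumr; apply: eq_bigr => r _; rewrite -/s; field.
rewrite !sumE -/E.
have e2 : SS u v = \sum_r vx r u * vy r v + \sum_r vx r v * vy r u.
  by rewrite /SS -big_split /=; apply: eq_bigr => r _; ring.
have e3 : \sum_r FF r s * (ax r ^+ 2 * (Gx r x u v * vx r l) + ay r ^+ 2 * (Gy r x u v * vy r l)) =
   b * us * EE x v l + b * vs' * EE x u l
   + (nn x v * (\sum_r vx r l * vy r u - \sum_r vx r u * vy r l) + nn x u * (\sum_r vx r l * vy r v - \sum_r vx r v * vy r l)) / 2.
  rewrite -!sumrB /EE !mulr_sumr -!big_split /= mulr_suml -!big_split /=.
  apply: eq_bigr => r _; rewrite /Gx /Gy /rho /al /be -/s -/us -/vs'.
  by field; rewrite FF_neq0 b0 ax0 ay0.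
rewrite e3 e2 /nn -/s -/us -/vs' -/ls -/wu -/wv -/wl -/c.
set a1 := \sum_r vx r u * vy r v; set a2 := \sum_r vx r v * vy r u; set a3 := \sum_r vx r l * vy r u.
set a4 := \sum_r vx r u * vy r l; set a5 := \sum_r vx r l * vy r v; set a6 := \sum_r vx r v * vy r l.
by field.
Qed.

Local Notation ix := (@ix m).
Local Notation iy := (@iy m).

Lemma EE_lin x u a v w : EE x u (a *: v + w) = a * EE x u v + EE x u w.
Proof.
by rewrite /EE mulr_sumr -big_split /=; apply: eq_bigr => r _; rewrite vx_lin vy_lin; ring.
Qed.

Lemma SS_lin (u : X) a (v w : X) : SS u (a *: v + w) = a * SS u v + SS u w.
Proof.
by rewrite /SS mulr_sumr -big_split /=; apply: eq_bigr => r _; rewrite vx_lin vy_lin; ring.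
Qed.

Lemma nn_lin x a v w : nn x (a *: v + w) = a * nn x v + nn x w.
Proof. by rewrite /nn vs_lin wz_lin; ring. Qed.

Lemma Gam_lin x u a v w : Gam x u (a *: v + w) = a *: Gam x u v + Gam x u w.
Proof.
apply: (@frame_eqP x).
- by rewrite vs_lin !vs_Gam /Gs EE_lin vs_lin wz_lin; ring.
- by rewrite wz_lin !wz_Gam /Gth EE_lin SS_lin wz_lin; ring.
- by move=> r; rewrite vx_lin !vx_Gam /Gx vs_lin vx_lin vy_lin nn_lin; ring.
- by move=> r; rewrite vy_lin !vy_Gam /Gy vs_lin vx_lin vy_lin nn_lin; ring.
Qed.

Lemma Gam_sym x u v : Gam x u v = Gam x v u.
Proof.
have eE : EE x u v = EE x v u by apply: eq_bigr => r _; ring.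
have eS : SS u v = SS v u by apply: eq_bigr => r _; ring.
apply: (@frame_eqP x).
- by rewrite !vs_Gam /Gs eE; ring.
- by rewrite !wz_Gam /Gth eE eS; ring.
- by move=> r; rewrite !vx_Gam /Gx; ring.
- by move=> r; rewrite !vy_Gam /Gy; ring.
Qed.

Definition es : X := pt 1 0.
Definition ea (a : 'I_(hdim m)) : X := pt 0 (delta_mx 0 a).
(** The left-invariant field d/dy_r + x_r d/dz, on which w^0 vanishes; [ea (ix r)] is already
    left-invariant. *)
Definition ey (x : X) (r : 'I_m) : X := vx r x *: ea 0 + ea (iy r).

Lemma delta_es : delta_mx 0 0 = es.
Proof.
apply/rowP => j; rewrite /es !mxE; case: splitP => k e; rewrite !mxE ?ord1.
  by rewrite (_ : j = 0)//; apply/val_inj; rewrite /= e ord1.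
by rewrite (_ : (j == 0) = false)//; apply/negbTE/eqP => j0; move: e; rewrite j0.
Qed.

Lemma delta_ea a : delta_mx 0 (rshift 1 a) = ea a.
Proof.
apply/rowP => j; rewrite /ea !mxE; case: splitP => k e; rewrite !mxE.
  rewrite mul0rn (_ : (j == _) = false) ?andbF//; apply/negbTE/eqP => j0; move: e.
  by rewrite j0 /= ord1.
by congr ((_ && _)%:R); rewrite (_ : j = rshift 1 k) ?(inj_eq (@rshift_inj _ _))//; apply/val_inj.
Qed.

Lemma vs_es : vs es = 1. Proof. exact: pt_time. Qed.
Lemma vx_es r : vx r es = 0. Proof. by rewrite /vx pt_space mxE. Qed.
Lemma vy_es r : vy r es = 0. Proof. by rewrite /vy pt_space mxE. Qed.
Lemma wz_es x : wz x es = 0.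
Proof. by rewrite wzE pt_space mxE big1 ?subr0// => r _; rewrite vy_es mulr0. Qed.
Lemma vs_ea a : vs (ea a) = 0. Proof. exact: pt_time. Qed.
Lemma vx_ea r a : vx r (ea a) = (ix r == a)%:R. Proof. by rewrite /vx pt_space mxE. Qed.
Lemma vy_ea r a : vy r (ea a) = (iy r == a)%:R. Proof. by rewrite /vy pt_space mxE. Qed.
Lemma vx_ez r : vx r (ea 0) = 0. Proof. by rewrite vx_ea ix_neq0. Qed.
Lemma vy_ez r : vy r (ea 0) = 0. Proof. by rewrite vy_ea iy_neq0. Qed.
Lemma vx_ex q r : vx q (ea (ix r)) = (q == r)%:R. Proof. by rewrite vx_ea (inj_eq (@ix_inj m)). Qed.
Lemma vy_ex q r : vy q (ea (ix r)) = 0. Proof. by rewrite vy_ea eq_sym ix_neq_iy. Qed.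
Lemma wz_ez x : wz x (ea 0) = 1.
Proof. by rewrite wzE pt_space mxE eqxx big1 ?subr0// => r _; rewrite vy_ea iy_neq0 mulr0. Qed.
Lemma wz_ex x r : wz x (ea (ix r)) = 0.
Proof. by rewrite wzE pt_space mxE eq_sym ix_neq0 big1 ?subr0// => q _; rewrite vy_ea eq_sym ix_neq_iy mulr0. Qed.
Lemma vs_ey x r : vs (ey x r) = 0. Proof. by rewrite vs_lin !vs_ea; ring. Qed.
Lemma vx_ey x r q : vx q (ey x r) = 0.
Proof. by rewrite vx_lin !vx_ea ix_neq_iy ix_neq0 mulr0 addr0. Qed.
Lemma vy_ey x r q : vy q (ey x r) = (q == r)%:R.
Proof. by rewrite vy_lin !vy_ea iy_neq0 (inj_eq (@iy_inj m)) mulr0 add0r. Qed.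
Lemma wz_ey x r : wz x (ey x r) = 0.
Proof.
rewrite wz_lin wz_ez wzE pt_space mxE eq_sym iy_neq0 (bigD1 r)//= big1 => [|q qr].
  by rewrite vy_ea eqxx /vx /=; ring.
by rewrite vy_ea (inj_eq (@iy_inj m)) (negbTE qr) mulr0.
Qed.

Lemma sum_coord (V : nmodType) (F : 'I_(1 + hdim m) -> V) :
  \sum_k F k = F 0 + (F (rshift 1 0) + \sum_r (F (rshift 1 (ix r)) + F (rshift 1 (iy r)))).
Proof.
by rewrite big_split_ord /= big_ord1 sum_hindex (_ : lshift _ 0 = 0)//; apply/val_inj.
Qed.

(** A trace does not depend on the basis; the left-invariant frame is the one in which [Gam] is
    explicit. *)
Lemma frame_trace x (L : X -> X) : (forall a u v, L (a *: u + v) = a *: L u + L v) ->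
  \sum_k L (delta_mx 0 k) 0 k =
  vs (L es) + wz x (L (ea 0)) + \sum_r (vx r (L (ea (ix r))) + vy r (L (ey x r))).
Proof.
move=> lin; rewrite sum_coord delta_es delta_ea -addrA; congr (_ + _).
rewrite wzE -rsubmxE -addrA; congr (_ + _).
rewrite -sumrN -big_split /=; apply: eq_bigr => r _.
by rewrite !delta_ea lin vy_lin /vx /vy !rsubmxE; ring.
Qed.

Lemma bilin_sum x (u w : X) : Gam x u w = \sum_l w 0 l *: Gam x u (delta_mx 0 l).
Proof.
have G0 : Gam x u 0 = 0.
  by have := Gam_lin x u (-1) 0 0; rewrite scaler0 addr0 scaleN1r addNr.
rewrite {1}[w]row_sum_delta; elim/big_rec2 : _ => [|i a c _ IH]; first exact: G0.
by rewrite Gam_lin IH.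
Qed.

Definition QQ r (u v : X) : R := ax r ^+ 2 * (vx r u * vx r v) + ay r ^+ 2 * (vy r u * vy r v).
Definition dEE (d u v : X) : R := vs d * \sum_r kq r / b * QQ r u v.
Definition dnn (x d u : X) : R := vs d * (dcc (vs x) * wz x u) + cc (vs x) * dw d u.
Definition dGs (x d u v : X) : R :=
  vs d * (ddcc (vs x) / (2 * b)) * (vs u * wz x v + vs v * wz x u) + gam (vs x) * (vs u * dw d v + vs v * dw d u)
  + vs d * (dcc (vs x) * gam (vs x) / b + cc (vs x) * (ddcc (vs x) / (2 * b)) / b) * (wz x u * wz x v)
  + cc (vs x) * gam (vs x) / b * (dw d u * wz x v + wz x u * dw d v)
  + vs d * (dcc (vs x) / b) * EE x u v + cc (vs x) / b * dEE d u v.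
Definition dGth (x d u v : X) : R :=
  - (vs d * (ddcc (vs x) / (2 * b)) * (wz x u * wz x v) + gam (vs x) * (dw d u * wz x v + wz x u * dw d v) + dEE d u v).
Definition dGx r (x d u v : X) : R :=
  vs d * drho r (vs x) * (vs u * vx r v + vs v * vx r u)
  + vs d * (- (2 * rho r (vs x) * al r (vs x))) * (nn x v * vy r u + nn x u * vy r v)
  + al r (vs x) * (dnn x d v * vy r u + dnn x d u * vy r v).
Definition dGy r (x d u v : X) : R :=
  vs d * drho r (vs x) * (vs u * vy r v + vs v * vy r u)
  - (vs d * (- (2 * rho r (vs x) * be r (vs x))) * (nn x v * vx r u + nn x u * vx r v)
  + be r (vs x) * (dnn x d v * vx r u + dnn x d u * vx r v)).

Local Notation line x d := (fun t : R => x + t *: d).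

Lemma line0 (x d : X) : x + (0 : R) *: d = x. Proof. by rewrite scale0r addr0. Qed.

Lemma is_derive_al r (c s : R) : c != 0 ->
  is_derive s (1 : R) (fun s => (2 * c ^+ 2 * FF r s)^-1) (- (2 * rho r s * (2 * c ^+ 2 * FF r s)^-1)).
Proof.
move=> c0; have n0 : 2 * c ^+ 2 * FF r s != 0.
  by rewrite mulf_neq0 ?FF_neq0// mulf_neq0 ?sqrf_eq0// pnatr_eq0.
have d0 := is_deriveM (is_derive_cst (2 * c ^+ 2) s (1 : R)) (is_derive_FF r s).
have d := is_deriveV (n0 : (cst (2 * c ^+ 2) * FF r) s != 0) d0.
apply: is_derive_eq d _; rewrite mulrfctE /GRing.scale /= /rho.
by field; rewrite c0 FF_neq0.
Qed.

Lemma is_derive_nn x d u : is_derive (0 : R) (1 : R) (fun t => nn (x + t *: d) u) (dnn x d u).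
Proof.
have e := is_deriveD (is_derive_cst (b * vs u) (0 : R) (1 : R))
  (is_deriveM (is_derive_of_vs d (is_derive_cc (vs x))) (is_derive_wz x d u)).
by apply: is_derive_eq e _; rewrite !line0 /GRing.scale /= /dnn; ring.
Qed.

Lemma is_derive_EE x d u v : is_derive (0 : R) (1 : R) (fun t => EE (x + t *: d) u v) (dEE d u v).
Proof.
rewrite /dEE mulr_sumr /EE; apply: is_derive_sum_ord => r.
have i := is_derive_of_vs d (is_derive_id (vs x) (1 : R)).
have e := is_deriveM (is_deriveM (is_deriveM (is_derive_cst (kq r) (0 : R) (1 : R)) i)
  (is_derive_cst b^-1 (0 : R) (1 : R))) (is_derive_cst (QQ r u v) (0 : R) (1 : R)).
by apply: is_derive_eq e _; rewrite !line0 /GRing.scale /= ; ring.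
Qed.

Lemma is_derive_Gs x d u v : is_derive (0 : R) (1 : R) (fun t => Gs (x + t *: d) u v) (dGs x d u v).
Proof.
have d1 := is_derive_wz x d u; have d2 := is_derive_wz x d v.
have dg := is_derive_of_vs d (is_derive_gam (vs x)).
have dc := is_derive_of_vs d (is_derive_cc (vs x)).
have db := is_derive_cst b^-1 (0 : R) (1 : R).
have e := is_deriveD (is_deriveD
  (is_deriveM dg (is_deriveD (is_deriveZ (vs u) d2) (is_deriveZ (vs v) d1)))
  (is_deriveM (is_deriveM (is_deriveM dc dg) db) (is_deriveM d1 d2)))
  (is_deriveM (is_deriveM dc db) (is_derive_EE x d u v)).
apply: is_derive_eq e _; rewrite ?mulrfctE ?addrfctE /= ?line0 /GRing.scale /= /dGs; try ring.
Qed.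

Lemma is_derive_Gth x d u v : is_derive (0 : R) (1 : R) (fun t => Gth (x + t *: d) u v) (dGth x d u v).
Proof.
have d1 := is_derive_wz x d u; have d2 := is_derive_wz x d v.
have dg := is_derive_of_vs d (is_derive_gam (vs x)).
have e := is_deriveB (is_deriveB (is_derive_cst (- (SS u v / 2)) (0 : R) (1 : R))
  (is_deriveM dg (is_deriveM d1 d2))) (is_derive_EE x d u v).
by apply: is_derive_eq e _; rewrite ?mulrfctE ?addrfctE ?line0 /GRing.scale /= /dGth; ring.
Qed.

Lemma is_derive_Gx r x d u v : is_derive (0 : R) (1 : R) (fun t => Gx r (x + t *: d) u v) (dGx r x d u v).
Proof.
have dr := is_derive_of_vs d (is_derive_rho r (vs x)).
have da := is_derive_of_vs d (is_derive_al r (vs x) (ax0 r)).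
have e := is_deriveD (is_deriveM dr (is_derive_cst (vs u * vx r v + vs v * vx r u) (0 : R) (1 : R)))
  (is_deriveM da (is_deriveD (is_deriveM (is_derive_nn x d v) (is_derive_cst (vy r u) (0 : R) (1 : R)))
    (is_deriveM (is_derive_nn x d u) (is_derive_cst (vy r v) (0 : R) (1 : R))))).
apply: is_derive_eq e _; rewrite ?mulrfctE ?addrfctE /= ?line0 /GRing.scale /= /dGx /al; try ring.
Qed.

Lemma is_derive_Gy r x d u v : is_derive (0 : R) (1 : R) (fun t => Gy r (x + t *: d) u v) (dGy r x d u v).
Proof.
have dr := is_derive_of_vs d (is_derive_rho r (vs x)).
have da := is_derive_of_vs d (is_derive_al r (vs x) (ay0 r)).
have e := is_deriveB (is_deriveM dr (is_derive_cst (vs u * vy r v + vs v * vy r u) (0 : R) (1 : R)))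
  (is_deriveM da (is_deriveD (is_deriveM (is_derive_nn x d v) (is_derive_cst (vx r u) (0 : R) (1 : R)))
    (is_deriveM (is_derive_nn x d u) (is_derive_cst (vx r v) (0 : R) (1 : R))))).
apply: is_derive_eq e _; rewrite ?mulrfctE ?addrfctE /= ?line0 /GRing.scale /= /dGy /be; try ring.
Qed.

Lemma Gam_coord_z x u v : Gam x u v 0 (rshift 1 0) = Gth x u v + \sum_r vx r x * Gy r x u v.
Proof. by rewrite -rsubmxE pt_space mxE eqxx. Qed.

Lemma is_derive_Gam x d u v k : is_derive x d (fun y => Gam y u v 0 k)
  (if fintype.split k is inr a then (if a == 0 then dGth x d u v + \sum_r (vx r d * Gy r x u v + vx r x * dGy r x d u v)
     else \sum_(r | a == ix r) dGx r x d u v + \sum_(r | a == iy r) dGy r x d u v) else dGs x d u v).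
Proof.
apply: is_derive_lineP; case: splitP => j e.
  have -> : k = 0 by apply/val_inj; rewrite /= e ord1.
  by under eq_fun do rewrite -/(vs (Gam _ u v)) vs_Gam; exact: is_derive_Gs.
have -> : k = rshift 1 j by apply/val_inj.
case: (hindexP j) => [->|[r ->]|[r ->]].
- rewrite eqxx; under eq_fun do rewrite Gam_coord_z.
  apply: is_deriveD (is_derive_Gth x d u v) _; apply: is_derive_sum_ord => r.
  have dx : is_derive (0 : R) (1 : R) (fun t => vx r (x + t *: d)) (vx r d).
    under eq_fun do rewrite addrC vx_lin addrC; exact: is_derive_affine.
  have e' := is_deriveM dx (is_derive_Gy r x d u v).
  by apply: is_derive_eq e' _; rewrite !line0 /GRing.scale /=; ring.
- rewrite ix_neq0 sum_ix sum_ix_iy addr0.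
  by under eq_fun do rewrite -rsubmxE -/(vx r _) vx_Gam; exact: is_derive_Gx.
- rewrite iy_neq0 sum_iy sum_iy_ix add0r.
  by under eq_fun do rewrite -rsubmxE -/(vy r _) vy_Gam; exact: is_derive_Gy.
Qed.

Lemma dw_ez u : dw (ea 0) u = 0.
Proof. by rewrite /dw big1 ?oppr0// => r _; rewrite vx_ea ix_neq0 mul0r. Qed.
Lemma dw_es u : dw es u = 0.
Proof. by rewrite /dw big1 ?oppr0// => r _; rewrite vx_es mul0r. Qed.
Lemma dw_ey r u : dw (ea (iy r)) u = 0.
Proof. by rewrite /dw big1 ?oppr0// => q _; rewrite vx_ea ix_neq_iy mul0r. Qed.
Lemma dw_ex r u : dw (ea (ix r)) u = - vy r u.
Proof.
rewrite /dw (bigD1 r)//= big1 => [|q qr]; first by rewrite vx_ea eqxx /=; ring.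
by rewrite vx_ea (inj_eq (@ix_inj m)) (negbTE qr) mul0r.
Qed.

Lemma div_Gam x u v : \sum_k pderiv k (fun y => Gam y u v 0 k) x =
  ddcc (vs x) / (2 * b) * (vs u * wz x v + vs v * wz x u)
  + (dcc (vs x) * gam (vs x) / b + cc (vs x) * (ddcc (vs x) / (2 * b)) / b) * (wz x u * wz x v)
  + \sum_r (dcc (vs x) / b * (kq r * vs x / b * QQ r u v) + cc (vs x) / b * (kq r / b * QQ r u v)
     - 2 * cc (vs x) * al r (vs x) * (vy r u * vy r v)).
Proof.
under eq_bigr => k _ do rewrite /pderiv (@derive_val _ _ _ _ _ _ _ (is_derive_Gam x (delta_mx 0 k) u v k)).
rewrite sum_coord delta_es.
have -> : fintype.split (0 : 'I_(1 + hdim m)) = inl 0.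
  by case: splitP => // j _; rewrite ord1.
have sr a : fintype.split (rshift 1 a : 'I_(1 + hdim m)) = inr a by exact: (unsplitK (inr a)).
rewrite sr eqxx delta_ea.
have -> : dGth x (ea 0) u v + \sum_r (vx r (ea 0) * Gy r x u v + vx r x * dGy r x (ea 0) u v) = 0.
  rewrite /dGth /dEE vs_ea !dw_ez [X in _ + X]big1 => [|r _]; first by ring.
  by rewrite vx_ez /dGy /dnn vs_ea !dw_ez; ring.
rewrite add0r.
have -> : dGs x es u v = ddcc (vs x) / (2 * b) * (vs u * wz x v + vs v * wz x u)
  + (dcc (vs x) * gam (vs x) / b + cc (vs x) * (ddcc (vs x) / (2 * b)) / b) * (wz x u * wz x v)
  + (dcc (vs x) / b * EE x u v + cc (vs x) / b * \sum_r kq r / b * QQ r u v).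
  by rewrite /dGs /dEE !dw_es !vs_es; ring.
rewrite -addrA; congr (_ + _).
rewrite /EE !mulr_sumr -!big_split /=; apply: eq_bigr => r _.
rewrite !sr ix_neq0 iy_neq0 !delta_ea sum_ix sum_ix_iy addr0 sum_iy_ix add0r sum_iy.
rewrite /dGx /dGy /dnn !vs_ea !dw_ex !dw_ey -/(QQ r u v); ring.
Qed.

(** The logarithmic derivative of the volume density, which is a constant times P(s). *)
Lemma tau_Gam x u : \sum_k Gam x u (delta_mx 0 k) 0 k = 2 * srho (vs x) * vs u.
Proof.
rewrite (frame_trace x (Gam_lin x u)) vs_Gam wz_Gam.
under eq_bigr => r _ do rewrite vx_Gam vy_Gam /Gx /Gy /nn vs_ea wz_ex vx_ea vy_ea eqxx eq_sym ix_neq_iy vs_ey wz_ey vx_ey vy_ey eqxx.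
rewrite /Gs /Gth vs_es wz_es wz_ez /=.
have -> : EE x u es = 0 by rewrite /EE big1// => r _; rewrite vx_es vy_es; ring.
have -> : EE x u (ea 0) = 0 by rewrite /EE big1// => r _; rewrite vx_ez vy_ez; ring.
have -> : SS u (ea 0) = 0 by rewrite /SS big1// => r _; rewrite vx_ez vy_ez; ring.
have -> : \sum_(r < m) (rho r (vs x) * (vs u * 1%:R + 0 * vx r u) + al r (vs x) * ((b * 0 + cc (vs x) * 0) * vy r u + (b * vs u + cc (vs x) * wz x u) * 0%:R) +
   (rho r (vs x) * (vs u * 1%:R + 0 * vy r u) - be r (vs x) * ((b * 0 + cc (vs x) * 0) * vx r u + (b * vs u + cc (vs x) * wz x u) * 0))) =
   2 * srho (vs x) * vs u.
  by rewrite /srho mulr_sumr mulr_suml; apply: eq_bigr => r _; ring.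
ring.
Qed.

(** The contribution of the pair r to the quadratic term Gam^k_{vl} Gam^l_{uk} of the Ricci
    tensor. *)
Definition TT r (x u v : X) : R :=
  let s := vs x in let c := cc s in let e := kq r * s / b in
  let p3s := c / b * (e * (ax r ^+ 2 * vx r u)) in let p3t := - (vy r u / 2) - e * (ax r ^+ 2 * vx r u) in
  let p4s := c / b * (e * (ay r ^+ 2 * vy r u)) in let p4t := - (vx r u / 2) - e * (ay r ^+ 2 * vy r u) in
  c / b * (e * (ax r ^+ 2 * (vx r v * (rho r s * vx r u + al r s * b * vy r u))
              + ay r ^+ 2 * (vy r v * (rho r s * vy r u - be r s * b * vx r u))))
  - (vx r v * (- (be r s * c * vx r u)) + vy r v * (al r s * c * vy r u)) / 2
  - e * (ax r ^+ 2 * (vx r v * (al r s * c * vy r u)) + ay r ^+ 2 * (vy r v * (- (be r s * c * vx r u))))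
  + (rho r s * (vs v * (rho r s * vs u) + p3s * vx r v)
     + al r s * ((b * p3s + c * p3t) * vy r v - nn x v * (be r s * nn x u)))
  + (rho r s * (vs v * (rho r s * vs u) + p4s * vy r v)
     - be r s * ((b * p4s + c * p4t) * vx r v + nn x v * (al r s * nn x u))).

Lemma EE_ex x u r : EE x u (ea (ix r)) = kq r * vs x / b * (ax r ^+ 2 * vx r u).
Proof.
rewrite /EE (bigD1 r)//= big1 => [|q qr]; rewrite vx_ex vy_ex.
  by rewrite eqxx /=; ring.
by rewrite (negbTE qr) /=; ring.
Qed.

Lemma EE_ey x u r : EE x u (ey x r) = kq r * vs x / b * (ay r ^+ 2 * vy r u).
Proof.
rewrite /EE (bigD1 r)//= big1 => [|q qr]; rewrite vx_ey vy_ey.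
  by rewrite eqxx /=; ring.
by rewrite (negbTE qr) /=; ring.
Qed.

Lemma SS_ex (u : X) r : SS u (ea (ix r)) = vy r u.
Proof.
rewrite /SS (bigD1 r)//= big1 => [|q qr]; rewrite vx_ex vy_ex.
  by rewrite eqxx /=; ring.
by rewrite (negbTE qr) /=; ring.
Qed.

Lemma SS_ey x (u : X) r : SS u (ey x r) = vx r u.
Proof.
rewrite /SS (bigD1 r)//= big1 => [|q qr]; rewrite vx_ey vy_ey.
  by rewrite eqxx /=; ring.
by rewrite (negbTE qr) /=; ring.
Qed.

Lemma trace_GG x u v : \sum_k Gam x v (Gam x u (delta_mx 0 k)) 0 k =
  2 * gam (vs x) ^+ 2 * (wz x u * wz x v) + \sum_r TT r x u v.
Proof.
rewrite (@frame_trace x (fun w => Gam x v (Gam x u w))) => [|a u1 u2]; last by rewrite !Gam_lin.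
rewrite vs_Gam wz_Gam.
under eq_bigr => r _.
  rewrite vx_Gam vy_Gam /Gx /Gy /nn !vs_Gam !wz_Gam !vx_Gam !vy_Gam /Gs /Gth /Gx /Gy /nn EE_ex EE_ey SS_ex SS_ey.
  rewrite vs_ea wz_ex vx_ea vy_ea eqxx (eq_sym (iy r)) ix_neq_iy vs_ey wz_ey vx_ey vy_ey eqxx /=.
  over.
have -> : Gs x v (Gam x u es) = gam (vs x) * (vs v * Gth x u es + Gs x u es * wz x v)
    + cc (vs x) * gam (vs x) / b * (wz x v * Gth x u es) + cc (vs x) / b * EE x v (Gam x u es).
  by rewrite -(vs_Gam x u es) -(wz_Gam x u es).
have -> : Gth x v (Gam x u (ea 0)) = - (SS v (Gam x u (ea 0)) / 2) - gam (vs x) * (wz x v * Gth x u (ea 0)) - EE x v (Gam x u (ea 0)).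
  by rewrite -(wz_Gam x u (ea 0)).
rewrite /Gs /Gth.
have -> : EE x u es = 0 by rewrite /EE big1// => r _; rewrite vx_es vy_es; ring.
have -> : EE x u (ea 0) = 0 by rewrite /EE big1// => r _; rewrite vx_ez vy_ez; ring.
have -> : SS u (ea 0) = 0 by rewrite /SS big1// => r _; rewrite vx_ez vy_ez; ring.
have -> : SS u es = 0 by rewrite /SS big1// => r _; rewrite vx_es vy_es; ring.
rewrite vs_es wz_es wz_ez.
have -> : EE x v (Gam x u es) = \sum_r kq r * vs x / b * (ax r ^+ 2 * (vx r v * (rho r (vs x) * vx r u + al r (vs x) * b * vy r u))
              + ay r ^+ 2 * (vy r v * (rho r (vs x) * vy r u - be r (vs x) * b * vx r u))).
  by apply: eq_bigr => r _; rewrite vx_Gam vy_Gam /Gx /Gy /nn vs_es wz_es vx_es vy_es; ring.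
have -> : EE x v (Gam x u (ea 0)) = \sum_r kq r * vs x / b * (ax r ^+ 2 * (vx r v * (al r (vs x) * cc (vs x) * vy r u))
   + ay r ^+ 2 * (vy r v * (- (be r (vs x) * cc (vs x) * vx r u)))).
  by apply: eq_bigr => r _; rewrite vx_Gam vy_Gam /Gx /Gy /nn vs_ea wz_ez vx_ez vy_ez; ring.
have -> : SS v (Gam x u (ea 0)) = \sum_r (vx r v * (- (be r (vs x) * cc (vs x) * vx r u)) + vy r v * (al r (vs x) * cc (vs x) * vy r u)).
  by apply: eq_bigr => r _; rewrite vx_Gam vy_Gam /Gx /Gy /nn vs_ea wz_ez vx_ez vy_ez; ring.
set S1 := \sum_r _; set S2 := \sum_r _; set S3 := \sum_r _; set S4 := \sum_r _.
have -> : \sum_r TT r x u v = cc (vs x) / b * S1 - S2 / 2 - S3 + S4.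
  rewrite /S1 /S2 /S3 /S4 !mulr_sumr mulr_suml -!sumrB -big_split /=.
  by apply: eq_bigr => r _; rewrite /TT /nn; ring.
ring.
Qed.

(** The Ricci tensor on constant fields: divergence of [Gam], minus the derivative of its trace,
    plus the two quadratic terms. The pairs r decouple, and what is left of them is summed up by
    [cc_ode]. *)
Lemma ricci_identity x u v :
  \sum_k pderiv k (fun y => Gam y u v 0 k) x - 2 * (vs v * \sum_r drho r (vs x)) * vs u
  + (2 * srho (vs x) * vs (Gam x u v) - \sum_k Gam x v (Gam x u (delta_mx 0 k)) 0 k) = 0.
Proof.
rewrite div_Gam trace_GG vs_Gam /Gs; set s := vs x; set us := vs u; set vv := vs v.
set wu := wz x u; set wv := wz x v.
have P0 : PP s != 0 by rewrite gt_eqF// PP_gt0.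
have ode := cc_ode s; set D := 4 * b ^+ 2 / PP s.
have eD : dcc s = D - 2 * cc s * srho s by [].
have ec : cc s = D * s by rewrite /D /cc; field.
set K2 := \sum_r (kq r / FF r s ^+ 2) in ode.
set S1 := \sum_r (_ - _).
have -> : S1 = \sum_r (D / b * (kq r * s / b * QQ r u v) + cc s / b * (kq r / b * QQ r u v) - 2 * cc s * al r s * (vy r u * vy r v))
   - 2 * cc s * srho s / b * EE x u v.
  rewrite /S1 /EE mulr_sumr -sumrB; apply: eq_bigr => r _; by rewrite eD -/(QQ r u v) -/s; field.
(* With F_r = 1 + kq s^2 and cc = D s, all horizontal terms of one pair cancel, leaving a multiple
   of kq / F_r^2 that involves only ds and w^0. *)
have eT (r : 'I_m) : D / b * (kq r * s / b * QQ r u v) + cc s / b * (kq r / b * QQ r u v) - 2 * cc s * al r s * (vy r u * vy r v)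
    - 2 * (vv * drho r s) * us - TT r x u v =
    2 * cc s / b * (us * wv + vv * wu + cc s / b * (wu * wv)) * (kq r / FF r s ^+ 2).
  rewrite /TT /QQ /nn -/s -/us -/vv -/wu -/wv /drho /rho /al /be ec.
  have F0 : 4 * (ax r * ay r) ^+ 2 + (b * s) ^+ 2 != 0.
    rewrite gt_eqF//; apply: ltr_pwDl; last exact: sqr_ge0.
    by rewrite pmulr_rgt0// lt_def sqr_ge0 sqrf_eq0 mulf_neq0.
  rewrite /FF /kq.
  by field; rewrite ay0 ax0 F0 b0.
have -> : \sum_r (D / b * (kq r * s / b * QQ r u v) + cc s / b * (kq r / b * QQ r u v) - 2 * cc s * al r s * (vy r u * vy r v))
  = 2 * cc s / b * (us * wv + vv * wu + cc s / b * (wu * wv)) * K2 + 2 * (vv * \sum_r drho r s) * us + \sum_r TT r x u v.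
  rewrite /K2 !mulr_sumr mulr_suml -!big_split /=; apply: eq_bigr => r _.
  by rewrite -eT; ring.
have edd : ddcc s = - (2 * dcc s * srho s + 4 * cc s * K2).
  by apply/eqP; rewrite -subr_eq0; apply/eqP; rewrite -[RHS]ode; ring.
rewrite edd /gam; set T := \sum_r TT r x u v; set E := EE x u v; set Z := \sum_r drho r s.
by field.
Qed.

Lemma hform_sym x : (hform x)^T = hform x.
Proof. by apply/matrixP => i j; rewrite !mxE hbil_sym. Qed.

(** An orthonormal frame valid for every sign of [cc]: g d/ds + d/dz has square norm 2 b g + cc, and
    g is chosen to make it -1 or 1. *)
Definition lframe (x : X) (i : 'I_(1 + hdim m)) : X :=
  if fintype.split i is inr a then
    if a == 0 then (1 - cc (vs x)) / (2 * b) *: es + ea 0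
    else \sum_(r | a == ix r) (ax r * Num.sqrt (FF r (vs x)))^-1 *: ea (ix r)
       + \sum_(r | a == iy r) (ay r * Num.sqrt (FF r (vs x)))^-1 *: ey x r
  else (- 1 - cc (vs x)) / (2 * b) *: es + ea 0.

Lemma hform_lorentz x : lorentz_form (hform x).
Proof.
pose P : 'M[R]_(1 + hdim m) := \matrix_i lframe x i.
have PE i j : (P *m hform x *m P^T) i j = hbil x (lframe x i) (lframe x j).
  rewrite -hformE -(rowK (lframe x) i) -(rowK (lframe x) j) -/P.
  by rewrite -row_mul !mxE; apply: eq_bigr => k _; rewrite !mxE.
have l0 : lframe x (lshift _ 0) = (- 1 - cc (vs x)) / (2 * b) *: es + ea 0.
  by rewrite /lframe (unsplitK (inl 0)).
have lr a : lframe x (rshift 1 a) = if a == 0 then (1 - cc (vs x)) / (2 * b) *: es + ea 0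
    else \sum_(r | a == ix r) (ax r * Num.sqrt (FF r (vs x)))^-1 *: ea (ix r)
       + \sum_(r | a == iy r) (ay r * Num.sqrt (FF r (vs x)))^-1 *: ey x r.
  by rewrite /lframe (unsplitK (inr a)).
have lx r : lframe x (rshift 1 (ix r)) = (ax r * Num.sqrt (FF r (vs x)))^-1 *: ea (ix r) + 0.
  by rewrite lr ix_neq0 sum_ix sum_ix_iy.
have ly r : lframe x (rshift 1 (iy r)) = (ay r * Num.sqrt (FF r (vs x)))^-1 *: ey x r + 0.
  by rewrite lr iy_neq0 sum_iy sum_iy_ix add0r addr0.
have lz : lframe x (rshift 1 0) = (1 - cc (vs x)) / (2 * b) *: es + ea 0 by rewrite lr eqxx.
have hb0 w : hbil x 0 w = 0 by have := hbil_lin x (-1) 0 0 w; rewrite scaler0 addr0 => h; lra.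
have hbE a u w : hbil x (a *: u + 0) w = a * hbil x u w by rewrite hbil_lin hb0 addr0.
have hs w : hbil x es w = b * wz x w.
  rewrite /hbil vs_es wz_es big1 => [|r _]; first by ring.
  by rewrite vx_es vy_es; ring.
have hz w : hbil x (ea 0) w = b * vs w + cc (vs x) * wz x w.
  rewrite /hbil vs_ea wz_ez big1 => [|r _]; first by ring.
  by rewrite vx_ez vy_ez; ring.
have hx r w : hbil x (ea (ix r)) w = FF r (vs x) * ax r ^+ 2 * vx r w.
  rewrite /hbil vs_ea wz_ex (bigD1 r)//= big1 => [|q qr]; rewrite vx_ex vy_ex.
    by rewrite eqxx /=; ring.
  by rewrite (negbTE qr) /=; ring.
have hy r w : hbil x (ey x r) w = FF r (vs x) * ay r ^+ 2 * vy r w.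
  rewrite /hbil vs_ey wz_ey (bigD1 r)//= big1 => [|q qr]; rewrite vx_ey vy_ey.
    by rewrite eqxx /=; ring.
  by rewrite (negbTE qr) /=; ring.
have n01 : vs (0 : X) = 0 by rewrite /vs mxE.
have n03 q : vx q (0 : X) = 0 by rewrite /vx !mxE.
have n04 q : vy q (0 : X) = 0 by rewrite /vy !mxE.
have n02 : wz x 0 = 0 by rewrite wzE !mxE big1 ?subr0// => r _; rewrite /vy !mxE mulr0.
have sF r : Num.sqrt (FF r (vs x)) ^+ 2 = FF r (vs x) by rewrite sqr_sqrtr// ltW// FF_gt0.
have sF0 r : Num.sqrt (FF r (vs x)) != 0 by rewrite -sqrf_eq0 sF FF_neq0.
have dE (i j : 'I_(1 + hdim m)) : hbil x (lframe x i) (lframe x j) =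
    (diag_mx (\row_i (if i == 0%N :> nat then -1 else 1)) : 'M[R]_(1 + hdim m)) i j.
  have hl g w : hbil x (g *: es + ea 0) w = g * (b * wz x w) + (b * vs w + cc (vs x) * wz x w).
    by rewrite hbil_lin hs hz.
  have [vl wl xl yl] : [/\ forall g, vs (g *: es + ea 0 : X) = g, forall g, wz x (g *: es + ea 0) = 1,
      forall g r, vx r (g *: es + ea 0 : X) = 0 & forall g r, vy r (g *: es + ea 0 : X) = 0].
    split=> g; rewrite ?vs_lin ?wz_lin ?vs_es ?vs_ea ?wz_es ?wz_ez; [by ring|by ring| |] => r.
      by rewrite vx_lin vx_es vx_ez; ring.
    by rewrite vy_lin vy_es vy_ez; ring.
  have [vk wk xk yk] : [/\ forall (g : R) r, vs (g *: ea (ix r) + 0 : X) = 0, forall (g : R) r, wz x (g *: ea (ix r) + 0) = 0,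
      forall (g : R) r q, vx q (g *: ea (ix r) + 0 : X) = g * (q == r)%:R & forall (g : R) r q, vy q (g *: ea (ix r) + 0 : X) = 0].
    split=> g r; rewrite ?vs_lin ?wz_lin ?n01 ?n02 ?vs_ea ?wz_ex; [by ring|by ring| |] => q.
      by rewrite vx_lin vx_ex ?n03 ?n04 addr0.
    by rewrite vy_lin vy_ex ?n03 ?n04 mulr0 addr0.
  have [vj wj xj yj] : [/\ forall (g : R) r, vs (g *: ey x r + 0 : X) = 0, forall (g : R) r, wz x (g *: ey x r + 0) = 0,
      forall (g : R) r q, vy q (g *: ey x r + 0 : X) = g * (q == r)%:R & forall (g : R) r q, vx q (g *: ey x r + 0 : X) = 0].
    split=> g r.
    - by rewrite vs_lin n01 (vs_ey x r) mulr0 addr0.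
    - by rewrite wz_lin n02 (wz_ey x r) mulr0 addr0.
    - by move=> q; rewrite vy_lin vy_ey ?n03 ?n04 addr0.
    - by move=> q; rewrite vx_lin vx_ey ?n03 ?n04 mulr0 addr0.
  have rI := inj_eq (@rshift_inj 1 (hdim m)).
  case: (split_ordP i) => i' ->; case: (split_ordP j) => j' ->; rewrite ?ord1 => {i j}.
  - by rewrite !l0 hl vl wl !mxE eqxx /= mulr1n; field.
  - rewrite l0 hl !mxE eq_lrshift mulr0n.
    case: (hindexP j') => [->|[r ->]|[r ->]]; rewrite ?lz ?lx ?ly ?vl ?wl ?vk ?wk ?vj ?wj; last 2 first.
    + by ring.
    + by ring.
    + by field.
  - rewrite l0 hbil_sym hl !mxE eq_rlshift mulr0n.
    case: (hindexP i') => [->|[r ->]|[r ->]]; rewrite ?lz ?lx ?ly ?vl ?wl ?vk ?wk ?vj ?wj; last 2 first.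
    + by ring.
    + by ring.
    + by field.
  rewrite !mxE rI (_ : (rshift 1 i' == 0%N :> nat) = false)//.
  case: (hindexP i') => [->|[r ->]|[r ->]]; case: (hindexP j') => [->|[q ->]|[q ->]];
    rewrite ?lz ?lx ?ly ?hbE ?hl ?hx ?hy ?vl ?wl ?vk ?wk ?vj ?wj ?xl ?yl ?xk ?yk ?xj ?yj ?(eq_sym 0) ?ix_neq0 ?iy_neq0
     ?(eq_sym (iy r)) ?ix_neq_iy ?eqxx ?(inj_eq (@ix_inj m)) ?(inj_eq (@iy_inj m)) ?mulr0n ?mulr1n; try by ring.
  - by field.
  - case: (eqVneq r q) => [<-|rq]; rewrite ?eqxx ?(eq_sym q) ?(negbTE rq) /= ?mulr0n; last by ring.
    by move: (sF r) (sF0 r); set S := Num.sqrt _ => <- S0; field; rewrite ax0 S0.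
  - case: (eqVneq r q) => [<-|rq]; rewrite ?eqxx ?(eq_sym q) ?(negbTE rq) /= ?mulr0n; last by ring.
    by move: (sF r) (sF0 r); set S := Num.sqrt _ => <- S0; field; rewrite ay0 S0.
have PD : P *m hform x *m P^T = diag_mx (\row_i (if i == 0%N :> nat then -1 else 1)).
  by apply/matrixP => i j; rewrite PE dE.
exists P; last exact: PD.
have : \det (P *m hform x *m P^T) != 0.
  rewrite PD det_diag; apply/prodf_neq0 => i _; rewrite mxE; case: ifP => _; rewrite ?oppr_eq0 oner_eq0//.
by rewrite !det_mulmx unitmxE unitfE; apply: contra_neq => ->; rewrite !mul0r.
Qed.

Lemma hform_unit x : hform x \in unitmx.
Proof.
have [P uP e] := hform_lorentz x.
have : \det (P *m hform x *m P^T) != 0.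
  rewrite e det_diag; apply/prodf_neq0 => i _; rewrite mxE; case: ifP => _; rewrite ?oppr_eq0 oner_eq0//.
by rewrite !det_mulmx unitmxE unitfE; apply: contra_neq => ->; rewrite mulr0 mul0r.
Qed.

Lemma christoffel_hform k i j x : christoffel hform k i j x = Gam x (delta_mx 0 i) (delta_mx 0 j) 0 k.
Proof.
have pd (l a c : 'I_(1 + hdim m)) : pderiv l (fun y => hform y a c) x = dh x (delta_mx 0 l) (delta_mx 0 a) (delta_mx 0 c).
  rewrite /pderiv; under eq_fun do rewrite mxE.
  exact: (@derive_val _ _ _ _ _ _ _ (is_derive_hbil x _ _ _)).
set g := Gam x _ _; pose d : X := g *m hform x.
have -> : g = d *m invmx (hform x) by rewrite mulmxK// hform_unit.
have -> : invmx (hform x) = (invmx (hform x))^T by rewrite trmx_inv hform_sym.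
rewrite /christoffel [in RHS]mxE mulr_sumr; apply: eq_bigr => l _; rewrite [_^T l k]mxE.
have -> : d 0 l = hbil x g (delta_mx 0 l).
  by rewrite /d -hformE trmx_delta -colE [RHS]mxE.
by rewrite !pd /g koszul//; field.
Qed.

Lemma ricci_hform i j x : ricci hform i j x = 0.
Proof.
set u : X := delta_mx 0 i; set v : X := delta_mx 0 j.
have cE k a c : christoffel hform k a c = fun y => Gam y (delta_mx 0 a) (delta_mx 0 c) 0 k.
  by apply/funext => y; exact: christoffel_hform.
rewrite /ricci -[RHS](ricci_identity x u v).
under eq_bigr do rewrite !cE; rewrite sumrB; congr (_ - _ + _).
  have d (k : 'I_(1 + hdim m)) := is_derive_Gam x v u (delta_mx 0 k) k.
  have e := is_derive_sum d.
  under eq_bigr => k _ do rewrite /pderiv (@derive_val _ _ _ _ _ _ _ (d k)).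
  rewrite -(@derive_val _ _ _ _ _ _ _ e).
  have -> : \sum_k (fun y => Gam y u (delta_mx 0 k) 0 k) = fun y : X => 2 * srho (vs y) * vs u.
    by apply/funext => y; rewrite fct_sumE tau_Gam.
  apply: (@derive_val _ _ _ _ _ _ _ _); apply: is_derive_lineP.
  have d1 := is_deriveM (is_deriveM (is_derive_cst (2 : R) (0 : R) (1 : R)) (is_derive_of_vs v (is_derive_srho (vs x)))) (is_derive_cst (vs u) (0 : R) (1 : R)).
  by apply: is_derive_eq d1 _; rewrite ?mulrfctE ?line0 /GRing.scale /=; ring.
under eq_bigr do rewrite sumrB; rewrite sumrB; congr (_ - _).
  rewrite exchange_big /=.
  transitivity (\sum_l 2 * srho (vs x) * vs (delta_mx 0 l : X) * Gam x u v 0 l).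
    apply: eq_bigr => l _; rewrite -tau_Gam mulr_suml; apply: eq_bigr => k _.
    by rewrite !christoffel_hform Gam_sym.
  rewrite (bigD1 0)//= big1 => [|l l0]; last by rewrite {2}/vs mxE eq_sym (negbTE l0) andbF mulr0 mul0r.
  by rewrite {2}/vs mxE !eqxx addr0 mulr1.
apply: eq_bigr => k _; rewrite [in RHS]bilin_sum summxE; apply: eq_bigr => l _.
by rewrite [RHS]mxE -!christoffel_hform mulrC.
Qed.

End Curvature.

(** * Maps of the quotient and analyticity *)

Section Smoothness.
Context {R : realType}.

Lemma Ck_on_near k (V W : normedModType R) (U : set V) (f : V -> W) :
  (forall x, U x -> exists U' g, [/\ open U', U' x, Ck_on k U' g & forall y, U' y -> f y = g y]) ->
  Ck_on k U f.
Proof.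
elim: k f => [|k IH] f H.
  split=> // x /H[U' [g [oU Ux [cg _] e]]].
  by apply: (@continuous_near_eq V W f g x (cg x Ux)); apply: filterS (open_nbhs_nbhs (conj oU Ux)) => y /e ->.
split=> [x /H[U' [g [oU Ux [cg _] e]]]|v].
  by apply: (@continuous_near_eq V W f g x (cg x Ux)); apply: filterS (open_nbhs_nbhs (conj oU Ux)) => y /e ->.
split=> [x /H[U' [g [oU Ux [_ /(_ v)[dg _]] e]]]|].
  apply: (@near_eq_derivable R V W g f x v _ (dg x Ux)).
  by apply: filterS (open_nbhs_nbhs (conj oU Ux)) => y /e ->.
apply: IH => x /H[U' [g [oU Ux [_ /(_ v)[_ Cg]] e]]].
exists U', (fun x => 'D_v g x); split => // y Uy.
by apply: near_eq_derive; apply: filterS (open_nbhs_nbhs (conj oU Uy)) => z /e.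
Qed.

Lemma Ck_on_sub k (V W : normedModType R) (U U' : set V) (f : V -> W) :
  U' `<=` U -> Ck_on k U f -> Ck_on k U' f.
Proof.
move=> s; elim: k f => [|k IH] f [c d]; split=> //; [by move=> x /s/c|by move=> x /s/c|move=> v].
by have [h1 h2] := d v; split=> [x /s/h1//|]; exact: IH.
Qed.

Lemma Ck_on_add k (V W : normedModType R) (f g : V -> W) :
  Ck_on k setT f -> Ck_on k setT g -> Ck_on k setT (fun y => f y + g y).
Proof.
elim: k f g => [|k IH] f g [cf df] [cg dg].
  by split=> // x _; exact: (@continuousD R W V f g x (cf x I) (cg x I)).
split=> [x _|v]; first exact: (@continuousD R W V f g x (cf x I) (cg x I)).
have [f1 f2] := df v; have [g1 g2] := dg v.
split=> [x _|]; first exact: (derivableD (f1 x I) (g1 x I)).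
rewrite (_ : 'D_v _ = fun x => 'D_v f x + 'D_v g x); first exact: IH.
by apply/funext => x; exact: (deriveD (f1 x I) (g1 x I)).
Qed.

Lemma smooth_affine (V W : normedModType R) (f : V -> W) (df : V -> W) :
  continuous f -> (forall x v, is_derive x v f (df v)) -> smooth_on setT f.
Proof.
move=> cf H.
have cst k (w : W) : Ck_on k setT (fun _ : V => w).
  elim: k w => [|k IH] w; (split; first by move=> x _; exact: cst_continuous) => // v.
  split=> [x _|]; first exact: derivable_cst.
  by rewrite (_ : 'D_v (fun=> w) = fun=> 0)//; apply/funext => x; exact: derive_cst.
move=> k; case: k => [|k]; (split; first by move=> x _; exact: cf) => // v.
split=> [x _|]; first by have [] := H x v.
by rewrite (_ : 'D_v f = fun=> df v)//; apply/funext => x; have [_ ->] := H x v.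
Qed.

(** A function packaged with all its derivatives, so that smoothness follows by one induction. *)
Definition derivs (g : nat -> R -> R) : Prop := forall n t, is_derive t (1 : R) (g n) (g n.+1 t).

(** The n-th derivative of a t + \sum_i q_i e^{2 i t}. The isometry is of this form, because
    P(e^{2t}) is a polynomial in e^{2t}; the linear term integrates its constant coefficient. *)
Definition expsum (N : nat) (q : nat -> R) (a : R) (n : nat) (t : R) : R :=
  (if n is 0%N then a * t else if n is 1%N then a else 0)
    + \sum_(i < N) q i * (2 * i%:R) ^+ n * expR (2 * i%:R * t).

Lemma derivs_expsum N q a : derivs (expsum N q a).
Proof.
move=> n t; apply: (@is_deriveD R R R _ _ t (1 : R)).
  case: n => [|[|n]]; [|exact: is_derive_cst|exact: is_derive_cst].
  have d := is_deriveM (is_derive_cst a t (1 : R)) (is_derive_id t (1 : R)).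
  by apply: is_derive_eq d _; rewrite /GRing.scale /=; ring.
apply: is_derive_sum_ord => i.
have e := is_deriveM (is_derive_cst (2 * i%:R : R) t (1 : R)) (is_derive_id t (1 : R)).
have d := is_deriveM (is_derive_cst (q i * (2 * i%:R) ^+ n) t (1 : R)) (is_derive_compR e (is_derive_expR (2 * i%:R * t))).
by apply: is_derive_eq d _; rewrite /GRing.scale /= exprS; ring.
Qed.

End Smoothness.

Section Equivariance.
Context {R : realType} {m : nat}.
Local Notation X := 'rV[R]_(1 + hdim m).

Lemma is_derive_warp (g : R -> R) dg (x v w : X) : is_derive (vs x) (1 : R) g dg ->
  is_derive x v (fun y : X => g (vs y) *: w) ((vs v * dg) *: w).
Proof.
move=> H; apply: is_derive_lineP; have e := is_derive_of_vs v H.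
apply: is_derive_rV => i j.
have e' := is_deriveM e (is_derive_cst (w i j) (0 : R) (1 : R)).
rewrite (_ : (fun y : R => (g (vs (x + y *: v)) *: w) i j) = fun t : R => g (vs (x + t *: v)) * w i j).
  by apply: is_derive_eq e' _; rewrite ?mxE /GRing.scale /=; ring.
by apply/funext => t; rewrite mxE.
Qed.

Lemma continuous_warp_at (g : R -> R) (w x : X) : {for vs x, continuous g} ->
  {for x, continuous (fun y : X => g (vs y) *: w)}.
Proof.
move=> cg; have c : {for x, continuous (fun y : X => g (vs y))}.
  by apply: (@continuous_comp _ _ _ (fun y : X => vs y) g); [exact: time_continuous|exact: cg].
rewrite /prop_for /=; move: c; move: (x : X) => x' c.
apply: (@cvg_rVP R X (nbhs x')) => j; rewrite mxE.
under eq_fun do rewrite mxE.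
exact: (cvgM c (cvg_cst (w 0 j))).
Qed.

Lemma continuous_warp (g : R -> R) (w : X) : continuous g -> continuous (fun y : X => g (vs y) *: w).
Proof. by move=> cg x; apply: continuous_warp_at; exact: cg. Qed.

Lemma derivs_continuous (g : nat -> R -> R) n : derivs g -> continuous (g n).
Proof. by move=> dg t; exact: is_derive_continuous (dg n t). Qed.

Lemma smooth_warp (f : X -> X) df (g1 g2 : nat -> R -> R) (w1 w2 : X) :
  continuous f -> (forall x v, is_derive x v f (df v)) -> derivs g1 -> derivs g2 ->
  smooth_on setT (fun y => f y + (g1 0%N (vs y) *: w1 + g2 0%N (vs y) *: w2)).
Proof.
move=> cf Hf d1 d2 k; apply: Ck_on_add; first exact: (smooth_affine cf Hf).
have warp (g : nat -> R -> R) n (a : R) (w : X) : derivs g -> Ck_on k setT (fun y : X => (a * g n (vs y)) *: w).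
  move=> dg; have D (n' : nat) (a' : R) (x v : X) : is_derive x v (fun y : X => (a' * g n' (vs y)) *: w) ((a' * vs v * g n'.+1 (vs x)) *: w).
    have e := is_deriveM (is_derive_cst a' (vs x) (1 : R)) (dg n' (vs x)).
    by apply: is_derive_eq (is_derive_warp v w e) _; rewrite /GRing.scale /=; congr (_ *: _); ring.
  have cw n' a' : continuous (fun y : X => (a' * g n' (vs y)) *: w).
    apply: (@continuous_warp (fun t => a' * g n' t)) => t.
    by apply: cvgM; [exact: cvg_cst|exact: derivs_continuous].
  elim: k n a => [|k IH] n a; (split; first by move=> x _; exact: cw) => // v.
  split=> [x _|]; first by have [] := D n a x v.
  rewrite (_ : 'D_v _ = fun x => (a * vs v * g n.+1 (vs x)) *: w); first exact: IH.
  by apply/funext => x; have [_ ->] := D n a x v.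
apply: Ck_on_add.
  by have := warp g1 0%N 1 w1 d1; congr (Ck_on _ _ _); apply/funext => y; rewrite mul1r.
by have := warp g2 0%N 1 w2 d2; congr (Ck_on _ _ _); apply/funext => y; rewrite mul1r.
Qed.

Variable Ga : set 'rV[R]_(hdim m).
Hypothesis dG : discrete_subgroup Ga.
Local Notation M := (spacetime Ga).

(* The differential of left translation by k. *)
Definition dltrans (k : 'rV[R]_(hdim m)) (v : X) : X := pt (vs v) (dhmul k (rsubmx v)).

Lemma ltransE k x : ltrans k x = pt 0 k + dltrans k x.
Proof.
rewrite -(pt_eta (_ + _)); congr pt; first by rewrite mxE !pt_time add0r.
rewrite linearD /= !pt_space; apply/rowP => a; rewrite hmulE !mxE.
by case: ifP => _; [rewrite addrA|rewrite !addr0].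
Qed.

Lemma dltransE k v : dltrans k v = v + (\sum_r k 0 (ix r) * vy r v) *: ea 0.
Proof.
rewrite -(pt_eta (v + _)); congr pt; first by rewrite mxE mxE pt_time mulr0 addr0.
rewrite linearD linearZ /= pt_space; apply/rowP => a; rewrite !mxE eqxx.
by case: eqVneq => _; rewrite ?mulr1 ?mulr0.
Qed.

Lemma is_derive_ltrans k (V : normedModType R) (f : V -> X) x v df :
  is_derive x v f df -> is_derive x v (fun y => ltrans k (f y)) (dltrans k df).
Proof.
move=> H; apply: is_derive_rV => i j; rewrite ord1 {i}.
have c (l : 'I_(1 + hdim m)) := is_derive_coord 0 l H.
have s : is_derive x v (fun y => \sum_r k 0 (ix r) * vy r (f y)) (\sum_r k 0 (ix r) * vy r df).
  have d (r : 'I_m) : is_derive x v (fun y => k 0 (ix r) * vy r (f y)) (k 0 (ix r) * vy r df).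
    have e := is_deriveM (is_derive_cst (k 0 (ix r)) x v) (c (rshift 1 (iy r))).
    rewrite (_ : (fun y => _) = cst (k 0 (ix r)) * (fun y => f y 0 (rshift 1 (iy r)))).
      by apply: is_derive_eq e _; rewrite /GRing.scale /= /vy rsubmxE; ring.
    by apply/funext => y; rewrite /vy rsubmxE.
  have := is_derive_sum d; rewrite (_ : \sum_r _ = fun y => \sum_r k 0 (ix r) * vy r (f y))//.
  by apply/funext => y; rewrite fct_sumE.
have e := is_deriveD (is_derive_cst ((pt 0 k : X) 0 j) x v) (is_deriveD (c j) (is_deriveM s (is_derive_cst ((ea 0 : X) 0 j) x v))).
rewrite (_ : (fun y => _) = (cst ((pt 0 k : X) 0 j) + ((fun y => f y 0 j) + (fun y => \sum_r k 0 (ix r) * vy r (f y)) * cst ((ea 0 : X) 0 j)))).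
  by apply: is_derive_eq e _; rewrite dltransE !mxE /GRing.scale /=; ring.
by apply/funext => y; rewrite ltransE dltransE mxE; congr (_ + _); rewrite mxE; congr (_ + _); rewrite mxE.
Qed.

Lemma ltrans_continuous k : continuous (ltrans k : X -> X).
Proof.
move=> x; apply: (@pt_continuous R m X (fun y : X => y 0 0) (fun y : X => hmul k (rsubmx y)) x); first exact: time_continuous.
by apply: (@hmul_continuous R m _ (fun=> k) _ x); [exact: cst_continuous|exact: rsubmx_continuous].
Qed.

Lemma ltrans_shift k (x : X) (a b : R) : ltrans k (x + (a *: es + b *: ea 0)) = ltrans k x + (a *: es + b *: ea 0).
Proof.
rewrite !ltransE !dltransE.
have -> : \sum_r k 0 (ix r) * vy r (x + (a *: es + b *: ea 0)) = \sum_r k 0 (ix r) * vy r x.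
  apply: eq_bigr => r _; congr (_ * _).
  by rewrite addrC -addrA vy_lin vy_es vy_lin vy_ez !mulr0 !add0r.
by rewrite -!addrA; congr (_ + (_ + _)); rewrite [RHS]addrC addrA.
Qed.

Lemma chart_exists (x : X) : exists c : chart R (1 + hdim m) M, atlas M c /\ cdom c x.
Proof.
have [W [oW Wx Winj]] := stproj_locally_injective dG x.
by exists (Chart W (stproj Ga : X -> M)).
Qed.

(** The charts are local inverses of the projection, so the coordinates of a projected map are
    locally the map itself up to one element of Ga. *)
Lemma coord_lift (V : normedModType R) (k : V -> X) v0 (c : chart R (1 + hdim m) M) :
  continuous k -> atlas M c -> cran c (stproj Ga (k v0)) ->
  exists ga U, [/\ Ga ga, open U, U v0 &
    forall u, U u -> cdom c (ltrans ga (k u)) /\ Defs.coord c (stproj Ga (k u)) = ltrans ga (k u)].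
Proof.
move=> ck [oc ic ec] [y cy]; rewrite ec => /esym/(stproj_eqP dG)[_ [ga Gga ey]].
exists ga, ((fun u => ltrans ga (k u)) @^-1` cdom c); split=> //.
- apply: (@open_comp _ _ (fun u => ltrans ga (k u)) (cdom c)) => // u _.
  exact: (@continuous_comp _ _ _ k (ltrans ga) u (ck u) (@ltrans_continuous ga (k u))).
- by rewrite /preimage /= -ey.
move=> u cu; split=> //.
by rewrite -(@stproj_ltrans _ _ _ dG ga (k u) Gga) -ec coordK// ec.
Qed.

Section Map.
Variables (F : M -> M) (phi : X -> X).
Hypotheses (cphi : continuous phi) (hF : forall x, F (stproj Ga x) = stproj Ga (phi x)).

Lemma locrep_lift (c c' : chart R (1 + hdim m) M) x : atlas M c -> atlas M c' -> locdom F c c' x ->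
  exists ga U, [/\ Ga ga, open U, U x & forall y, U y ->
    [/\ locdom F c c' y, cdom c' (ltrans ga (phi y)) & locrep F c c' y = ltrans ga (phi y)]].
Proof.
move=> ac ac' [cx]; have [oc ic ec] := ac; rewrite ec hF => crx.
have [ga [U [Gga oU Ux HU]]] := coord_lift cphi ac' crx.
exists ga, (U `&` cdom c); split => //; first exact: openI.
move=> y [/HU[h1 h2] cy]; split => //; last by rewrite /locrep /= ec hF.
split=> //; rewrite ec hF; exists (ltrans ga (phi y)) => //.
by have [_ _ ->] := ac'; rewrite stproj_ltrans.
Qed.

Lemma smooth_map_lift : (forall ga, smooth_on setT (fun y => ltrans ga (phi y))) -> smooth_map F.
Proof.
move=> sm; split.
  apply/continuousP => U oU.
  rewrite (_ : F @^-1` U = stproj Ga @` ((fun x => stproj Ga (phi x)) @^-1` U)).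
    apply: (stproj_open dG); apply: (@open_comp _ _ (fun x => stproj Ga (phi x)) U) => // x _.
    apply: (@continuous_comp _ _ _ phi (stproj Ga)); [exact: cphi|exact: stproj_continuous].
  apply/seteqP; split=> [q|_ [x Ux <-]]; last by rewrite /preimage /= hF.
  by have [x <-] := stproj_surj q; rewrite /preimage /= hF => Ux; exists x.
move=> c c' ac ac' k; apply: Ck_on_near => x Dx.
have [ga [U [Gga oU Ux HU]]] := locrep_lift ac ac' Dx.
exists U, (fun y => ltrans ga (phi y)); split => //; last by move=> y /HU[].
exact: Ck_on_sub (sm ga k).
Qed.

(** All tensor conditions on the quotient reduce through this lemma to identities on the cover and
    invariance under left translations. *)
Lemma jacobian_lift (dphi : X -> X -> X) (c c' : chart R (1 + hdim m) M) x :
  (forall y v, is_derive y v phi (dphi y v)) -> (forall v, continuous (dphi^~ v)) ->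
  atlas M c -> atlas M c' -> locdom F c c' x ->
  exists ga, [/\ Ga ga, cdom c' (ltrans ga (phi x)), locrep F c c' x = ltrans ga (phi x) &
    forall v, v *m 'J (locrep F c c') x = dltrans ga (dphi x v)].
Proof.
move=> dp cdp ac ac' Dx; have [ga [U [Gga oU Ux HU]]] := locrep_lift ac ac' Dx.
exists ga; have [h1 h2 h3] := HU x Ux; split=> // v.
have D y w : U y -> is_derive y w (locrep F c c') (dltrans ga (dphi y w)).
  move=> Uy; apply: (@near_eq_is_derive R X X (fun y => ltrans ga (phi y))).
    by apply: filterS (open_nbhs_nbhs (conj oU Uy)) => z /HU[].
  by apply: is_derive_ltrans; exact: dp.
have dx : differentiable (locrep F c c') x.
  apply: (@is_diff_C1 R _ _ U _ x oU) => // w y Uy; have [d1 d2] := D y w Uy; split=> //.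
  apply: (@continuous_near_eq X X _ (fun y => dltrans ga (dphi y w))).
    have e z : dltrans ga (dphi z w) = ltrans ga (dphi z w) - pt 0 ga by rewrite ltransE addrC addKr.
    rewrite (_ : (fun z => dltrans ga (dphi z w)) = (fun z => ltrans ga (dphi z w) - pt 0 ga)); last by apply/funext.
    apply: (@continuousB R X X (fun z => ltrans ga (dphi z w)) (fun=> pt 0 ga) y _ (@cst_continuous _ _ _ _)).
    exact: (@continuous_comp _ _ _ (dphi^~ w) (ltrans ga) y (cdp w y) (@ltrans_continuous ga _)).
  by apply: filterS (open_nbhs_nbhs (conj oU Uy)) => z Uz; have [_ ->] := D z w Uz.
rewrite -(diff_jacobian v dx) -deriveE//; by have [_ ->] := D x v Ux.
Qed.

End Map.

End Equivariance.

(** * Power series of rational functions and analyticity of the metric *)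

Section RationalSeries.
Context {R : realType}.

Definition ratfun (f : R -> R) : Prop :=
  exists p q : {poly R}, (forall t, q.[t] != 0) /\ forall t, f t = p.[t] / q.[t].

Lemma ratfun_poly (p : {poly R}) : ratfun (fun t => p.[t]).
Proof. by exists p, 1; split=> t; rewrite hornerC ?oner_neq0// divr1. Qed.

Lemma ratfun_cst (a : R) : ratfun (fun=> a).
Proof. by have := ratfun_poly a%:P; congr ratfun; apply/funext => t; rewrite hornerC. Qed.

Lemma ratfun_mul f g : ratfun f -> ratfun g -> ratfun (fun t => f t * g t).
Proof.
move=> [p [q [q0 e]]] [p' [q' [q0' e']]]; exists (p * p'), (q * q'); split=> t; rewrite !hornerM.
  by rewrite mulf_neq0.
by rewrite e e' mulrACA -invfM.
Qed.

Lemma half_geometric N : \sum_(k < N) (2^-1 : R) ^+ k <= 2.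
Proof.
have -> : \sum_(k < N) (2^-1 : R) ^+ k = 2 - 2 * 2^-1 ^+ N.
  elim: N => [|N IH]; first by rewrite big_ord0 expr0; ring.
  by rewrite big_ord_recr /= IH exprS; field.
by rewrite gerBl mulr_ge0// exprn_ge0// invr_ge0.
Qed.

Section Division.
Variables p q : {poly R}.
Hypothesis q0 : q`_0 != 0.

(* The successive remainders of the division of p by q along increasing
   powers. *)
Fixpoint rmd (k j : nat) : R :=
  if k is k'.+1 then rmd k' j.+1 - rmd k' 0%N / q`_0 * q`_j.+1 else p`_j.

Definition quo (k : nat) : R := rmd k 0 / q`_0.

Let d := (maxn (size p) (size q)).+1.
Let nq : R := \sum_(j < d) `|q`_j|.
Let M : R := 1 + nq / `|q`_0|.
Let nr k : R := \sum_(j < d) `|rmd k j|.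

Lemma rmd_big k j : (d <= j)%N -> rmd k j = 0.
Proof.
elim: k j => [|k IH] j dj /=; first by rewrite nth_default// (leq_trans _ dj)// leqW// leq_maxl.
rewrite IH ?(leqW dj)// [q`_j.+1]nth_default ?mulr0 ?subr0//.
by apply: leqW; apply: leq_trans dj; rewrite leqW// leq_maxr.
Qed.

Lemma rmd_norm k j : `|rmd k j| <= nr k.
Proof.
case: (leqP d j) => [/(rmd_big k) ->|jd]; first by rewrite normr0 sumr_ge0.
by rewrite /nr (bigD1 (Ordinal jd))//= lerDl sumr_ge0.
Qed.

(** The l^1 norm of the remainders grows at most geometrically, which gives the radius of
    convergence. *)
Lemma nr_step k : nr k.+1 <= M * nr k.
Proof.
rewrite /nr /= mulrDl mul1r.
apply: (@le_trans _ _ (\sum_(j < d) (`|rmd k j.+1| + nr k / `|q`_0| * `|q`_j.+1|))).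
  apply: ler_sum => j _; apply: le_trans (ler_normB _ _) _.
  rewrite lerD2l normrM normf_div ler_wpM2r// ler_wpM2r ?invr_ge0//; exact: rmd_norm.
(* The shift loses nothing because coefficients of index d vanish; d exceeds both sizes by at least
   one for this purpose. *)
have sh (f : nat -> R) : (forall j, 0 <= f j) -> f d = 0 -> \sum_(j < d) f j.+1 <= \sum_(j < d) f j.
  move=> f0 fd; have e : \sum_(j < d.+1) f j = \sum_(j < d) f j by rewrite big_ord_recr /= fd addr0.
  by rewrite -e [leRHS]big_ord_recl /= lerDr.
rewrite big_split /= lerD//.
  by apply: (sh (fun j => `|rmd k j|)) => //; rewrite rmd_big// normr0.
rewrite -mulr_sumr mulrAC [leRHS]mulrAC [nq * _]mulrC ler_wpM2r ?invr_ge0//.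
rewrite ler_wpM2l ?sumr_ge0//; apply: (sh (fun j => `|q`_j|)) => //.
by rewrite nth_default ?normr0// leqW// leq_maxr.
Qed.

Lemma M_ge1 : 1 <= M. Proof. by rewrite lerDl divr_ge0// sumr_ge0. Qed.

Lemma nr_bound k : nr k <= nr 0 * M ^+ k.
Proof.
elim: k => [|k IH]; first by rewrite expr0 mulr1.
apply: le_trans (nr_step k) _; rewrite exprS mulrCA ler_wpM2l//.
by apply: le_trans M_ge1.
Qed.

Lemma division_identity t N : p.[t] = q.[t] * \sum_(k < N) quo k * t ^+ k
  + t ^+ N * \sum_(j < d) rmd N j * t ^+ j.
Proof.
have wide (P : {poly R}) n : (size P <= n)%N -> P.[t] = \sum_(j < n) P`_j * t ^+ j by exact: horner_coef_wide.
elim: N => [|N IH].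
  by rewrite big_ord0 mulr0 add0r expr0 mul1r (@wide p d)// leqW// leq_maxl.
rewrite IH [\sum_(k < N.+1) _]big_ord_recr /= mulrDr -!addrA; congr (_ + _).
rewrite (_ : q.[t] * (quo N * t ^+ N) = t ^+ N * (quo N * q.[t])); last by ring.
rewrite exprSr -mulrA -mulrDr; congr (_ * _).
rewrite (@wide q d.+1); last by rewrite !leqW// leq_maxr.
rewrite [in RHS]big_ord_recl /= expr0 mulr1 mulrDr /quo divfK// -addrA.
transitivity (\sum_(j < d.+1) rmd N j * t ^+ j); first by rewrite [RHS]big_ord_recr /= rmd_big// mul0r addr0.
rewrite big_ord_recl /= expr0 mulr1; congr (_ + _).
rewrite !mulr_sumr -big_split /=; apply: eq_bigr => j _.
by rewrite /bump /= add1n exprS; ring.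
Qed.

(** For |t| < 1 / (2M) the k-th term is at most a constant times 2^{-k}, and by [division_identity]
    so is the remainder after k steps. *)
Lemma division_series : exists2 r : R, 0 < r &
  exists B : R, forall t, `|t| < r -> q.[t] != 0 ->
    (forall N, \sum_(k < N) `|quo k| * `|t| ^+ k <= B) /\
    (\sum_(k < N) quo k * t ^+ k) @[N --> \oo] --> p.[t] / q.[t].
Proof.
have M0 : 0 < M by apply: lt_le_trans M_ge1.
exists (2 * M)^-1; first by rewrite invr_gt0 mulr_gt0.
exists (nr 0 / `|q`_0| * 2) => t ht qt.
have Mt : M * `|t| <= 2^-1.
  by rewrite -ler_pdivlMl// mulrC -invfM ltW// mulrC.
have t1 : `|t| <= 1.
  have M1 := M_ge1; apply: le_trans (_ : M * `|t| <= _); first by rewrite ler_peMl.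
  by apply: le_trans Mt _; rewrite invf_le1// ler1n.
have pw k : M ^+ k * `|t| ^+ k <= 2^-1 ^+ k by rewrite -exprMn lerXn2r// ?nnegrE ?mulr_ge0// ?invr_ge0// ltW.
have nr0 : 0 <= nr 0 by apply: sumr_ge0.
split=> [N|].
  apply: (@le_trans _ _ (\sum_(k < N) nr 0 / `|q`_0| * 2^-1 ^+ k)).
    apply: ler_sum => k _; rewrite /quo normf_div.
    apply: (@le_trans _ _ (nr 0 / `|q`_0| * (M ^+ k * `|t| ^+ k))); last by rewrite ler_wpM2l ?divr_ge0.
    rewrite mulrA ler_wpM2r ?exprn_ge0// [leRHS]mulrAC ler_wpM2r ?invr_ge0//.
    exact: le_trans (rmd_norm k 0) (nr_bound k).
  by rewrite -mulr_sumr ler_wpM2l ?divr_ge0// half_geometric.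
apply/cvgrPdist_le => e e0.
have c0 : nr 0 / `|q.[t]| * 2^-1 ^+ N @[N --> \oo] --> (0 : R).
  rewrite -[X in _ --> X](mulr0 (nr 0 / `|q.[t]|)); apply: cvgM; first exact: cvg_cst.
  by apply: cvg_expr; rewrite ger0_norm ?invr_ge0// invf_lt1// ltr1n.
have /cvgrPdist_le/(_ e e0) := c0; apply: filterS => N; rewrite sub0r normrN; apply: le_trans.
have -> : p.[t] / q.[t] - \sum_(k < N) quo k * t ^+ k = t ^+ N * (\sum_(j < d) rmd N j * t ^+ j) / q.[t].
  by rewrite (division_identity t N); field.
rewrite [leRHS]ger0_norm; last first.
  by apply: mulr_ge0; [exact: divr_ge0|rewrite exprn_ge0// invr_ge0].
rewrite normf_div normrM normrX [leRHS]mulrAC ler_wpM2r ?invr_ge0//.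
apply: (@le_trans _ _ (`|t| ^+ N * (nr 0 * M ^+ N))).
  rewrite ler_wpM2l ?exprn_ge0//; apply: le_trans (nr_bound N).
  apply: le_trans (ler_norm_sum _ _ _) _; apply: ler_sum => j _.
  by rewrite normrM normrX ler_piMr// exprn_ile1.
by rewrite mulrCA ler_wpM2l// mulrC.
Qed.

End Division.

Lemma ratfun_series f (a : R) : ratfun f -> exists (c : nat -> R) (r : R) (B : R), 0 < r /\
  forall t : R, `|t| < r -> (forall N, \sum_(k < N) `|c k| * `|t| ^+ k <= B) /\
    (\sum_(k < N) c k * t ^+ k) @[N --> \oo] --> f (a + t).
Proof.
move=> [p [q [q0 e]]].
pose sh (P : {poly R}) := P \Po ('X + a%:P).
have shE P t : (sh P).[t] = P.[a + t] by rewrite horner_comp !hornerE addrC.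
have s0 : (sh q)`_0 != 0 by rewrite -horner_coef0 shE.
have [r r0 [B H]] := division_series (sh p) s0.
exists (quo (sh p) (sh q)), r, B; split=> // t ht; rewrite e -!shE; apply: H => //.
by rewrite shE.
Qed.

End RationalSeries.

Section Analytic.
Context {R : realType} {n : nat}.
Implicit Types (f g : 'rV[R]_n -> R).

(** With coefficients that are products over the variables, the partial sum over the cube of
    multi-indices factors exactly into one-variable partial sums. *)
Lemma analytic_prod (g : 'I_n -> R -> R) x : (forall i, ratfun (g i)) ->
  analytic_at (fun y : 'rV[R]_n => \prod_i g i (y 0 i)) x.
Proof.
move=> rg; have H i := ratfun_series (x 0 i) (rg i).
have [c Hc] := choice H; have [r Hr] := choice Hc; have [B HB] := choice Hr => {H Hc Hr}.
pose rr := (1 + \sum_i (r i)^-1)^-1.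
have S0 : 0 < 1 + \sum_i (r i)^-1.
  by rewrite ltr_pwDl// sumr_ge0// => i _; rewrite invr_ge0; have [/ltW] := HB i.
have rri i : rr <= r i.
  have [ri0 _] := HB i; rewrite /rr invf_ple ?posrE//.
  rewrite (bigD1 i)//= addrCA lerDl addr_ge0// sumr_ge0// => j _.
  by rewrite invr_ge0; have [/ltW] := HB j.
exists (fun al => \prod_i c i (al i)), rr; split; first by rewrite /rr invr_gt0.
move=> u hu; have ui i : `|u 0 i| < r i.
  exact: lt_le_trans (le_lt_trans (coord_le_norm u 0 i) hu) (rri i).
have key (w : 'rV[R]_n) (C : 'I_n -> nat -> R) N : power_sum (fun al => \prod_i C i (al i)) w N =
    \prod_i \sum_(k < N) C i k * w 0 i ^+ k.
  rewrite bigA_distr_bigA /power_sum; apply: eq_bigr => al _.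
  by rewrite -big_split /=; apply: eq_bigr => i _; rewrite ffunE.
split.
  exists (\prod_i B i) => N.
  rewrite (_ : (fun al => _) = fun al : {ffun 'I_n -> nat} => \prod_i `|c i (al i)|); last first.
    by apply/funext => al; rewrite normr_prod.
  rewrite (key _ (fun i k => `|c i k|)); apply: ler_prod => i _; apply/andP; split.
    by apply: sumr_ge0 => k _; rewrite mulr_ge0// exprn_ge0// mxE.
  by rewrite mxE; have [_ /(_ _ (ui i))[]] := HB i.
rewrite (_ : power_sum _ u = fun N => \prod_i \sum_(k < N) c i k * u 0 i ^+ k); last first.
  by apply/funext => N; rewrite key.
have cvp (l : seq 'I_n) : (\prod_(i <- l) \sum_(k < N) c i k * u 0 i ^+ k) @[N --> \oo] -->
    \prod_(i <- l) g i ((x + u) 0 i).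
  elim: l => [|i l IH].
    by under eq_fun do rewrite big_nil; rewrite big_nil; exact: cvg_cst.
  under eq_fun do rewrite big_cons; rewrite big_cons; apply: cvgM => //.
  by rewrite mxE; have [_ /(_ _ (ui i))[]] := HB i.
exact: cvp.
Qed.

Lemma analytic_add f g x : analytic_at f x -> analytic_at g x -> analytic_at (fun y => f y + g y) x.
Proof.
move=> [c [r [r0 H]]] [c' [r' [r0' H']]].
exists (fun al => c al + c' al), (Num.min r r'); split; first by rewrite lt_min r0.
move=> u; rewrite lt_min => /andP[/H[[B HB] cv] /H'[[B' HB'] cv']].
have key (C C' : {ffun 'I_n -> nat} -> R) w N :
    power_sum (fun al => C al + C' al) w N = power_sum C w N + power_sum C' w N.
  by rewrite /power_sum -big_split /=; apply: eq_bigr => al _; rewrite mulrDl.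
split.
  exists (B + B') => N; apply: le_trans (lerD (HB N) (HB' N)); rewrite -key.
  apply: ler_sum => al _; rewrite ler_wpM2r ?ler_normD//.
  by apply: prodr_ge0 => i _; rewrite exprn_ge0// mxE.
rewrite (_ : power_sum _ u = fun N => power_sum c u N + power_sum c' u N); first exact: cvgD.
by apply/funext => N; rewrite key.
Qed.

(** Sums of products of one-variable rational functions: closed under products, so that no product
    of multivariate power series has to be formed, and large enough for the metric coefficients. *)
Inductive separable : ('rV[R]_n -> R) -> Prop :=
| separable_prod (g : 'I_n -> R -> R) : (forall i, ratfun (g i)) -> separable (fun y => \prod_i g i (y 0 i))
| separable_add f g : separable f -> separable g -> separable (fun y => f y + g y).

Lemma separable_analytic f x : separable f -> analytic_at f x.
Proof. by elim=> [g|f1 f2 _ IH1 _ IH2]; [exact: analytic_prod|exact: analytic_add]. Qed.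

Lemma separable_mul f g : separable f -> separable g -> separable (fun y => f y * g y).
Proof.
move=> sf sg; elim: sf => [u ru|f1 f2 _ IH1 _ IH2]; last first.
  rewrite (_ : (fun y => _) = fun y => f1 y * g y + f2 y * g y); first exact: separable_add.
  by apply/funext => y; rewrite mulrDl.
elim: sg => [v rv|f1 f2 _ IH1 _ IH2]; last first.
  by rewrite (_ : (fun y => _) = fun y : 'rV[R]_n => (\prod_i u i (y 0 i)) * f1 y + (\prod_i u i (y 0 i)) * f2 y);
    [exact: separable_add|apply/funext => y; rewrite mulrDr].
rewrite (_ : (fun y => _) = fun y : 'rV[R]_n => \prod_i (u i (y 0 i) * v i (y 0 i))).
  by apply: (@separable_prod (fun i t => u i t * v i t)) => i; exact: ratfun_mul.
by apply/funext => y; rewrite big_split.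
Qed.

Lemma separable_coord i (h : R -> R) : ratfun h -> separable (fun y => h (y 0 i)).
Proof.
move=> rh; rewrite (_ : (fun y => _) = fun y : 'rV[R]_n => \prod_j (if j == i then h (y 0 j) else 1)).
  apply: (@separable_prod (fun j t => if j == i then h t else 1)) => j.
  by case: (j == i) => //; exact: ratfun_cst.
apply/funext => y; rewrite (bigD1 i)//= eqxx big1 ?mulr1// => j ji.
by rewrite (negbTE ji).
Qed.

Lemma separable_cst (a : R) : (0 < n)%N -> separable (fun=> a).
Proof. by move=> n0; exact: (separable_coord (Ordinal n0) (ratfun_cst a)). Qed.

Lemma separable_sum (I : Type) (l : seq I) (F : I -> 'rV[R]_n -> R) : (0 < n)%N -> (forall i, separable (F i)) ->
  separable (fun y => \sum_(i <- l) F i y).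
Proof.
move=> n0 sF; elim: l => [|i l IH].
  by rewrite (_ : (fun y => _) = fun=> 0); [exact: separable_cst|apply/funext => y; rewrite big_nil].
rewrite (_ : (fun y => _) = fun y => F i y + \sum_(j <- l) F j y); first exact: separable_add.
by apply/funext => y; rewrite big_cons.
Qed.

End Analytic.

Section FormAnalytic.
Context {R : realType} {m : nat}.
Local Notation X := 'rV[R]_(1 + hdim m).
Variables (b : R) (ax ay : 'I_m -> R).

Lemma hform_analytic (x : X) i j : analytic_at (fun y => hform b ax ay y i j) x.
Proof.
apply: separable_analytic; rewrite /hform; under eq_fun do rewrite mxE.
set u : X := delta_mx 0 i; set v : X := delta_mx 0 j.
have cs a : separable (fun _ : X => a) by exact: separable_cst.
have FE r s : FF b ax ay r s = (1 + (kq b ax ay r)%:P * 'X^2).[s] by rewrite /FF !hornerE.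
have sw w : separable (fun y : X => wz y w).
  under eq_fun do rewrite wzE; apply: separable_add => //.
  rewrite (_ : (fun y => _) = fun y : X => \sum_r (- vy r w) * vx r y).
    apply: separable_sum => // r; apply: separable_mul => //.
    rewrite (_ : vx r = fun y : X => y 0 (rshift 1 (ix r))); last by apply/funext => y; rewrite /vx rsubmxE.
    apply: (separable_coord _ (h := id)); have := @ratfun_poly R 'X.
    by congr ratfun; apply/funext => t; rewrite hornerX.
  by apply/funext => y; rewrite -sumrN; apply: eq_bigr => r _; ring.
have sc : separable (fun y : X => cc b ax ay (vs y)).
  apply: (separable_coord 0 (h := cc b ax ay)).
  exists ((4 * b ^+ 2)%:P * 'X), (\prod_r (1 + (kq b ax ay r)%:P * 'X^2)).
  have PE s : (\prod_r (1 + (kq b ax ay r)%:P * 'X^2)).[s] = PP b ax ay s.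
    by rewrite horner_prod; apply: eq_bigr => r _; rewrite FE.
  by split=> s; rewrite PE ?gt_eqF ?PP_gt0// /cc hornerM hornerX hornerC.
have sF r : separable (fun y : X => FF b ax ay r (vs y)).
  apply: (separable_coord 0 (h := FF b ax ay r)); have := ratfun_poly (1 + (kq b ax ay r)%:P * 'X^2).
  by congr ratfun; apply/funext => s; rewrite FE.
rewrite /hbil; apply: separable_add; first apply: separable_add.
- apply: separable_mul => //; apply: separable_add; exact: separable_mul.
- apply: separable_mul => //; exact: separable_mul.
by apply: separable_sum => // r; exact: separable_mul.
Qed.

End FormAnalytic.

(** * Topology of the quotient and orbits of its centre *)

Section QuotientTopology.
Context {R : realType} {m : nat} {Ga : set 'rV[R]_(hdim m)}.
Hypothesis dG : discrete_subgroup Ga.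
Local Notation H := 'rV[R]_(hdim m).
Local Notation ix := (@ix m).
Local Notation iy := (@iy m).

Definition zc (t : R) : H := t *: delta_mx 0 0.

Lemma zc_ix t r : zc t 0 (ix r) = 0. Proof. by rewrite !mxE ix_neq0 mulr0. Qed.
Lemma zc_iy t r : zc t 0 (iy r) = 0. Proof. by rewrite !mxE iy_neq0 mulr0. Qed.
Lemma zcD a c : zc (a + c) = zc a + zc c. Proof. exact: scalerDl. Qed.

Lemma hmul_zcr h k t : hmul h (k + zc t) = hmul h k + zc t.
Proof.
apply/rowP => a; rewrite mxE [RHS]mxE [X in _ = X + _]mxE [(k + zc t) 0 a]mxE.
under eq_bigr do rewrite mxE zc_iy addr0.
by rewrite [RHS]addrAC !addrA.
Qed.

Lemma hmul_zcl k t : hmul (zc t) k = k + zc t.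
Proof.
apply/rowP => a; rewrite mxE big1 => [|r _]; last by rewrite zc_ix mul0r.
by rewrite if_same addr0 addrC [RHS]mxE.
Qed.

Lemma hinv_zc t : hinv (zc t) = zc (- t).
Proof.
apply/rowP => a; rewrite mxE big1 => [|r _]; last by rewrite zc_ix mul0r.
by rewrite if_same addr0 !mxE mulNr.
Qed.

Lemma discrete_closed g : ~ Ga g -> exists W : set H, [/\ open W, W g & forall u, W u -> ~ Ga u].
Proof.
move=> ng; have [G1 Gm Gi Gd] := dG.
have n0 := Gd 0 G1.
have cm : {for (g, g), continuous (fun q : H * H => hmul q.1 (hinv q.2))}.
  apply: (@hmul_continuous R m _ (fun q : H * H => q.1) (fun q => hinv q.2)); first exact: cvg_fst.
  by apply: continuous_comp; [exact: cvg_snd|exact: hinv_continuous].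
have n1 : nbhs (hmul g (hinv g)) (fun k => Ga k -> k = 0) by rewrite hmulhV.
have [d d0 Hd] := nbhs_pairP (cm _ n1).
have uq u v : `|g - u| < d -> `|g - v| < d -> Ga u -> Ga v -> u = v.
  move=> hu hv Gu Gv; have e := Hd u v hu hv (Gm _ _ Gu (Gi _ Gv)).
  by rewrite -[LHS](hmulh0 u) -(hmulVh v) hmulA e hmul0h.
have [[u [Gu gu]]|nu] := pselect (exists u, Ga u /\ `|g - u| < d).
  have ne : 0 < `|g - u| by rewrite normr_gt0 subr_eq0; apply/eqP => e; apply: ng; rewrite e.
  exists (ball g `|g - u|); split; [exact: ball_open|exact: ballxx|] => v.
  rewrite -ball_normE /ball_ /= => hv Gv; have := uq u v gu (lt_trans hv gu) Gu Gv.
  by move=> e; move: hv; rewrite -e ltxx.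
exists (ball g d); split; [exact: ball_open|exact: ballxx|] => v.
by rewrite -ball_normE /ball_ /= => hv Gv; apply: nu; exists v.
Qed.

Lemma hquot_hausdorff : hausdorff_space (hquot Ga).
Proof.
move=> q q'; have [h <-] := hproj_surj q; have [k <-] := hproj_surj q' => cl.
apply: contrapT => ne.
have ng : ~ Ga (hmul k (hinv h)).
  move=> Gg; apply: ne; apply/(hproj_eqP dG); exists (hmul k (hinv h)) => //.
  by rewrite -hmulA hmulVh hmulh0.
have [W [oW Wg HW]] := discrete_closed ng.
have cm : {for (h, k), continuous (fun q : H * H => hmul q.2 (hinv q.1))}.
  apply: (@hmul_continuous R m _ (fun q : H * H => q.2) (fun q => hinv q.1)); first exact: cvg_snd.
  by apply: continuous_comp; [exact: cvg_fst|exact: hinv_continuous].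
have [d d0 Hd] := nbhs_pairP (continuous_nbhs cm oW Wg).
have nb (x : H) : nbhs (hproj Ga x) (hproj Ga @` ball x d).
  apply: (@open_nbhs_nbhs (hquot Ga)); split; first by apply: (hproj_open dG); exact: ball_open.
  by exists x => //; exact: ballxx.
have [_ [[h' bh <-] [k' bk]]] := cl _ _ (nb h) (nb k).
move=> /esym/(hproj_eqP dG)[ga Gga e].
move: bh bk; rewrite -!ball_normE /ball_ /= => bh bk.
by apply: (HW _ (Hd h' k' bh bk)); rewrite /= e hmulhK.
Qed.

Lemma hproj_shift_cvg (T : Type) (F : set_system T) {FF : Filter F} (k : T -> H) (del : T -> R) (l : H) (d : R) :
  hproj Ga (k t) @[t --> F] --> hproj Ga l -> del t @[t --> F] --> d ->
  hproj Ga (k t + zc (del t)) @[t --> F] --> hproj Ga (l + zc d).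
Proof.
move=> ck cd U nU.
have cm : {for (l, d), continuous (fun q : H * R => q.1 + zc q.2)}.
  apply: (@continuousD R H _ (fun q : H * R => q.1) (fun q => zc q.2)); first exact: cvg_fst.
  apply: (@cvg_rVP R _ (nbhs (l, d)) _) => j; under eq_fun do rewrite !mxE; rewrite !mxE.
  by apply: cvgM; [exact: cvg_snd|exact: cvg_cst].
have c2 : {for (l, d), continuous (fun q : H * R => hproj Ga (q.1 + zc q.2))}.
  by apply: continuous_comp; [exact: cm|exact: hproj_continuous].
have [e e0 He] := nbhs_pairP (c2 _ nU).
have n1 : nbhs (hproj Ga l) (hproj Ga @` ball l e).
  apply: (@open_nbhs_nbhs (hquot Ga)); split; first by apply: (hproj_open dG); exact: ball_open.
  by exists l => //; exact: ballxx.
have n2 : nbhs d (ball d e) by exact: nbhsx_ballx.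
apply: (@filterS2 _ F FF _ _ _ _ (ck _ n1) (cd _ n2)) => t [k' bk ek] bd.
move: bk bd; rewrite -!ball_normE /ball_ /= => bk bd.
have := He k' (del t) bk bd; rewrite /=.
move: ek => /(hproj_eqP dG)[ga Gga ->].
by rewrite -hmul_zcr hproj_hmul.
Qed.

(** Shifting the parameter shows that a limit would be fixed by the whole centre, so Ga would
    contain the centre, contrary to discreteness. *)
Lemma central_no_limit (h : H) (a : R) : a != 0 ->
  ~ exists q, hproj Ga (h + zc (a * t)) @[t --> +oo] --> (q : hquot Ga).
Proof.
move=> a0 [q]; have [l <-] := hproj_surj q => cv.
have [G1 Gm Gi Gd] := dG.
have zG d : Ga (zc d).
  have c1 : hproj Ga (h + zc (a * t) + zc d) @[t --> +oo] --> hproj Ga (l + zc d).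
    exact: (@hproj_shift_cvg _ _ _ _ (fun=> d) _ _ cv (cvg_cst d)).
  have c2 : hproj Ga (h + zc (a * t) + zc d) @[t --> +oo] --> hproj Ga l.
    have e t : h + zc (a * t) + zc d = h + zc (a * (t + d / a)).
      by rewrite mulrDr [a * (d / a)]mulrCA mulfV// mulr1 zcD addrA.
    under eq_fun do rewrite e.
    have sh : (t + d / a) @[t --> +oo] --> +oo.
      move=> A [M [Mr HM]]; exists (M - d / a); split; first exact: num_real.
      by move=> t ht; apply: HM; rewrite -ltrBlDr.
    exact: (@cvg_comp _ _ _ (fun t => t + d / a) (fun t => hproj Ga (h + zc (a * t))) _ _ _ sh cv).
  have := cvg_unique hquot_hausdorff c2 c1 => /(_ (fmap_proper_filter _ _)).
  move=> /(hproj_eqP dG)[ga Gga e].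
  rewrite (_ : zc d = ga)//.
  by rewrite -[ga](hmulhK l) -e -hmul_zcl hmulhK.
have [d d0 Hd] := nbhs_distP (Gd 0 G1).
have := Hd (zc (d / 2)); rewrite sub0r normrN => h0.
have : zc (d / 2) = 0.
  apply: h0 => //; apply: mx_norm_ltP => // i j; rewrite !mxE normrM.
  apply: (@le_lt_trans _ _ (`|d / 2| * 1)).
    by rewrite ler_wpM2l//; case: (_ && _); rewrite ?normr1 ?normr0.
  by rewrite mulr1 gtr0_norm ?divr_gt0// ltr_pdivrMr// ltr_pMr// ltr1n.
move=> /rowP/(_ 0); rewrite !mxE !eqxx mulr1 => e.
by move: d0; rewrite -(pmulr_lgt0 _ (_ : 0 < 2^-1)) ?invr_gt0// e ltxx.
Qed.

(** A homomorphism to R killing Ga descends to a continuous function on the compact quotient. *)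
Lemma compact_vanishing (f : H -> R) : compact [set: hquot Ga] -> continuous f ->
  (forall h k, f (hmul h k) = f h + f k) -> (forall g, Ga g -> f g = 0) -> exists B, forall h, `|f h| <= B.
Proof.
move=> cpt cf fM fG.
pose F (q : hquot Ga) := f (xget 0 [set h | hproj Ga h = q]).
have FE h : F (hproj Ga h) = f h.
  have : hproj Ga (xget 0 [set k | hproj Ga k = hproj Ga h]) = hproj Ga h.
    by apply: (@xgetPex _ 0 [set k | hproj Ga k = hproj Ga h]); exists h.
  by rewrite /F; set y := xget _ _ => /esym/(hproj_eqP dG)[ga Gga ->]; rewrite fM fG// add0r.
have cF : continuous F.
  apply/continuousP => U oU; rewrite (_ : F @^-1` U = hproj Ga @` (f @^-1` U)).
    by apply: (hproj_open dG); apply: open_comp oU => x _; exact: cf.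
  apply/seteqP; split=> [q|_ [h Uh <-]]; last by rewrite /preimage /= FE.
  by have [h <-] := hproj_surj q; rewrite /preimage /= FE => Uh; exists h.
have [M [_ HM]] := @compact_bounded R R _ (continuous_compact (continuous_subspaceT cF) cpt).
exists (M + 1) => h; apply: (HM (M + 1)); first by rewrite ltrDl.
by exists (hproj Ga h) => //; exact: FE.
Qed.

(** If Ga met the centre trivially, its commutators, which are central, would vanish. Then [om g]
    for g in Ga with nonzero horizontal part, or an x-coordinate if there is no such g, is an
    unbounded homomorphism killing Ga. *)
Lemma compact_central : (0 < m)%N -> compact [set: hquot Ga] -> exists2 L, 0 < L & Ga (zc L).
Proof.
move=> m0 cpt; apply: contrapT => nc.
have [G1 Gm Gi Gd] := dG.
have zG t : Ga (zc t) -> t = 0.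
  move=> Gt; case: (ltrgtP t 0) => // ht; exfalso; apply: nc.
    by exists (- t); [rewrite oppr_gt0|rewrite -hinv_zc; exact: Gi].
  by exists t.
pose om (g h : H) := \sum_r (g 0 (ix r) * h 0 (iy r) - h 0 (ix r) * g 0 (iy r)).
have comm g h : hmul g h = hmul h g + zc (om g h).
  apply/rowP => a; rewrite [RHS]mxE !hmulE !mxE.
  case: eqVneq => [->|_]; last by rewrite andbF mulr0 addr0 !addr0 addrC.
  by rewrite eqxx mulr1 /om sumrB; ring.
have omG g h : Ga g -> Ga h -> om g h = 0.
  move=> Gg Gh; apply: zG.
  have -> : zc (om g h) = hmul (hmul g h) (hinv (hmul h g)) by rewrite (comm g h) -hmul_zcl hmulhK.
  by apply: (Gm); [exact: Gm|apply: Gi; exact: Gm].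
have unb (f : H -> R) h0 : f h0 != 0 -> (forall t, f (t *: h0) = t * f h0) -> continuous f ->
    (forall h k, f (hmul h k) = f h + f k) -> (forall g, Ga g -> f g = 0) -> False.
  move=> f0 fZ cf fM fG; have [B HB] := compact_vanishing cpt cf fM fG.
  have := HB (((B + 1) / f h0) *: h0); rewrite fZ divfK//.
  have B0 : 0 <= B by apply: le_trans (HB 0); exact: normr_ge0.
  by rewrite ger0_norm ?addr_ge0// gerDl ler10.
have cc (a : 'I_(hdim m)) : continuous (fun h : H => h 0 a).
  by move=> h; exact: (@cvg_coord R H (nbhs h) _ _ _ id h 0 a (@cvg_id _ _)).
have [[g [Gg [r gr]]]|ng] := pselect (exists g, Ga g /\ exists r, g 0 (ix r) != 0 \/ g 0 (iy r) != 0).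
  have com : continuous (om g).
    move=> h; apply: (@cvg_bigsum R R H (nbhs h) _ 'I_m _ _ (fun r h' => g 0 (ix r) * h' 0 (iy r) - h' 0 (ix r) * g 0 (iy r))) => r'.
    by apply: cvgB; apply: cvgM; try exact: cvg_cst; exact: cc.
  have omM h k : om g (hmul h k) = om g h + om g k.
    by rewrite /om -big_split /=; apply: eq_bigr => r' _; rewrite hmul_ix hmul_iy; ring.
  have omZ t h : om g (t *: h) = t * om g h.
    by rewrite /om mulr_sumr; apply: eq_bigr => r' _; rewrite !mxE; ring.
  case: gr => gr.
    apply: (unb (om g) (delta_mx 0 (iy r))) => //; last by move=> g' Gg'; exact: omG.
    rewrite /om (bigD1 r)//= big1 => [|q qr]; rewrite !mxE !eqxx ix_neq_iy /=; first by rewrite mulr1 mul0r subr0 addr0.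
    by rewrite (inj_eq (@iy_inj m)) (negbTE qr) /=; ring.
  apply: (unb (om g) (delta_mx 0 (ix r))) => //; last by move=> g' Gg'; exact: omG.
  rewrite /om (bigD1 r)//= big1 => [|q qr]; rewrite !mxE !eqxx (eq_sym (iy _)) ix_neq_iy /=.
    by rewrite mulr0 sub0r mul1r addr0 oppr_eq0.
  by rewrite (inj_eq (@ix_inj m)) (negbTE qr) /=; ring.
pose r0 := Ordinal m0.
apply: (unb (fun h => h 0 (ix r0)) (delta_mx 0 (ix r0))).
- by rewrite mxE !eqxx oner_eq0.
- by move=> t; rewrite mxE.
- exact: cc.
- by move=> h k; rewrite hmul_ix.
move=> g Gg; apply/eqP; apply: contrapT => /negP gn; apply: ng; exists g; split=> //.
by exists r0; left.
Qed.

End QuotientTopology.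

(** * Lifts of piecewise smooth curves *)

Section CurveLifts.
Context {R : realType} {m : nat} {Ga : set 'rV[R]_(hdim m)}.
Hypothesis dG : discrete_subgroup Ga.
Local Notation X := 'rV[R]_(1 + hdim m).
Local Notation M := (spacetime Ga).
Implicit Type P : chart R (1 + hdim m) M -> X -> X -> Prop.

Lemma curve_lift_derivable (k : R -> X) (si : R -> M) (J : set R) t : open J -> J t -> continuous k ->
  smooth_curve J si -> (\forall u \near t, stproj Ga (k u) = si u) ->
  exists2 v, is_derive t 1 k v & forall P, velocity_cond P [set t] si -> exists2 c, atlas M c & P c (k t) v.
Proof.
move=> oJ Jt ck [csi ssi] near_e.
have [c [ac ckt]] := chart_exists dG (k t); have [oc ic ec] := ac.
have e0 : stproj Ga (k t) = si t by exact: nbhs_singleton near_e.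
have nc : \forall u \near t, k u = (Defs.coord c \o si) u.
  have n1 : nbhs t (k @^-1` cdom c) by apply: continuous_nbhs; [exact: ck|exact: oc|exact: ckt].
  by apply: filterS2 n1 near_e => u cu eu; rewrite /= -eu -ec coordK// ec.
have nc' : \forall u \near t, (Defs.coord c \o si) u = k u by apply: filterS nc => u ->.
have cr : cran c (si t) by exists (k t) => //; rewrite ec.
have [_ /(_ (1 : R))[d1 _]] := ssi c ac 1%N.
have dk : derivable k t 1 by apply: near_eq_derivable nc' (d1 t _).
exists ('D_1 k t); first exact: derivableP.
move=> P vP; exists c => //.
have := vP t erefl c ac cr; rewrite derive1E (near_eq_derive (1 : R) nc').
by rewrite -[Defs.coord c (si t)]/((Defs.coord c \o si) t) -(nbhs_singleton nc).
Qed.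

Lemma segment_interior P (ga : R -> M) a b (k : R -> X) t : segment P ga a b -> a < t < b ->
  continuous k -> (forall u, a <= u <= b -> stproj Ga (k u) = ga u) ->
  exists v c, [/\ is_derive t 1 k v, atlas M c & P c (k t) v].
Proof.
move=> [si [J [oJ sJ smJ e vP]]] /andP[at_ tb] ck ke.
have tab : `[a, b]%classic t by rewrite /= in_itv /= !ltW.
have ne : \forall u \near t, stproj Ga (k u) = si u.
  have n : \forall u \near t, u \in `]a, b[ by apply: near_in_itvoo; rewrite in_itv /= at_.
  apply: filterS n => u; rewrite in_itv /= => /andP[/ltW h1 /ltW h2].
  by rewrite ke ?h1//; apply: e; rewrite /= in_itv /= h1.
have [v dv H] := curve_lift_derivable oJ (sJ t tab) ck smJ ne.
have [c ac Pc] := H P (fun u ut => vP u (eq_ind_r (fun w => `[a, b]%classic w) tab ut)).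
by exists v, c.
Qed.

Lemma segment_within P (ga : R -> M) a b : segment P ga a b -> {within `[a, b], continuous ga}.
Proof.
move=> [si [J [oJ sJ [csi _] e _]]].
apply: (@subspace_eq_continuous _ _ _ si) => [t|]; first by rewrite inE => /e.
by apply: continuous_in_subspaceT => t; rewrite inE => /sJ/csi.
Qed.

Lemma partition_le (t : nat -> R) k : (forall i, (i < k)%N -> t i < t i.+1) ->
  forall j, (j <= k)%N -> t 0%N <= t j.
Proof.
move=> H; elim=> [|j IH] jk //.
by apply: le_trans (IH (ltnW jk)) (ltW (H j jk)).
Qed.

Lemma piecewise_within P (ga : R -> M) a b : piecewise P ga a b -> {within `[a, b], continuous ga}.
Proof.
move=> [k [t [<- <- H]]].
have mono := partition_le (fun i ik => proj1 (H i ik)).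
suff G j : (j <= k)%N -> {within `[t 0%N, t j], continuous ga} by exact: G.
elim: j => [|j IH] jk.
  rewrite set_itv1; exact: continuous_subspace1.
have [tj sj] := H j jk.
have -> : `[t 0%N, t j.+1]%classic = `[t 0%N, t j]%classic `|` `[t j, t j.+1]%classic.
  have t0j := mono j (ltnW jk).
  apply/seteqP; split=> u /=; rewrite !in_itv /=.
    by case: (leP u (t j)) => h /andP[h1 h2]; [left; rewrite h1|right; rewrite h2 ltW].
  by case=> /andP[h1 h2]; rewrite ?h1 ?h2 ?andbT//=; [exact: le_trans h2 (ltW tj)|exact: le_trans h1].
apply: withinU_continuous; [exact: itv_closed|exact: itv_closed|exact: IH (ltnW jk)|exact: segment_within sj].
Qed.

(** Extends a curve on [0, b] constantly to R, so that it can be lifted as a map of the whole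
    line. *)
Definition clamp (b t : R) : R := Num.min (Num.max t 0) b.

Lemma clamp_itv b t : 0 <= b -> 0 <= clamp b t <= b.
Proof. by move=> b0; rewrite /clamp ge_min lexx orbT le_min b0 le_max lexx orbT. Qed.

Lemma clamp_id b t : 0 <= t <= b -> clamp b t = t.
Proof. by move=> /andP[t0 tb]; rewrite /clamp (max_idPl t0) (min_idPl tb). Qed.

Lemma clamp_lip b t u : `|clamp b t - clamp b u| <= `|t - u|.
Proof.
rewrite /clamp; have mx (v w c : R) : `|Num.max v c - Num.max w c| <= `|v - w|.
  rewrite ler_norml; case: (leP v c) => h1; case: (leP w c) => h2; case: (ler0P (v - w)) => h3; lra.
apply: le_trans (mx t u 0); set v := Num.max t 0; set w := Num.max u 0.
rewrite ler_norml; case: (leP v b) => h1; case: (leP w b) => h2; case: (ler0P (v - w)) => h3; lra.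
Qed.

Lemma clamp_continuous b : continuous (clamp b).
Proof.
move=> t; apply/cvgrPdist_lt => e e0.
have n : nbhs t (ball t e) by exact: nbhsx_ballx.
apply: filterS n => u; rewrite -ball_normE /ball_ /= => h.
exact: le_lt_trans (clamp_lip b t u) h.
Qed.

Lemma within_clamp (ga : R -> M) b : 0 <= b -> {within `[0, b], continuous ga} ->
  continuous (fun t => ga (clamp b t)).
Proof.
move=> b0 /subspace_continuousP cg t U nU.
have ct : `[0, b]%classic (clamp b t) by rewrite /= in_itv /= clamp_itv.
have n1 := cg _ ct U nU.
apply: (@filterS _ (nbhs t) _ _ _ _ (@clamp_continuous b t _ n1)) => u /= h; apply: h.
by rewrite /= in_itv /= clamp_itv.
Qed.

Lemma piecewise_clamp P (ga : R -> M) b : 0 <= b -> piecewise P ga 0 b -> continuous (fun t => ga (clamp b t)).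
Proof. by move=> b0 /piecewise_within; exact: within_clamp. Qed.

Lemma ray_continuous P (ga : R -> M) : (forall b, 0 < b -> piecewise P ga 0 b) ->
  continuous (fun t : R => ga (Num.max t 0)).
Proof.
move=> H t; pose b := `|t| + 1; have b0 : 0 < b by rewrite ltr_pwDr.
apply: (@continuous_near_eq _ _ _ (fun t => ga (clamp b t)) t).
  exact: (piecewise_clamp (ltW b0) (H _ b0)).
have n : nbhs t (ball t 1) by exact: nbhsx_ballx.
apply: filterS n => u; rewrite -ball_normE /ball_ /= => h.
congr ga; rewrite /clamp; apply/min_idPl.
rewrite ge_max (ltW b0) andbT.
have := ler_norm t; have := ler_norm (u - t); rewrite distrC => h1 h2.
by rewrite -[u](subrK t) addrC lerD// (le_trans h1)// ltW.
Qed.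

Lemma curve_lift (f : R -> M) (x0 : X) : continuous f -> stproj Ga x0 = f 0 ->
  exists k : R -> X, [/\ continuous k, forall t, stproj Ga (k t) = f t & k 0 = x0].
Proof.
move=> cf e0.
pose f2 (t : R) : hquot Ga := (f t).2.
have c2 (y : R) : {for y, continuous f2}.
  by apply: (@continuous_comp R (R * hquot Ga)%type (hquot Ga) f snd y); [exact: cf|exact: cvg_snd].
have c1 (y : R) : {for y, continuous (fun t => (f t).1)}.
  by apply: (@continuous_comp R (R * hquot Ga)%type R f fst y); [exact: cf|exact: cvg_fst].
have e2 : hproj Ga (rsubmx x0) = f2 0 by have := congr1 snd e0; rewrite stprojE.
have star (y t : R) : setT y -> 0 <= t <= 1 -> setT ((0 : R) + t *: (y - 0)) by [].
have [h [ch he h0]] := lifting dG openT I star (fun y _ => c2 y) e2.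
exists (fun t => pt (f t).1 (h t)); split.
- by move=> t; apply: (@pt_continuous R m R (fun t => (f t).1) h t); [exact: c1|exact: ch].
- by move=> t; rewrite stproj_pt (he t I) /f2; case: (f t).
have := congr1 fst e0; rewrite h0 stprojE /= => <-; exact: pt_eta.
Qed.

(** The derivative is examined only inside the smooth pieces; continuity of G bridges the break
    points. *)
Lemma piecewise_le P (ga : R -> M) a b (k : R -> X) (G : R -> R) :
  piecewise P ga a b -> continuous k -> (forall u, a <= u <= b -> stproj Ga (k u) = ga u) -> continuous G ->
  forall u v, a <= u -> u <= v -> v <= b ->
  (forall t w c, u < t < v -> is_derive t 1 k w -> atlas M c -> P c (k t) w -> exists2 d, is_derive t 1 G d & 0 <= d) ->
  G u <= G v.
Proof.
move=> [n [t [ea eb H]]] ck ke cG.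
have mono := partition_le (fun i ik => proj1 (H i ik)).
have step j u v : (j < n)%N -> t j <= u -> u <= v -> v <= t j.+1 ->
  (forall t w c, u < t < v -> is_derive t 1 k w -> atlas M c -> P c (k t) w -> exists2 d, is_derive t 1 G d & 0 <= d) ->
  G u <= G v.
  move=> jn ju uv vj D; have [tj sj] := H j jn.
  have tb : t j.+1 <= b.
    rewrite -eb; have HH i : (i <= n)%N -> (j.+1 <= i)%N -> t j.+1 <= t i.
      elim: i => // i IH iN; rewrite leq_eqVlt => /orP[/eqP <-//|ji].
      by apply: le_trans (IH (ltnW iN) ji) (ltW (proj1 (H i iN))).
    exact: HH.
  have key s : s \in `]u, v[%R -> exists2 d, is_derive s 1 G d & 0 <= d.
    rewrite in_itv /= => /andP[us sv].
    have [||w [c [dw ac Pc]]] := @segment_interior P ga (t j) (t j.+1) k s sj _ ck.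
    - by rewrite (le_lt_trans ju us) (lt_le_trans sv vj).
    - move=> x /andP[x1 x2]; apply: ke; rewrite (le_trans x2 tb) andbT.
      by apply: le_trans x1; rewrite -ea; exact: mono (ltnW jn).
    by apply: (D s w c) => //; rewrite us.
  apply: (@ger0_derive1_ndecr R G u v) => //.
  - by move=> s /key[d [dG' _] _].
  - by move=> s /key[d [_ <-]]; rewrite derive1E.
  - exact: continuous_subspaceT.
suff gl j : (j <= n)%N -> forall u v, t 0%N <= u -> u <= v -> v <= t j ->
  (forall t w c, u < t < v -> is_derive t 1 k w -> atlas M c -> P c (k t) w -> exists2 d, is_derive t 1 G d & 0 <= d) ->
  G u <= G v by move=> u v; rewrite -ea -eb; exact: gl.
elim: j => [|j IH] jn u v u0 uv vj D.
  by have -> : u = v by apply/eqP; rewrite eq_le uv; exact: le_trans vj u0.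
case: (leP v (t j)) => vtj; first exact: IH (ltnW jn) _ _ u0 uv vtj D.
case: (leP (t j) u) => utj; first exact: step jn utj uv vj D.
apply: (@le_trans _ _ (G (t j))).
  apply: (IH (ltnW jn) _ _ u0 (ltW utj) (lexx _)) => s w c /andP[h1 h2]; apply: D.
  by rewrite h1 (lt_trans h2 vtj).
apply: (step j) => //; first exact: ltW.
by move=> s w c /andP[h1 h2]; apply: D; rewrite h2 (lt_trans utj h1).
Qed.

End CurveLifts.

(** * The one-sided extensions *)

Section Invariance.
Context {R : realType} {m : nat}.
Local Notation X := 'rV[R]_(1 + hdim m).

Lemma quadratic_ext n (G H : 'M[R]_n) : G^T = G -> H^T = H ->
  (forall v, qform G v = qform H v) -> G = H.
Proof.
move=> sG sH E.
have sw (B : 'M[R]_n) (u v : 'rV[R]_n) : B^T = B -> (v *m B *m u^T) 0 0 = (u *m B *m v^T) 0 0.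
  by move=> sB; rewrite -[in LHS](trmxK (v *m B *m u^T)) mxE !trmx_mul trmxK sB mulmxA.
have pol (B : 'M[R]_n) (u v : 'rV[R]_n) : B^T = B ->
    qform B (u + v) = qform B u + 2 * (u *m B *m v^T) 0 0 + qform B v.
  move=> sB; rewrite /qform linearD /= mulmxDl mulmxDl !mulmxDr.
  have e (P Q : 'M[R]_1) : (P + Q) 0 0 = P 0 0 + Q 0 0 by rewrite mxE.
  by rewrite !e (sw B u v sB); ring.
apply: bilinear_matrix_ext => u v.
have := pol G u v sG; have := pol H u v sH; rewrite !E => -> h; lra.
Qed.

Variables (b : R) (ax ay : 'I_m -> R).
Local Notation hbil := (hbil b ax ay).
Local Notation hform := (hform b ax ay).

Lemma vs_ltrans k (x : X) : vs (ltrans k x) = vs x. Proof. exact: pt_time. Qed.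
Lemma vs_dltrans k (v : X) : vs (dltrans k v) = vs v. Proof. exact: pt_time. Qed.
Lemma vx_dltrans r k (v : X) : vx r (dltrans k v) = vx r v.
Proof. by rewrite /vx pt_space mxE ix_neq0 addr0. Qed.
Lemma vy_dltrans r k (v : X) : vy r (dltrans k v) = vy r v.
Proof. by rewrite /vy pt_space mxE iy_neq0 addr0. Qed.
Lemma wz_dltrans k (x v : X) : wz (ltrans k x) (dltrans k v) = wz x v.
Proof. by rewrite /wz !pt_space cow_dhmul. Qed.

Lemma hbil_ltrans k (x u v : X) : hbil (ltrans k x) (dltrans k u) (dltrans k v) = hbil x u v.
Proof.
rewrite /hbil !vs_dltrans !wz_dltrans !vs_ltrans; congr (_ + _).
by apply: eq_bigr => r _; rewrite !vx_dltrans !vy_dltrans.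
Qed.

Lemma vs0 : vs (0 : X) = 0. Proof. by rewrite /vs mxE. Qed.
Lemma vx0 r : vx r (0 : X) = 0. Proof. by rewrite /vx !mxE. Qed.
Lemma vy0 r : vy r (0 : X) = 0. Proof. by rewrite /vy !mxE. Qed.
Lemma wz0 (x : X) : wz x 0 = 0.
Proof. by rewrite wzE !mxE big1 ?subr0// => r _; rewrite vy0 mulr0. Qed.

Lemma vs_vert (a c : R) : vs (a *: es + c *: ea 0 : X) = a.
Proof. by rewrite vs_lin vs_es -[c *: _]addr0 vs_lin vs_ea vs0; ring. Qed.
Lemma vx_vert r (a c : R) : vx r (a *: es + c *: ea 0 : X) = 0.
Proof. by rewrite vx_lin vx_es -[c *: _]addr0 vx_lin vx_ez vx0; ring. Qed.
Lemma vy_vert r (a c : R) : vy r (a *: es + c *: ea 0 : X) = 0.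
Proof. by rewrite vy_lin vy_es -[c *: _]addr0 vy_lin vy_ez vy0; ring. Qed.
Lemma wz_vert (x : X) (a c : R) : wz x (a *: es + c *: ea 0) = c.
Proof. by rewrite wz_lin wz_es -[c *: _]addr0 wz_lin wz_ez wz0; ring. Qed.

Lemma vsD (u v : X) : vs (u + v) = vs u + vs v. Proof. by rewrite -[u]scale1r vs_lin scale1r mul1r. Qed.
Lemma vxD r (u v : X) : vx r (u + v) = vx r u + vx r v. Proof. by rewrite -[u]scale1r vx_lin scale1r mul1r. Qed.
Lemma vyD r (u v : X) : vy r (u + v) = vy r u + vy r v. Proof. by rewrite -[u]scale1r vy_lin scale1r mul1r. Qed.
Lemma wzD (x u v : X) : wz x (u + v) = wz x u + wz x v. Proof. by rewrite -[u]scale1r wz_lin scale1r mul1r. Qed.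

Lemma dltrans_vertical k (a c : R) : dltrans k (a *: es + c *: ea 0 : X) = a *: es + c *: ea 0.
Proof.
rewrite dltransE big1 ?scale0r ?addr0// => r _.
by rewrite vy_vert mulr0.
Qed.

End Invariance.

Section MonotoneLimits.
Context {R : realType}.

Lemma ray_monotone_cvg (h : R -> R) (B : R) : (forall u v, 0 <= u -> u <= v -> h u <= h v) ->
  (forall u, 0 <= u -> h u <= B) -> exists l : R, h t @[t --> +oo] --> l.
Proof.
move=> mono bd; pose A := [set h u | u in [set u : R | 0 <= u]].
have hA : has_sup A by split; [exists (h 0), 0 => /=|exists B => _ [u /= u0 <-]; exact: bd].
exists (sup A); apply/cvgrPdist_le => e e0.
have [_ [u /= u0 <-] hu] := sup_adherent e0 hA.
exists u; split; first exact: num_real.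
move=> t /ltW ut; have t0 := le_trans u0 ut.
have h1 : h t <= sup A by apply: ub_le_sup; [exact: (proj2 hA)|exists t].
rewrite ger0_norm ?subr_ge0// lerBlDr -lerBlDl; apply: le_trans (ltW hu) _.
exact: mono.
Qed.

(** Both G and C G + f are monotone and bounded, hence convergent, and so is f. *)
Lemma ray_lipschitz_cvg (G f : R -> R) (C B : R) : 0 <= C ->
  (forall u v, 0 <= u -> u <= v -> G u <= G v) -> (forall u, 0 <= u -> G u <= B) ->
  (forall u v, 0 <= u -> u <= v -> `|f v - f u| <= C * (G v - G u)) ->
  exists l : R, f t @[t --> +oo] --> l.
Proof.
move=> C0 mono bd lip; have [g cg] := ray_monotone_cvg mono bd.
have [||k ck] := @ray_monotone_cvg (fun t => C * G t + f t) (C * B + `|f 0| + C * (B - G 0)).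
- move=> u v u0 uv; have := lip u v u0 uv; rewrite ler_norml => /andP[h _].
  by rewrite -subr_ge0 opprD addrACA -mulrBr -lerBlDl sub0r.
- move=> u u0; rewrite -addrA lerD ?ler_wpM2l ?bd//.
  rewrite -[f u](subrKC (f 0)) lerD ?ler_norm//.
  apply: le_trans (le_trans (ler_norm _) (lip 0 u (lexx _) u0)) _.
  by rewrite ler_wpM2l// lerD2r bd.
exists (k - C * g).
have e : f = fun t => (C * G t + f t) - C * G t by apply/funext => t; rewrite addrAC subrr add0r.
by rewrite e; apply: cvgB => //; apply: cvgM => //; exact: cvg_cst.
Qed.

End MonotoneLimits.

Section Extension.
Context {R : realType} {m : nat}.
Local Notation X := 'rV[R]_(1 + hdim m).
Variables (A p : 'I_(hdim m) -> R) (Ga : set 'rV[R]_(hdim m)) (ep : R).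
Hypotheses (A0 : forall a, 0 < A a) (dG : discrete_subgroup Ga).
Hypotheses (p0 : p 0 = 1) (ph : forall i, i != 0 -> p i = 0).
Hypothesis ep2 : ep ^+ 2 = 1.
Local Notation M := (spacetime Ga).
Local Notation ix := (@ix m).
Local Notation iy := (@iy m).

Definition eb : R := ep * A 0 / 2.
Local Notation b := eb.
Local Notation ax := (fun r => A (ix r)).
Local Notation ay := (fun r => A (iy r)).
Local Notation kq := (kq b ax ay).
Local Notation FF := (FF b ax ay).
Local Notation PP := (PP b ax ay).
Local Notation cc := (cc b ax ay).
Local Notation hbil := (hbil b ax ay).
Local Notation hform := (hform b ax ay).

Definition ext_metric : bfield M := fun _ x => hform x.

Lemma ep_neq0 : ep != 0. Proof. by rewrite -sqrf_eq0 ep2 oner_eq0. Qed.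
Lemma eb_neq0 : b != 0.
Proof. by rewrite /eb !mulf_neq0 ?ep_neq0 ?invr_eq0 ?pnatr_eq0// gt_eqF. Qed.
Lemma eb_sqr : 4 * b ^+ 2 = A 0 ^+ 2.
Proof. by rewrite /eb !exprMn ep2; field. Qed.
Lemma ax_neq0 r : ax r != 0. Proof. by rewrite gt_eqF. Qed.
Lemma ay_neq0 r : ay r != 0. Proof. by rewrite gt_eqF. Qed.

Definition PPpoly : {poly R} := \prod_r (1 + (kq r)%:P * 'X^2).

Lemma PPpolyE s : PPpoly.[s] = PP s.
Proof. by rewrite horner_prod; apply: eq_bigr => r _; rewrite /FF !hornerE. Qed.

(* psi' = - PP(e^{2 tau}) / (2 b) makes the image metric vanish on the pairs
   of the normal of the slices with the fibres. *)
Definition g1 : nat -> R -> R := expsum 2 (fun i => (i == 1%N)%:R) (-1).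
Definition psi : nat -> R -> R :=
  expsum (size PPpoly) (fun i => - (2 * b)^-1 * (PPpoly`_i / (2 * i%:R))) (- (2 * b)^-1).

Lemma g1E t : g1 0 t = expR (2 * t) - t.
Proof.
rewrite /g1 /expsum big_ord_recl big_ord1 /= /bump /= !expr0 mul0r mul0r mulr1 mulr1; ring.
Qed.

Lemma dg1E t : g1 1 t = 2 * expR (2 * t) - 1.
Proof. rewrite /g1 /expsum big_ord_recl big_ord1 /= /bump /= !expr1 mulr1 mul0r mul0r; ring. Qed.

Lemma dpsiE t : psi 1 t = - (PP (expR (2 * t)) / (2 * b)).
Proof.
have b0 := eb_neq0; rewrite /psi /expsum /= -PPpolyE horner_coef.
have P0 : PPpoly`_0 = 1 by rewrite -horner_coef0 PPpolyE /PP big1// => r _; rewrite /FF; ring.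
have : (0 < size PPpoly)%N by rewrite lt0n size_poly_eq0; apply: contra_eq_neq P0 => ->; rewrite coef0 eq_sym oner_eq0.
case: (size PPpoly) => // n _.
rewrite [\sum_(i < n.+1) (_ * expR _)]big_ord_recl [\sum_(i < n.+1) (_ * _ ^+ _)]big_ord_recl.
rewrite /= P0 mulr0n !mulr0 ?expr1 ?mulr0 !mul0r add0r expr0 !mulr1 [(1 + _) / (2 * b)]mulrDl opprD; congr (_ + _).

  by rewrite mul1r.
rewrite mulr_suml -sumrN; apply: eq_bigr => i _.
rewrite /bump /= add1n ?expr1 -expRM_natl.
have -> : expR (2 * i.+1%:R * t) = expR (i.+1%:R * (2 * t)) by congr expR; ring.
by field; rewrite b0 nat1r pnatr_eq0.
Qed.

(** Adding e^{2 tau} - tau turns the time into s. As identity plus a vertical shift depending on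
    time only, the map commutes with left translations and descends to every quotient. *)
Definition phi (x : X) : X := x + (g1 0 (vs x) *: es + psi 0 (vs x) *: ea 0).
Definition dphi (x v : X) : X := v + ((vs v * g1 1 (vs x)) *: es + (vs v * psi 1 (vs x)) *: ea 0).

Lemma g1_derivs : derivs g1. Proof. exact: derivs_expsum. Qed.
Lemma psi_derivs : derivs psi. Proof. exact: derivs_expsum. Qed.

Lemma vs_phi x : vs (phi x) = expR (2 * vs x).
Proof. by rewrite /phi vsD vs_vert g1E; ring. Qed.

Lemma phi_continuous : continuous phi.
Proof.
move=> x; apply: (@continuousD R X X id _ x); first exact: cvg_id.
apply: (@continuousD R X X (fun y : X => g1 0 (vs y) *: es) (fun y : X => psi 0 (vs y) *: ea 0) x).
  by have := @continuous_warp R m (g1 0%N) es (@derivs_continuous R g1 0%N g1_derivs) x.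
by have := @continuous_warp R m (psi 0%N) (ea 0) (@derivs_continuous R psi 0%N psi_derivs) x.
Qed.

Lemma is_derive_phi x v : is_derive x v phi (dphi x v).
Proof.
exact: (is_deriveD (is_derive_id x v) (is_deriveD (is_derive_warp v es (g1_derivs 0 (vs x))) (is_derive_warp v (ea 0) (psi_derivs 0 (vs x))))).
Qed.

Lemma dphi_continuous v : continuous (dphi^~ v).
Proof.
move=> x; apply: (@continuousD R X X (fun=> v) _ x (@cst_continuous _ _ _ _)).
have c n g (dg : derivs g) : continuous (fun t => vs v * g n t).
  by move=> t; apply: cvgM; [exact: cvg_cst|exact: derivs_continuous].
apply: (@continuousD R X X (fun y : X => (vs v * g1 1 (vs y)) *: es) (fun y : X => (vs v * psi 1 (vs y)) *: ea 0) x).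
  exact: (@continuous_warp R m (fun t => vs v * g1 1 t) es (c 1%N _ g1_derivs) x).
exact: (@continuous_warp R m (fun t => vs v * psi 1 t) (ea 0) (c 1%N _ psi_derivs) x).
Qed.

Lemma phi_ltrans k x : phi (ltrans k x) = ltrans k (phi x).
Proof. by rewrite /phi ltrans_shift vs_ltrans. Qed.

Lemma ltrans_phi_smooth k : smooth_on setT (fun y => ltrans k (phi y)).
Proof.
rewrite (_ : (fun y => _) = fun y => ltrans k y + (g1 0 (vs y) *: es + psi 0 (vs y) *: ea 0)).
  apply: (@smooth_warp R m (ltrans k) (dltrans k) g1 psi); last 2 first.
  - exact: g1_derivs.
  - exact: psi_derivs.
  - exact: ltrans_continuous.
  - by move=> x v; apply: is_derive_ltrans; exact: is_derive_id.
by apply/funext => y; rewrite ltrans_shift.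
Qed.

(** An arbitrary representative is used; [phi_ltrans] makes the result independent of it, see
    [io_stproj]. *)
Definition io (q : M) : M := stproj Ga (phi (xget 0 [set x | stproj Ga x = q])).

Lemma io_stproj x : io (stproj Ga x) = stproj Ga (phi x).
Proof.
have : stproj Ga (xget 0 [set y | stproj Ga y = stproj Ga x]) = stproj Ga x.
  by apply: (@xgetPex _ 0 [set y | stproj Ga y = stproj Ga x]); exists x.
rewrite /io; set y := xget _ _ => /esym/(stproj_eqP dG)[_ [ga Gga ->]].
by rewrite phi_ltrans stproj_ltrans.
Qed.

Lemma phi_inj : injective phi.
Proof.
move=> x y e; have := congr1 (@vs R m) e; rewrite !vs_phi => /expR_inj h.
have vxy : vs x = vs y by lra.
by move: e; rewrite /phi vxy => /addIr.
Qed.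

Definition pinv (y : X) : X :=
  y - ((vs y - ln (vs y) / 2) *: es + psi 0 (ln (vs y) / 2) *: ea 0).

Lemma pinvK y : 0 < vs y -> phi (pinv y) = y.
Proof.
move=> y0.
have e : vs (pinv y) = ln (vs y) / 2.
  by rewrite /pinv addrC -scaleN1r vs_lin vs_vert; ring.
have e2 : expR (2 * (ln (vs y) / 2)) = vs y by rewrite mulrC divfK// lnK// posrE.
by rewrite /phi e g1E e2 /pinv subrK.
Qed.

Lemma phiK x : pinv (phi x) = x.
Proof. by apply: phi_inj; rewrite pinvK// vs_phi expR_gt0. Qed.

Lemma pinv_continuous y : 0 < vs y -> {for y, continuous pinv}.
Proof.
move=> y0; have cl : {for vs y, continuous (fun s : R => ln s / 2)}.
  by apply: cvgM; [exact: continuous_ln|exact: cvg_cst].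
apply: (@continuousB R X X id _ y); first exact: cvg_id.
apply: (@continuousD R X X (fun y : X => (vs y - ln (vs y) / 2) *: es) (fun y : X => psi 0 (ln (vs y) / 2) *: ea 0) y).
  by apply: (@continuous_warp_at R m (fun s => s - ln s / 2) es y); apply: cvgB; [exact: cvg_id|exact: cl].
apply: (@continuous_warp_at R m (fun s => psi 0%N (ln s / 2)) (ea 0) y).
by apply: (@continuous_comp _ _ _ (fun s : R => ln s / 2) (psi 0%N)); [exact: cl|exact: derivs_continuous psi_derivs _].
Qed.

Lemma phi_open (U : set X) : open U -> open (phi @` U).
Proof.
move=> oU; rewrite openE => _ [x Ux <-]; rewrite /interior.
have p1 : 0 < vs (phi x) by rewrite vs_phi expR_gt0.
have n1 : nbhs (phi x) (pinv @^-1` U).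
  by apply: (continuous_nbhs (pinv_continuous p1) oU); rewrite phiK.
have n2 : nbhs (phi x) [set y : X | 0 < vs y].
  by apply: (continuous_nbhs (@time_continuous R m (phi x)) (@open_gt R 0)).
by apply: filterS2 n1 n2 => y Uy y0; exists (pinv y) => //; exact: pinvK.
Qed.

Lemma hbil_phi x v : hbil (phi x) (dphi x v) (dphi x v) =
  cc (expR (2 * vs x)) * wz x v ^+ 2 - expR (2 * vs x) * PP (expR (2 * vs x)) * vs v ^+ 2
  + \sum_r FF r (expR (2 * vs x)) * (A (ix r) ^+ 2 * vx r v ^+ 2 + A (iy r) ^+ 2 * vy r v ^+ 2).
Proof.
have b0 := eb_neq0; set s := expR (2 * vs x).
have P0 : PP s != 0 by rewrite gt_eqF// PP_gt0.
have e1 : vs (dphi x v) = 2 * s * vs v.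
  by rewrite /dphi vsD vs_vert dg1E /s; ring.
have e2 r : vx r (dphi x v) = vx r v by rewrite /dphi vxD vx_vert addr0.
have e3 r : vy r (dphi x v) = vy r v by rewrite /dphi vyD vy_vert addr0.
have xp r : vx r (phi x) = vx r x by rewrite /phi vxD vx_vert addr0.
have e4 : wz (phi x) (dphi x v) = wz x v - PP s / (2 * b) * vs v.
  have -> : wz (phi x) (dphi x v) = wz x (dphi x v) by rewrite !wzE; under eq_bigr do rewrite xp.
  by rewrite /dphi wzD wz_vert dpsiE -/s; ring.
rewrite /hbil e1 e4 vs_phi -/s /cc; under eq_bigr do rewrite e2 e3 -!expr2.
by congr (_ + _); field; rewrite b0 P0.
Qed.

Lemma chi_two r : chi p r = 2.
Proof. by rewrite /chi p0 !ph ?ix_neq0 ?iy_neq0//; ring. Qed.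

Lemma Fr_FF r t : Fr A p r t = FF r (expR (2 * t)).
Proof.
rewrite /Fr chi_two /FF /kq /kappa (_ : expR (2 * 2 * t) = expR (2 * t) ^+ 2); last first.
  by rewrite -expRM_natl; congr expR; ring.
rewrite (_ : b ^+ 2 = A 0 ^+ 2 / 4); last by rewrite -eb_sqr; field.
by field; rewrite !gt_eqF.
Qed.

Lemma lapse_sqr t : lapse A p t ^+ 2 = expR (2 * t) * PP (expR (2 * t)).
Proof.
rewrite /lapse exprMn -expRM_natl /PP; congr (_ * _).
rewrite -prodrXl; apply: eq_bigr => r _; rewrite Fr_FF sqr_sqrtr// ltW// FF_gt0//.
Qed.

Lemma scale0_sqr t : scale A p 0 t ^+ 2 = cc (expR (2 * t)).
Proof.
rewrite /scale eqxx p0 mul1r !exprMn -expRM_natl /cc eb_sqr; congr (_ * _).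
rewrite -prodrXl /PP -prodfV; apply: eq_bigr => r _.
by rewrite Fr_FF exprVn sqr_sqrtr// ltW// FF_gt0.
Qed.

Lemma scale_ix_sqr r t : scale A p (ix r) t ^+ 2 = A (ix r) ^+ 2 * FF r (expR (2 * t)).
Proof.
rewrite /scale ix_neq0 ph ?ix_neq0// mul0r expR0 mulr1 exprMn (big_pred1 r) => [|i].
  by rewrite Fr_FF sqr_sqrtr// ltW// FF_gt0.
by rewrite /= (inj_eq (@ix_inj m)) ix_neq_iy orbF eq_sym.
Qed.

Lemma scale_iy_sqr r t : scale A p (iy r) t ^+ 2 = A (iy r) ^+ 2 * FF r (expR (2 * t)).
Proof.
rewrite /scale iy_neq0 ph ?iy_neq0// mul0r expR0 mulr1 exprMn (big_pred1 r) => [|i].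
  by rewrite Fr_FF sqr_sqrtr// ltW// FF_gt0.
by rewrite /= (inj_eq (@iy_inj m)) [iy r == ix i]eq_sym ix_neq_iy eq_sym.
Qed.

Lemma qform_phi x v : qform (family_form A p x) v = hbil (phi x) (dphi x v) (dphi x v).
Proof.
have N0 t : 0 < lapse A p t by exact: lapse_gt0.
rewrite qform_family// hbil_phi mulrBr mulr_sumr.
have sq a : lapse A p (vs x) ^+ 2 * (ratio A p a (vs x) * cow (rsubmx x) (rsubmx v) a) ^+ 2 =
    scale A p a (vs x) ^+ 2 * cow (rsubmx x) (rsubmx v) a ^+ 2.
  by rewrite /ratio; field; rewrite gt_eqF.
rewrite -/(vs x) -/(vs v); under eq_bigr do rewrite sq.
rewrite sum_hindex scale0_sqr -/(wz x v) lapse_sqr addrAC; congr (_ + _).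
apply: eq_bigr => r _; rewrite scale_ix_sqr scale_iy_sqr !cow_neq0 ?ix_neq0 ?iy_neq0//.
by rewrite -/(vx r v) -/(vy r v); ring.
Qed.

Lemma family_sym x : (family_form A p x)^T = family_form A p x.
Proof. by rewrite /family_form tr_block_mx !trmx0 tr_scalar_mx !trmx_mul trmxK tr_diag_mx mulmxA. Qed.

Lemma sandwich_sym n (G J : 'M[R]_n) : G^T = G -> (J *m G *m J^T)^T = J *m G *m J^T.
Proof. by move=> s; rewrite !trmx_mul trmxK s mulmxA. Qed.

Lemma qform_sandwich n (G J : 'M[R]_n) v : qform (J *m G *m J^T) v = qform G (v *m J).
Proof. by rewrite /qform trmx_mul !mulmxA. Qed.

Lemma ext_lorentz : lorentz_metric ext_metric.
Proof.
split=> [c x _ _|c c' ac ac' x Dx]; first exact: (hform_lorentz eb_neq0 ax_neq0 ay_neq0).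
have [ga [Gga _ e J]] := @jacobian_lift R m Ga dG id id (fun x => @cvg_id _ _) (fun=> erefl) (fun _ v => v) c c' x
  (fun y v => is_derive_id y v) (fun v => @cst_continuous _ _ _) ac ac' Dx.
rewrite /ext_metric; apply: quadratic_ext; [exact: hform_sym|apply: sandwich_sym; exact: hform_sym|] => v.
by rewrite qform_sandwich J e /qform /ext_metric !hformE hbil_ltrans.
Qed.

Lemma one_sided : one_sided_extension (family_metric A p Ga) ext_metric io.
Proof.
split.
- split; first exact: ext_lorentz.
  by move=> c _ x _ i j; exact: hform_analytic.
- split.
  + apply: (smooth_map_lift dG phi_continuous io_stproj); exact: ltrans_phi_smooth.
  + move=> q q'; have [x <-] := stproj_surj q; have [x' <-] := stproj_surj q'.
    rewrite !io_stproj => /(stproj_eqP dG)[_ [ga Gga]]; rewrite -phi_ltrans => /phi_inj ->.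
    by rewrite stproj_ltrans.
  + move=> U oU; rewrite (_ : io @` U = stproj Ga @` (phi @` (stproj Ga @^-1` U))).
      apply: (stproj_open dG); apply: phi_open.
      by apply: open_comp oU => x _; exact: stproj_continuous.
    apply/seteqP; split=> [_ [q Uq <-]|_ [_ [x Ux <-] <-]].
      have [x e] := stproj_surj q; exists (phi x); last by rewrite -e io_stproj.
      by exists x => //; rewrite /preimage /= e.
    by exists (stproj Ga x) => //; rewrite io_stproj.
  + move=> c c' ac ac' x Dx.
    have [ga [Gga _ e J]] := jacobian_lift dG phi_continuous io_stproj is_derive_phi dphi_continuous ac ac' Dx.
    rewrite /ext_metric /family_metric; apply: quadratic_ext; [exact: family_sym|apply: sandwich_sym; exact: hform_sym|] => v.
    by rewrite qform_sandwich J e {2}/qform /ext_metric !hformE hbil_ltrans; exact: qform_phi.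
- apply/seteqP; split=> [_ [q _ <-]|q].
    have [x <-] := stproj_surj q; rewrite io_stproj stprojE /= -/(vs (phi x)) vs_phi; exact: expR_gt0.
  have [y <-] := stproj_surj q; rewrite stprojE /= => y0.
  by exists (stproj Ga (pinv y)) => //; rewrite io_stproj pinvK// stprojE.
- move=> q; have [x <-] := stproj_surj q.
  by rewrite io_stproj !stprojE /= -/(vs (phi x)) vs_phi.
Qed.

Lemma ext_ricci_flat : ricci_flat ext_metric.
Proof. by move=> c _ x _ i j; exact: (ricci_hform eb_neq0 ax_neq0 ay_neq0). Qed.

(** * Causality of the extended spacetime *)

Hypothesis m0 : (0 < m)%N.
Local Notation h := ext_metric.

Lemma b_ne0 : b != 0. Proof. exact: eb_neq0. Qed.

Lemma kq_gt0 r : 0 < kq r.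
Proof.
by apply: divr_gt0; [rewrite lt_def sqr_ge0 sqrf_eq0 b_ne0|rewrite !mulr_gt0// exprn_gt0].
Qed.

Lemma FF_ge1 r s : 1 <= FF r s.
Proof. by rewrite lerDl mulr_ge0 ?sqr_ge0// ltW// kq_gt0. Qed.

Lemma prod_ge1 (I : finType) (Q : pred I) (f : I -> R) : (forall i, 1 <= f i) -> 1 <= \prod_(i | Q i) f i.
Proof.
move=> f1; elim/big_ind : _ => // x y x1 y1.
by rewrite -[leLHS]mulr1 ler_pM.
Qed.

Lemma cc_sign s : (0 < s -> 0 < cc s) /\ (s <= 0 -> cc s <= 0).
Proof.
have P0 := PP_gt0 b ax ay s.
have b2 : 0 < 4 * b ^+ 2 by rewrite mulr_gt0// lt_def sqr_ge0 sqrf_eq0 b_ne0.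
split=> hs; first by rewrite divr_gt0// mulr_gt0.
by rewrite pmulr_lle0 ?invr_gt0// pmulr_rle0.
Qed.

Lemma cc0 : cc 0 = 0. Proof. by rewrite /cc mulr0 mul0r. Qed.

(** [cc] is bounded above: it is nonpositive for s <= 0, and P >= 1 + kq s^2 makes s / P bounded.
    The bound makes [time_vec] timelike everywhere and the coefficient of w^0 in [hbil_T]
    one-signed. *)
Lemma T_exists : exists V, forall s, 2 * cc s < A 0 * V.
Proof.
pose r0 := Ordinal m0; pose C := 1 + (kq r0)^-1.
have k0 := kq_gt0 r0; have C1 : 1 <= C by rewrite lerDl invr_ge0 ltW.
have b2 : 0 < 4 * b ^+ 2 by rewrite mulr_gt0// lt_def sqr_ge0 sqrf_eq0 b_ne0.
have bd s : cc s <= 4 * b ^+ 2 * C.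
  case: (leP s 0) => hs; first by apply: le_trans (proj2 (cc_sign s) hs) _; rewrite mulr_ge0 ?ltW// (lt_le_trans ltr01).
  rewrite /cc -mulrA ler_pM2l// ler_pdivrMr ?PP_gt0//.
  apply: (@le_trans _ _ (C * FF r0 s)); last first.
    rewrite ler_wpM2l ?(le_trans ler01)// /PP (bigD1 r0)//= ler_peMr// ?(le_trans ler01 (FF_ge1 _ _))//.
    by apply: prod_ge1 => r; exact: FF_ge1.
  rewrite /FF /C; case: (leP s 1) => s1.
    apply: (le_trans s1); rewrite -[leLHS]mulr1 ler_pM// ?FF_ge1//.
  have e : (1 + (kq r0)^-1) * (1 + kq r0 * s ^+ 2) = s ^+ 2 + (1 + (kq r0)^-1 + kq r0 * s ^+ 2).
    by field; rewrite gt_eqF.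
  have z1 : 0 <= kq r0 * s ^+ 2 by exact: mulr_ge0 (ltW k0) (sqr_ge0 s).
  have z2 : 0 <= (kq r0)^-1 by rewrite invr_ge0; exact: ltW.
  have z3 : s <= s ^+ 2 by rewrite expr2 ler_peMr// ltW.
  rewrite e; apply: (le_trans z3); rewrite lerDl; apply: addr_ge0 => //; exact: addr_ge0.
exists ((2 * (4 * b ^+ 2 * C) + 1) / A 0) => s.
by rewrite [A 0 * _]mulrC divfK ?gt_eqF// ltr_pwDr// ler_pM2l.
Qed.

Variable V : R.
Hypothesis hV : forall s, 2 * cc s < A 0 * V.

Definition time_vec : X := V *: es + (- ep) *: ea 0.
Definition time_field : vfield M := fun _ _ => time_vec.

Definition causal_vec (x v : X) : Prop := [/\ v <> 0, hbil x v v <= 0 & hbil x v time_vec < 0].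

Lemma V_gt0 : 0 < V.
Proof. by have := hV 0; rewrite cc0 mulr0 pmulr_rgt0. Qed.

(** Normalises the sign of w^0, so both extensions are treated by the same formulas. *)
Definition fiber_om (x v : X) : R := ep * wz x v.
Definition energy (x v : X) : R := \sum_r FF r (vs x) * (ax r ^+ 2 * vx r v ^+ 2 + ay r ^+ 2 * vy r v ^+ 2).

Lemma hbil_om x v : hbil x v v = A 0 * (vs v * fiber_om x v) + cc (vs x) * fiber_om x v ^+ 2 + energy x v.
Proof.
rewrite /hbil /energy /fiber_om exprMn ep2; under eq_bigr do rewrite -!expr2.
by rewrite /eb; congr (_ + _); field.
Qed.

Lemma hbil_T x v : hbil x v time_vec = - (A 0 / 2 * vs v) + (A 0 * V / 2 - cc (vs x)) * fiber_om x v.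
Proof.
rewrite /hbil /time_vec vs_vert wz_vert big1 ?addr0 => [|r _]; last by rewrite vx_vert vy_vert; ring.
transitivity (- (ep ^+ 2 * (A 0 / 2 * vs v)) + (A 0 * V / 2 - cc (vs x)) * fiber_om x v); last by rewrite ep2 mul1r.
by rewrite /fiber_om /eb; field.
Qed.

Lemma energy_ge0 x v : 0 <= energy x v.
Proof.
apply: sumr_ge0 => r _; rewrite mulr_ge0 ?(le_trans ler01 (FF_ge1 _ _))//.
by rewrite addr_ge0// mulr_ge0 ?sqr_ge0.
Qed.

(** For s >= 0 all terms of the norm except ds w^0 are nonnegative. If ds were negative, causality
    would force [fiber_om] >= 0, and then v would not be future pointing. *)
Lemma fcausal_time x v : 0 <= vs x -> causal_vec x v -> 0 <= vs v.
Proof.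
move=> x0 [_ h1 h2]; rewrite leNgt; apply/negP => v0.
move: h1 h2; rewrite hbil_om hbil_T => h1 h2.
have E0 := energy_ge0 x v; have c0 : 0 <= cc (vs x).
  by move: x0; rewrite le_eqVlt => /orP[/eqP <-|/(proj1 (cc_sign _))/ltW//]; rewrite cc0.
have o0 : 0 <= fiber_om x v.
  have neg : A 0 * vs v < 0 by rewrite pmulr_rlt0.
  rewrite -(nmulr_rle0 _ neg).
  rewrite -mulrA; apply: le_trans h1; rewrite -addrA lerDl; apply: addr_ge0 => //; exact: mulr_ge0 c0 (sqr_ge0 _).
have : 0 <= - (A 0 / 2 * vs v) + (A 0 * V / 2 - cc (vs x)) * fiber_om x v.
  apply: addr_ge0; first by rewrite oppr_ge0 pmulr_rle0 ?divr_gt0// ltW.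
  by apply: (mulr_ge0 _ o0); rewrite subr_ge0 ler_pdivlMr// mulrC; exact: ltW.
by rewrite leNgt h2.
Qed.

(** Away from s = 0 the coefficient [cc] is bounded below, so the causal condition bounds first w^0
    and then the horizontal components by ds. *)
Lemma fcausal_bound s1 s0 : 0 < s1 -> s1 <= s0 -> exists2 C, 0 <= C & forall x v, s1 <= vs x <= s0 -> causal_vec x v ->
  `|wz x v| <= C * vs v /\ forall r, `|vx r v| <= C * vs v /\ `|vy r v| <= C * vs v.
Proof.
move=> s10 s10'.
have b2 : 0 < 4 * b ^+ 2 by rewrite mulr_gt0// lt_def sqr_ge0 sqrf_eq0 b_ne0.
pose cm := 4 * b ^+ 2 * s1 / PP s0.
have cm0 : 0 < cm by rewrite divr_gt0 ?PP_gt0// mulr_gt0.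
pose K := A 0 ^+ 2 / cm; have K0 : 0 < K by rewrite divr_gt0// exprn_gt0.
pose C := 1 + A 0 / cm + \sum_r (K / ax r ^+ 2 + K / ay r ^+ 2).
have S0 : 0 <= \sum_r (K / ax r ^+ 2 + K / ay r ^+ 2).
  by apply: sumr_ge0 => r _; rewrite addr_ge0// divr_ge0 ?sqr_ge0// ltW.
have A1 : 0 <= A 0 / cm by apply: divr_ge0; apply: ltW.
have C1 : 1 <= C by rewrite /C -addrA lerDl addr_ge0.
have C0 : 0 <= C by apply: le_trans C1.
exists C => // x v /andP[h1 h2] fc; have [_ q1 _] := fc.
have x0 : 0 < vs x by apply: lt_le_trans h1.
have v0 := fcausal_time (ltW x0) fc.
have cx : cm <= cc (vs x).
  have iP : (PP s0)^-1 <= (PP (vs x))^-1.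
    rewrite lef_pV2 ?posrE ?PP_gt0//; apply: ler_prod => r _; apply/andP; split.
      exact: le_trans ler01 (FF_ge1 _ _).
    rewrite lerD2l ler_pM2l ?kq_gt0// lerXn2r ?nnegrE ?(ltW x0)//.
    by apply: ltW; apply: lt_le_trans s10 s10'.
  rewrite /cm /cc -[leLHS]mulrA -[leRHS]mulrA ler_pM2l//; apply: ler_pM; [exact: ltW| |exact: h1|exact: iP].
  by rewrite invr_ge0; exact: ltW (PP_gt0 _ _ _ _).
move: q1; rewrite hbil_om => q1; set o := fiber_om x v in q1; have E0 := energy_ge0 x v.
have q2 : cc (vs x) * o ^+ 2 + energy x v <= A 0 * vs v * `|o|.
  have : - (vs v * o) <= vs v * `|o| by rewrite -mulrN ler_wpM2l// -normrN ler_norm.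
  by rewrite -(ler_pM2l (A0 0)) => hh; rewrite -mulrA; lra.
have ob : `|o| <= A 0 / cm * vs v.
  have [->|o0] := eqVneq o 0; first by rewrite normr0 mulr_ge0.
  have no : 0 < `|o| by rewrite normr_gt0.
  rewrite mulrAC ler_pdivlMr// -(ler_pM2r no); apply: le_trans q2.
  have e : o ^+ 2 = `|o| * `|o| by rewrite -expr2 real_normK ?num_real.
  apply: (@le_trans _ _ (cc (vs x) * o ^+ 2)); last by rewrite lerDl.
  by rewrite e mulrAC [leLHS]mulrC ler_wpM2r ?mulr_ge0.
have Eb : energy x v <= K * vs v ^+ 2.
  apply: (@le_trans _ _ (A 0 * vs v * (A 0 / cm * vs v))).
    have : A 0 * vs v * `|o| <= A 0 * vs v * (A 0 / cm * vs v) by rewrite ler_wpM2l// mulr_ge0// ltW.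
    apply: le_trans; apply: le_trans q2; rewrite lerDr mulr_ge0 ?sqr_ge0//.
    exact: le_trans (ltW cm0) cx.
  by rewrite le_eqVlt; apply/orP; left; apply/eqP; rewrite /K; field; rewrite gt_eqF.
have sq a D : 0 < a -> K / a ^+ 2 <= C -> a ^+ 2 * D ^+ 2 <= K * vs v ^+ 2 -> `|D| <= C * vs v.
  move=> a0 aC aD; rewrite -ler_sqr ?nnegrE ?mulr_ge0// real_normK ?num_real//.
  apply: (@le_trans _ _ (C * vs v ^+ 2)).
    apply: (@le_trans _ _ (K / a ^+ 2 * vs v ^+ 2)); last by rewrite ler_wpM2r ?sqr_ge0.
    by rewrite mulrAC ler_pdivlMr ?exprn_gt0// mulrC.
  by rewrite exprMn ler_wpM2r ?sqr_ge0// expr2 ler_peMl.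
have En r : ax r ^+ 2 * vx r v ^+ 2 <= energy x v /\ ay r ^+ 2 * vy r v ^+ 2 <= energy x v.
  have z1 : 0 <= ax r ^+ 2 * vx r v ^+ 2 by rewrite mulr_ge0 ?sqr_ge0.
  have z2 : 0 <= ay r ^+ 2 * vy r v ^+ 2 by rewrite mulr_ge0 ?sqr_ge0.
  have : ax r ^+ 2 * vx r v ^+ 2 + ay r ^+ 2 * vy r v ^+ 2 <= energy x v.
    rewrite /energy (bigD1 r)//=; apply: ler_wpDr.
      apply: sumr_ge0 => q _; rewrite mulr_ge0 ?(le_trans ler01 (FF_ge1 _ _))//.
      by rewrite addr_ge0// mulr_ge0 ?sqr_ge0.
    by rewrite ler_peMl ?FF_ge1// addr_ge0.
  by move=> hh; split; apply: le_trans hh; rewrite ?lerDl ?lerDr.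
have Cr r : K / ax r ^+ 2 <= C /\ K / ay r ^+ 2 <= C.
  have z1 : 0 <= K / ax r ^+ 2 by rewrite divr_ge0 ?sqr_ge0 ?ltW.
  have z2 : 0 <= K / ay r ^+ 2 by rewrite divr_ge0 ?sqr_ge0 ?ltW.
  have : K / ax r ^+ 2 + K / ay r ^+ 2 <= C.
    rewrite /C (bigD1 r)//= addrCA lerDl addr_ge0 ?addr_ge0//.
    by apply: sumr_ge0 => q _; rewrite addr_ge0// divr_ge0 ?sqr_ge0// ltW.
  by move=> hh; split; apply: le_trans hh; rewrite ?lerDl ?lerDr.
split.
  have <- : `|o| = `|wz x v|.
    have e1 : `|ep| = 1 by apply/eqP; rewrite -(@eqrXn2 _ 2)// ?real_normK ?num_real// ep2 expr1n.
    by rewrite /o /fiber_om normrM e1 mul1r.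
  apply: le_trans ob _; rewrite ler_wpM2r// /C -addrA addrCA lerDl addr_ge0//.
move=> r; have [E1 E2] := En r; have [D1 D2] := Cr r.
by split; [apply: (sq (ax r))|apply: (sq (ay r))] => //; [apply: le_trans E1 Eb|apply: le_trans E2 Eb].
Qed.

Lemma future_timelike_vec (c : chart R (1 + hdim m) M) x v : future_timelike h time_field c x v -> causal_vec x v.
Proof.
rewrite /future_timelike /ext_metric /time_field !hformE => -[h1 h2]; split; [|exact: ltW|exact: h2].
move=> v0; move: h1; rewrite v0.
by have := hbil_lin b ax ay x (-1) 0 0 0; rewrite scaler0 addr0 => e; rewrite (_ : hbil x 0 0 = 0) ?ltxx//; lra.
Qed.

Section AlongCurve.
Variable P : chart R (1 + hdim m) M -> X -> X -> Prop.
Hypothesis hP : forall c x v, P c x v -> causal_vec x v.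
Variables (ga : R -> M) (B : R) (k : R -> X).
Hypotheses (pw : piecewise P ga 0 B) (ck : continuous k).
Hypothesis kga : forall u, 0 <= u <= B -> stproj Ga (k u) = ga u.

Let vk_continuous : continuous (fun u => vs (k u)).
Proof. by move=> u; apply: (@continuous_comp _ _ _ k (fun x : X => vs x)); [exact: ck|exact: time_continuous]. Qed.

Let vk_mono u v : 0 <= u -> u <= v -> v <= B -> (forall t, u < t < v -> 0 <= vs (k t)) -> vs (k u) <= vs (k v).
Proof.
move=> u0 uv vB H; apply: (piecewise_le dG pw ck kga vk_continuous u0 uv vB) => t w c tuv dw ac Pc.
exists (vs w); first exact: (is_derive_coord 0 0 dw).
by apply: fcausal_time (hP Pc); exact: H.
Qed.

(** The bound on velocities holds only where s >= 0, so staying there and being monotone are proved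
    together by the continuity method. *)
Lemma causal_time_ge u : 0 < vs (k 0) -> 0 <= u <= B -> vs (k 0) <= vs (k u).
Proof.
move=> k0; apply: (@real_induction R 0 B (fun u => vs (k 0) <= vs (k u))) => t /andP[t0 tB] IH.
have ht : vs (k 0) <= vs (k t).
  apply: vk_mono => // s /andP[s0 st]; apply: le_trans (ltW k0) (IH s _); by rewrite ltW.
have kt : 0 < vs (k t) by apply: lt_le_trans ht.
have n1 : nbhs t (fun u => 0 < vs (k u)).
  have /cvgrPdist_lt/(_ _ kt) := @vk_continuous t; apply: filterS => w.
  by rewrite ltr_norml => /andP[_]; rewrite ltrBlDl ltrDr.
have [d d0 Hd] := nbhs_distP n1; exists d => // v /andP[v0 vB] vd.
case: (ltP v t) => vt; first by apply: IH; rewrite v0.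
apply: vk_mono => // s /andP[s0 sv]; case: (ltP s t) => st.
  by apply: le_trans (ltW k0) (IH s _); rewrite st ltW.
apply: ltW; apply: Hd; rewrite distrC ger0_norm ?subr_ge0// ltrBlDl; exact: lt_trans sv vd.
Qed.

Lemma causal_time_le u v : 0 < vs (k 0) -> 0 <= u -> u <= v -> v <= B -> vs (k u) <= vs (k v).
Proof.
move=> k0 u0 uv vB; apply: vk_mono => // t /andP[ut tv].
apply: le_trans (ltW k0) (causal_time_ge k0 _).
by rewrite (le_trans u0 (ltW ut)) (le_trans (ltW tv) vB).
Qed.

Lemma causal_lipschitz (f : R -> R) C : 0 < vs (k 0) -> continuous f ->
  (forall t w, 0 < t < B -> is_derive t 1 k w -> causal_vec (k t) w -> exists2 d, is_derive t 1 f d & `|d| <= C * vs w) ->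
  forall u v, 0 <= u -> u <= v -> v <= B -> `|f v - f u| <= C * (vs (k v) - vs (k u)).
Proof.
move=> k0 cf H u v u0 uv vB.
have D (sg : R) : `|sg| = 1 -> C * vs (k u) + sg * f u <= C * vs (k v) + sg * f v.
  move=> sg1; apply: (piecewise_le (G := fun t => C * vs (k t) + sg * f t) dG pw ck kga _ u0 uv vB).
    by move=> t; apply: cvgD; apply: cvgM; try exact: cvg_cst; [exact: vk_continuous|exact: cf].
  move=> t w c /andP[ut tv] dw ac Pc.
  have [|d df dle] := H t w _ dw (hP Pc); first by rewrite (le_lt_trans u0 ut) (lt_le_trans tv vB).
  exists (C * vs w + sg * d).
    have e := is_deriveD (is_deriveM (is_derive_cst C t (1 : R)) (is_derive_coord 0 0 dw)) (is_deriveM (is_derive_cst sg t (1 : R)) df).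
    by apply: is_derive_eq e _; rewrite /GRing.scale /= /vs; ring.
  have : `|sg * d| <= C * vs w by rewrite normrM sg1 mul1r.
  by rewrite ler_norml => /andP[h1 _]; rewrite -lerBlDl sub0r.
have := D 1 (normr1 _); have := D (-1); rewrite normrN1 => /(_ erefl) h1 h2.
rewrite ler_norml; apply/andP; split; lra.
Qed.

End AlongCurve.

Section Lines.
Variables (x v : X).
Hypothesis hv : forall ga, dltrans ga v = v.

Let line (t : R) : M := stproj Ga (x + t *: v).

Lemma ltrans_line ga t : ltrans ga (x + t *: v) = ltrans ga x + t *: v.
Proof.
rewrite !ltransE -addrA; congr (_ + _); rewrite !dltransE.
have e : (\sum_r ga 0 (ix r) * vy r v) *: ea 0 = 0 :> X.
  by have := hv ga; rewrite dltransE => /(congr1 (fun w => w - v)); rewrite addrAC subrr add0r.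
have -> : \sum_r ga 0 (ix r) * vy r (x + t *: v) = t * (\sum_r ga 0 (ix r) * vy r v) + \sum_r ga 0 (ix r) * vy r x.
  by rewrite mulr_sumr -big_split /=; apply: eq_bigr => r _; rewrite [x + _]addrC vy_lin; ring.
by rewrite scalerDl -scalerA e scaler0 add0r addrAC.
Qed.

Lemma is_derive_line_point (y : X) (t w : R) : is_derive t w (fun u : R => y + u *: v) (w *: v).
Proof.
apply: is_derive_rV => i j.
rewrite (_ : (fun u : R => (y + u *: v) i j) = (cst (y i j) + (id : R -> R) * cst (v i j))).
  have e := is_deriveD (is_derive_cst (y i j) t w) (is_deriveM (is_derive_id t w) (is_derive_cst (v i j) t w)).
  by apply: is_derive_eq e _; rewrite !mxE /GRing.scale /=; ring.
by apply/funext => u; rewrite !mxE.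
Qed.

Lemma line_point_continuous (y : X) : continuous (fun u : R => y + u *: v).
Proof. by move=> t; exact: is_derive_continuous (is_derive_line_point y t 1). Qed.

Lemma line_coord (c : chart R (1 + hdim m) M) t : atlas M c -> cran c (line t) ->
  exists ga U, [/\ Ga ga, open U, U t & forall u, U u -> (Defs.coord c \o line) u = ltrans ga x + u *: v].
Proof.
move=> ac cr; have [ga [U [Gga oU Ut HU]]] := coord_lift dG (@line_point_continuous x) ac cr.
by exists ga, U; split=> // u /HU[_ e]; rewrite /= e ltrans_line.
Qed.

Lemma line_smooth : smooth_curve setT line.
Proof.
split=> [t _|c ac k].
  apply: (@continuous_comp _ _ _ (fun t : R => x + t *: v) (stproj Ga)); first exact: line_point_continuous.
  exact: stproj_continuous.
apply: Ck_on_near => t [_ cr]; have [ga [U [Gga oU Ut HU]]] := line_coord ac cr.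
exists U, (fun u => ltrans ga x + u *: v); split => //.
apply: (@Ck_on_sub R k R X setT) => //.
exact: (@smooth_affine R R X _ (fun w => w *: v) (@line_point_continuous _) (is_derive_line_point _) k).
Qed.

Lemma line_velocity P J : (forall c ga t, Ga ga -> J t -> P c (ltrans ga (x + t *: v)) v) -> velocity_cond P J line.
Proof.
move=> HP t Jt c ac cr; have [ga [U [Gga oU Ut HU]]] := line_coord ac cr.
have n : \forall u \near t, (Defs.coord c \o line) u = ltrans ga x + u *: v.
  by apply: filterS (open_nbhs_nbhs (conj oU Ut)).
have -> : Defs.coord c (line t) = ltrans ga (x + t *: v) by rewrite ltrans_line -(nbhs_singleton n).
rewrite derive1E (near_eq_derive (1 : R) n).
have [_ ->] := is_derive_line_point (ltrans ga x) t 1; rewrite scale1r; exact: HP.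
Qed.

Lemma line_piecewise P b' : 0 < b' -> (forall c ga t, Ga ga -> P c (ltrans ga (x + t *: v)) v) -> piecewise P line 0 b'.
Proof.
move=> b0 HP; exists 1%N, (fun i => if i is 0%N then 0 else b'); split=> // -[|//] _.
split=> //; exists line, setT; split=> //; [exact: openT|exact: line_smooth|].
by apply: line_velocity => c ga t Gga _; exact: HP.
Qed.

End Lines.

Lemma vertical_inv (a c : R) ga : dltrans ga (a *: es + c *: ea 0 : X) = a *: es + c *: ea 0.
Proof. exact: dltrans_vertical. Qed.

Lemma fcausal_ltrans ga x v : (forall ga, dltrans ga v = v) -> causal_vec x v -> causal_vec (ltrans ga x) v.
Proof.
move=> hv [v0 h1 h2]; split=> //; first by rewrite -(hv ga) hbil_ltrans.
by rewrite -(hv ga) -[time_vec](vertical_inv V (- ep) ga) hbil_ltrans.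
Qed.

Lemma future_causalE c x v : future_causal h time_field c x v <-> causal_vec x v.
Proof. by rewrite /future_causal /ext_metric /time_field !hformE. Qed.

Lemma future_timelikeE c x v : future_timelike h time_field c x v <-> hbil x v v < 0 /\ hbil x v time_vec < 0.
Proof. by rewrite /future_timelike /ext_metric /time_field !hformE. Qed.

Lemma vertical_energy x (a c : R) : energy x (a *: es + c *: ea 0) = 0.
Proof. by rewrite /energy big1// => r _; rewrite vx_vert vy_vert; ring. Qed.

Lemma T_timelike x : hbil x time_vec time_vec < 0.
Proof.
rewrite hbil_T// /fiber_om /time_vec vs_vert wz_vert mulrN -expr2 ep2.
by have := hV (vs x); have := hV 0; rewrite cc0; lra.
Qed.

Lemma T_fcausal x : causal_vec x time_vec.
Proof.
have h0 := T_timelike x; split=> //; last exact: ltW.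
have V0 : 0 < V by exact: (V_gt0).
by move=> /(congr1 (@vs R m)); rewrite /time_vec vs_vert vs0 => e; move: V0; rewrite e ltxx.
Qed.

(** The future pointing generator of the centre: null on s = 0 and timelike beyond it. *)
Definition null_vec : X := 0 *: es + (- ep) *: ea 0.

Lemma N_norm x : hbil x null_vec null_vec = cc (vs x).
Proof.
rewrite hbil_om// vertical_energy /fiber_om /null_vec vs_vert wz_vert mulrN -expr2 ep2; ring.
Qed.

Lemma N_T x : hbil x null_vec time_vec < 0.
Proof.
rewrite hbil_T// /fiber_om /null_vec vs_vert wz_vert mulrN -expr2 ep2.
by have := hV (vs x); have := hV 0; rewrite cc0; lra.
Qed.

Lemma N_fcausal x : vs x <= 0 -> causal_vec x null_vec.
Proof.
move=> x0; have nT := N_T x; split=> //; last by rewrite N_norm; exact: (proj2 (cc_sign _)).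
move=> e; move: nT; rewrite e.
by have := hbil_lin b ax ay x (-1) 0 0 time_vec; rewrite scaler0 addr0 => z; rewrite (_ : hbil x 0 _ = 0) ?ltxx//; lra.
Qed.

Lemma line_time (x v : X) t : (stproj Ga (x + t *: v)).1 = vs x + t * vs v.
Proof. by rewrite stprojE /= -vs_line. Qed.

Definition dep (s0 : R) : set M := past_domain_of_dependence h time_field [set q | q.1 = s0].

(** Two inextendible test curves avoid the slice: for s <= 0 the orbit of the centre, which stays at
    constant s, and for s > s0 the line along [time_vec], on which s increases without bound. *)
Lemma dep_sub s0 q : 0 < s0 -> dep s0 q -> 0 < q.1 <= s0.
Proof.
move=> s00; have [x <-] := stproj_surj q; rewrite stprojE => D.
have ext v (hv : forall ga, dltrans ga v = v) : (forall t, causal_vec (x + t *: v) v) ->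
    ~ (exists q : M, (stproj Ga (x + t *: v) : M) @[t --> +oo] --> q) -> exists2 t, 0 <= t & vs x + t * vs v = s0.
  move=> fc nl; have [||t t0 e] := D (fun t => stproj Ga (x + t *: v)).
  - split=> // b' b0; apply: (line_piecewise hv b0) => c ga t _.
    by apply/future_causalE; exact: fcausal_ltrans.
  - by rewrite scale0r addr0 stprojE.
  by exists t => //; rewrite -e line_time.
rewrite /= -/(vs x); apply/andP; split; rewrite ltNge || rewrite leNgt; apply/negP => hx.
  have [||t _] := ext null_vec (vertical_inv 0 (- ep)).
  - move=> t; apply: N_fcausal; by rewrite vs_line /null_vec vs_vert mulr0 addr0.
  - move=> [q' cv]; have c2 := @cvg_comp _ _ _ _ (@snd R (hquot Ga)) _ _ _ cv (@cvg_snd _ _ _ _ _ : snd @ nbhs q' --> q'.2).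
    apply: (@central_no_limit R m Ga dG (rsubmx x) (- ep)); first by rewrite oppr_eq0; exact: (ep_neq0).
    exists q'.2; rewrite (_ : (fun t : R => _) = snd \o (fun t : R => stproj Ga (x + t *: null_vec))); first exact: c2.
    apply/funext => t /=; rewrite linearD linearZ /= /null_vec scale0r add0r linearZ /= /ea pt_space /zc scalerA.
    by congr (hproj _ (_ + _ *: _)); ring.
  by rewrite /null_vec vs_vert mulr0 addr0 => e; move: s00; rewrite -e ltNge hx.
have V0 : 0 < V by exact: (V_gt0).
have [||t t0] := ext time_vec (vertical_inv V (- ep)).
- by move=> t; exact: T_fcausal.
- move=> [q' cv]; have c1 := @cvg_comp _ _ _ _ (@fst R (hquot Ga)) _ _ _ cv (@cvg_fst _ _ _ _ _ : fst @ nbhs q' --> q'.1).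
  have c2 : (vs x + t * vs time_vec) @[t --> +oo] --> q'.1.
    rewrite (_ : (fun t : R => _) = fst \o (fun t : R => stproj Ga (x + t *: time_vec))); first exact: c1.
    by apply/funext => t; rewrite -line_time.
  have /cvgrPdist_lt/(_ 1 ltr01)[B [_ HB]] := c2.
  pose t := Num.max (B + 1) ((q'.1 + 1 - vs x) / V).
  have tB : B < t by rewrite lt_max ltrDl ltr01.
  have := HB t tB; rewrite /= /time_vec vs_vert ltr_norml => /andP[h1 _].
  have : (q'.1 + 1 - vs x) / V <= t by rewrite le_max lexx orbT.
  by rewrite ler_pdivrMr//; lra.
rewrite /time_vec vs_vert => e; have : 0 <= t * V by rewrite mulr_ge0// ltW.
by lra.
Qed.

(** A future causal curve missing the slice keeps s monotone between its initial value and s0. There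
    all coordinates are Lipschitz in s, so the lift converges and the curve is extendible. *)
Lemma sub_dep s0 q : 0 < q.1 <= s0 -> dep s0 q.
Proof.
move=> /andP[q0 qs] ga [pw nl] g0; apply: contrapT => ns.
have cf := ray_continuous pw; set f := (fun t : R => ga (Num.max t 0)) in cf.
have [x0 ex0] := stproj_surj (f 0).
have [k [ck kf k0]] := curve_lift dG cf ex0.
have kga u : 0 <= u -> stproj Ga (k u) = ga u by move=> u0; rewrite kf /f (max_idPl u0).
have vg u : 0 <= u -> (ga u).1 = vs (k u) by move=> u0; rewrite -kga// stprojE.
have v0 : vs (k 0) = q.1 by rewrite -vg// g0.
have v00 : 0 < vs (k 0) by rewrite v0.
have hP (c : chart R (1 + hdim m) M) x v : future_causal h time_field c x v -> causal_vec x v by move/future_causalE.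
have pwb u : 0 <= u -> piecewise (future_causal h time_field) ga 0 (u + 1) by move=> u0; apply: pw; rewrite ltr_wpDl.
have kgb u : 0 <= u -> forall w, 0 <= w <= u + 1 -> stproj Ga (k w) = ga w by move=> u0 w /andP[w0 _]; exact: kga.
have ge u : 0 <= u -> vs (k 0) <= vs (k u).
  by move=> u0; apply: (causal_time_ge hP (pwb u u0) ck (kgb u u0) v00); rewrite u0 lerDl ler01.
have mono u v : 0 <= u -> u <= v -> vs (k u) <= vs (k v).
  move=> u0 uv; have v0' := le_trans u0 uv.
  by apply: (causal_time_le hP (pwb v v0') ck (kgb v v0') v00 u0 uv); rewrite lerDl ler01.
have cv : continuous (fun u => vs (k u)).
  by move=> u; apply: (@continuous_comp _ _ _ k (fun x : X => vs x)); [exact: ck|exact: time_continuous].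
have lt u : 0 <= u -> vs (k u) <= s0.
  move=> u0; rewrite leNgt; apply/negP => hu.
  have [|w] := @IVT R (fun u => vs (k u)) 0 u s0 u0 (continuous_subspaceT cv).
    by rewrite ge_min le_max v0 qs (ltW hu) orbT.
  rewrite in_itv /= => /andP[w0 _] e; apply: ns; exists w => //.
  by rewrite /= vg.
have [|C C0 HC] := fcausal_bound v00 (_ : vs (k 0) <= s0); first by rewrite v0.
have bd u w : 0 <= u -> causal_vec (k u) w -> `|wz (k u) w| <= C * vs w /\
    forall r, `|vx r w| <= C * vs w /\ `|vy r w| <= C * vs w.
  by move=> u0; apply: HC; rewrite ge// lt.
have lip (f' : R -> R) D : continuous f' ->
    (forall (t : R) (w : X), 0 < t -> is_derive t 1 k w -> causal_vec (k t) w -> exists2 d, is_derive t 1 f' d & `|d| <= D * vs w) ->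
    forall u v, 0 <= u -> u <= v -> `|f' v - f' u| <= D * (vs (k v) - vs (k u)).
  move=> cf' H u v u0 uv; have v0' := le_trans u0 uv.
  have H' t w : 0 < t < v + 1 -> is_derive t 1 k w -> causal_vec (k t) w -> exists2 d, is_derive t 1 f' d & `|d| <= D * vs w.
    by move=> /andP[t0 _]; exact: H.
  have vv : v <= v + 1 by rewrite lerDl ler01.
  exact: (causal_lipschitz hP (pwb v v0') ck (kgb v v0') v00 cf' H' u0 uv vv).
have cj (j : 'I_(1 + hdim m)) : continuous (fun t => k t 0 j).
  by move=> t; exact: (@cvg_coord R R (nbhs t) _ _ _ k (k t) 0 j (ck t)).
have lx r : forall u v, 0 <= u -> u <= v -> `|vx r (k v) - vx r (k u)| <= C * (vs (k v) - vs (k u)).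
  apply: (lip (fun t => vx r (k t))).
    by rewrite (_ : (fun t => _) = fun t => k t 0 (rshift 1 (ix r))); [exact: cj|apply/funext => t; rewrite /vx rsubmxE].
  move=> t w t0 dw fw; exists (vx r w); last by have [_ /(_ r)[]] := bd t w (ltW t0) fw.
  rewrite /vx rsubmxE (_ : (fun t => _) = fun t => k t 0 (rshift 1 (ix r))); first exact: is_derive_coord.
  by apply/funext => t'; rewrite rsubmxE.
have ly r : forall u v, 0 <= u -> u <= v -> `|vy r (k v) - vy r (k u)| <= C * (vs (k v) - vs (k u)).
  apply: (lip (fun t => vy r (k t))).
    by rewrite (_ : (fun t => _) = fun t => k t 0 (rshift 1 (iy r))); [exact: cj|apply/funext => t; rewrite /vy rsubmxE].
  move=> t w t0 dw fw; exists (vy r w); last by have [_ /(_ r)[]] := bd t w (ltW t0) fw.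
  rewrite /vy rsubmxE (_ : (fun t => _) = fun t => k t 0 (rshift 1 (iy r))); first exact: is_derive_coord.
  by apply/funext => t'; rewrite rsubmxE.
(* Bounds the x-coordinates, as needed for the central one because dz = w^0 + \sum_r x_r dy_r. *)
pose B := \sum_r `|vx r (k 0)| + C * s0.
have Bx r t : 0 <= t -> `|vx r (k t)| <= B.
  move=> t0; rewrite -[vx r (k t)](subrKC (vx r (k 0))); apply: le_trans (ler_normD _ _) _.
  apply: lerD; first by rewrite (bigD1 r)//= lerDl sumr_ge0.
  apply: le_trans (lx r 0 t (lexx _) t0) _; rewrite ler_wpM2l// lerBlDr.
  by apply: le_trans (lt t t0) _; rewrite lerDl ltW.
have lz : forall u v, 0 <= u -> u <= v -> `|k v 0 (rshift 1 0) - k u 0 (rshift 1 0)| <=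
    (C + \sum_(r < m) B * C) * (vs (k v) - vs (k u)).
  apply: (lip (fun t => k t 0 (rshift 1 0))); first exact: cj.
  move=> t w t0 dw fw; exists (w 0 (rshift 1 0)); first exact: is_derive_coord.
  have [w1 w2] := bd t w (ltW t0) fw.
  have -> : w 0 (rshift 1 0) = wz (k t) w + \sum_r vx r (k t) * vy r w by rewrite wzE rsubmxE subrK.
  apply: le_trans (ler_normD _ _) _; rewrite mulrDl; apply: lerD => //.
  apply: le_trans (ler_norm_sum _ _ _) _; rewrite mulr_suml; apply: ler_sum => r _.
  rewrite normrM -mulrA; apply: ler_pM => //; first exact: Bx (ltW t0).
  by have [_] := w2 r.
have cvj j : exists l : R, k t 0 j @[t --> +oo] --> l.
  have D (f' : R -> R) K : 0 <= K -> (forall u v, 0 <= u -> u <= v -> `|f' v - f' u| <= K * (vs (k v) - vs (k u))) ->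
      exists l : R, f' t @[t --> +oo] --> l.
    by move=> K0 H; exact: (ray_lipschitz_cvg K0 mono lt H).
  case: (split_ordP j) => j' ->.
    rewrite ord1; apply: (D _ 1 ler01) => u v u0 uv.
    rewrite mul1r (_ : lshift _ 0 = 0); last exact: val_inj.
    by rewrite ger0_norm// subr_ge0; exact: mono.
  case: (hindexP j') => [->|[r ->]|[r ->]].
  - apply: (D _ _ _ lz); rewrite addr_ge0// sumr_ge0// => r _; rewrite mulr_ge0//.
    exact: le_trans (normr_ge0 _) (Bx r 0 (lexx _)).
  - by apply: (D _ C C0) => u v u0 uv; rewrite -!rsubmxE; exact: lx.
  - by apply: (D _ C C0) => u v u0 uv; rewrite -!rsubmxE; exact: ly.
have [l hl] := choice cvj.
have ckl : k t @[t --> +oo] --> (\row_j l j : X).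
  by apply: (@cvg_rVP R R (+oo : set_system R) _) => j; rewrite mxE; exact: hl.
apply: nl; exists (stproj Ga (\row_j l j)) => U nU.
have nV := ckl _ (@stproj_continuous R m Ga (\row_j l j) U nU).
apply: (@filterS2 _ (+oo : set_system R) _ _ _ _ _ nV (nbhs_pinfty_gt (num_real 0))) => t /= Ut t0.
by rewrite -kga// ltW.
Qed.

Lemma dep_eq s0 : 0 < s0 -> dep s0 = [set q | 0 < q.1 <= s0].
Proof. by move=> s00; apply/seteqP; split=> q; [exact: dep_sub|exact: sub_dep]. Qed.

(** By [dep_eq] the domain of dependence is 0 < s <= s0. Its points are in its own chronological
    future, and no causal curve returns from s > 0 to s = 0. *)
Lemma past_horizon s0 : 0 < s0 -> past_cauchy_horizon h time_field [set q | q.1 = s0] = boundary Ga.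
Proof.
move=> s00; rewrite /past_cauchy_horizon -/(dep s0) dep_eq//.
have V0 : 0 < V by exact: (V_gt0).
apply/seteqP; split=> q.
  move=> [cq nq]; have [x ex] := stproj_surj q.
  have qle : 0 <= q.1 <= s0.
    have cl : closed [set q : M | 0 <= q.1 <= s0].
      rewrite (_ : [set q | _] = (fst @^-1` `[0, s0]%classic : set M)).
        apply: (@preimage_closed _ _ (@fst R (hquot Ga))); last exact: itv_closed.
        by move=> y _; exact: cvg_fst.
      by apply/seteqP; split=> y /=; rewrite in_itv.
    apply: cl; apply: closure_subset cq => y /= /andP[y0 ys]; by rewrite ltW.
  move: qle => /andP[q0 qs]; apply/eqP; rewrite -[_ == _]negbK; apply/negP => q1.
  have {q1}q1 : 0 < q.1 by rewrite lt_def q1.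
  (* Following [time_vec] backwards for the parameter d halves s, so the starting point is still in
     the domain of dependence. *)
  apply: nq; pose d := q.1 / (2 * V).
  have d0 : 0 < d by rewrite divr_gt0// mulr_gt0.
  have dV : d * V = q.1 / 2 by rewrite /d; field; rewrite gt_eqF.
  have vd ga : dltrans ga (d *: time_vec) = d *: time_vec.
    by rewrite /time_vec scalerDr !scalerA vertical_inv.
  exists (fun t => stproj Ga ((x - d *: time_vec) + t *: (d *: time_vec))); split.
  - apply: (line_piecewise vd ltr01) => c ga t _; apply/future_timelikeE.
    set y := ltrans _ _; have hT := T_timelike y.
    have e w : hbil y (d *: time_vec) w = d * hbil y time_vec w.
      have z := hbil_lin b ax ay y (-1) 0 0 w; rewrite scaler0 addr0 in z.
      rewrite -[d *: _]addr0 hbil_lin (_ : hbil y 0 w = 0) ?addr0//; lra.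
    by rewrite !e hbil_sym e pmulr_rlt0// pmulr_rlt0.
  - have e1 : (stproj Ga ((x - d *: time_vec) + 0 *: (d *: time_vec))).1 = q.1 / 2.
      rewrite line_time mul0r addr0 -scaleN1r addrC vs_lin -[d *: _]addr0 vs_lin vs0.
      have -> : vs x = q.1 by rewrite -ex stprojE.
      by rewrite /time_vec vs_vert; lra.
    by rewrite /mkset e1; apply/andP; split; lra.
  - by rewrite scale1r subrK.
have [x <-] := stproj_surj q; rewrite /boundary /= => x0'; have x0 : vs x = 0 by rewrite -x0' rV_time.
split.
  move=> U nU; pose f (t : R) := stproj Ga (x + t *: es).
  have cf : {for 0, continuous f}.
    apply: (@continuous_comp _ _ _ (fun t : R => x + t *: es) (stproj Ga)); first exact: line_point_continuous.
    exact: stproj_continuous.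
  have n0 : nbhs (f 0) U by rewrite /f scale0r addr0.
  have [d d0 Hd] := nbhs_distP (cf U n0).
  pose t := Num.min (d / 2) s0.
  have t0 : 0 < t by rewrite lt_min divr_gt0.
  exists (f t); split; last first.
    apply: Hd; rewrite sub0r normrN gtr0_norm// gt_min; apply/orP; left.
    by rewrite ltr_pdivrMr// ltr_pMr// ltr1n.
  have ef : (f t).1 = t by rewrite /f line_time vs_es x0; ring.
  by rewrite /mkset ef t0 ge_min lexx orbT.
move=> [ga [pw]] /= /andP[g0 _] g1.
have [y0 ey0] := stproj_surj (ga (clamp 1 0)).
have [k [ck kf k0]] := curve_lift dG (piecewise_clamp ler01 pw) ey0.
have kga u : 0 <= u <= 1 -> stproj Ga (k u) = ga u by move=> hu; rewrite kf clamp_id.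
have vg u : 0 <= u <= 1 -> (ga u).1 = vs (k u) by move=> hu; rewrite -kga// stprojE.
have h00 : 0 <= (0 : R) <= 1 by rewrite lexx ler01.
have h11 : 0 <= (1 : R) <= 1 by rewrite lexx ler01.
have k00 : 0 < vs (k 0) by rewrite -vg.
have hP (c : chart R (1 + hdim m) M) y v : future_timelike h time_field c y v -> causal_vec y v by exact: future_timelike_vec.
have := causal_time_ge hP pw ck kga k00 h11.
by rewrite -[vs (k 1)]vg// g1 (_ : (stproj Ga x).1 = 0) ?leNgt ?k00// stprojE.
Qed.

(** * The central Killing field, its horizon and its closed orbits *)

Local Notation line x v := (fun t : R => stproj Ga (x + t *: v) : M).
Definition Kfield : vfield M := fun _ _ => ea 0.

Lemma jacobian_id (c c' : chart R (1 + hdim m) M) x : atlas M c -> atlas M c' -> locdom id c c' x ->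
  exists ga, [/\ Ga ga, cdom c' (ltrans ga x), locrep id c c' x = ltrans ga x &
    forall v, v *m 'J (locrep id c c') x = dltrans ga v].
Proof.
exact: (@jacobian_lift R m Ga dG id id (fun x => @cvg_id _ _) (fun=> erefl) (fun _ v => v) c c' x
  (fun y v => is_derive_id y v) (fun v => @cst_continuous _ _ _)).
Qed.

Lemma const_compat v : (forall ga, dltrans ga v = v) -> vfield_compat ((fun _ _ => v) : vfield M).
Proof. by move=> hv c c' ac ac' x Dx; have [ga [_ _ _ ->]] := jacobian_id ac ac' Dx; rewrite hv. Qed.

Lemma vertical_T ga : dltrans ga time_vec = time_vec. Proof. exact: vertical_inv. Qed.
Lemma vertical_N ga : dltrans ga null_vec = null_vec. Proof. exact: vertical_inv. Qed.
Lemma ez_vert : ea 0 = 0 *: es + 1 *: ea 0 :> X. Proof. by rewrite scale0r add0r scale1r. Qed.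
Lemma vertical_K ga : dltrans ga (ea 0) = ea 0 :> X. Proof. by rewrite ez_vert vertical_inv. Qed.

Lemma time_oriented : time_orientation_extends h io time_field.
Proof.
split.
  split; first by split; [exact: const_compat vertical_T|move=> c _ x _; exact: cst_continuous].
  by move=> c _ x _; rewrite /ext_metric hformE; exact: T_timelike.
move=> c c' ac ac' x Dx.
have [ga [Gga _ e J]] := jacobian_lift dG (phi_continuous) (io_stproj)
  (is_derive_phi) (dphi_continuous) ac ac' Dx.
rewrite J e /ext_metric hformE /time_field -(vertical_T ga) hbil_ltrans hbil_T//.
set s := expR (2 * vs x); have s0 : 0 < s by exact: expR_gt0.
have dv : dphi x (delta_mx 0 0) = (2 * s) *: es + (- (PP s / (2 * b))) *: ea 0.
  rewrite delta_es /dphi vs_es !mul1r dg1E dpsiE// -/s addrA -{1}[es]scale1r -scalerDl.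
  by congr (_ *: _ + _); ring.
rewrite dv /fiber_om vs_vert wz_vert vs_phi -/s.
have -> : ep * - (PP s / (2 * b)) = - (PP s / A 0).
  have e0 := ep_neq0; rewrite /eb; field; by rewrite e0 gt_eqF.
have P0 := PP_gt0 b ax ay s; have q0 : 0 < PP s / A 0 by rewrite divr_gt0.
have h1 : 0 < A 0 / 2 * (2 * s) by rewrite mulr_gt0// ?divr_gt0// mulr_gt0.
have h2 : 0 < (A 0 * V / 2 - cc s) * (PP s / A 0).
  by apply: mulr_gt0 => //; have := hV s; have := hV 0; rewrite cc0; lra.
by rewrite mulrN -opprD oppr_lt0 addr_gt0.
Qed.

Lemma dh_ez (x u v : X) : dh b ax ay x (ea 0) u v = 0.
Proof. by rewrite /dh !dw_ez vs_ea; ring. Qed.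

Lemma ezE (k : 'I_(1 + hdim m)) : (ea 0 : X) 0 k = (k == rshift 1 0)%:R.
Proof. by rewrite -delta_ea mxE eqxx. Qed.

Lemma const_smooth (U : set X) (v : X) : smooth_on U (fun _ : X => v).
Proof.
move=> k; apply: (@Ck_on_sub R k X X setT) => //.
exact: (@smooth_affine R X X (fun=> v) (fun=> 0) (fun x => @cst_continuous _ _ _ x) (fun x w => is_derive_cst v x w) k).
Qed.

Lemma K_killing : killing_field h Kfield.
Proof.
split; first by split; [exact: const_compat vertical_K|move=> c _; exact: const_smooth].
move=> c _ x _ i j; rewrite (bigD1 (rshift 1 0))//= big1 => [|k kn].
  rewrite /Kfield ezE eqxx mul1r /pderiv !derive_cst !mulr0 !addr0 delta_ea.
  rewrite /ext_metric; under eq_fun do rewrite mxE.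
  by rewrite (@derive_val _ _ _ _ _ _ _ (is_derive_hbil b ax ay x _ _ _)) dh_ez.
by rewrite /Kfield ezE (negbTE kn) mul0r add0r /pderiv !derive_cst !mulr0 addr0.
Qed.

Lemma time_affine_smooth (U : set X) : smooth_on U (fun x : X => vs x).
Proof.
move=> k; apply: (@Ck_on_sub R k X R setT) => //.
apply: (@smooth_affine R X R (fun x => vs x) (fun v => vs v)) => [|x w]; first exact: time_continuous.
apply: is_derive_lineP; under eq_fun do rewrite vs_line; exact: is_derive_affine.
Qed.

(** At s = 0 only the w^0-component - [gam] survives, and [gam] is 2 b there because cc' = 4 b^2. *)
Lemma Gam_K x : vs x = 0 -> Gam b ax ay x (ea 0) (ea 0) = (- (2 * b)) *: ea 0.
Proof.
move=> x0; have b0 := b_ne0.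
have g0 : gam b ax ay (vs x) = 2 * b.
  rewrite /gam /dcc x0 cc0 mulr0 mul0r subr0 /PP big1 => [|r _]; first by field.
  by rewrite /FF; ring.
have c0 : cc (vs x) = 0 by rewrite x0 cc0.
have EE0 : EE b ax ay x (ea 0) (ea 0) = 0.
  by rewrite /EE big1// => r _; rewrite vx_ez vy_ez; ring.
have SS0 : SS (ea 0 : X) (ea 0) = 0.
  by rewrite /SS big1// => r _; rewrite vx_ez vy_ez; ring.
rewrite -[RHS]add0r -[X in X + _](scale0r (es : X)); apply: (@frame_eqP _ _ x).
- by rewrite vs_Gam vs_vert /Gs c0 vs_ea EE0; ring.
- by rewrite wz_Gam wz_vert /Gth wz_ez g0 EE0 SS0; ring.
- by move=> r; rewrite vx_Gam vx_vert /Gx vs_ea vx_ez vy_ez; ring.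
- by move=> r; rewrite vy_Gam vy_vert /Gy vs_ea vx_ez vy_ez; ring.
Qed.

Lemma hbil_K x v : hbil x (ea 0) v = b * vs v + cc (vs x) * wz x v.
Proof.
rewrite /hbil vs_ea wz_ez big1 => [|r _]; first by ring.
by rewrite vx_ez vy_ez; ring.
Qed.

Lemma K_horizon : killing_horizon h (fun q : M => q.1) Kfield (- (2 * b)).
Proof.
have b0 := b_ne0.
split; first exact: K_killing.
move=> c ac x cx; have [_ _ ec] := ac.
have fE : (fun q : M => q.1) \o cmap c = fun y : X => vs y.
  by apply/funext => y; rewrite /= ec stprojE.
have dE v : 'D_v ((fun q : M => q.1) \o cmap c) x = vs v.
  rewrite fE; have d : is_derive x v (fun y : X => vs y) (vs v).
    apply: is_derive_lineP; under eq_fun do rewrite vs_line; exact: is_derive_affine.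
  by have [_ ->] := d.
move=> x0'; have x0 : vs x = 0 by move: x0'; rewrite ec stprojE.
have c0 : cc (vs x) = 0 by rewrite x0 cc0.
have m11 (B C : X) : (B *m hform x *m C^T) = (hbil x B C)%:M.
  by apply/matrixP => i j; rewrite !ord1 hformE mxE eqxx.
split.
- by rewrite fE; exact: time_affine_smooth.
- by exists es; rewrite dE vs_es; apply/eqP; exact: oner_neq0.
- split; last by rewrite /Kfield /ext_metric m11 hbil_K vs_ea c0 mulr0 mul0r addr0 raddf0.
  move=> /rowP/(_ (rshift 1 0)); rewrite /Kfield ezE eqxx mxE => /eqP; by rewrite oner_eq0.
- by move=> v; rewrite dE => v0; rewrite /Kfield /ext_metric m11 hbil_K v0 c0 mulr0 mul0r addr0 raddf0.
move=> k; rewrite /acceleration big1 => [|i _]; last by rewrite /Kfield /pderiv derive_cst mulr0.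
rewrite add0r (bigD1 (rshift 1 0))//= [X in _ + X]big1 => [|i ni]; last first.
  by rewrite big1// => j _; rewrite /Kfield ezE (negbTE ni) mulr0 mul0r.
rewrite (bigD1 (rshift 1 0))//= [X in _ + X + _]big1 => [|j nj]; last by rewrite /Kfield [X in _ * X]ezE (negbTE nj) mulr0.
rewrite /Kfield !ezE eqxx !mulr1 !addr0 /ext_metric (christoffel_hform b0 (ax_neq0) (ay_neq0)).
by rewrite delta_ea Gam_K// mxE ezE.
Qed.

Lemma io_slice tau : io @` slice Ga tau = [set q | q.1 = expR (2 * tau)].
Proof.
have [_ _ rg tE] := one_sided.
apply/seteqP; split=> [_ [q qt <-]|q /= qt]; first by rewrite /mkset tE; congr (expR (2 * _)); exact: qt.
have : range io q by rewrite rg /= qt; exact: expR_gt0.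
move=> [q' _ e]; exists q' => //; rewrite /slice /=.
by move: qt; rewrite -e tE => /expR_inj; lra.
Qed.

Lemma zc_shift L (x : X) : Ga (zc L) -> stproj Ga (x + L *: ea 0) = stproj Ga x.
Proof.
move=> GL; rewrite -[in RHS](@stproj_ltrans _ _ _ dG (zc L) x GL); congr (stproj _ _).
rewrite ltransE dltransE big1 => [|r _]; last by rewrite zc_ix mul0r.
rewrite scale0r addr0 addrC; congr (_ + _).
by rewrite -(pt_eta (L *: _)) linearZ /= pt_space -/(vs _) -[L *: _]addr0 vs_lin vs_ea vs0 mulr0 addr0.
Qed.

(** The lift has constant velocity d/dz, so it is a straight line: every generator is an orbit of
    the centre. *)
Lemma generator_line (ga : R -> M) : null_generator Kfield (boundary Ga) ga ->
  exists x : X, forall t, ga t = stproj Ga (x + t *: ea 0).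
Proof.
move=> [sm _ vc]; have [cga _] := sm.
have [x ex] := stproj_surj (ga 0).
have [k [ck kf k0]] := curve_lift dG (fun t => cga t I) ex.
exists x => t; rewrite -kf; congr (stproj _ _).
have dk (u : R) : is_derive u (1 : R) k (ea 0).
  have ne : \forall w \near u, stproj Ga (k w) = ga w by near=> w; exact: kf.
  have [v dv H] := curve_lift_derivable dG openT I ck sm ne.
  have [c _ e] := H (fun c x v => v = Kfield c x) (fun w wu => vc w I).
  by rewrite e in dv.
apply/rowP => j; rewrite [RHS]mxE [X in _ = _ + X]mxE.
have d0 (u : R) : is_derive u (1 : R) (fun w : R => k w 0 j - w * (ea 0 : X) 0 j) 0.
  have e := is_deriveB (is_derive_coord 0 j (dk u)) (is_deriveM (is_derive_id u (1 : R)) (is_derive_cst ((ea 0 : X) 0 j) u (1 : R))).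
  by apply: is_derive_eq e _; rewrite /GRing.scale /=; ring.
have := @is_derive_0_is_cst R _ t 0 d0; rewrite /= k0 mul0r subr0 => /eqP.
by rewrite subr_eq => /eqP.
Unshelve. all: by end_near. Qed.

Lemma generators_closed L : 0 < L -> Ga (zc L) -> null_generators_closed Kfield (boundary Ga).
Proof.
move=> L0 GL; split=> [q qS|ga /generator_line[x e]].
  have [x ex] := stproj_surj q; exists (line x (ea 0)); last by rewrite scale0r addr0.
  split; first exact: (line_smooth x vertical_K).
    move=> t; rewrite /boundary /mkset line_time vs_ea mulr0 addr0.
    by move: qS; rewrite /boundary /= -ex stprojE.
  by apply: (line_velocity vertical_K) => c ga t _ _.
by exists L => // t; rewrite !e scalerDl addrA (zc_shift _ GL).
Qed.

(** The orbit of the centre through s = -1, closed by the central element of Ga and timelike since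
    [cc] < 0 there. *)
Lemma ctc_exists L : 0 < L -> Ga (zc L) ->
  exists2 ga, closed_timelike_curve h time_field ga & forall t, (ga t).1 < 0.
Proof.
move=> L0 GL; exists (line (pt (-1) 0) null_vec); last first.
  move=> t; rewrite line_time /null_vec vs_vert mulr0 addr0 (_ : vs _ = -1) ?ltrN10//; exact: pt_time.
split; first exact: (line_smooth _ vertical_N).
  exists L => // t; rewrite scalerDl addrA.
  have -> : L *: null_vec = (- ep * L) *: ea 0 by rewrite /null_vec scale0r add0r scalerA mulrC.
  apply: zc_shift; have [_ _ Gi _] := dG.
  have : (ep == 1) || (ep == -1) by rewrite -sqrf_eq1 ep2.
  by case/orP => /eqP ->; rewrite ?opprK ?mul1r ?mulN1r// -hinv_zc; exact: Gi.
apply: (line_velocity vertical_N) => c ga t Gga _; apply/future_timelikeE; split; last exact: N_T.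
rewrite N_norm// vs_ltrans vs_line /null_vec vs_vert mulr0 addr0 (_ : vs _ = -1); last exact: pt_time.
have P0 := PP_gt0 b ax ay (-1); have b0 := b_ne0.
rewrite /cc pmulr_llt0 ?invr_gt0// mulrN1 oppr_lt0 mulr_gt0//.
by rewrite lt_def sqr_ge0 sqrf_eq0 b0.
Qed.

End Extension.

(** * Horizon properties and inequivalence of the two extensions *)

Section HorizonProperties.
Context {R : realType} {m : nat}.
Local Notation X := 'rV[R]_(1 + hdim m).
Variables (A p : 'I_(hdim m) -> R) (Ga : set 'rV[R]_(hdim m)).
Hypotheses (A0 : forall a, 0 < A a) (dG : discrete_subgroup Ga).
Hypotheses (p0 : p 0 = 1) (ph : forall i, i != 0 -> p i = 0).
Hypothesis m0 : (0 < m)%N.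
Local Notation M := (spacetime Ga).

Lemma ext_horizon_properties ep : ep ^+ 2 = 1 -> horizon_properties (@ext_metric R m A Ga ep) (@io R m A Ga ep).
Proof.
move=> ep2; have [V hV] := T_exists A0 ep2 m0.
exists (@time_field R m Ga ep V), (@Kfield R m Ga), (- (2 * eb A ep)); split.
- exact: time_oriented.
- split; first exact: K_horizon.
  by apply/eqP; rewrite oppr_eq0 mulf_neq0// ?pnatr_eq0// (b_ne0 A0 ep2).
- by move=> tau; rewrite (io_slice A0 dG p0 ph ep2); apply: past_horizon => //; exact: expR_gt0.
move=> cpt; have [L L0 GL] := compact_central dG m0 cpt.
by split; [exact: (generators_closed dG L0 GL)|exact: (ctc_exists A0 dG ep2 hV L0 GL)].
Qed.

Lemma expR_decay (c : R) : 1 <= c -> expR (- (c * t)) @[t --> +oo] --> (0 : R).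
Proof.
move=> c1; apply/cvgrPdist_le => e e0; exists e^-1; split; first exact: num_real.
move=> t et; have t0 : 0 < t by apply: lt_trans et; rewrite invr_gt0.
rewrite sub0r normrN ger0_norm ?expR_ge0// expRN.
rewrite invf_ple ?posrE ?expR_gt0//; apply: le_trans (ltW et) _.
apply: (@le_trans _ _ (1 + c * t)); last exact: expR_ge1Dx.
by rewrite ler_wpDl// ler_peMl// ltW.
Qed.

Definition psi_rest ep (t : R) : R :=
  \sum_(i < size (PPpoly A ep)) (- (2 * eb A ep)^-1 * ((PPpoly A ep)`_i / (2 * i%:R))) * expR (2 * i%:R * t).

Lemma psiE ep t : psi A ep 0 t = - (2 * eb A ep)^-1 * t + psi_rest ep t.
Proof.
rewrite /psi /expsum /psi_rest; congr (_ + _).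
by apply: eq_bigr => i _; rewrite expr0 mulr1.
Qed.

Lemma psi_rest_cvg ep : psi_rest ep (- t) @[t --> +oo] --> (0 : R).
Proof.
rewrite (_ : (fun t => psi_rest ep (- t)) = fun t : R => \sum_(i < size (PPpoly A ep))
  (- (2 * eb A ep)^-1 * ((PPpoly A ep)`_i / (2 * i%:R))) * expR (2 * i%:R * (- t)))//.
rewrite -[X in _ --> X](@big1 R 0 +%R 'I_(size (PPpoly A ep)) (index_enum _) xpredT (fun=> 0))//.
apply: (@cvg_bigsum R R R (+oo : set_system R) _ _ _ _ (fun (i : 'I_(size (PPpoly A ep))) (t : R) => (- (2 * eb A ep)^-1 * ((PPpoly A ep)`_i / (2 * i%:R))) * expR (2 * i%:R * (- t)))) => i.
(* The summand i = 0 is zero by the convention 0^-1 = 0; all others decay as t tends to +oo. *)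
case: (posnP i) => [->|i0].
  rewrite (_ : (fun t : R => _) = fun=> 0); first exact: cvg_cst.
  by apply/funext => t; rewrite mulr0n mulr0 invr0 !mulr0 mul0r.
rewrite -[X in _ --> X](mulr0 (- (2 * eb A ep)^-1 * ((PPpoly A ep)`_i / (2 * i%:R)))).
apply: cvgM; first exact: cvg_cst.
under eq_fun do rewrite mulrN; apply: expR_decay.
have : (1 : R) <= i%:R by rewrite ler1n.
lra.
Qed.

(** A curve to the past end that converges in one extension drifts along the centre in the other,
    where it has no limit; a continuous identification of the two would carry the limit over. *)
Lemma not_equivalent : ~ equivalent_extensions (@ext_metric R m A Ga 1) (@io R m A Ga 1) (@ext_metric R m A Ga (-1)) (@io R m A Ga (-1)).
Proof.
move=> [Psi [iso _ e]].
have cPsi : continuous Psi by exact: (proj1 (ioe_smooth iso)).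
pose b := eb A 1; have b0 : b != 0 by exact: (eb_neq0 A0 (expr1n _ 2)).
have eb2 : eb A (-1) = - b by rewrite /b /eb mul1r !mulN1r mulNr.
(* The central shift cancels the linear part of [psi] for ep = 1; for ep = -1 it doubles it to - t /
   b. *)
pose x (t : R) : X := pt (- t) (zc (- t / (2 * b))).
have vx_ t : vs (x t) = - t by exact: pt_time.
have ph_ ep t : phi A ep (x t) = pt (expR (- (2 * t))) (zc (- t / (2 * b) + psi A ep 0 (- t))).
  rewrite /phi vx_ g1E -(pt_eta (_ + _)) -/(vs _) vsD vs_vert vx_; congr pt.
    by rewrite mulrN; ring.
  rewrite linearD linearD /= !linearZ /= /x /es /ea !pt_space scaler0 add0r.
  by rewrite [in RHS]zcD.
have c1 : (@io R m A Ga 1 (stproj Ga (x t)) : M) @[t --> +oo] --> (stproj Ga (pt 0 0) : M).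
  have k1 : (pt (expR (- (2 * t))) (zc (psi_rest 1 (- t))) : X) @[t --> +oo] --> (pt 0 0 : X).
    apply: (@cvg_rVP R R (+oo : set_system R) _) => j.
    case: (split_ordP j) => j' ->.
      rewrite ord1 (_ : lshift _ 0 = 0); last exact: val_inj.
      under eq_fun do rewrite pt_time; rewrite pt_time; apply: expR_decay; lra.
    under eq_fun do rewrite -rsubmxE pt_space; rewrite -rsubmxE pt_space.
    under eq_fun do rewrite !mxE; rewrite mxE -(mul0r ((0 == 0 :> 'I_1) && (j' == 0))%:R).
    by apply: cvgM; [exact: psi_rest_cvg|exact: cvg_cst].
  have e1 t : @io R m A Ga 1 (stproj Ga (x t)) = stproj Ga (pt (expR (- (2 * t))) (zc (psi_rest 1 (- t)))).
    rewrite (io_stproj A 1 dG) ph_ psiE -/b; congr (stproj _ (pt _ (zc _))).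
    by field.
  rewrite (_ : (fun t => _) = (fun t => stproj Ga (pt (expR (- (2 * t))) (zc (psi_rest 1 (- t)))) : M)); last exact/funext.
  exact: (@cvg_comp _ _ _ _ (stproj Ga : X -> M) _ _ _ k1 (@stproj_continuous R m Ga (pt 0 0))).
have c2 : (Psi (@io R m A Ga 1 (stproj Ga (x t))) : M) @[t --> +oo] --> (Psi (stproj Ga (pt 0 0)) : M).
  exact: (@cvg_comp _ _ _ _ Psi _ _ _ c1 (cPsi _)).
have [l hl] := hproj_surj (Psi (stproj Ga (pt 0 0))).2.
have c3 : hproj Ga (zc (- t / b + psi_rest (-1) (- t))) @[t --> +oo] --> hproj Ga l.
  rewrite hl (_ : (fun t : R => _) = snd \o (fun t : R => Psi (@io R m A Ga 1 (stproj Ga (x t))))).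
    exact: (@cvg_comp _ _ _ _ (@snd R (hquot Ga)) _ _ _ c2 (@cvg_snd _ _ _ _ _)).
  apply/funext => t; rewrite /= -[Psi _]/((Psi \o @io R m A Ga 1) (stproj Ga (x t))) e (io_stproj A (-1) dG) ph_ stproj_pt /=.
  by congr (hproj _ (zc _)); rewrite psiE eb2; field.
have c4 : - psi_rest (-1) (- t) @[t --> +oo] --> (0 : R).
  by rewrite -oppr0; apply: cvgN; exact: psi_rest_cvg.
have c5 := hproj_shift_cvg dG c3 c4.
apply: (@central_no_limit R m Ga dG 0 (- b^-1)); first by rewrite oppr_eq0 invr_eq0.
exists (hproj Ga (l + zc 0)); rewrite (_ : (fun t : R => _) = fun t : R => hproj Ga (zc (- t / b + psi_rest (-1) (- t)) + zc (- psi_rest (-1) (- t)))); first exact: c5.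
by apply/funext => t; rewrite -zcD add0r; congr (hproj _ (zc _)); ring.
Qed.

End HorizonProperties.

(** * Consequences of the conditions on the exponents *)

Section Exponents.
Context {R : realType} {m : nat}.
Variable p : 'I_(hdim m) -> R.
Hypotheses (sp : \sum_a p a = 1) (sp2 : \sum_a p a ^+ 2 = 1).

(** The squares sum to 1, so one exponent of modulus at least 1 leaves nothing for the others; this
    yields the strict bounds behind the constants c and c1. *)
Lemma exponent_extremal a : 1 <= p a ^+ 2 -> forall i, i != a -> p i = 0.
Proof.
move=> pa i ia; apply/eqP; rewrite -sqrf_eq0 eq_le sqr_ge0 andbT.
have := sp2; rewrite (bigD1 a)//= (bigD1 i)//= => e.
have : 0 <= \sum_(j | (j != a) && (j != i)) p j ^+ 2 by apply: sumr_ge0 => j _; exact: sqr_ge0.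
have := sqr_ge0 (p i); lra.
Qed.

Lemma exponent_gtN1 a : 0 < 1 + p a.
Proof.
rewrite ltNge; apply/negP => h; have pa : 1 <= p a ^+ 2 by rewrite -sqrrN expr2; nra.
have := sp; rewrite (bigD1 a)//= big1 => [|i /(exponent_extremal pa)//]; lra.
Qed.

Lemma exponent_lt1 i a : p i < 0 -> 0 < 1 - p a.
Proof.
move=> pi0; rewrite ltNge; apply/negP => h.
have pa : 1 <= p a ^+ 2 by rewrite expr2; nra.
have ia : i != a by apply/eqP => e; move: pi0 h; rewrite e; lra.
by move: pi0; rewrite (exponent_extremal pa ia) ltxx.
Qed.

(** Nonnegativity of the partner exponent in a pair turns chi_r > 0 into 1 + p_0 - p_i > 0, so each
    term of the vanishing sum is zero. *)
Lemma exponents_nonneg : (forall r : 'I_m, 0 < chi p r) -> (forall i, i != 0 -> 0 <= p i) ->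
  p 0 = 1 /\ forall i, i != 0 -> p i = 0.
Proof.
move=> ch nn.
have lt i : i != 0 -> 0 < 1 + p 0 - p i.
  case: (hindexP i) => [->|[r ->]|[r ->]]; rewrite ?eqxx// => _.
    by have := ch r; have := nn (iy r); rewrite iy_neq0 /chi => /(_ isT); lra.
  by have := ch r; have := nn (ix r); rewrite ix_neq0 /chi => /(_ isT); lra.
have s0 : \sum_(i | i != 0) p i * (1 + p 0 - p i) = 0.
  have e1 := sp; have e2 := sp2; rewrite (bigD1 0)//= in e1; rewrite (bigD1 0)//= in e2.
  transitivity ((1 + p 0) * \sum_(i | i != 0) p i - \sum_(i | i != 0) p i ^+ 2).
    by rewrite mulr_sumr -sumrB; apply: eq_bigr => i _; ring.
  have -> : \sum_(i | i != 0) p i = 1 - p 0 by lra.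
  have -> : \sum_(i | i != 0) p i ^+ 2 = 1 - p 0 ^+ 2 by lra.
  by ring.
have z i : i != 0 -> p i = 0.
  move=> i0; have := @psumr_eq0P R _ (fun i => i != 0) (fun i => p i * (1 + p 0 - p i)).
  move=> /(_ (fun j j0 => mulr_ge0 (nn j j0) (ltW (lt j j0))) s0 i i0) /eqP.
  by rewrite mulf_eq0 (gt_eqF (lt i i0)) orbF => /eqP.
split=> //; have := sp; rewrite (bigD1 0)//= big1 => [|i /z//]; by rewrite addr0.
Qed.

End Exponents.

Lemma positive_lower_bound (R : realType) (I : finType) (f : I -> R) : (forall i, 0 < f i) ->
  exists c : R, [/\ 0 < c, c <= 1 & forall i, c <= f i].
Proof.
move=> f0; have S0 : 0 <= \sum_i (f i)^-1 by apply: sumr_ge0 => i _; rewrite invr_ge0 ltW.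
have S1 : 0 < 1 + \sum_i (f i)^-1 by rewrite ltr_pwDl.
exists (1 + \sum_i (f i)^-1)^-1; split; [by rewrite invr_gt0|by rewrite invf_le1// lerDl|move=> i].
rewrite invf_ple ?posrE// (bigD1 i)//= addrCA lerDl addr_ge0// sumr_ge0// => j _.
by rewrite invr_ge0 ltW.
Qed.

Theorem proposition8p13 (R : realType) (m : nat) (A p : 'I_(hdim m) -> R)
    (Ga : set 'rV[R]_(hdim m)) :
  (1 <= m)%N ->
  (forall a, 0 < A a) ->
  \sum_a p a = 1 ->
  \sum_a p a ^+ 2 = 1 ->
  (forall r : 'I_m, 0 < chi p r) ->
  discrete_subgroup Ga ->
  let g : bfield (spacetime Ga) := family_metric A p Ga in
  let case_i : Prop :=
    (exists i : 'I_(hdim m), i <> 0 /\ p i < 0) /\ C0_inextendible g in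
  let case_ii : Prop :=
    (p 0 = 1 /\ forall i : 'I_(hdim m), i <> 0 -> p i = 0) /\
    exists (h1 h2 : bfield (spacetime Ga))
           (io1 io2 : spacetime Ga -> spacetime Ga),
      [/\ one_sided_extension g h1 io1 /\ one_sided_extension g h2 io2,
          ricci_flat h1 /\ ricci_flat h2,
          ~ equivalent_extensions h1 io1 h2 io2
        & horizon_properties h1 io1 /\ horizon_properties h2 io2] in
  (case_i \/ case_ii) /\ ~ (case_i /\ case_ii).
Proof.
move=> m0 A0 sp sp2 ch dG g case_i case_ii.
have excl : ~ (case_i /\ case_ii).
  by move=> [[[i [i0 pi0]] _] [[_ z] _]]; move: pi0; rewrite (z i i0) ltxx.
split; last exact: excl.
have [[i [i0 pi0]]|ni] := pselect (exists i, i <> 0 /\ p i < 0).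
  left; split; first by exists i.
  have [c [c0 _ cle]] := positive_lower_bound (fun a => exponent_lt1 sp2 a pi0).
  have [c1 [c10 c11 c1le]] := positive_lower_bound (exponent_gtN1 sp sp2).
  by apply: (family_inextendible dG A0 ch c0 cle c10 c11 c1le) pi0; apply/eqP.
right; have nn i : i != 0 -> 0 <= p i.
  by move=> /eqP i0; rewrite leNgt; apply/negP => pi0; apply: ni; exists i.
have [p0 ph] := exponents_nonneg sp sp2 ch nn.
split; first by split=> // i /eqP; exact: ph.
have e1 : (1 : R) ^+ 2 = 1 by rewrite expr1n.
have e2 : (-1 : R) ^+ 2 = 1 by rewrite sqrrN expr1n.
exists (@ext_metric R m A Ga 1), (@ext_metric R m A Ga (-1)), (@io R m A Ga 1), (@io R m A Ga (-1)); split.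
- by split; exact: one_sided.
- by split; exact: ext_ricci_flat.
- exact: not_equivalent.
- by split; [exact: (ext_horizon_properties A0 dG p0 ph m0 e1)|exact: (ext_horizon_properties A0 dG p0 ph m0 e2)].
Qed.
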